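(* Let $m,d\in\mathbb{N}$ with $m,d\ge1$, let $\mathcal{H}=\mathcal{H}^m([0,1])^{\otimes d}$ be the tensor product Sobolev space on $[0,1]^d$, and let $y_i=f_0(x_i)+\epsilon_i$, $i=1,\dots,n$, where the predictors $\{x_i\}_{i=1}^n$ are i.i.d. random vectors on $[0,1]^d$ with distribution $v$ having a Lebesgue density bounded away from zero and infinity. Suppose that: (A2) The loss $\rho:\mathbb{R}\to\mathbb{R}$ is convex and absolutely continuous with derivative $\psi$ existing almost everywhere. (A3) There exist constants $\kappa,M_1>0$ such that for all $|y|\le\kappa$, $|\psi(x+y)-\psi(x)|\le M_1$ uniformly in $x\in\mathbb{R}$. (A4) The errors $\{\epsilon_i\}_{i=1}^n$ are i.i.d., independent of $\{x_i\}_{i=1}^n$, satisfy $\mathbb{E}[\psi(\epsilon_1)]=0$, $\mathbb{E}[|\psi(\epsilon_1)|^2]<\infty$, and there exists $\gamma>0$ such that $\mathbb{E}[\psi(\epsilon_1+t)]=\gamma t+o(t)$ as $t\to0$. (A5) There exists $\beta\in(0,1]$ such that $f_0\in[\mathcal{H}]^\beta$. (A6) There exists $\alpha\in(0,\beta)$ such that the inclusion $[\mathcal{H}]^\alpha\hookrightarrow\mathcal{L}^\infty_v([0,1]^d)$ is continuous. Let $\lambda=\lambda_n>0$ and let $$\widehat f_n=\operatorname*{argmin}_{f\in\mathcal{H}}\Big[\frac1n\sum_{i=1}^n\rho(y_i-f(x_i))+\lambda\|f\|_{\mathcal{H}}^2\Big].$$ Suppose that $\lambda\to0$ in such a way that $\lambda^{-1/m}[\log(1/\lambda)]^{2(d-1)}/n\to0$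 and $\lambda^{\beta-1/(2m)}[\log(1/\lambda)]^{d-1}\to0$. Then $$\int_{[0,1]^d}\{\widehat f_n(x)-f_0(x)\}^2\,dx=O_{\mathbb{P}}\left(\frac{[\log(1/\lambda)]^{d-1}}{n\lambda^{\frac1{2m}}}\right)+O_{\mathbb{P}}(\lambda^\beta),\qquad n\to\infty.$$
   Context: $\psi:\mathbb{R}\to\mathbb{R}$ denotes a fixed Borel version of the a.e. derivative of $\rho$. The objects $v,\rho,f_0$ and the law of $\epsilon_1$ do not depend on $n$. $\mathcal{H}^m([0,1])$ is the standard univariate Sobolev space of functions in $\mathcal{L}^2([0,1])$ with all weak derivatives of order $\le m$ in $\mathcal{L}^2([0,1])$, with its usual inner product $\sum_{k=0}^m\int_0^1 f^{(k)}g^{(k)}$. It is an RKHS with a kernel $K$; let $(\mu_j,\phi_j)_{j\ge1}$ be the eigenvalues and $\mathcal{L}^2([0,1])$-orthonormal eigenfunctions of the integral operator with kernel $K$ on $\mathcal{L}^2([0,1])$ (Lebesgue measure), so $\{\phi_j\}$ is a complete orthonormal system of $\mathcal{L}^2([0,1])$ and $\{\mu_j^{1/2}\phi_j\}$ of $\mathcal{H}^m([0,1])$. Tensor product space: $\mathcal{H}^m([0,1])^{\otimes d}$ consists of all $f:[0,1]^d\to\mathbb{R}$ of the form $f(x)=\sum_{i_1,\dots,i_d\ge1}f_{i_1,\dots,i_d}\phi_{i_1}(x_1)\cdots\phi_{i_d}(x_d)$ with $\|f\|^2_{\mathcal{H}^m([0,1])^{\otimes d}}:=\sum_{i_1,\dots,i_d}|f_{i_1,\dots,i_d}|^2/(\mu_{i_1}\cdots\mu_{i_d})<\infty$.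 It is an RKHS with kernel $\widetilde K(x,y)=\prod_{i=1}^dK(x_i,y_i)$. Below $\|\cdot\|_{\mathcal{H}}$ is this norm. Power spaces: let $(\widetilde\mu_j,\widetilde\phi_j)_{j\ge1}$ be the (positive) eigenvalues and $\mathcal{L}^2_v([0,1]^d)$-orthonormal eigenfunctions of $f\mapsto\int_{[0,1]^d}\widetilde K(\cdot,y)f(y)\,v(dy)$ on $\mathcal{L}^2_v([0,1]^d)$. For $\beta\in(0,1]$, $[\mathcal{H}]^\beta=\{\sum_jf_j\widetilde\mu_j^{\beta/2}\widetilde\phi_j:\sum_j|f_j|^2<\infty\}$ with norm $\|\sum_jf_j\widetilde\mu_j^{\beta/2}\widetilde\phi_j\|_\beta=(\sum_jf_j^2)^{1/2}$. $Z_n=O_{\mathbb{P}}(a_n)$ means $Z_n/a_n$ is bounded in probability as $n\to\infty$; the displayed conclusion means the left side is bounded by the sum of two such terms. *)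

(* Defs.v *)
From HB Require Import structures.
From mathcomp Require Export all_boot all_order all_algebra finmap.
From mathcomp Require Export all_classical all_reals all_analysis ess_sup_inf.
Export Order.TTheory GRing.Theory Num.Theory numFieldNormedType.Exports.

Set Implicit Arguments.
Unset Strict Implicit.
Unset Printing Implicit Defensive.

Local Open Scope classical_set_scope.
Local Open Scope ring_scope.

Section lebesgue_tuple.
Context {R : realType}.

(* [R] carries its Borel sets under two displays: the default one, inherited by
   [n.-tuple R], and that of [measurableTypeR R], the domain of
   [lebesgue_measure]. The two families of measurable sets are convertible. *)
Let toR : measurableTypeR R -> R := idfun.
Let ofR : R -> measurableTypeR R := idfun.

Let measurable_toR : measurable_fun setT toR.
Proof. exact: (@measurable_id _ (measurableTypeR R) setT). Qed.

Let measurable_ofR : measurable_fun setT ofR.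
Proof. exact: (@measurable_id _ (measurableTypeR R) setT). Qed.

Definition tuple_cons (n : nat) (p : measurableTypeR R * n.-tuple R) : n.+1.-tuple R :=
  [tuple of (p.1 : R) :: p.2].

Definition tuple_uncons (n : nat) (t : n.+1.-tuple R) : measurableTypeR R * n.-tuple R :=
  (thead t, [tuple of behead t]).

Lemma measurable_tuple_cons (n : nat) :
  measurable_fun [set: measurableTypeR R * n.-tuple R] (@tuple_cons n).
Proof.
apply: (@measurable_cons _ _ _ _ (toR \o fst) n snd _ measurable_snd).
exact: measurableT_comp measurable_toR measurable_fst.
Qed.

Lemma measurable_tuple_uncons (n : nat) :
  measurable_fun [set: n.+1.-tuple R] (@tuple_uncons n).
Proof.
apply/measurable_fun_pairP; split; last exact: measurable_behead.
apply: (measurableT_comp measurable_ofR).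
exact: measurable_tnth.
Qed.

Lemma tuple_consK (n : nat) : cancel (@tuple_cons n) (@tuple_uncons n).
Proof.
move=> [x t]; rewrite /tuple_uncons /tuple_cons /= theadE; congr pair.
exact: val_inj.
Qed.

Section step.
Variables (n : nat) (nu : {sigma_finite_measure set (measurableTypeR R) -> \bar R})
  (mu : {sigma_finite_measure set (n.-tuple R) -> \bar R}).

Definition prod_cons : set (n.+1.-tuple R) -> \bar R :=
  pushforward (nu \x mu)%E (@tuple_cons n).

Let preimage_cons (A : set (n.+1.-tuple R)) :
  measurable A -> measurable (@tuple_cons n @^-1` A).
Proof.
by move=> mA; rewrite -[X in measurable X]setTI; exact: measurable_tuple_cons.
Qed.

Let prod_cons0 : prod_cons set0 = 0%E.
Proof. by rewrite /prod_cons /pushforward preimage_set0 measure0. Qed.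

Let prod_cons_ge0 A : (0 <= prod_cons A)%E.
Proof. by rewrite /prod_cons /pushforward; exact: measure_ge0. Qed.

Let prod_cons_sigma_additive : semi_sigma_additive prod_cons.
Proof.
move=> F mF tF mUF; rewrite /prod_cons /pushforward preimage_bigcup.
apply: measure_semi_sigma_additive.
- by move=> k; exact: preimage_cons.
- apply/trivIsetP => /= i j _ _ ij; rewrite -preimage_setI.
  by move/trivIsetP : tF => /(_ _ _ _ _ ij) ->//; rewrite preimage_set0.
- by rewrite -preimage_bigcup; exact: preimage_cons.
Qed.

HB.instance Definition _ := isMeasure.Build _ _ _ prod_cons
  prod_cons0 prod_cons_ge0 prod_cons_sigma_additive.

Let prod_cons_sigma_finite : sigma_finite setT prod_cons.
Proof.
have /sigma_finiteP[F [FT ndF mF]] := sigma_finiteT nu.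
have /sigma_finiteP[G [GT ndG mG]] := sigma_finiteT mu.
exists (fun k => @tuple_uncons n @^-1` (F k `*` G k)).
  apply/seteqP; split=> // t _.
  have [i _ Fi] : (\bigcup_i F i) (tuple_uncons t).1 by rewrite -FT.
  have [j _ Gj] : (\bigcup_i G i) (tuple_uncons t).2 by rewrite -GT.
  exists (maxn i j) => //; split.
    by move: Fi; exact/subsetPset/ndF/leq_maxl.
  by move: Gj; exact/subsetPset/ndG/leq_maxr.
move=> k; have [mFk Fkoo] := mF k; have [mGk Gkoo] := mG k; split.
  rewrite -[X in measurable X]setTI; apply: measurable_tuple_uncons => //.
  exact: measurableX.
rewrite /prod_cons /pushforward.
have -> : @tuple_cons n @^-1` (@tuple_uncons n @^-1` (F k `*` G k)) =
    F k `*` G k.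
  by apply/funext => p; rewrite /preimage /mkset tuple_consK.
by rewrite product_measure1E// lte_mul_pinfty// ge0_fin_numE.
Qed.

HB.instance Definition _ := Measure_isSigmaFinite.Build _ _ _ prod_cons
  prod_cons_sigma_finite.

End step.

Fixpoint lebesgue_tuple (n : nat) :
    {sigma_finite_measure set (n.-tuple R) -> \bar R} :=
  match n with
  | 0%N => @dirac _ (0.-tuple R) [tuple] R
  | k.+1 => prod_cons (@lebesgue_measure R) (lebesgue_tuple k)
  end.

End lebesgue_tuple.

Definition unit_cube (R : realType) (d : nat) : set (d.-tuple R) :=
  [set x | forall k, 0 <= tnth x k <= 1].

Section integral_operators.
Context {dX : measure_display} {X : measurableType dX} {R : realType}.
Variables (nu : {measure set X -> \bar R}) (D : set X).

Definition square_integrable (f : X -> R) : Prop :=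
  measurable_fun D f /\ (\int[nu]_(x in D) (f x ^+ 2)%:E < +oo)%E.

Definition integral_operator (k : X -> X -> R) (f : X -> R) : X -> R :=
  fun x => \int[nu]_(y in D) (k x y * f y).

(* The last clause says that the list exhausts the positive spectrum: the
   operator vanishes on the orthogonal complement of the [phi j]. *)
Definition eigen_system (k : X -> X -> R) (mu : nat -> R)
    (phi : nat -> X -> R) : Prop :=
  [/\ forall j, 0 < mu j,
      forall j, square_integrable (phi j),
      forall i j, \int[nu]_(x in D) (phi i x * phi j x) = (i == j)%:R,
      forall j, {ae nu, forall x, D x ->
        integral_operator k (phi j) x = mu j * phi j x}
    & forall f, square_integrable f ->
        (forall j, \int[nu]_(x in D) (f x * phi j x) = 0) ->
        {ae nu, forall x, D x -> integral_operator k f x = 0}].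

(* [f] represents the class of \sum_j c_j mu_j^(b/2) phi_j, the series
   converging in L^2(nu, D). *)
Definition power_expansion (mu : nat -> R) (phi : nat -> X -> R) (b : R)
    (c : nat -> R) (f : X -> R) : Prop :=
  [/\ (\sum_(0 <= j <oo) (c j ^+ 2)%:E < +oo)%E,
      square_integrable f
    & (\int[nu]_(x in D)
        ((f x - (\sum_(j < N) c j * mu j `^ (b / 2) * phi j x)%R) ^+ 2)%:E)%E
        @[N --> \oo] --> 0%E].

Definition power_space (mu : nat -> R) (phi : nat -> X -> R) (b : R) :
    set (X -> R) :=
  [set f | exists c, power_expansion mu phi b c f].

Definition power_embeds_Linfty (mu : nat -> R) (phi : nat -> X -> R)
    (b : R) : Prop :=
  exists C : R, forall c f, power_expansion mu phi b c f ->
    (ess_sup nu (fun x => (`|(f \_ D) x|)%:E) <=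
     C%:E * (\sum_(0 <= j <oo) (c j ^+ 2)%:E) `^ 2^-1)%E.

End integral_operators.

Section sobolev.
Context {R : realType}.

Local Notation I01 := (`[0%R, 1%R]%classic : set R).
Local Notation leb := (@lebesgue_measure R).

Definition test_function (h : R -> R) : Prop :=
  (forall k x, derivable (derive1n k h) x 1) /\
  exists a b, [/\ 0 < a, b < 1 & forall x, h x != 0 -> a <= x <= b].

Definition weak_derivative (k : nat) (f g : R -> R) : Prop :=
  square_integrable leb I01 g /\
  forall h, test_function h ->
    \int[leb]_(x in I01) (f x * derive1n k h x) =
    (-1) ^+ k * \int[leb]_(x in I01) (g x * h x).

(* Choice of a version; weak derivatives are unique up to null sets. *)
Definition wderiv (k : nat) (f : R -> R) : R -> R :=
  xget (fun=> 0) [set g | weak_derivative k f g].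

Definition sobolev_inner (m : nat) (f g : R -> R) : R :=
  \sum_(k < m.+1) \int[leb]_(x in I01) (wderiv k f x * wderiv k g x).

(* For m >= 1 each class has exactly one continuous representative; it is the
   one on which point evaluation, hence the RKHS structure, is defined. *)
Definition sobolev (m : nat) : set (R -> R) :=
  [set f | [/\ {within I01, continuous f},
               square_integrable leb I01 f
             & forall k, (k <= m)%N -> exists g, weak_derivative k f g]].

Definition sobolev_kernel (m : nat) (K : R -> R -> R) : Prop :=
  forall x, I01 x -> sobolev m (K x) /\
    forall f, sobolev m f -> sobolev_inner m f (K x) = f x.

(* The eigenfunctions are taken in H^m, i.e. as continuous representatives,
   since the tensor product space below uses their pointwise values. *)
Definition sobolev_eigen_system (m : nat) (K : R -> R -> R) (mu : nat -> R)
    (phi : nat -> R -> R) : Prop :=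
  eigen_system leb I01 K mu phi /\ forall j, sobolev m (phi j).

End sobolev.

Definition has_sum (R : realType) (I : choiceType) (F : I -> R) (s : R) : Prop :=
  forall e, 0 < e -> exists A : {fset I}, forall B : {fset I},
    fsubset A B -> `|\sum_(i <- B) F i - s| < e.

Section tensor.
Context {R : realType}.
Variables (d : nat) (mu : nat -> R) (phi : nat -> R -> R).

Definition tensor_expansion (c : d.-tuple nat -> R) (f : d.-tuple R -> R) : Prop :=
  forall x, unit_cube x ->
    has_sum (fun i => c i * \prod_(k < d) phi (tnth i k) (tnth x k)) (f x).

(* Membership of [f] together with its squared norm [s]; stated as a relation
   because the norm is read off the coefficients (which [f] determines). *)
Definition tensor_sqnorm (f : d.-tuple R -> R) (s : R) : Prop :=
  exists2 c, tensor_expansion c f &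
    (\esum_(i in [set: d.-tuple nat])
       (c i ^+ 2 / \prod_(k < d) mu (tnth i k))%:E = s%:E)%E.

Definition penalized_risk (rho : R -> R) (lambda : R) (n : nat)
    (x : 'I_n -> d.-tuple R) (y : 'I_n -> R) (f : d.-tuple R -> R) (s : R) : R :=
  n%:R^-1 * \sum_(i < n) rho (y i - f (x i)) + lambda * s.

Definition penalized_argmin (rho : R -> R) (lambda : R) (n : nat)
    (x : 'I_n -> d.-tuple R) (y : 'I_n -> R) : set (d.-tuple R -> R) :=
  [set f | exists2 s, tensor_sqnorm f s & forall g t, tensor_sqnorm g t ->
     penalized_risk rho lambda x y f s <= penalized_risk rho lambda x y g t].

End tensor.

Definition tensor_kernel (R : realType) (d : nat) (K : R -> R -> R)
    (x y : d.-tuple R) : R :=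
  \prod_(k < d) K (tnth x k) (tnth y k).

Definition bounded_density (R : realType) (d : nat)
    (v : {measure set (d.-tuple R) -> \bar R}) : Prop :=
  exists (p : d.-tuple R -> R) (c1 c2 : R),
    [/\ 0 < c1,
        measurable_fun (@unit_cube R d) p,
        forall x, unit_cube x -> c1 <= p x <= c2
      & forall A, measurable A ->
          v A = (\int[lebesgue_tuple d]_(x in A `&` @unit_cube R d) (p x)%:E)%E].

Section probability_notions.
Context {dO : measure_display} {Omega : measurableType dO} {R : realType}.
Variable P : probability Omega R.

Definition iid {dE : measure_display} {E : measurableType dE}
    (X : nat -> {mfun Omega >-> E}) : Prop :=
  (forall (J : {fset nat}) (A : nat -> set E), (forall i, measurable (A i)) ->
     (P (\bigcap_(i in [set` J]) X i @^-1` A i) =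
      \prod_(i <- J) P (X i @^-1` A i))%E) /\
  (forall i A, measurable A -> distribution P (X i) A = distribution P (X 0%N) A).

Definition sigma_generated {dE : measure_display} {E : measurableType dE}
    (X : nat -> {mfun Omega >-> E}) : set (set Omega) :=
  <<s \bigcup_i preimage_set_system setT (X i) measurable >>.

Definition independent_families {dE dF : measure_display}
    {E : measurableType dE} {F : measurableType dF}
    (X : nat -> {mfun Omega >-> E}) (Y : nat -> {mfun Omega >-> F}) : Prop :=
  forall A B, sigma_generated X A -> sigma_generated Y B ->
    P (A `&` B) = (P A * P B)%E.

(* Boundedness in probability of [Z n / a n] as n tends to infinity. [Z n] is
   not required to be measurable: the probability is the outer one (infimum over
   measurable supersets), which is [P] itself on measurable events. *)
Definition bigO_prob (Z : nat -> Omega -> R) (a : nat -> R) : Prop :=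
  forall e, 0 < e -> exists M : R, \forall n \near \oo,
    exists A : set Omega,
      [/\ measurable A, [set w | M < `|Z n w / a n|] `<=` A & (P A <= e%:E)%E].

End probability_notions.

(* On every compact interval; on the whole line a global modulus would exclude
   e.g. the square loss. *)
Definition absolutely_continuous (R : realType) (f : R -> R) : Prop :=
  forall a b e, a < b -> 0 < e -> exists2 delta, 0 < delta &
    forall (n : nat) (l r : 'I_n -> R),
      (forall i, a <= l i <= r i /\ r i <= b) ->
      trivIset setT (fun i => `]l i, r i[%classic) ->
      \sum_(i < n) (r i - l i) < delta ->
      \sum_(i < n) `|f (r i) - f (l i)| < e.

(* Main.v *)
(* Write a^2_lam for the sum of (1 + lam / mu_i) a_i^2 over multi-indices. Two
   facts about the eigensystem are needed. The interpolation inequality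
   |g(x)| <= C (h^(-1/2) |g|_2 + h^(m-1/2) |g|_(H^m)), applied to a function
   built from the kernel, yields sum_j phi_j(x)^2 / (1 + h^(2m) / mu_j) <= C / h,
   and a decomposition of the eigenvalues into shells turns it into the tensor bound
   N = C lam^(-1/2m) log(1/lam)^(d-1). The spectral cut-off f_lam of f0 satisfies
   lam |f_lam|_H^2 + |f0 - f_lam|_2^2 <= C lam^beta and, by (A6), is uniformly
   close to f0.

   By (A3) and (A4) the expected loss is comparable to a quadratic near 0. If the
   coefficients c of fhat - f_lam had c^2_lam > T, convexity would produce g on
   the segment with g^2_lam = T whose empirical penalized risk does not exceed
   that of f_lam; truncating and rounding, g may be taken in a countable class of
   finite rational combinations, on which |g| is uniformly small since T N -> 0.
   The expected risk of such a g exceeds that of f_lam by a multiple of g^2_lam,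
   up to lam^beta, so the empirical fluctuation at g is large. Symmetrization,
   contraction and completing the square coordinate by coordinate bound the
   expected supremum of the fluctuations, penalized by g^2_lam, by a constant
   times N; with T = D (N / n + lam^beta), Markov's inequality makes this event
   have probability O(1/D). *)

From HB Require Import structures.
Require Import Defs.
From mathcomp Require Import measurable_realfun.
From mathcomp Require Import ring lra.
From mathcomp Require Import zify.

Set Implicit Arguments.
Unset Strict Implicit.
Unset Printing Implicit Defensive.

Local Open Scope classical_set_scope.
Local Open Scope ring_scope.

(** The eigen-equation is an L^2 statement: it does not say how the [phi j] sit in H^m, and
    completeness of H^m is never established. So T q, for the kernel operator T, is approximated by
    finite combinations of kernel sections, and the energy, the integral of q T q, stands for its
    squared H^m-norm. Two eigensystems have to be reconciled. The power spaces use
    L^2(v)-eigenfunctions, the penalty uses the Lebesgue-orthonormal tensor basis. Mercer's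
    expansion is the bridge: for q in L^2(v) it gives the tensor coefficients and the squared tensor
    norm of T q explicitly. Up to constants, the two rate conditions say that N^2 / n and lam^beta N
    tend to 0. This is what makes T N small and keeps all candidates in the window where (A3) and
    (A4) act. Only two moments of psi(eps) are available, so the Lipschitz constant |psi(eps)| + M1
    of the loss stays random and enters through its second moment. The estimator is not assumed
    measurable. A measurable exceptional event, built from the sample and the cut-off, is fixed
    beforehand and serves for every minimizer at once. *)

Section square_integrable_functions.
Context {d : measure_display} {T : measurableType d} {R : realType}.
Variables (mu : {measure set T -> \bar R}) (D : set T).
Hypothesis mD : measurable D.
Implicit Types (f g h : T -> R) (a b : R).

Lemma le_integrable_EFin f g : measurable_fun D f ->
  (forall x, D x -> `|f x| <= g x) -> mu.-integrable D (EFin \o g) ->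
  mu.-integrable D (EFin \o f).
Proof.
move=> mf fg; apply: le_integrable => //; first exact/measurable_EFinP.
by move=> x Dx; rewrite /= lee_fin (le_trans (fg x Dx))// ler_norm.
Qed.

Lemma square_integrableP f : square_integrable mu D f <->
  measurable_fun D f /\ mu.-integrable D (EFin \o (fun x => f x ^+ 2)).
Proof.
split=> -[mf If]; split=> //.
  apply/integrableP; split.
    by apply/measurable_EFinP; exact: measurable_funX.
  by under eq_integral do rewrite /= ger0_norm ?sqr_ge0//.
move/integrableP : If => [_].
by under eq_integral do rewrite /= ger0_norm ?sqr_ge0//.
Qed.

Lemma integrableD_EFin f g : mu.-integrable D (EFin \o f) ->
  mu.-integrable D (EFin \o g) -> mu.-integrable D (EFin \o (fun x => f x + g x)).
Proof. by move=> If Ig; have := integrableD mD If Ig; apply: eq_integrable. Qed.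

Lemma integrableZ_EFin a f : mu.-integrable D (EFin \o f) ->
  mu.-integrable D (EFin \o (fun x => a * f x)).
Proof. by move=> If; have := integrableZl mD a If; apply: eq_integrable. Qed.

Lemma square_integrableM f g : square_integrable mu D f ->
  square_integrable mu D g -> mu.-integrable D (EFin \o (fun x => f x * g x)).
Proof.
move=> /square_integrableP[mf If] /square_integrableP[mg Ig].
apply: (le_integrable_EFin _ _ (integrableD_EFin If Ig)).
  exact: measurable_funM.
move=> x _; rewrite ler_norml; have := sqr_ge0 (f x + g x);
  have := sqr_ge0 (f x - g x); have := sqr_ge0 (f x); have := sqr_ge0 (g x); nra.
Qed.

Lemma square_integrableD f g : square_integrable mu D f ->
  square_integrable mu D g -> square_integrable mu D (fun x => f x + g x).
Proof.
move=> sf sg; have /square_integrableP[mf If] := sf; have /square_integrableP[mg Ig] := sg.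
apply/square_integrableP; split; first exact: measurable_funD.
have := integrableD_EFin If (integrableD_EFin (integrableZ_EFin 2 (square_integrableM sf sg)) Ig).
by apply: eq_integrable => // x _ /=; congr EFin; ring.
Qed.

Lemma square_integrableZ a f : square_integrable mu D f ->
  square_integrable mu D (fun x => a * f x).
Proof.
move=> /square_integrableP[mf If]; apply/square_integrableP; split.
  exact: measurable_funM.
have := integrableZ_EFin (a ^+ 2) If.
by apply: eq_integrable => // x _ /=; congr EFin; ring.
Qed.

Lemma square_integrableB f g : square_integrable mu D f ->
  square_integrable mu D g -> square_integrable mu D (fun x => f x - g x).
Proof.
move=> sf /(square_integrableZ (-1)) sg; have := square_integrableD sf sg.
by congr square_integrable; apply/funext => x; rewrite mulN1r.
Qed.

Lemma square_integrable0 : square_integrable mu D (fun=> 0).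
Proof.
by split=> //; under eq_integral do rewrite expr0n /=; rewrite integral0.
Qed.

Lemma square_integrable_sum (I : Type) (s : seq I) (P : pred I) (F : I -> T -> R) :
  (forall i, P i -> square_integrable mu D (F i)) ->
  square_integrable mu D (fun x => \sum_(i <- s | P i) F i x).
Proof.
move=> sF; elim: s => [|i s IH].
  have := square_integrable0; congr square_integrable.
  by apply/funext => x; rewrite big_nil.
have [Pi|Pi] := boolP (P i).
  have := square_integrableD (sF _ Pi) IH; congr square_integrable.
  by apply/funext => x; rewrite big_cons Pi.
move: IH; congr square_integrable.
by apply/funext => x; rewrite big_cons (negbTE Pi).
Qed.

Lemma Rintegral_sum (I : Type) (s : seq I) (P : pred I) (F : I -> T -> R) :
  (forall i, P i -> mu.-integrable D (EFin \o F i)) ->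
  \int[mu]_(x in D) (\sum_(i <- s | P i) F i x) =
  \sum_(i <- s | P i) \int[mu]_(x in D) F i x.
Proof.
move=> IF.
suff : mu.-integrable D (EFin \o (fun x => \sum_(i <- s | P i) F i x)) /\
   \int[mu]_(x in D) (\sum_(i <- s | P i) F i x) =
  \sum_(i <- s | P i) \int[mu]_(x in D) F i x by case.
elim: s => [|i s [IH1 IH2]].
  have E : (fun x => \sum_(i <- [::] | P i) F i x) = (fun=> 0).
    by apply/funext => x; rewrite big_nil.
  rewrite E big_nil; split; first exact: integrable0.
  by rewrite /Rintegral integral0.
have [Pi|Pi] := boolP (P i).
  have E : (fun x => \sum_(i <- i :: s | P i) F i x) = (fun x => F i x + \sum_(i <- s | P i) F i x).
    by apply/funext => x; rewrite big_cons Pi.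
  rewrite E big_cons Pi; split; first by apply: integrableD_EFin => //; exact: IF.
  rewrite -IH2 -RintegralD//; exact: IF.
have E : (fun x => \sum_(i <- i :: s | P i) F i x) = (fun x => \sum_(i <- s | P i) F i x).
  by apply/funext => x; rewrite big_cons (negbTE Pi).
by rewrite E big_cons (negbTE Pi).
Qed.

Definition sqnorm f := \int[mu]_(x in D) (f x ^+ 2).

Lemma sqnorm_ge0 f : 0 <= sqnorm f.
Proof. by apply: Rintegral_ge0 => x _; rewrite sqr_ge0. Qed.

(** Common source of the Cauchy-Schwarz inequalities for integrals, for the Sobolev form and for
    finite sums. Leaving the sign of c free spares a separate treatment of vanishing norms. *)
Lemma quadratic_discr (a b c : R) : 0 <= a ->
  (forall t, 0 <= a + 2 * t * b + t ^+ 2 * c) -> b ^+ 2 <= a * c.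
Proof.
move=> a0 H; have [c0|c0|c0] := ltgtP c 0.
(* Averaging over t and -t removes b. What is left is negative at t = u + 1 with u c = -(a + 1), so
   this case is void. *)
- have Hs t : 0 <= a + t ^+ 2 * c by have := H t; have := H (- t); rewrite sqrrN; nra.
  have := Hs ((a + 1) / - c + 1).
  set u := (a + 1) / - c => Ht; have Eu : u * c = - (a + 1).
    by rewrite /u; field; rewrite lt_eqF.
  have u0 : 0 < u by rewrite divr_gt0 ?oppr_gt0//; lra.
  have E : (u + 1) ^+ 2 * c = u * (u * c) + 2 * (u * c) + c by ring.
  by move: Ht; rewrite E Eu; nra.
- have := H (- b / c); have : (- b / c) * c = - b by field; rewrite gt_eqF.
  set t := _ / c => Et Ht.
  suff : b * b <= a * c by rewrite expr2.
  have : 0 <= (a + 2 * t * b + t ^+ 2 * c) * c by rewrite mulr_ge0// ltW.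
  have -> : (a + 2 * t * b + t ^+ 2 * c) * c = a * c + 2 * (t * c) * b + (t * c) ^+ 2 by ring.
  rewrite Et; nra.
- rewrite c0 mulr0; have [->|b0] := eqVneq b 0; first by rewrite expr0n.
  have := H (- (a + 1) / (2 * b)).
  have -> : 2 * (- (a + 1) / (2 * b)) * b = - (a + 1) by field.
  rewrite c0 mulr0; lra.
Qed.

Lemma cauchy_schwarz f g : square_integrable mu D f -> square_integrable mu D g ->
  (\int[mu]_(x in D) (f x * g x)) ^+ 2 <= sqnorm f * sqnorm g.
Proof.
move=> sf sg; apply: quadratic_discr; first exact: sqnorm_ge0.
move=> t; have /square_integrableP[_ If] := sf; have /square_integrableP[_ Ig] := sg.
have Ifg := square_integrableM sf sg.
have : 0 <= sqnorm (fun x => f x + t * g x) by exact: sqnorm_ge0.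
rewrite /sqnorm.
have -> : \int[mu]_(x in D) (f x + t * g x) ^+ 2 =
  \int[mu]_(x in D) (f x ^+ 2 + ((2 * t) * (f x * g x) + t ^+ 2 * g x ^+ 2)).
  by apply: eq_Rintegral => x _; ring.
have I2 := integrableZ_EFin (2 * t) Ifg; have I3 := integrableZ_EFin (t ^+ 2) Ig.
rewrite (RintegralD mD If (integrableD_EFin I2 I3)) (RintegralD mD I2 I3).
by rewrite !RintegralZl// addrA.
Qed.

Lemma Rintegral_ae_eq f g : measurable_fun D f -> measurable_fun D g ->
  {ae mu, forall x, D x -> f x = g x} ->
  \int[mu]_(x in D) f x = \int[mu]_(x in D) g x.
Proof.
move=> mf mg fg; rewrite /Rintegral; congr fine; apply: ae_eq_integral => //;
  [exact/measurable_EFinP..|].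
by apply: filterS fg => x fg Dx; rewrite fg.
Qed.

End square_integrable_functions.

(** * Test functions *)

Section smooth_functions.
Context {R : realType}.
Implicit Types (f g h : R -> R) (x y a b s u : R) (k n : nat).

Definition smooth h : Prop := forall k x, derivable (derive1n k h) x 1.

Lemma smooth_coind (P : (R -> R) -> Prop) :
  (forall h, P h -> (forall x, derivable h x 1) /\ P (derive1 h)) ->
  forall h, P h -> smooth h.
Proof.
move=> Pd h Ph k.
have Pk : P (derive1n k h).
  elim: k => [//|k IH]; rewrite derive1nS.
  by have [] := Pd _ IH.
by have [] := Pd _ Pk.
Qed.

Lemma smooth_derivable h x : smooth h -> derivable h x 1.
Proof. by move=> /(_ 0%N x). Qed.

Lemma smooth_derive1 h : smooth h -> smooth (derive1 h).
Proof.
by move=> sh k x; have := sh k.+1 x; rewrite /derive1n iterSr.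
Qed.

(** Finite order of smoothness, on which closure under products can be proved by induction: the
    derivative of a product is a sum of products in which one factor has lost an order. *)
Fixpoint is_Ck k h : Prop :=
  if k is k'.+1 then (forall x, derivable h x 1) /\ is_Ck k' (derive1 h)
  else True.

Lemma smoothP h : smooth h <-> forall k, is_Ck k h.
Proof.
split.
  move=> sh k; elim: k h sh => [//|k IH] h sh /=; split.
    by move=> x; exact: smooth_derivable.
  exact/IH/smooth_derive1.
move=> Ch; apply: (@smooth_coind (fun h => forall k, is_Ck k h)) => // {Ch}h Ch.
split; first by have [] := Ch 1%N.
by move=> k; have [] := Ch k.+1.
Qed.

Lemma is_CkS k h : is_Ck k.+1 h -> is_Ck k h.
Proof. by elim: k h => [//|k IH] h [dh /IH]. Qed.

Lemma is_derive1_eq h (dh : R -> R) :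
  (forall x, is_derive x 1 h (dh x)) ->
  (forall x, derivable h x 1) /\ derive1 h = dh.
Proof.
move=> H; split=> [x|]; first exact: (@ex_derive _ _ _ _ _ _ _ (H x)).
by apply/funext => x; rewrite derive1E; exact: (@derive_val _ _ _ _ _ _ _ (H x)).
Qed.

Lemma derivable_is_derive h x : derivable h x 1 -> is_derive x 1 h (derive1 h x).
Proof. by move=> dh; rewrite derive1E; exact: DeriveDef. Qed.

Lemma is_CkD k f g : is_Ck k f -> is_Ck k g -> is_Ck k (fun x => f x + g x).
Proof.
elim: k f g => [//|k IH] f g [df Cf] [dg Cg].
have [D E] := @is_derive1_eq (fun x => f x + g x) (fun x => derive1 f x + derive1 g x)
  (fun x => is_deriveD (derivable_is_derive (df x)) (derivable_is_derive (dg x))).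
by split=> //; rewrite E; exact: IH.
Qed.

Lemma is_CkN k f : is_Ck k f -> is_Ck k (fun x => - f x).
Proof.
elim: k f => [//|k IH] f [df Cf].
have [D E] := @is_derive1_eq (fun x => - f x) (fun x => - derive1 f x)
  (fun x => is_deriveN (derivable_is_derive (df x))).
by split=> //; rewrite E; exact: IH.
Qed.

Lemma is_CkM k f g : is_Ck k f -> is_Ck k g -> is_Ck k (fun x => f x * g x).
Proof.
elim: k f g => [//|k IH] f g Cf Cg.
have [df Cf'] := Cf; have [dg Cg'] := Cg.
have [D E] := @is_derive1_eq (fun x => f x * g x)
  (fun x => f x * derive1 g x + g x * derive1 f x)
  (fun x => is_deriveM (derivable_is_derive (df x)) (derivable_is_derive (dg x))).
split=> //; rewrite E; apply: is_CkD; apply: IH => //; exact: is_CkS.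
Qed.

Lemma is_Ck_cst k a : is_Ck k (fun=> a).
Proof.
elim: k a => [//|k IH] a.
have [D E] := @is_derive1_eq (fun=> a : R) (fun=> 0) (fun x => is_derive_cst a x 1).
by split => //; rewrite E; exact: IH.
Qed.

Lemma is_Ck_comp_affine k f a b : is_Ck k f -> is_Ck k (fun x => f (a * x + b)).
Proof.
elim: k f => [//|k IH] f [df Cf].
have dab x : is_derive x 1 (fun x : R => a * x + b) a.
  by apply: is_derive_eq; rewrite /GRing.scale /= addr0 mulr1.
have [D E] := @is_derive1_eq (fun x => f (a * x + b)) (fun x => derive1 f (a * x + b) * a)
  (fun x => @is_derive1_comp R f (fun x => a * x + b) x _ _ (derivable_is_derive (df (a * x + b))) (dab x)).
split=> //; rewrite E; apply: (is_CkM (IH _ Cf)).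
exact: is_Ck_cst.
Qed.

Lemma smoothB f g : smooth f -> smooth g -> smooth (fun x => f x - g x).
Proof.
move=> /smoothP sf /smoothP sg; apply/smoothP => k; apply: is_CkD => //.
exact: is_CkN.
Qed.

Lemma smoothM f g : smooth f -> smooth g -> smooth (fun x => f x * g x).
Proof. by move=> /smoothP sf /smoothP sg; apply/smoothP => k; exact: is_CkM. Qed.

Lemma smooth_cst a : smooth (fun=> a).
Proof. by apply/smoothP => k; exact: is_Ck_cst. Qed.

Lemma smooth_affine f a b : smooth f -> smooth (fun x => f (a * x + b)).
Proof. by move=> /smoothP sf; apply/smoothP => k; exact: is_Ck_comp_affine. Qed.

Lemma smooth_shift f s : smooth f -> smooth (fun x => f (x - s)).
Proof.
move=> /(@smooth_affine _ 1 (- s)); congr smooth.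
by apply/funext => x; rewrite mul1r.
Qed.

Lemma smooth_continuous f : smooth f -> continuous f.
Proof.
by move=> sf x; apply/differentiable_continuous/derivable1_diffP/smooth_derivable.
Qed.

Lemma smooth_primitive f g : (forall x, is_derive x 1 g (f x)) -> smooth f -> smooth g.
Proof.
move=> /is_derive1_eq[dg Eg] /smoothP sf; apply/smoothP => -[//|k].
by split => //; rewrite Eg.
Qed.

(* The flat functions p(1/u) exp(-1/u), extended by 0 to u <= 0, are closed
   under differentiation. *)
Definition flat (p : {poly R}) (u : R) : R :=
  if 0 < u then p.[u^-1] * expR (- u^-1) else 0.

(** With n = [size p], the exponential series gives exp(1/u) >= u^-(n+2) / (n+2)!, which beats
    p(1/u) with u^2 to spare. The spare square makes the difference quotient at 0 vanish in the
    limit. *)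
Lemma flat_bound (p : {poly R}) : exists2 C : R, 0 <= C &
  forall u, 0 < u <= 1 -> `|flat p u| <= C * u ^+ 2.
Proof.
set n := size p.
exists (\sum_(i < n) `|p`_i| * (n.+2)`!%:R).
  by apply: sumr_ge0 => i _; rewrite mulr_ge0.
move=> u /andP[u0 u1]; rewrite /flat u0 normrM (ger0_norm (expR_ge0 _)).
have i1 : 1 <= u^-1 by rewrite invf_ge1.
have i0 : 0 < u^-1 by rewrite invr_gt0.
rewrite expRN.
have E : expR u^-1 >= u^-1 ^+ n.+2 / (n.+2)`!%:R.
  apply: le_trans (expR_ge1Dxn n.+1 (ltW i0)).
  by rewrite lerDr.
have un0 : 0 < u ^+ n.+2 by rewrite exprn_gt0.
have E' : (expR u^-1)^-1 <= (n.+2)`!%:R * u ^+ n.+2.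
  rewrite exprVn in E; move: (u ^+ n.+2) un0 E => X X0 E.
  rewrite -[leRHS]invrK lef_pV2 ?posrE ?expR_gt0 ?invr_gt0 ?mulr_gt0 ?ltr0n ?fact_gt0//.
  by rewrite invfM mulrC.
apply: (@le_trans _ _ (\sum_(i < n) `|p`_i| * u^-1 ^+ n * ((n.+2)`!%:R * u ^+ n.+2))).
  rewrite -mulr_suml; apply: ler_pM => //.
  rewrite horner_coef; apply: (le_trans (ler_norm_sum _ _ _)).
  apply: ler_sum => i _; rewrite normrM ler_wpM2l// normrX gtr0_norm//.
  by apply: ler_weXn2l => //; rewrite ltnW.
rewrite mulr_suml; apply: ler_sum => i _.
rewrite -!mulrA ler_wpM2l// mulrCA ler_wpM2l//.
have -> : u ^+ n.+2 = u ^+ n * u ^+ 2 by rewrite -exprD addn2.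
by rewrite mulrA -exprMn mulVf ?gt_eqF// expr1n mul1r.
Qed.

(** For u > 0 the chain rule applied to p(1/u) exp(-1/u) produces the polynomial (p - p') X^2 in
    1/u; at 0 the derivative is 0 by [flat_bound]. *)
Lemma is_derive_flat (p : {poly R}) u :
  is_derive u 1 (flat p) (flat ((p - p^`()) * 'X^2) u).
Proof.
have [u0|u0|<-] := ltgtP 0 u.
- have H : is_derive u 1 (fun u => p.[u^-1] * expR (- u^-1))
     (flat ((p - p^`()) * 'X^2) u).
    have u1 : u != 0 by rewrite gt_eqF.
    have dV : is_derive u 1 (fun u : R => u^-1) (- u ^- 2).
      apply: is_derive_eq; first exact: is_deriveV.
      by rewrite /GRing.scale /= mulr1 .
    have dp : is_derive u 1 (fun u => p.[u^-1]) ((p^`()).[u^-1] * - u^- 2).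
      have := @is_derive1_comp R (horner p) (fun u => u^-1) u _ _ (is_derive_poly p _) dV.
      by [].
    have de : is_derive u 1 (fun u => expR (- u^-1)) (expR (- u^-1) * u^- 2).
      have := @is_derive1_comp R expR (fun u => - u^-1) u _ _ (is_derive_expR _) (is_deriveN dV).
      by rewrite opprK.
    apply: (is_derive_eq (is_deriveM dp de)).
    rewrite /flat u0 /GRing.scale /= !hornerE /=. by field.
  apply: (near_eq_is_derive _ H).
  by near=> v; rewrite /flat ifT//; near: v; exact: lt_nbhsr.
- rewrite /flat ltNge (ltW u0) /=.
  apply: (near_eq_is_derive _ (is_derive_cst 0 u 1)).
  by near=> v; rewrite ltNge (_ : v <= 0)//; apply/ltW; near: v; exact: lt_nbhsl.
- rewrite {2}/flat ltxx.
  have [C C0 HC] := flat_bound p.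
  have L : (fun h : R => h^-1 *: (flat p (h *: 1 + 0) - flat p 0)) @ 0^' --> (0 : R).
    apply/cvgr0Pnorm_le => e e0.
    near=> h; have h0 : h != 0 by near: h; exact: nbhs_dnbhs_neq.
    rewrite /GRing.scale /= mulr1 addr0 {2}/flat ltxx subr0.
    have [hp|hn] := ltP 0 h; last by rewrite /flat ltNge hn mulr0 normr0 ltW.
    rewrite normrM gtr0_norm ?invr_gt0// mulrC ler_pdivrMr//.
    have h1 : h <= 1.
      have : `|h| < 1 by near: h; exact: dnbhs0_lt.
      by rewrite gtr0_norm//; exact: ltW.
    rewrite (le_trans (HC _ _)) ?hp// expr2 mulrA ler_wpM2r ?ltW//.
    have hC : h < e / (C + 1).
      have : `|h| < e / (C + 1) by near: h; apply: dnbhs0_lt; rewrite divr_gt0//; lra.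
      by rewrite gtr0_norm.
    move: hC; rewrite ltr_pdivlMr; last lra.
    by apply: le_lt_trans; nra.
  apply: DeriveDef; first by apply/cvg_ex; exists 0.
  by apply: cvg_lim.
Unshelve. all: by end_near. Qed.

Lemma smooth_flat p : smooth (flat p).
Proof.
apply: (@smooth_coind (fun h => exists p, h = flat p)); last by exists p.
move=> _ [q ->]; have [D E] := is_derive1_eq (is_derive_flat q).
by split=> //; rewrite E; eexists.
Qed.

Lemma bump_exists a b : a < b -> exists h, [/\ smooth h, forall x, 0 <= h x,
  forall x, a < x < b -> 0 < h x & forall x, ~~ (a < x < b) -> h x = 0].
Proof.
move=> ab; pose e := flat 1.
have e0 u : 0 <= e u by rewrite /e /flat; case: ifP => // _; rewrite hornerC mul1r expR_ge0.
have e1 u : 0 < u -> 0 < e u by move=> u0; rewrite /e /flat u0 hornerC mul1r expR_gt0.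
have e2 u : u <= 0 -> e u = 0 by move=> u0; rewrite /e /flat ltNge u0.
exists (fun x => e (x - a) * e (b - x)); split.
- apply: smoothM; first exact/smooth_shift/smooth_flat.
  have := @smooth_affine e (-1) b (@smooth_flat 1); congr smooth.
  by apply/funext => x; congr e; ring.
- by move=> x; rewrite mulr_ge0.
- by move=> x /andP[ax xb]; rewrite mulr_gt0// e1// subr_gt0.
- move=> x; rewrite negb_and -!leNgt => /orP[xa|bx].
    by rewrite e2 ?mul0r// subr_le0.
  by rewrite [X in _ * X]e2 ?mulr0// subr_le0.
Qed.

End smooth_functions.

Section test_functions.
Context {R : realType}.
Local Notation I01 := (`[0%R, 1%R]%classic : set R).
Local Notation leb := (@lebesgue_measure R).
Implicit Types (f g h B E G : R -> R) (x y a b s u : R) (k m n : nat).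

Lemma measurable_I01 : measurable (I01 : set (measurableTypeR R)).
Proof. exact: measurable_itv. Qed.

Lemma within_continuousM (A : set R) f g : {within A, continuous f} ->
  {within A, continuous g} -> {within A, continuous (fun x => f x * g x)}.
Proof. by move=> cf cg x; apply: cvgM; [exact: cf|exact: cg]. Qed.

Lemma within_continuousD (A : set R) f g : {within A, continuous f} ->
  {within A, continuous g} -> {within A, continuous (fun x => f x + g x)}.
Proof. by move=> cf cg x; apply: cvgD; [exact: cf|exact: cg]. Qed.

Lemma within_continuous_cst (A : set R) (c : R) : {within A, continuous (fun=> c)}.
Proof. by apply: continuous_subspaceT => x; exact: cvg_cst. Qed.

Lemma within_continuousZ (A : set R) (c : R) f : {within A, continuous f} ->
  {within A, continuous (fun x => c * f x)}.
Proof. by move=> cf; apply: within_continuousM => //; exact: within_continuous_cst. Qed.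

Lemma within_continuous_eq (A : set R) f g : f =1 g ->
  {within A, continuous f} -> {within A, continuous g}.
Proof. by move=> /funext ->. Qed.

Lemma continuous_integrable_itv a b f : {within `[a, b], continuous f} ->
  leb.-integrable `[a, b] (EFin \o f).
Proof. by move=> cf; apply: continuous_compact_integrable => //; exact: segment_compact. Qed.

Lemma continuous_integrableT a b f : continuous f -> leb.-integrable `[a, b] (EFin \o f).
Proof. by move=> cf; apply: continuous_integrable_itv; exact: continuous_subspaceT. Qed.

Lemma continuous_square_integrable f : {within I01, continuous f} ->
  square_integrable leb I01 f.
Proof.
move=> cf; apply/square_integrableP; split.
  by have /measurable_int /measurable_EFinP := continuous_integrable_itv cf.
apply: continuous_integrable_itv.
by apply: within_continuous_eq (within_continuousM cf cf) => x; rewrite expr2.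
Qed.

Lemma is_derive_continuous E B x : is_derive x 1 E (B x) -> {for x, continuous E}.
Proof. by move=> dE; apply/differentiable_continuous/derivable1_diffP. Qed.

Lemma is_derive_MVT E B a b : (forall x, is_derive x 1 E (B x)) -> a < b ->
  exists2 c, a < c < b & E b - E a = B c * (b - a).
Proof.
move=> dE ab; have [|c /[!in_itv]/= cab cE] := MVT ab (fun x _ => dE x).
  by apply: continuous_subspaceT => x; exact: is_derive_continuous (dE x).
by exists c.
Qed.

(** The primitive is the integral over [0, x], which says nothing for x < 0. Vanishing of B up to
    some a > 0 makes it identically 0 there, so the fundamental theorem is only invoked at points x
    >= a. *)
Lemma antiderivative_exists a B : 0 < a -> continuous B -> (forall x, x <= a -> B x = 0) ->
  exists2 E : R -> R, (forall x, is_derive x 1 E (B x)) & (forall x, x <= a -> E x = 0).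
Proof.
move=> a0 cB Ba; pose E x := \int[leb]_(t in `[0, x]) B t.
have Ea x : x <= a -> E x = 0.
  move=> xa; rewrite /E (_ : Rintegral _ _ _ = \int[leb]_(t in `[0, x]) 0).
    by rewrite /Rintegral integral0.
  by apply: eq_Rintegral => t /[!inE]/= /[!in_itv]/= /andP[_ tx]; rewrite Ba// (le_trans tx).
exists E => // x; have [xa|ax] := ltP x a.
  apply: (near_eq_is_derive (f := cst 0)).
    by near=> y; rewrite Ea//; apply: ltW; near: y; exact: lt_nbhsl.
  by rewrite Ba ?ltW//; exact: is_derive_cst.
have xx1 : x < x + 1 by rewrite ltrDl.
have [dE <-] := continuous_FTC1_closed xx1
  (@continuous_integrableT 0 (x + 1) B cB) (lt_le_trans a0 ax) (cB x).
by rewrite derive1E; exact: DeriveDef.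
Unshelve. all: by end_near. Qed.

Lemma integral_is_derive E B a b : a < b -> (forall x, is_derive x 1 E (B x)) -> continuous B ->
  \int[leb]_(x in `[a, b]) B x = E b - E a.
Proof.
move=> ab dE cB; rewrite /Rintegral (@continuous_FTC2 _ B E)//.
- exact: continuous_subspaceT.
- split=> [x _||].
  + by have [] := dE x.
  + by apply: cvg_at_right_filter; exact: is_derive_continuous (dE a).
  + by apply: cvg_at_left_filter; exact: is_derive_continuous (dE b).
- by move=> x _; rewrite derive1E derive_val.
Qed.

(** E is a smooth step from 0 to 1 and B its derivative, a probability density concentrated on ]a,
    b[. B serves as averaging kernel, E starts the chain of antiderivatives in
    [bdiff_test_function]. *)
Lemma normalized_bump a b : 0 < a -> a < b -> exists B E : R -> R,
  [/\ [/\ smooth B, forall x, 0 <= B x & forall x, ~~ (a < x < b) -> B x = 0],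
      forall x, is_derive x 1 E (B x),
      forall x, x <= a -> E x = 0, forall x, b <= x -> E x = 1 & forall x, 0 <= E x <= 1].
Proof.
move=> a0 ab; have [h [sh h0 h1 h2]] := bump_exists ab.
have [E dE Ea] : exists2 E : R -> R, (forall x, is_derive x 1 E (h x)) & (forall x, x <= a -> E x = 0).
  apply: (antiderivative_exists a0); first exact: smooth_continuous.
  by move=> x xa; rewrite h2// negb_and -leNgt xa.
have [c cab Ec] := is_derive_MVT dE ab.
have Ebp : 0 < E b by move: Ec; rewrite (Ea a)// subr0 => ->; rewrite mulr_gt0 ?subr_gt0// h1.
have Eb x : b <= x -> E x = E b.
  rewrite le_eqVlt => /predU1P[->//|bx]; have [t /andP[bt tx]] := is_derive_MVT dE bx.
  by rewrite h2 ?mul0r => [/subr0_eq//|]; rewrite negb_and -!leNgt (ltW bt) orbT.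
have ndE x y : x <= y -> E x <= E y.
  rewrite le_eqVlt => /predU1P[->//|xy]; have [t _] := is_derive_MVT dE xy.
  by move=> Et; rewrite -subr_ge0 Et mulr_ge0// subr_ge0 ltW.
exists (fun x => (E b)^-1 * h x), (fun x => (E b)^-1 * E x); split.
- split=> [|x|x xab]; first exact: (@smoothM _ _ _ (@smooth_cst R (E b)^-1) sh).
  + by rewrite mulr_ge0// invr_ge0 ltW.
  + by rewrite h2// mulr0.
- by move=> x; have := is_deriveZ (E b)^-1 (dE x).
- by move=> x xa; rewrite (Ea x)// mulr0.
- by move=> x bx; rewrite (Eb x)// mulVf// gt_eqF.
- move=> x; apply/andP; split.
    apply: mulr_ge0; first by rewrite invr_ge0 ltW.
    have [xa|ax] := leP x a; first by rewrite Ea.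
    by rewrite -(Ea a)// ndE// ltW.
  rewrite mulrC ler_pdivrMr// mul1r; have [bx|xb] := leP b x; first by rewrite Eb.
  by rewrite ndE// ltW.
Qed.

Definition bdiff s f : R -> R := fun y => f y - f (y - s).

Lemma smooth_bdiff s f : smooth f -> smooth (bdiff s f).
Proof. by move=> sf; exact: (@smoothB _ _ _ sf (@smooth_shift _ _ s sf)). Qed.

Lemma is_derive_shift E B s x : (forall x, is_derive x 1 E (B x)) ->
  is_derive x 1 (fun y => E (y - s)) (B (x - s)).
Proof.
move=> dE; have d1 : is_derive x 1 (fun y : R => y - s) 1.
  by apply: is_derive_eq; rewrite subr0.
by have := @is_derive1_comp R E (fun y => y - s) x _ _ (dE _) d1; rewrite mulr1.
Qed.

Lemma is_derive_bdiff E B s x : (forall x, is_derive x 1 E (B x)) ->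
  is_derive x 1 (bdiff s E) (bdiff s B x).
Proof. by move=> dE; apply: is_deriveB; exact: is_derive_shift. Qed.

Lemma derive1n_bdiff k s f : smooth f -> derive1n k (bdiff s f) = bdiff s (derive1n k f).
Proof.
elim: k f => [//|k IH] f sf.
rewrite /derive1n !iterSr -/(derive1n k (derive1 f)) -/(derive1n k _).
have -> : derive1 (bdiff s f) = bdiff s (derive1 f).
  apply/funext => x; rewrite derive1E; apply: derive_val.
  by apply: is_derive_bdiff => y; exact/derivable_is_derive/smooth_derivable.
by rewrite IH; [|exact: (@smooth_derive1 _ _ sf)].
Qed.

Lemma iter_bdiffE m s f y : iter m (bdiff s) f y =
  \sum_(j < m.+1) (-1) ^+ j * 'C(m, j)%:R * f (y - s *+ j).
Proof.
elim: m f y => [|m IH] f y.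
  by rewrite big_ord1 /= expr0 mul1r bin0 mul1r mulr0n subr0.
rewrite iterSr IH /bdiff.
under eq_bigr do rewrite mulrBr.
rewrite big_split /= [RHS]big_ord_recl [in LHS]big_ord_recl /= !bin0 !expr0 mulr0n subr0 !mul1r -addrA; congr +%R.
rewrite [RHS]big_ord_recr /= [X in _ + X]big_ord_recr /= binn sumrN.
have -> : \sum_(i < m) (-1) ^+ bump 0 i * 'C(m.+1, bump 0 i)%:R * f (y - s *+ bump 0 i) =
   \sum_(i < m) ((-1) ^+ bump 0 i * 'C(m, bump 0 i)%:R * f (y - s *+ bump 0 i)
     - (-1) ^+ i * 'C(m, i)%:R * f (y - s *+ i - s)).
  apply: eq_bigr => i _; rewrite /bump leq0n !add1n binS natrD exprS mulrSr.
  by rewrite opprD addrA; ring.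
rewrite sumrB -!addrA; congr +%R; congr +%R.
rewrite /bump leq0n add1n !binn exprS (mulrSr s m) opprD; ring.
Qed.

(** G is a mollified B-spline. Taking a primitive and then a backward difference of step s
    integrates over a window of length s, which multiplies the supremum by s and lengthens the
    support by s. Testing a weak derivative of order m+1 with G produces the finite difference of
    order m+1 of f, averaged by B. *)
Lemma bdiff_test_function m a b s B E : smooth B -> (forall x, 0 <= B x) ->
    (forall x, ~~ (a < x < b) -> B x = 0) -> 0 < a -> a < b ->
    (forall x, is_derive x 1 E (B x)) -> (forall x, 0 <= E x <= 1) ->
    (forall x, x <= a -> E x = 0) -> (forall x, b <= x -> E x = 1) -> 0 < s ->
  exists G : R -> R, [/\ smooth G, derive1n m.+1 G = iter m.+1 (bdiff s) B,
    forall x, 0 <= G x <= s ^+ m & forall x, ~~ (a <= x <= b + s *+ m.+1) -> G x = 0].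
Proof.
move=> sB B0 Bs a0 ab dE E01 Ea Eb s0; elim: m => [|m [G [sG dG bG zG]]].
  have sE : smooth E by exact: smooth_primitive dE sB.
  exists (bdiff s E); split.
  - exact: smooth_bdiff.
  - rewrite derive1n_bdiff//= ; congr bdiff; apply/funext => x.
    by rewrite derive1E derive_val.
  - move=> x; rewrite expr0 /bdiff.
    have -> /= : 0 <= E x - E (x - s).
      have [t _ ->] := @is_derive_MVT E B (x - s) x dE ltac:(lra).
      by rewrite mulr_ge0//; lra.
    by have := E01 x; have := E01 (x - s); lra.
  - move=> x; rewrite negb_and -!ltNge mulr1n => /orP[xa|bx]; rewrite /bdiff.
      by rewrite !Ea ?subrr//; lra.
    by rewrite !Eb ?subrr//; lra.
(* G is known to vanish only strictly to the left of a, whence the point a / 2. *)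
have [F dF _] : exists2 F : R -> R, (forall x, is_derive x 1 F (G x)) & (forall x, x <= a / 2 -> F x = 0).
  apply: antiderivative_exists; [lra|exact: smooth_continuous|].
  by move=> x xa; rewrite zG// negb_and -!ltNge; apply/orP; left; lra.
have sF : smooth F by exact: smooth_primitive dF sG.
exists (bdiff s F); split.
- exact: smooth_bdiff.
- rewrite derive1n_bdiff//= -[in RHS]iterS -dG; congr bdiff.
  rewrite derive1nS -/(derive1n m.+1 F).
  have <- : derive1 F = G by apply/funext => x; rewrite derive1E derive_val.
  by rewrite /derive1n -iterS iterSr.
- move=> x; rewrite /bdiff; have [t _ ->] := @is_derive_MVT F G (x - s) x dF ltac:(lra).
  have /andP[g0 g1] := bG t.
  by rewrite opprB addrCA subrr addr0 mulr_ge0 ?(ltW s0)//= exprSr ler_wpM2r// ltW.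
- move=> x xz; rewrite /bdiff; have [t /andP[t1 t2] ->] := @is_derive_MVT F G (x - s) x dF ltac:(lra).
  rewrite zG ?mul0r//; move: xz; rewrite !negb_and -!ltNge => /orP[xa|bx].
    by apply/orP; left; lra.
  by apply/orP; right; move: bx; rewrite mulrSr; lra.
Qed.

End test_functions.

(** * Weak derivatives *)

Section weak_derivatives.
Context {R : realType}.
Local Notation I01 := (`[0%R, 1%R]%classic : set R).
Local Notation leb := (@lebesgue_measure R).
Local Notation mI := (@measurable_I01 R).
Implicit Types (f g h B E G : R -> R) (x y a b c e s u p q : R) (k m n : nat).

Lemma leb_I01 : leb I01 = 1%E.
Proof. by rewrite lebesgue_measure_itv /= lte_fin ltr01 oppr0 adde0. Qed.

Lemma Rintegral_I01_cst c : \int[leb]_(x in I01) c = c.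
Proof. by rewrite Rintegral_cst// [X in fine X](_ : _ = 1%E) /= ?mulr1//; exact: leb_I01. Qed.

Lemma integrable_I01_bounded f c : measurable_fun (I01 : set (measurableTypeR R)) f ->
  (forall x, I01 x -> `|f x| <= c) -> leb.-integrable I01 (EFin \o f).
Proof.
move=> mf fc; apply: measurable_bounded_integrable => //.
  by rewrite [X in (X < _)%E](_ : _ = 1%E) ?ltry//; exact: leb_I01.
by exists c; split=> [|z cz x Ix]; rewrite ?num_real//= (le_trans (fc x Ix))// ltW.
Qed.

Lemma smooth_within f : smooth f -> {within I01, continuous f}.
Proof. by move=> sf; apply: continuous_subspaceT; exact: (@smooth_continuous _ _ sf). Qed.

Lemma integrable_I01 f : {within I01, continuous f} -> leb.-integrable I01 (EFin \o f).
Proof. exact: continuous_integrable_itv. Qed.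

Lemma bump_average f c e p q B : {within I01, continuous f} -> continuous B ->
  (forall x, 0 <= B x) -> (forall x, ~~ (p < x < q) -> B x = 0) ->
  \int[leb]_(x in I01) B x = 1 ->
  (forall x, p < x < q -> `|f x - c| <= e) ->
  `|\int[leb]_(x in I01) (f x * B x) - c| <= e.
Proof.
move=> cf cB B0 Bs B1 fc.
have cBI : {within I01, continuous B} by exact: continuous_subspaceT.
have Ec : c = \int[leb]_(x in I01) (c * B x).
  by rewrite RintegralZl ?B1 ?mulr1//; exact: integrable_I01.
have Ee : e = \int[leb]_(x in I01) (e * B x).
  by rewrite RintegralZl ?B1 ?mulr1//; exact: integrable_I01.
have cfB := within_continuousM cf cBI.
have ccB := @within_continuousZ _ _ c _ cBI.
have ceB := @within_continuousZ _ _ e _ cBI.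
rewrite {1}Ec -RintegralB; [|exact: mI|exact: integrable_I01|exact: integrable_I01].
have cd : {within I01, continuous (fun x => f x * B x - c * B x)}.
  apply: (within_continuous_eq _ (within_continuousD cfB (@within_continuousZ _ _ (-1) _ ccB))) => x.
  by rewrite mulN1r.
apply: le_trans (le_normr_Rintegral mI (integrable_I01 cd)) _.
rewrite [leRHS]Ee; apply: le_Rintegral; [exact: mI| |exact: integrable_I01|].
  have /integrableP[md Id] := integrable_I01 cd.
  have := integrable_norm (integrable_I01 cd).
  by apply: eq_integrable; first exact: mI.
move=> x _; rewrite -mulrBl normrM (ger0_norm (B0 x)).
have [xs|xs] := boolP (p < x < q); first by rewrite ler_wpM2r// fc.
by rewrite Bs// !mulr0.
Qed.

Lemma shifted_bump_integral B E a b t : (forall x, is_derive x 1 E (B x)) -> continuous B ->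
  (forall x, x <= a -> E x = 0) -> (forall x, b <= x -> E x = 1) ->
  0 <= a + t -> b + t <= 1 -> \int[leb]_(x in I01) B (x - t) = 1.
Proof.
move=> dE cB Ea Eb at0 bt1.
have dE' x : is_derive x 1 (fun y => E (y - t)) (B (x - t)) by exact: is_derive_shift.
have cB' : continuous (fun y => B (y - t)).
  move=> x; apply: (@continuous_comp _ _ _ (fun y => y - t) B); last exact: cB.
  by apply: cvgB; [exact: cvg_id|exact: cvg_cst].
rewrite (integral_is_derive ltr01 dE' cB') Eb ?Ea ?subr0//; lra.
Qed.

Lemma within_continuous_at f x : {within I01, continuous f} -> 0 < x < 1 ->
  {for x, continuous f}.
Proof.
move=> /(continuous_within_itvP _ ltr01)[cf _ _] x01.
by apply: cf; rewrite in_itv.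
Qed.

Lemma continuous_delta f x e : {for x, continuous f} -> 0 < e ->
  exists2 d, 0 < d & forall y, `|y - x| < d -> `|f y - f x| <= e.
Proof.
move=> cf e0; have /cvgrPdist_le/(_ _ e0) := cf.
rewrite -nbhs_ballE => -[d /= d0 Hd]; exists d => // y yx.
by rewrite distrC; apply: Hd; rewrite /ball /= distrC.
Qed.

(** Testing with the G of [bdiff_test_function] turns the integral of g G into an average of the
    finite difference near u. Cauchy-Schwarz applies with G at most s^m on its support, and the
    averaging error vanishes as the bump shrinks to the point u. *)
Lemma fdiff_bound m f g u s : {within I01, continuous f} ->
  weak_derivative m.+1 f g -> 0 < u -> 0 < s -> u + s *+ m.+1 < 1 ->
  (\sum_(j < m.+2) (-1) ^+ j * 'C(m.+1, j)%:R * f (u + s *+ j)) ^+ 2 <=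
  s ^+ (2 * m) * (s *+ m.+1 *+ 2) * sqnorm leb I01 g.
Proof.
move=> cf [sg wg] u0 s0 usm; set M := m.+1; set S := \sum_(j < M.+1) _.
set c := fun j : 'I_M.+1 => (-1) ^+ j * 'C(M, j)%:R : R.
set K := s ^+ (2 * m) * _ * _.
have sM : 0 < s *+ M by rewrite pmulrn_lgt0.
have K0 : 0 <= K by rewrite !mulr_ge0 ?exprn_ge0 ?sqnorm_ge0 ?mulrn_wge0 ?ltW.
suff SK : `|S| <= Num.sqrt K.
  by rewrite -real_normK ?num_real// -[leRHS]sqr_sqrtr// lerXn2r ?nnegrE ?sqrtr_ge0.
(* Total weight of the nodes: an error e / C at each node adds up to at most e. The added 1 keeps C
   positive. *)
pose C := \sum_j `|c j| + 1.
have usM : u + s *+ M < 1 := usm.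
clear usm; have C0 : 0 < C by rewrite ltr_wpDl ?sumr_ge0.
apply/ler_addgt0Pr => e e0.
have eC : 0 < e / C by rewrite divr_gt0.
have sj (j : 'I_M.+1) : s *+ j <= s *+ M by rewrite ler_wpMn2l ?ltW// -ltnS.
have sj0 (j : 'I_M.+1) : 0 <= s *+ j by rewrite mulrn_wge0// ltW.
(* The bound eps <= s (m+1) limits the support of G to length 2 s (m+1), the origin of the factor 2
   in the statement. *)
have [eps [eps0 epss epsu epsf]] : exists eps : R, [/\ 0 < eps, eps <= s *+ M, u + s *+ M + eps < 1
    & forall j : 'I_M.+1, forall y, u + s *+ j < y < u + s *+ j + eps -> `|f y - f (u + s *+ j)| <= e / C].
  near (0:R)^'+ => eps; exists eps; split.
  - by near: eps; exact: nbhs_right_gt.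
  - by near: eps; exact: nbhs_right_le.
  - rewrite -ltrBrDl; near: eps; apply: nbhs_right_lt; rewrite subr_gt0//.
  - near: eps; apply: filter_forall => j.
    have cj : {for u + s *+ j, continuous f}.
      by apply: within_continuous_at => //; have := sj j; have := sj0 j; lra.
    have [d d0 Hd] := continuous_delta cj eC.
    near=> eps => y /andP[y1 y2]; apply: Hd; rewrite ltr_norml.
    have : eps < d by near: eps; exact: nbhs_right_lt.
    lra.
have [B [E [[sB B0 Bs] dE Ea Eb E01]]] := @normalized_bump R u (u + eps) u0 ltac:(lra).
have cB : continuous B by exact: (@smooth_continuous _ _ sB).
have [G [sG dG G01 zG]] := @bdiff_test_function R m u (u + eps) s B E sB B0 Bs u0
   ltac:(lra) dE E01 Ea Eb s0.
have tG : test_function G.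
  split=> //; exists u, (u + eps + s *+ M); split=> //; first lra.
  by move=> x; apply: contraNT => /zG ->.
have := wg _ tG; rewrite dG.
set Sf := \int[leb]_(x in I01) _ => ESf.
have ESf' : Sf = \sum_j c j * \int[leb]_(x in I01) (f x * B (x - s *+ j)).
  have cfB (j : 'I_M.+1) : {within I01, continuous (fun x => f x * B (x - s *+ j))}.
    by apply: within_continuousM => //; apply: smooth_within; exact: (@smooth_shift _ _ _ sB).
  have -> : Sf = \int[leb]_(x in I01) (\sum_j c j * (f x * B (x - s *+ j))).
    apply: eq_Rintegral => x _; rewrite iter_bdiffE mulr_sumr.
    by apply: eq_bigr => j _; rewrite /c; ring.
  rewrite Rintegral_sum; [|exact: mI|].
    by apply: eq_bigr => j _; rewrite RintegralZl//; exact: integrable_I01.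
  move=> j _; exact/integrable_I01/within_continuousZ.
have d1 : `|Sf - S| <= e.
  rewrite ESf' /S -sumrB.
  apply: (@le_trans _ _ (\sum_j `|c j| * (e / C))).
    apply: le_trans (ler_norm_sum _ _ _) _; apply: ler_sum => j _.
    rewrite /c -mulrBr normrM ler_wpM2l//.
    apply: (@bump_average _ _ _ (u + s *+ j) (u + s *+ j + eps)) => //.
    - have sBj := @smooth_shift _ _ (s *+ j) sB; exact: (@smooth_continuous _ _ sBj).
    - move=> x; rewrite negb_and -!leNgt => xn; rewrite Bs// negb_and -!leNgt.
      by case/orP: xn => xn; apply/orP; [left|right]; lra.
    - by apply: (shifted_bump_integral dE cB Ea Eb); have := sj j; have := sj0 j; lra.
    - exact: epsf.
  rewrite -mulr_suml mulrCA; rewrite ger_pMr//.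
  by rewrite ler_pdivrMr// mul1r /C lerDl.
have d2 : `|Sf| <= Num.sqrt K.
  have cG : {within I01, continuous G} by exact: smooth_within.
  have sqG := continuous_square_integrable cG.
  rewrite ESf normrM normrX normrN normr1 expr1n mul1r.
  rewrite -[leLHS]sqrtr_sqr ler_sqrt//.
  apply: le_trans (cauchy_schwarz mI sg sqG) _.
  rewrite /K mulrC ler_wpM2r ?sqnorm_ge0//.
  pose A := `[u, u + s *+ M *+ 2]%classic : set (measurableTypeR R).
  have mA : measurable A by exact: measurable_itv.
  have IA : leb.-integrable I01 (EFin \o (fun x => s ^+ (2 * m) * \1_A x)).
    apply: (@integrableZ_EFin _ _ _ leb I01 mI).
    apply: (@integrable_I01_bounded _ 1); first exact: measurable_indic.
    by move=> x _; rewrite indicE; case: (_ \in _); rewrite ?normr1 ?normr0.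
  apply: (@le_trans _ _ (\int[leb]_(x in I01) (s ^+ (2 * m) * \1_A x))).
    apply: le_Rintegral => //.
      by have [_] := (square_integrableP leb I01 G).1 sqG.
    move=> x _; rewrite indicE; have [xA|xA] := boolP (x \in A).
      rewrite mulr1 mulnC exprM lerXn2r ?nnegrE ?exprn_ge0 ?(ltW s0)//;
        by have /andP[] := G01 x.
    rewrite zG ?expr0n ?mulr0//=; apply: contra xA => /andP[x1 x2].
    rewrite inE /A /= in_itv/= x1/= (le_trans x2)// mulr2n -/M; lra.
  rewrite RintegralZl//; last first.
    have := @integrableZ_EFin _ _ _ leb I01 mI (s ^+ (2 * m))^-1 _ IA.
    apply: eq_integrable; first exact: mI.
    by move=> x _ /=; rewrite mulrA mulVf ?mul1r// expf_neq0// gt_eqF.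
  rewrite ler_wpM2l ?exprn_ge0 ?(ltW s0)//.
  rewrite /Rintegral integral_indic//.
  have AE : leb A = (s *+ M *+ 2)%:E.
    rewrite /A lebesgue_measure_itv /= lte_fin ltrDl pmulrn_lgt0//= sM.
    by rewrite -EFinD addrAC subrr add0r.
  have AI : (leb (A `&` (I01 : set (measurableTypeR R))) <= leb A)%E.
    by apply: (@le_measure _ _ _ leb); rewrite ?inE//; exact: measurableI.
  rewrite -[leRHS]/(fine (s *+ M *+ 2)%:E) -AE fine_le// ?AE//.
  by rewrite ge0_fin_numE// (le_lt_trans AI)// AE ltry.
have : `|S| <= `|Sf| + `|Sf - S|.
  by rewrite -{1}(subKr Sf S) (le_trans (ler_normB _ _)).
lra.
Unshelve. all: by end_near. Qed.

End weak_derivatives.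

Section weak_derivative_uniqueness.
Context {R : realType}.
Local Notation I01 := (`[0%R, 1%R]%classic : set R).
Local Notation leb := (@lebesgue_measure R).
Local Notation mI := (@measurable_I01 R).
Implicit Types (f g h : R -> R) (x y a b c e s u w : R) (k m n : nat).

Lemma square_integrable_integrable g : square_integrable leb I01 g ->
  leb.-integrable I01 (EFin \o g).
Proof.
move=> sg; have s1 := continuous_square_integrable (@within_continuous_cst R I01 1).
have := square_integrableM mI sg s1.
by apply: eq_integrable; [exact: mI|move=> x _ /=; rewrite mulr1].
Qed.

(** The difference of a steep smooth step at u and its translate at w is a test function. As the
    steps steepen, it tends pointwise to the indicator of ]u, w] while staying bounded by 1, so
    dominated convergence applies. *)
Lemma itv_integral_eq0 g u w : square_integrable leb I01 g ->
  (forall h, test_function h -> \int[leb]_(x in I01) (g x * h x) = 0) ->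
  0 < u -> u < w -> w < 1 -> \int[leb]_(x in `]u, w]) g x = 0.
Proof.
move=> sg g0 u0 uw w1.
pose eps n := (1 - w) / (n.+2)%:R.
have eps0 n : 0 < eps n by rewrite divr_gt0// subr_gt0.
have eps1 n : eps n < 1 - w.
  by rewrite ltr_pdivrMr// ltr_pMr ?subr_gt0// ltr1n.
have epscvg : eps n @[n --> \oo] --> 0.
  rewrite -(mulr0 (1 - w)); apply: cvgM; first exact: cvg_cst.
  apply/cvgr0Pnorm_lt => e e0; near=> n.
  rewrite ger0_norm ?invr_ge0// invf_plt ?posrE//.
  apply: (@lt_trans _ _ n%:R); last by rewrite ltr_nat.
  by near: n; exact: nbhs_infty_gtr.
have HBE n : exists BE : (R -> R) * (R -> R),
  [/\ [/\ smooth BE.1, forall x, 0 <= BE.1 x & forall x, ~~ (u < x < u + eps n) -> BE.1 x = 0],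
      forall x, is_derive x 1 BE.2 (BE.1 x),
      forall x, x <= u -> BE.2 x = 0, forall x, u + eps n <= x -> BE.2 x = 1 & forall x, 0 <= BE.2 x <= 1].
  by have [B [E H]] := @normalized_bump R u (u + eps n) u0 ltac:(by rewrite ltrDl); exists (B, E).
pose BE n := projT1 (cid (HBE n)); pose B n := (BE n).1; pose E n := (BE n).2.
have HBE' n : [/\ [/\ smooth (B n), forall x, 0 <= B n x & forall x, ~~ (u < x < u + eps n) -> B n x = 0],
      forall x, is_derive x 1 (E n) (B n x),
      forall x, x <= u -> E n x = 0, forall x, u + eps n <= x -> E n x = 1 & forall x, 0 <= E n x <= 1].
  exact: (projT2 (cid (HBE n))).
pose h n := bdiff (w - u) (E n).
have sE n : smooth (E n).
  by have [[sB _ _] dE _ _ _] := HBE' n; exact: smooth_primitive dE sB.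
have th n : test_function (h n).
  have [_ _ Ea Eb _] := HBE' n.
  split; first exact: (@smooth_bdiff _ _ _ (sE n)).
  exists u, (w + eps n); split=> //; first by have := eps1 n; lra.
  move=> x; rewrite /h /bdiff; apply: contraNT.
  rewrite negb_and -!ltNge => /orP[xu|wx].
    by rewrite !Ea ?subrr//; lra.
  by rewrite !Eb ?subrr//; lra.
have h1 n x : `|h n x| <= 1.
  have [_ _ _ _ E01] := HBE' n; rewrite /h /bdiff ler_norml.
  by have := E01 x; have := E01 (x - (w - u)); lra.
have mg : measurable_fun (I01 : set (measurableTypeR R)) g by have [] := sg.
have mh n : measurable_fun (I01 : set (measurableTypeR R)) (h n).
  by have /measurable_int/measurable_EFinP :=
    integrable_I01 (smooth_within (@smooth_bdiff _ (w - u) _ (sE n))).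
pose A := `]u, w]%classic : set (measurableTypeR R).
have cvh x : I01 x -> ((g x * h n x)%:E @[n --> \oo] --> (g x * \1_A x)%:E)%E.
  move=> _; apply: cvg_EFin; first by near=> n.
  rewrite indicE; have [xu|ux] := leP x u.
    rewrite memNset/=; last by rewrite /A /= in_itv/= ltNge xu.
    rewrite mulr0; apply: cvg_near_cst; near=> n; have [_ _ Ea _ _] := HBE' n.
    by rewrite /= /h /bdiff !Ea ?subrr ?mulr0//; lra.
  have [xw|wx] := leP x w.
    rewrite mem_set/=; last by rewrite /A /= in_itv/= ux.
    apply: cvg_near_cst; near=> n; have [_ _ Ea Eb _] := HBE' n.
    rewrite /= /h /bdiff (Ea (x - _)) ?subr0; last by lra.
    rewrite Eb ?mulr1// -lerBrDl; apply: ltW.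
    have : `|eps n| < x - u.
      by near: n; apply: cvgr0_norm_lt => //; rewrite subr_gt0.
    by rewrite gtr0_norm.
  rewrite memNset/=; last by rewrite /A /= in_itv/= ux leNgt wx.
  apply: cvg_near_cst; near=> n; have [_ _ Ea Eb _] := HBE' n.
  have : `|eps n| < x - w.
    by near: n; apply: cvgr0_norm_lt => //; rewrite subr_gt0.
  rewrite gtr0_norm// => epsx.
  by rewrite /= /h /bdiff !Eb ?subrr ?mulr0//; lra.
have Ig := square_integrable_integrable sg.
have mgA : measurable_fun (I01 : set (measurableTypeR R)) (fun x => g x * \1_A x).
  have mA : measurable A by exact: measurable_itv.
  by apply: measurable_funM => //; exact: measurable_indic.
have A1 : {ae leb, forall x, I01 x -> ((g x * h n x)%:E @[n --> \oo] --> (g x * \1_A x)%:E)%E}.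
  exact: aeW.
have A2 : {ae leb, forall x, forall n, I01 x -> (`|(g x * h n x)%:E| <= `|(g x)%:E|)%E}.
  by apply: aeW => x n _; rewrite /= lee_fin normrM ler_piMr.
have m1 n : measurable_fun (I01 : set (measurableTypeR R)) (fun x => (g x * h n x)%:E).
  by apply/measurable_EFinP; exact: measurable_funM.
have [_ _ cvint] := dominated_convergence mI m1 ((measurable_EFinP _ _).2 mgA) A1 (integrable_abse Ig) A2.
have : (\int[leb]_(x in I01) (g x * \1_A x)%:E = 0)%E.
  rewrite -(cvg_lim _ cvint)//.
  rewrite (_ : [sequence _]_n = fun=> 0%E); first by rewrite lim_cst.
  apply/funext => n /=; have := g0 _ (th n); rewrite /Rintegral => /eqP.
  rewrite fine_eq0 => [/eqP//|].
  apply: integrable_fin_num; first exact: mI.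
  have sh := continuous_square_integrable (smooth_within (@smooth_bdiff _ (w - u) _ (sE n))).
  exact: (square_integrableM mI sg sh).
move=> H; have <- : \int[leb]_(x in I01) (g x * \1_A x) = 0 by rewrite /Rintegral H.
rewrite (_ : `]u, w]%classic = I01 `&` A); last first.
  by apply/seteqP; split => x; rewrite /A /= !in_itv/=; lra.
rewrite Rintegral_mkcondr; apply: eq_Rintegral => x _.
by rewrite patchE indicE; case: ifPn; rewrite ?mulr1 ?mulr0.
Unshelve. all: by end_near. Qed.

(** By [itv_integral_eq0] the primitive of g is constant on ]0, 1[; by Lebesgue differentiation its
    derivative is g almost everywhere. The two endpoints form a null set. *)
Lemma test_functions_separate g : square_integrable leb I01 g ->
  (forall h, test_function h -> \int[leb]_(x in I01) (g x * h x) = 0) ->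
  {ae leb, forall x, I01 x -> g x = 0}.
Proof.
move=> sg g0; have Ig := square_integrable_integrable sg.
pose f := g \_ I01.
have If : leb.-integrable setT (EFin \o f).
  by rewrite /f -restrict_EFin; exact: (integrable_mkcond _ mI).1.
have Ify y : leb.-integrable `]-oo, y] (EFin \o f) by apply: integrableS If.
have locf : locally_integrable [set: R] f by apply: integrable_locally_restrict => //; exact: mI.
have ae01 (c : R) : {ae leb, forall x : R, x != c}.
  have : leb.-negligible [set c] by apply/negligibleP => //; exact: lebesgue_measure_set1.
  by apply: negligibleS => x /= /negP; rewrite negbK => /eqP.
have FF := ae_filter_ringOfSetsType leb.
apply: filterS3 (ae01 0) (ae01 1) (FTC1Ny Ify locf) => x x0 x1 [dF EF] Ix.
have <- : f x = g x by rewrite /f patchE mem_set.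
rewrite -EF; move: Ix; rewrite /= in_itv/= => /andP[x0' x1'].
have {}x0 : 0 < x by rewrite lt_neqAle eq_sym x0.
have {}x1 : x < 1 by rewrite lt_neqAle x1.
rewrite derive1E; set F := (X in 'D_1 X x).
suff : \forall y \near x, F y = F x.
  by move=> FE; rewrite (near_eq_derive (1 : R) FE); exact: derive_cst.
have Fuw u w : 0 < u -> u < w -> w < 1 -> F w = F u.
  move=> u0 uw w1; apply/eqP; rewrite -subr_eq0 /F Rintegral_itvB//; last by rewrite bnd_simp ltW.
  apply/eqP; rewrite -(itv_integral_eq0 sg g0 u0 uw w1).
  apply: eq_Rintegral => y; rewrite inE/= in_itv/= => /andP[uy yw].
  by rewrite /f patchE mem_set//= in_itv/=; lra.
near=> y.
have y0 : 0 < y by near: y; exact: lt_nbhsr.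
have y1 : y < 1 by near: y; exact: lt_nbhsl.
by have [yx|xy|->//] := ltgtP y x; [symmetry|]; exact: Fuw.
Unshelve. all: by end_near. Qed.

Lemma weak_derivativeD k f1 f2 g1 g2 :
  square_integrable leb I01 f1 -> square_integrable leb I01 f2 ->
  weak_derivative k f1 g1 -> weak_derivative k f2 g2 ->
  weak_derivative k (fun x => f1 x + f2 x) (fun x => g1 x + g2 x).
Proof.
move=> sf1 sf2 [sg1 w1] [sg2 w2]; split; first exact: square_integrableD.
move=> h th; have [sh _] := th.
have sqd i : square_integrable leb I01 (derive1n i h).
  apply/continuous_square_integrable/smooth_within.
  by elim: i => [//|i IH]; rewrite derive1nS; exact: (@smooth_derive1 _ _ IH).
have E F1 F2 i : square_integrable leb I01 F1 -> square_integrable leb I01 F2 ->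
    \int[leb]_(x in I01) ((F1 x + F2 x) * derive1n i h x) =
    \int[leb]_(x in I01) (F1 x * derive1n i h x) + \int[leb]_(x in I01) (F2 x * derive1n i h x).
  move=> s1 s2; rewrite -RintegralD; [|exact: mI|exact: square_integrableM|exact: square_integrableM].
  by apply: eq_Rintegral => x _; rewrite mulrDl.
by rewrite E// w1// w2// -mulrDr -(E _ _ 0%N).
Qed.

Lemma weak_derivativeZ k c f g : square_integrable leb I01 f ->
  weak_derivative k f g -> weak_derivative k (fun x => c * f x) (fun x => c * g x).
Proof.
move=> sf [sg wg]; split; first exact: square_integrableZ.
move=> h th; have [sh _] := th.
have sqd i : square_integrable leb I01 (derive1n i h).
  apply/continuous_square_integrable/smooth_within.
  by elim: i => [//|i IH]; rewrite derive1nS; exact: (@smooth_derive1 _ _ IH).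
have E F i : square_integrable leb I01 F ->
    \int[leb]_(x in I01) (c * F x * derive1n i h x) = c * \int[leb]_(x in I01) (F x * derive1n i h x).
  move=> s1; rewrite -RintegralZl; [|exact: mI|exact: square_integrableM].
  by apply: eq_Rintegral => x _; rewrite mulrA.
by rewrite E// wg// mulrCA -(E _ 0%N).
Qed.

(** This is what makes [sobolev_inner] bilinear in spite of the arbitrary version chosen by
    [wderiv]. *)
Lemma weak_derivative_unique k f g1 g2 :
  weak_derivative k f g1 -> weak_derivative k f g2 ->
  {ae leb, forall x, I01 x -> g1 x = g2 x}.
Proof.
move=> [sg1 w1] [sg2 w2].
suff H : forall h, test_function h -> \int[leb]_(x in I01) ((g1 x - g2 x) * h x) = 0.
  have := @test_functions_separate (fun x => g1 x - g2 x) (square_integrableB mI sg1 sg2) H.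
  apply: filterS; first exact: (ae_filter_ringOfSetsType leb).
  by move=> x g12 Ix; apply/subr0_eq/g12.
move=> h th; have [sh _] := th.
have sqh : square_integrable leb I01 h by exact/continuous_square_integrable/smooth_within.
have -> : \int[leb]_(x in I01) ((g1 x - g2 x) * h x) =
   \int[leb]_(x in I01) (g1 x * h x - g2 x * h x).
  by apply: eq_Rintegral => x _; rewrite mulrBl.
rewrite RintegralB; [|exact: mI|exact: square_integrableM|exact: square_integrableM].
have := w1 _ th; rewrite w2// => /(congr1 (fun z => (-1) ^+ k * z)).
by rewrite !mulrA -exprMn mulrNN mulr1 expr1n !mul1r => ->; rewrite subrr.
Qed.

Lemma wderivP k f : (exists g, weak_derivative k f g) -> weak_derivative k f (wderiv k f).
Proof. by move=> fg; rewrite /wderiv; exact: (@xgetPex _ _ [set g | weak_derivative k f g]). Qed.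

End weak_derivative_uniqueness.

(** * Pointwise interpolation *)

Lemma integrable_sum_EFin {d} {T : measurableType d} {R : realType}
    (mu : {measure set T -> \bar R}) (D : set T) (I : Type) (s : seq I) (P : pred I)
    (F : I -> T -> R) : measurable D ->
  (forall i, P i -> mu.-integrable D (EFin \o F i)) ->
  mu.-integrable D (EFin \o (fun x => \sum_(i <- s | P i) F i x)).
Proof.
move=> mD IF; have := integrable_sum mD s IF.
by apply: eq_integrable => // x _; rewrite /= sumEFin.
Qed.

Section sobolev_inequality.
Context {R : realType}.
Local Notation I01 := (`[0%R, 1%R]%classic : set R).
Local Notation leb := (@lebesgue_measure R).
Local Notation mI := (@measurable_I01 R).
Implicit Types (f g h q : R -> R) (x y a b c e s u w eta : R) (k m n : nat).

(** Projection onto [0, 1]. Composing with it extends a function continuous on [0, 1] to a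
    continuous function on the line, as substitution and neighbourhood arguments require. *)
Definition clamp01 y : R := Num.max 0 (Num.min y 1).

Lemma clamp01_id y : I01 y -> clamp01 y = y.
Proof.
rewrite /= in_itv/= => /andP[y0 y1]; rewrite /clamp01.
by rewrite (min_idPl y1) (max_idPr y0).
Qed.

Lemma clamp01_in y : I01 (clamp01 y).
Proof.
by rewrite /clamp01 /= in_itv/= le_max lexx/= ge_max ler01/= ge_min lexx orbT.
Qed.

Lemma clamp01_lip x y : `|clamp01 x - clamp01 y| <= `|x - y|.
Proof.
have E z : clamp01 z = if z <= 0 then 0 else if z <= 1 then z else 1.
  rewrite /clamp01; case: (leP z 1) => z1; last first.
    by rewrite (max_idPr ler01) leNgt (lt_trans ltr01 z1).
  by case: (leP z 0).
have cm a b : a <= b -> clamp01 a <= clamp01 b /\ clamp01 b - clamp01 a <= b - a.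
  by rewrite !E => ab; case: (leP a 0) => ?; case: (leP b 0) => ?; case: (leP a 1) => ?;
    case: (leP b 1) => ?; split; lra.
have [xy|/ltW yx] := leP x y; last by have [c1 c2] := cm _ _ yx; rewrite !ger0_norm; lra.
by have [c1 c2] := cm _ _ xy; rewrite !ler0_norm; lra.
Qed.

Lemma clamp01_extension f : {within I01, continuous f} -> continuous (f \o clamp01).
Proof.
move=> /subspace_continuousP cf x.
apply/cvgrPdist_le => e e0.
have := cf _ (clamp01_in x) => /cvgrPdist_le/(_ e e0).
rewrite near_withinE -nbhs_ballE => -[d /= d0 Hd].
exists d => //= y xy; apply: Hd; last exact: clamp01_in.
exact: le_lt_trans (clamp01_lip _ _) xy.
Qed.

(** Finite-difference bounds are only available at interior points, test functions being supported
    inside ]0, 1[. This carries them to the endpoints, by moving a point slightly towards the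
    middle. *)
Lemma le_closure01 f c : {within I01, continuous f} ->
  (forall x, 0 < x < 1 -> f x <= c) -> forall x, I01 x -> f x <= c.
Proof.
move=> cf fc x Ix; have cfx := clamp01_extension cf (x := x).
rewrite leNgt; apply/negP => cx.
have [d d0 Hd] := @continuous_delta _ (f \o clamp01) x ((f x - c) / 2) cfx ltac:(lra).
have /andP[x0 x1] : 0 <= x <= 1 by move: Ix; rewrite /= in_itv.
have H y : 0 < y < 1 -> `|y - x| < d -> False.
  move=> y01 yx; have := Hd _ yx; have := fc _ y01.
  rewrite /comp (clamp01_id Ix) clamp01_id; last by rewrite /= in_itv/=; lra.
  rewrite ler_norml; lra.
pose t := Num.min d 1 / 2.
have t0 : 0 < t by rewrite /t divr_gt0// lt_min d0 ltr01.
have [td t1] : t <= d / 2 /\ t <= 1 / 2.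
  by split; rewrite /t ler_wpM2r// ge_min lexx ?orbT.
have [xh|xh] := leP x (1 / 2).
  apply: (H (x + t / 2)); first lra.
  by rewrite ger0_norm; lra.
apply: (H (x - t / 2)); first lra.
by rewrite ler0_norm; lra.
Qed.

(** A substitution of slope at least 1 in absolute value can only shrink the integral of a
    nonnegative function, and its range stays inside [0, 1]. Used to average over the step of a
    finite difference, the slope being plus or minus the index of the node. *)
Lemma affine_subst_le q u c eta : {within I01, continuous q} ->
  (forall x, I01 x -> 0 <= q x) -> 1 <= `|c| -> 0 < eta ->
  (forall s, 0 <= s <= eta -> 0 <= u + c * s <= 1) ->
  leb.-integrable `[0, eta] (EFin \o (fun s => q (u + c * s))) /\
  \int[leb]_(s in `[0, eta]) q (u + c * s) <= \int[leb]_(x in I01) q x.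
Proof.
move=> cq q0 c1 eta0 uc.
pose Q := q \o clamp01; have cQ : continuous Q by exact: clamp01_extension.
pose F s := u + c * s.
have dF s : is_derive s 1 F c.
  apply: (is_derive_eq (is_deriveD (is_derive_cst u s 1) (is_deriveZ c (is_derive_id s 1)))).
  by rewrite add0r /GRing.scale/= mulr1.
have cF : continuous F by move=> s; exact: is_derive_continuous (dF s).
have dFE : derive1 F = cst c by apply/funext => s; rewrite derive1E derive_val.
have QE s : 0 <= s <= eta -> q (u + c * s) = Q (F s).
  by move=> /uc uc1; rewrite /Q /comp clamp01_id//= in_itv.
have cQF : continuous (Q \o F) by move=> s; apply: continuous_comp; [exact: cF|exact: cQ].
have IQF : leb.-integrable `[0, eta] (EFin \o (Q \o F)) by exact: continuous_integrableT.
split.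
  apply: eq_integrable IQF => // s; rewrite inE/= in_itv/= => s0.
  by rewrite /= QE.
have -> : \int[leb]_(s in `[0, eta]) q (u + c * s) = \int[leb]_(s in `[0, eta]) (Q (F s)).
  by apply: eq_Rintegral => s; rewrite inE/= in_itv/= => s0; rewrite QE.
have -> : \int[leb]_(x in I01) q x = \int[leb]_(x in I01) Q x.
  by apply: eq_Rintegral => s; rewrite inE => s0; rewrite /Q /comp clamp01_id.
have Q0 y : 0 <= Q y by apply: q0; exact: clamp01_in.
have sub a b : 0 <= a -> b <= 1 ->
    (\int[leb]_(x in `[a, b]) (Q x)%:E <= \int[leb]_(x in I01) (Q x)%:E)%E.
  move=> a0 b1; apply: ge0_subset_integral => //.
  - exact: measurable_int (@continuous_integrableT R 0 1 _ cQ).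
  - by move=> x _; rewrite lee_fin.
  - by apply: subset_itv; rewrite bnd_simp.
have fin01 : (\int[leb]_(x in I01) (Q x)%:E)%E \is a fin_num.
  by apply: integrable_fin_num; [exact: mI|exact: continuous_integrableT].
have key : (\int[leb]_(s in `[0%R, eta]) ((Q (F s) * `|c|)%R)%:E <= \int[leb]_(x in I01) (Q x)%:E)%E.
  have LR : derivable_oo_LRcontinuous F 0 eta.
    by split=> [s _||]; [by have [] := dF s|
      apply: cvg_at_right_filter; exact: cF|apply: cvg_at_left_filter; exact: cF].
  have H0 := uc 0 ltac:(lra); have H1 := uc eta ltac:(lra).
  have [cp|cn] := ltP 0 c.
    have := @integration_by_substitution_increasing R F Q 0 eta (ltW eta0).
    rewrite dFE => /(_ _ _ _ _ LR (continuous_subspaceT cQ)) E.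
    have {E} : (\int[leb]_(x in `[F 0%R, F eta]) (Q x)%:E =
      \int[leb]_(x in `[0%R, eta]) (((Q \o F) * cst c)%R x)%:E)%E.
      apply: E.
      + by move=> s t _ _ st; rewrite /F ltrD2l ltr_pM2l.
      + by move=> s _; exact: cvg_cst.
      + exact: is_cvg_cst.
      + exact: is_cvg_cst.
    rewrite gtr0_norm// => <-; apply: sub; rewrite /F; lra.
  have {}cn : c < 0 by rewrite lt_neqAle cn andbT; apply: contraTneq c1 => ->; rewrite normr0 ler10.
  have := @integration_by_substitution_decreasing R F Q 0 eta (ltW eta0).
  rewrite dFE => /(_ _ _ _ _ LR (continuous_subspaceT cQ)) E.
  have {E} : (\int[leb]_(x in `[F eta, F 0%R]) (Q x)%:E =
      \int[leb]_(x in `[0%R, eta]) (((Q \o F) * - cst c)%R x)%:E)%E.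
    apply: E.
    + by move=> s t _ _ st; rewrite /F ltrD2l ltr_nM2l.
    + by move=> s _; exact: cvg_cst.
    + exact: is_cvg_cst.
    + exact: is_cvg_cst.
  rewrite ltr0_norm// => <-; apply: sub; rewrite /F; lra.
rewrite /Rintegral fine_le//; first by apply: integrable_fin_num.
apply: le_trans key; apply: ge0_le_integral => //.
- by move=> s _; rewrite lee_fin.
- exact: measurable_int IQF.
- have : leb.-integrable `[0, eta] (EFin \o (fun s => `|c| * (Q (F s)))).
    by apply: integrableZ_EFin.
  move=> /measurable_int.
  have -> // : (EFin \o (fun s => `|c| * Q (F s))) = (fun s => (Q (F s) * `|c|)%:E).
  by apply/funext => s /=; rewrite mulrC.
- by move=> s _; rewrite lee_fin ler_peMr.
Qed.

Lemma sum_sqr_le n (F : 'I_n -> R) : (\sum_i F i) ^+ 2 <= n%:R * \sum_i F i ^+ 2.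
Proof.
have : 0 <= \sum_i \sum_j (F i - F j) ^+ 2.
  by apply: sumr_ge0 => i _; apply: sumr_ge0 => j _; rewrite sqr_ge0.
have -> : \sum_i \sum_j (F i - F j) ^+ 2 =
    n%:R * (\sum_i F i ^+ 2) - 2 * (\sum_i F i) ^+ 2 + n%:R * (\sum_i F i ^+ 2).
  have E i : \sum_j (F i - F j) ^+ 2 = n%:R * F i ^+ 2 - 2 * (\sum_j F j) * F i + \sum_j F j ^+ 2.
    transitivity (\sum_j (F i ^+ 2 - (2 * F i) * F j + F j ^+ 2)).
      by apply: eq_bigr => j _; ring.
    rewrite !big_split /= sumrN sumr_const card_ord -mulr_sumr.
    by rewrite (_ : F i ^+ 2 *+ n = n%:R * F i ^+ 2) ?mulr_natl//; ring.
  rewrite (eq_bigr _ (fun i _ => E i)) !big_split /= sumrN -!mulr_sumr sumr_const card_ord -[_ *+ n]mulr_natl.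
  ring.
lra.
Qed.

(** The node 0 has coefficient 1, so [f 0] is D minus the other m+1 terms, a sum of m+2 summands to
    which [sum_sqr_le] applies. *)
Lemma fdiff_step (m : nat) (f : nat -> R) c (D : R) : \sum_(j < m.+2) (-1) ^+ j * 'C(m.+1, j)%:R * f j = D ->
  D ^+ 2 <= c -> f 0%N ^+ 2 <= m.+2%:R * (c + \sum_(j < m.+1) 'C(m.+1, j.+1)%:R ^+ 2 * f j.+1 ^+ 2).
Proof.
move=> ED Dc; move: ED; rewrite big_ord_recl expr0 bin0 !mul1r /= => /eqP.
rewrite eq_sym -subr_eq => /eqP <-.
pose F (i : 'I_m.+2) : R := if unlift ord0 i is Some j then
  - ((-1) ^+ bump 0 j * 'C(m.+1, bump 0 j)%:R * f (bump 0 j)) else D.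
have -> : D - \sum_(i < m.+1) (-1) ^+ bump 0 i * 'C(m.+1, bump 0 i)%:R * f (bump 0 i) = \sum_i F i.
  rewrite [RHS]big_ord_recl /F unlift_none -sumrN; congr +%R.
  by apply: eq_bigr => i _; rewrite liftK.
apply: le_trans (sum_sqr_le F) _; rewrite ler_wpM2l//.
rewrite big_ord_recl /F unlift_none lerD//.
apply: ler_sum => i _; rewrite liftK sqrrN !exprMn -exprM mulnC exprM sqrrN !expr1n mul1r.
by rewrite /bump leq0n add1n.
Qed.

End sobolev_inequality.
Section sobolev_inequality2.
Context {R : realType}.
Local Notation I01 := (`[0%R, 1%R]%classic : set R).
Local Notation leb := (@lebesgue_measure R).
Local Notation mI := (@measurable_I01 R).
Implicit Types (f g h q : R -> R) (x y a b c e s u w eta : R) (k m n : nat).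

(** The nodes are laid out from x towards the farther endpoint; as they span at most 1/4, they stay
    in ]0, 1[. For x > 1/2 the bound is applied at the leftmost node, and reversing the sum costs
    only the sign (-1)^(m+1). *)
Lemma fdiff_bound_sym m f g x s : {within I01, continuous f} ->
  weak_derivative m.+1 f g -> 0 < x < 1 -> 0 < s -> s *+ m.+1 <= 1 / 4 ->
  exists2 sigma : R, `|sigma| = 1 &
  (x <= 1 / 2 -> sigma = 1) /\ (1 / 2 < x -> sigma = - 1) /\
  f x ^+ 2 <= m.+2%:R * (s ^+ (2 * m) * (s *+ m.+1 *+ 2) * sqnorm leb I01 g +
     \sum_(j < m.+1) 'C(m.+1, j.+1)%:R ^+ 2 * f (x + sigma * (s *+ j.+1)) ^+ 2).
Proof.
move=> cf wg /andP[x0 x1] s0 sm.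
set K := s ^+ (2 * m) * _ * _.
have [xh|xh] := leP x (1 / 2).
  exists 1; first by rewrite normr1.
  split=> //; split=> //.
  have D := @fdiff_bound R m f g x s cf wg x0 s0 ltac:(lra).
  have := fdiff_step (f := fun j => f (x + s *+ j)) erefl D.
  rewrite /= mulr0n addr0 => /le_trans; apply; rewrite ler_wpM2l// lerD2l.
  by apply: ler_sum => i _; rewrite mul1r.
exists (- 1); first by rewrite normrN1.
split=> //; split=> //.
have D := @fdiff_bound R m f g (x - s *+ m.+1) s cf wg ltac:(lra) s0 ltac:(lra).
have E : \sum_(j < m.+2) (-1) ^+ j * 'C(m.+1, j)%:R * f (x + - 1 * (s *+ j)) =
   (-1) ^+ m.+1 * \sum_(j < m.+2) (-1) ^+ j * 'C(m.+1, j)%:R * f (x - s *+ m.+1 + s *+ j).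
  rewrite mulr_sumr (reindex_inj rev_ord_inj) /=; apply: eq_bigr => i _.
  have im : (i <= m.+1)%N by rewrite -ltnS.
  rewrite subSS bin_sub//.
  have -> : (-1) ^+ m.+1 = (-1) ^+ (m.+1 - i) * (-1) ^+ i :> R by rewrite -exprD subnK.
  have ii : (-1) ^+ i * (-1) ^+ i = 1 :> R by rewrite -exprMn mulrNN mulr1 expr1n.
  have -> : x + - 1 * (s *+ (m.+1 - i)) = x - s *+ m.+1 + s *+ i by rewrite mulrnBr//; ring.
  move: (f _) => F; rewrite -[LHS]mul1r -[X in X * _ = _]ii; ring.
have := fdiff_step (f := fun j => f (x + - 1 * (s *+ j))) E.
rewrite exprMn -exprM mulnC exprM sqrrN !expr1n mul1r => /(_ _ D).
by rewrite /= mulr0n mulr0 addr0.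
Qed.

(** The finite-difference bound is averaged over steps s in [0, c1 h]. Each shifted term contributes
    at most the squared norm of f, so dividing by the length yields 1/h, while the difference itself
    contributes s^(2m+1). The constant c1 = 1 / (4 (m+1)) keeps the nodes within distance 1/4. *)
Lemma sobolev_interpolation m : exists2 C : R, 0 < C & forall f g,
  {within I01, continuous f} -> weak_derivative m.+1 f g ->
  forall h : R, 0 < h <= 1 -> forall x, I01 x ->
    f x ^+ 2 <= C * (h^-1 * sqnorm leb I01 f + h ^+ (2 * m).+1 * sqnorm leb I01 g).
Proof.
pose c1 : R := (4 * m.+1%:R)^-1.
have m0 : 0 < m.+1%:R :> R by rewrite ltr0n.
have c10 : 0 < c1 by rewrite invr_gt0 mulr_gt0.
pose B : R := \sum_(j < m.+1) 'C(m.+1, j.+1)%:R ^+ 2.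
have B0 : 0 <= B by apply: sumr_ge0 => i _; rewrite sqr_ge0.
pose C1 : R := m.+2%:R * (2 * m.+1%:R * c1 ^+ (2 * m).+1).
pose C2 : R := m.+2%:R * (c1^-1 * B).
have C10 : 0 <= C1 by rewrite /C1 !mulr_ge0 ?exprn_ge0 ?(ltW c10)// ltW.
have C20 : 0 <= C2 by rewrite /C2 !mulr_ge0// invr_ge0 ltW.
exists (C1 + C2 + 1); first by lra.
move=> f g cf wg h /andP[h0 h1].
set Nf := sqnorm leb I01 f; set Ng := sqnorm leb I01 g.
have Nf0 : 0 <= Nf by exact: sqnorm_ge0.
have Ng0 : 0 <= Ng by exact: sqnorm_ge0.
have cf2 : {within I01, continuous (fun x => f x ^+ 2)}.
  by apply: within_continuous_eq (within_continuousM cf cf) => x; rewrite expr2.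
apply: le_closure01 => // x /[dup] x01 /andP[x0 x1].
pose eta := c1 * h.
have eta0 : 0 < eta by rewrite mulr_gt0.
have etam : eta *+ m.+1 <= 1 / 4.
  have -> : eta *+ m.+1 = (m.+1%:R / m.+1%:R) * (h / 4).
    by rewrite /eta /c1 -mulr_natr invfM; ring.
  by rewrite divff ?gt_eqF// mul1r; lra.
pose sigma : R := if x <= 1 / 2 then 1 else - 1.
have s1 : `|sigma| = 1 by rewrite /sigma; case: ifP; rewrite ?normrN1 ?normr1.
pose K : R := eta ^+ (2 * m) * (eta *+ m.+1 *+ 2) * Ng.
have K0 : 0 <= K by rewrite !mulr_ge0 ?exprn_ge0 ?(ltW eta0)// !mulrn_wge0// ltW.
have pt s : 0 <= s <= eta -> f x ^+ 2 <= m.+2%:R * (K +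
     \sum_(j < m.+1) 'C(m.+1, j.+1)%:R ^+ 2 * f (x + (sigma * j.+1%:R) * s) ^+ 2).
  (* Averaging needs the bound on the closed interval of steps. At s = 0 all nodes coincide with x,
     and the first summand alone, of weight (m+1)^2, suffices. *)
  move=> /andP[]; rewrite le_eqVlt => /predU1P[<- _|s0 se].
    apply: (@le_trans _ _ (1 * (0 + 1 * f x ^+ 2))); first by rewrite add0r !mul1r.
    apply: ler_pM => //; first by rewrite add0r mul1r sqr_ge0.
      by rewrite ler1n.
    apply: lerD => //; rewrite big_ord_recl mulr0 addr0 bin1.
    apply: (@le_trans _ _ (m.+1%:R ^+ 2 * f x ^+ 2)); last first.
      by rewrite lerDl sumr_ge0// => i _; rewrite mulr_ge0 ?sqr_ge0.
    by rewrite ler_wpM2r ?sqr_ge0// expr_ge1// ler1n.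
  have sm : s *+ m.+1 <= 1 / 4 by rewrite (le_trans _ etam)// lerMn2r se orbT.
  have [sg _ [sg1 [sg2 H]]] := fdiff_bound_sym cf wg x01 s0 sm.
  have Esg : sg = sigma by rewrite /sigma; case: leP => [/sg1|/sg2].
  apply: (le_trans H); rewrite ler_wpM2l// lerD//; last first.
    apply: ler_sum => j _; rewrite Esg (_ : sigma * (s *+ j.+1) = sigma * j.+1%:R * s)//.
    by rewrite -mulr_natr; ring.
  rewrite /K ler_wpM2r//; apply: ler_pM.
  - by rewrite exprn_ge0// ltW.
  - by rewrite !mulrn_wge0// ltW.
  - by rewrite lerXn2r// nnegrE ltW.
  - by rewrite !lerMn2r se !orbT.
have q0 y : I01 y -> 0 <= f y ^+ 2 by rewrite sqr_ge0.
have sub (j : 'I_m.+1) := @affine_subst_le R (fun y => f y ^+ 2) x (sigma * j.+1%:R) eta cf2 q0.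
have {}sub (j : 'I_m.+1) : leb.-integrable `[0, eta] (EFin \o (fun s => f (x + sigma * j.+1%:R * s) ^+ 2)) /\
  \int[leb]_(s in `[0, eta]) f (x + sigma * j.+1%:R * s) ^+ 2 <= Nf.
  apply: sub => //.
    by rewrite normrM s1 mul1r ger0_norm ?ler1n.
  move=> s /andP[s0 se].
  have j1 : j.+1%:R * s <= 1 / 4.
    apply: le_trans etam; rewrite mulr_natl (@le_trans _ _ (s *+ m.+1))//.
      by rewrite ler_wpMn2l.
    by rewrite lerMn2r se orbT.
  have j0 : 0 <= j.+1%:R * s by rewrite mulr_ge0.
  rewrite -mulrA; move: (j.+1%:R * s) j0 j1 => z z0 z1.
  rewrite /sigma; clear -x0 x1 z0 z1; have [xh|xh] := leP x (1 / 2).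
    by apply/andP; split; lra.
  by apply/andP; split; lra.
have Icst (c : R) : leb.-integrable `[0, eta] (EFin \o (fun=> c)).
  by apply: continuous_integrableT => y; exact: cvg_cst.
have mE : measurable (`[0, eta]%classic : set (measurableTypeR R)) by exact: measurable_itv.
have lE : fine (leb `[0, eta]) = eta.
  by rewrite lebesgue_measure_itv /= lte_fin eta0 -EFinD subr0.
have : \int[leb]_(s in `[0, eta]) (f x ^+ 2) <= \int[leb]_(s in `[0, eta]) (m.+2%:R * (K +
     \sum_(j < m.+1) 'C(m.+1, j.+1)%:R ^+ 2 * f (x + (sigma * j.+1%:R) * s) ^+ 2)).
  apply: le_Rintegral => //.
    apply: integrableZ_EFin => //; apply: integrableD_EFin => //.
    apply: integrable_sum_EFin => // j _.
    by apply: integrableZ_EFin => //; case: (sub j).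
have IS : leb.-integrable `[0, eta] (EFin \o (fun s => \sum_(j < m.+1) 'C(m.+1, j.+1)%:R ^+ 2 * f (x + (sigma * j.+1%:R) * s) ^+ 2)).
  apply: integrable_sum_EFin => // j _.
  by apply: integrableZ_EFin => //; case: (sub j).
rewrite RintegralZl//; last by apply: integrableD_EFin.
rewrite RintegralD// !Rintegral_cst// lE Rintegral_sum//; last first.
  by move=> j _; apply: integrableZ_EFin => //; case: (sub j).
move=> H; have {H} H : f x ^+ 2 * eta <= m.+2%:R * (K * eta + B * Nf).
  apply: (le_trans H); rewrite ler_wpM2l// lerD2l /B mulr_suml.
  apply: ler_sum => j _; have [Ij Hj] := sub j.
  by rewrite RintegralZl// ler_wpM2l// sqr_ge0.
have EK : K = 2 * m.+1%:R * c1 ^+ (2 * m).+1 * h ^+ (2 * m).+1 * Ng.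
  have E2 : eta *+ m.+1 *+ 2 = 2 * m.+1%:R * eta.
    by rewrite -(mulr_natl (eta *+ _) 2) -(mulr_natl eta m.+1) mulrA.
  rewrite /K E2 /eta exprMn !(exprS _ (2 * m)); ring.
have {}H : f x ^+ 2 <= m.+2%:R * K + m.+2%:R * (eta^-1 * B * Nf).
  rewrite -(ler_pM2r eta0) (le_trans H)//.
  have -> : (m.+2%:R * K + m.+2%:R * (eta^-1 * B * Nf)) * eta =
    m.+2%:R * (K * eta + (eta^-1 * eta) * B * Nf) by ring.
  by rewrite mulVf ?gt_eqF// mul1r.
apply: (le_trans H).
have -> : m.+2%:R * K = C1 * (h ^+ (2 * m).+1 * Ng) by rewrite EK /C1; ring.
have -> : m.+2%:R * (eta^-1 * B * Nf) = C2 * (h^-1 * Nf) by rewrite /C2 /eta invfM; ring.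
have : 0 <= h ^+ (2 * m).+1 * Ng by rewrite mulr_ge0// exprn_ge0// ltW.
have : 0 <= h^-1 * Nf by rewrite mulr_ge0// invr_ge0 ltW.
move: (h ^+ _ * Ng) (h^-1 * Nf) => X Y; nra.
Qed.

(** The first-order case of [fdiff_bound] in the open interval, extended to the endpoints one
    variable at a time. *)
Lemma weak_derivative1_hoelder f g x y : {within I01, continuous f} ->
  weak_derivative 1 f g -> I01 x -> I01 y ->
  (f y - f x) ^+ 2 <= 2 * `|y - x| * sqnorm leb I01 g.
Proof.
move=> cf wg; set Ng := sqnorm leb I01 g.
have Ng0 : 0 <= Ng by exact: sqnorm_ge0.
have H0 u w : 0 < u -> u < w -> w < 1 -> (f w - f u) ^+ 2 <= 2 * (w - u) * Ng.
  move=> u0 uw w1; have := @fdiff_bound R 0 f g u (w - u) cf wg u0.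
  rewrite subr_gt0 mulr1n addrC subrK => /(_ uw w1).
  rewrite !big_ord_recl big_ord0 /= !bin0 bin1 mulr1n mulr0n /bump /= mulr1n expr0 expr1 muln0 expr0.
  rewrite addr0 (_ : u + (w - u) = w); last by ring.
  rewrite -/Ng; lra.
have H1 u w : 0 < u < 1 -> 0 < w < 1 -> (f w - f u) ^+ 2 <= 2 * `|w - u| * Ng.
  move=> /andP[u0 u1] /andP[w0 w1]; have [uw|wu|->] := ltgtP u w.
  - by rewrite gtr0_norm ?subr_gt0//; exact: H0.
  - by rewrite distrC gtr0_norm ?subr_gt0// -sqrrN opprB; exact: H0.
  - by rewrite !subrr normr0 mulr0 mul0r expr0n.
have cD c : {within I01, continuous (fun w => (f w - c) ^+ 2 + (-1) * (2 * `|w - c| * Ng) )} -> True by [].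
have cnorm c : {within I01, continuous (fun w => - (2 * Ng) * `|w - c|)}.
  apply: within_continuousZ; apply: continuous_subspaceT => w.
  by apply: cvg_norm; apply: cvgB; [exact: cvg_id|exact: cvg_cst].
have csq c : {within I01, continuous (fun w => (f w - c) ^+ 2)}.
  have cfc := within_continuousD cf (@within_continuous_cst R I01 (- c)).
  by apply: within_continuous_eq (within_continuousM cfc cfc) => w; rewrite expr2.
have H2 u w : 0 < u < 1 -> I01 w -> (f w - f u) ^+ 2 + - (2 * Ng) * `|w - u| <= 0.
  move=> u01; apply: (le_closure01 (within_continuousD (csq (f u)) (cnorm u))) => {}w w01.
  have := H1 _ _ u01 w01; lra.
move=> Ix Iy; suff : (f x - f y) ^+ 2 + - (2 * Ng) * `|x - y| <= 0.
  rewrite distrC -sqrrN opprB; lra.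
move: x Ix; apply: (le_closure01 (within_continuousD (csq (f y)) (cnorm y))) => x x01.
by have := H2 _ _ x01 Iy; rewrite distrC -sqrrN opprB.
Qed.

End sobolev_inequality2.

(** * The Sobolev form: bilinearity, Cauchy-Schwarz and pointwise bounds *)

Section sobolev_space.
Context {R : realType}.
Local Notation I01 := (`[0%R, 1%R]%classic : set R).
Local Notation leb := (@lebesgue_measure R).
Local Notation mI := (@measurable_I01 R).
Variable m : nat.
Hypothesis m_gt0 : (0 < m)%N.
Implicit Types (f g h q : R -> R) (x y a b c e s u w : R) (k n : nat).

Local Notation H := (@sobolev R m).
Local Notation inner := (@sobolev_inner R m).

Lemma sobolevZ c f : H f -> H (fun x => c * f x).
Proof.
move=> [cf sf df]; split.
- exact: within_continuousZ.
- exact: square_integrableZ.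
- by move=> k /df[g wg]; exists (fun x => c * g x); exact: weak_derivativeZ.
Qed.

Lemma sobolevD f g : H f -> H g -> H (fun x => f x + g x).
Proof.
move=> [cf sf df] [cg sg dg]; split.
- exact: within_continuousD.
- exact: square_integrableD.
- move=> k km; have [f' wf] := df _ km; have [g' wg] := dg _ km.
  by exists (fun x => f' x + g' x); exact: weak_derivativeD.
Qed.

Lemma sobolev_eq f g : f =1 g -> H f -> H g.
Proof. by move=> /funext ->. Qed.

Lemma sobolevB f g : H f -> H g -> H (fun x => f x - g x).
Proof.
move=> Hf Hg; apply: sobolev_eq (sobolevD Hf (sobolevZ (-1) Hg)) => x.
by rewrite mulN1r.
Qed.

Lemma sobolev0 : H (fun=> 0).
Proof.
split; first exact: within_continuous_cst.
  exact: square_integrable0.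
move=> k _; exists (fun=> 0); split; first exact: square_integrable0.
move=> h th; rewrite (@eq_Rintegral _ _ _ leb _ (fun=> 0)); last by move=> x _; rewrite mul0r.
rewrite [in RHS](@eq_Rintegral _ _ _ leb _ (fun=> 0)); last by move=> x _; rewrite mul0r.
by rewrite Rintegral_I01_cst mulr0.
Qed.

Lemma sobolev_sum (I : Type) (r : seq I) (P : pred I) (F : I -> R -> R) :
  (forall i, P i -> H (F i)) -> H (fun x => \sum_(i <- r | P i) F i x).
Proof.
move=> HF; elim: r => [|i r IH].
  by apply: sobolev_eq sobolev0 => x; rewrite big_nil.
have [Pi|Pi] := boolP (P i).
  by apply: sobolev_eq (sobolevD (HF _ Pi) IH) => x; rewrite big_cons Pi.
by apply: sobolev_eq IH => x; rewrite big_cons (negbTE Pi).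
Qed.

Lemma sobolev_wderiv k f : (k <= m)%N -> H f -> weak_derivative k f (wderiv k f).
Proof. by move=> km [_ _ df]; exact/wderivP/df. Qed.

Lemma sobolev_wderiv_sq k f : (k <= m)%N -> H f -> square_integrable leb I01 (wderiv k f).
Proof. by move=> km Hf; have [] := sobolev_wderiv km Hf. Qed.

Lemma inner_sym f g : inner f g = inner g f.
Proof. by apply: eq_bigr => k _; apply: eq_Rintegral => x _; rewrite mulrC. Qed.

Lemma innerZl c f g : H f -> H g -> inner (fun x => c * f x) g = c * inner f g.
Proof.
move=> Hf Hg; rewrite /sobolev_inner mulr_sumr; apply: eq_bigr => -[k /= km] _.
rewrite ltnS in km; have sf := sobolev_wderiv_sq km Hf; have sg := sobolev_wderiv_sq km Hg.
have scf := sobolev_wderiv_sq km (sobolevZ c Hf).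
have [_ Sf _] := Hf.
have E := weak_derivative_unique (sobolev_wderiv km (sobolevZ c Hf))
  (weak_derivativeZ c Sf (sobolev_wderiv km Hf)).
rewrite -RintegralZl; [|exact: mI|exact: (square_integrableM mI sf sg)].
apply: Rintegral_ae_eq; first exact: mI.
- by have /measurable_int/measurable_EFinP := square_integrableM mI scf sg.
- have /measurable_int/measurable_EFinP := square_integrableM mI (square_integrableZ mI c sf) sg.
  rewrite (_ : (fun x => c * wderiv k f x * wderiv k g x) = (fun x => c * (wderiv k f x * wderiv k g x)))//.
  by apply/funext => x; rewrite mulrA.
- apply: filterS E; first exact: (ae_filter_ringOfSetsType leb).
  by move=> x E Ix; rewrite E// mulrA.
Qed.

Lemma innerDl f1 f2 g : H f1 -> H f2 -> H g ->
  inner (fun x => f1 x + f2 x) g = inner f1 g + inner f2 g.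
Proof.
move=> Hf1 Hf2 Hg; rewrite /sobolev_inner -big_split /=; apply: eq_bigr => -[k /= km] _.
rewrite ltnS in km; have sg := sobolev_wderiv_sq km Hg.
have sf1 := sobolev_wderiv_sq km Hf1; have sf2 := sobolev_wderiv_sq km Hf2.
have sf := sobolev_wderiv_sq km (sobolevD Hf1 Hf2).
have [_ S1 _] := Hf1; have [_ S2 _] := Hf2.
have E := weak_derivative_unique (sobolev_wderiv km (sobolevD Hf1 Hf2))
  (weak_derivativeD S1 S2 (sobolev_wderiv km Hf1) (sobolev_wderiv km Hf2)).
rewrite -(RintegralD mI (square_integrableM mI sf1 sg) (square_integrableM mI sf2 sg)).
apply: Rintegral_ae_eq; first exact: mI.
- by have /measurable_int/measurable_EFinP := square_integrableM mI sf sg.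
- have /measurable_int/measurable_EFinP := square_integrableM mI (square_integrableD mI sf1 sf2) sg.
  rewrite (_ : (fun x => (wderiv k f1 x + wderiv k f2 x) * wderiv k g x) =
    (fun x => wderiv k f1 x * wderiv k g x + wderiv k f2 x * wderiv k g x))//.
  by apply/funext => x; rewrite mulrDl.
- apply: filterS E; first exact: (ae_filter_ringOfSetsType leb).
  by move=> x E Ix; rewrite E// mulrDl.
Qed.

Lemma inner_ge0 f : 0 <= inner f f.
Proof.
by apply: sumr_ge0 => k _; apply: Rintegral_ge0 => x _; rewrite -expr2 sqr_ge0.
Qed.

Local Opaque sobolev sobolev_inner.

Lemma inner0l g : H g -> inner (fun=> 0) g = 0.
Proof.
move=> Hg; have := innerZl 0 sobolev0 Hg; rewrite mul0r.
by rewrite mul0r.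
Qed.

Lemma inner_suml (I : Type) (r : seq I) (F : I -> R -> R) g :
  (forall i, H (F i)) -> H g ->
  inner (fun x => \sum_(i <- r) F i x) g = \sum_(i <- r) inner (F i) g.
Proof.
move=> HF Hg; elim: r => [|i r IH].
  rewrite big_nil (_ : (fun x => \sum_(i <- [::]) F i x) = (fun=> 0)); first exact: inner0l.
  by apply/funext => x; rewrite big_nil.
rewrite big_cons -IH.
rewrite (_ : (fun x => \sum_(i <- i :: r) F i x) = (fun x => F i x + \sum_(i <- r) F i x)).
  have HS : H (fun x => \sum_(i <- r) F i x) by apply: sobolev_sum.
  exact: (innerDl (HF i) HS Hg).
by apply/funext => x; rewrite big_cons.
Qed.

Lemma innerBl f1 f2 g : H f1 -> H f2 -> H g ->
  inner (fun x => f1 x - f2 x) g = inner f1 g - inner f2 g.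
Proof.
move=> Hf1 Hf2 Hg; rewrite -mulN1r -(innerZl (-1) Hf2 Hg) -(innerDl Hf1 (sobolevZ (-1) Hf2) Hg).
rewrite (_ : (fun x => f1 x - f2 x) = (fun x => f1 x + -1 * f2 x))//.
by apply/funext => x; rewrite mulN1r.
Qed.

Lemma inner_combination f g c : H f -> H g ->
  inner (fun x => f x + c * g x) (fun x => f x + c * g x) =
  inner f f + 2 * c * inner f g + c ^+ 2 * inner g g.
Proof.
move=> Hf Hg; have Hcg := sobolevZ c Hg; have HH := sobolevD Hf Hcg.
rewrite (innerDl Hf Hcg HH) (inner_sym f) (inner_sym (fun x => c * g x)).
rewrite (innerDl Hf Hcg Hf) (innerDl Hf Hcg Hcg) (innerZl c Hg Hf) (innerZl c Hg Hcg).
rewrite (inner_sym f (fun x => c * g x)) (inner_sym g (fun x => c * g x)).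
rewrite (innerZl c Hg Hf) (innerZl c Hg Hg) (inner_sym g f).
by move: (inner f f) (inner f g) (inner g g) => X Y Z; ring.
Qed.

Lemma inner_cauchy_schwarz f g : H f -> H g -> inner f g ^+ 2 <= inner f f * inner g g.
Proof.
move=> Hf Hg; apply: quadratic_discr; first exact: inner_ge0.
by move=> t; rewrite -(inner_combination t Hf Hg) inner_ge0.
Qed.

Local Transparent sobolev sobolev_inner.

Lemma sqnorm_wderiv_le k f : (k <= m)%N -> sqnorm leb I01 (wderiv k f) <= inner f f.
Proof.
rewrite -ltnS => km; rewrite /sobolev_inner (bigD1 (Ordinal km))//=.
rewrite (_ : sqnorm _ _ _ = \int[leb]_(x in I01) (wderiv k f x * wderiv k f x)).
  by rewrite lerDl sumr_ge0// => i _; apply: Rintegral_ge0 => x _; rewrite -expr2 sqr_ge0.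
by apply: eq_Rintegral => x _; rewrite expr2.
Qed.

(** f is a weak derivative of order 0 of itself, so the version chosen by [wderiv 0 f] agrees with f
    almost everywhere. *)
Lemma sqnorm_le_inner f : H f -> sqnorm leb I01 f <= inner f f.
Proof.
move=> Hf; apply: le_trans (@sqnorm_wderiv_le 0 f _) => //.
have [_ sf _] := Hf; have s0 := sobolev_wderiv_sq (leq0n m) Hf.
have w0 : weak_derivative 0 f f.
  by split=> // h _; rewrite expr0 mul1r.
have E := weak_derivative_unique w0 (sobolev_wderiv (leq0n m) Hf).
rewrite le_eqVlt; apply/orP; left; apply/eqP; apply: Rintegral_ae_eq; first exact: mI.
- by have [mf _] := sf; exact: measurable_funX.
- by have [mf _] := s0; exact: measurable_funX.
- apply: filterS E; first exact: (ae_filter_ringOfSetsType leb).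
  by move=> x E Ix; rewrite E.
Qed.

Lemma sobolev_hoelder f x y : H f -> I01 x -> I01 y ->
  (f y - f x) ^+ 2 <= 2 * `|y - x| * inner f f.
Proof.
move=> Hf Ix Iy; have [cf _ _] := Hf.
apply: (le_trans (weak_derivative1_hoelder cf (sobolev_wderiv m_gt0 Hf) Ix Iy)).
by rewrite ler_wpM2l ?mulr_ge0//; exact: sqnorm_wderiv_le.
Qed.

Lemma sobolev_pointwise : exists2 C : R, 0 < C & forall f, H f ->
  forall h : R, 0 < h <= 1 -> forall x, I01 x ->
    f x ^+ 2 <= C * (h^-1 * sqnorm leb I01 f + h ^+ (2 * m).-1 * inner f f).
Proof.
case: m m_gt0 (@sobolev_wderiv) (@sqnorm_wderiv_le) => // m' _ HW HS.
have [C C0 HC] := @sobolev_interpolation R m'; exists C => // f Hf h h01 x Ix.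
have [cf _ _] := Hf.
have := HC f _ cf (HW _ _ (leqnn _) Hf) h h01 x Ix.
move=> /le_trans; apply; rewrite ler_wpM2l ?(ltW C0)// lerD2l mulnS.
by rewrite ler_wpM2l ?HS// exprn_ge0//; case/andP: h01 => /ltW.
Qed.

End sobolev_space.

(** * Functions of Hoelder exponent one half and the error of Riemann sums *)

Section hoelder_and_riemann.
Context {R : realType}.
Local Notation I01 := (`[0%R, 1%R]%classic : set R).
Local Notation leb := (@lebesgue_measure R).
Local Notation mI := (@measurable_I01 R).
Implicit Types (f g h q : R -> R) (x y z a b c e u w L B : R) (k n N : nat).

(** Hoelder continuity of exponent 1/2, in squared form: this is how the Sobolev bounds deliver it,
    and no square roots appear. *)
Definition hoelder_half L f : Prop :=
  forall x y, I01 x -> I01 y -> (f x - f y) ^+ 2 <= L * `|x - y|.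

Lemma hoelder_halfM L1 L2 B1 B2 f g : hoelder_half L1 f -> hoelder_half L2 g ->
  (forall x, I01 x -> `|f x| <= B1) -> (forall x, I01 x -> `|g x| <= B2) ->
  hoelder_half (2 * (B2 ^+ 2 * L1 + B1 ^+ 2 * L2)) (fun x => f x * g x).
Proof.
move=> hf hg Bf Bg x y Ix Iy; have Hf := hf x y Ix Iy; have Hg := hg x y Ix Iy.
have fy : f y ^+ 2 <= B1 ^+ 2.
  by rewrite -(real_normK (num_real (f y))) lerXn2r ?nnegrE ?Bf// (le_trans _ (Bf y Iy)).
have gx : g x ^+ 2 <= B2 ^+ 2.
  by rewrite -(real_normK (num_real (g x))) lerXn2r ?nnegrE ?Bg// (le_trans _ (Bg x Ix)).
have E : f x * g x - f y * g y = g x * (f x - f y) + f y * (g x - g y) by ring.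
rewrite E.
have H1 : g x ^+ 2 * (f x - f y) ^+ 2 <= B2 ^+ 2 * (L1 * `|x - y|).
  by apply: ler_pM; rewrite ?sqr_ge0.
have H2 : f y ^+ 2 * (g x - g y) ^+ 2 <= B1 ^+ 2 * (L2 * `|x - y|).
  by apply: ler_pM; rewrite ?sqr_ge0.
have := sqr_ge0 (g x * (f x - f y) - f y * (g x - g y)).
move: H1 H2; rewrite -!exprMn; move: (g x * _) (f y * _) => X Y; nra.
Qed.

Lemma sqr_le_norm a b : 0 <= b -> a ^+ 2 <= b ^+ 2 -> `|a| <= b.
Proof. by move=> b0 ab; rewrite -(@ler_pXn2r _ 2)// ?nnegrE// real_normK// num_real. Qed.

Lemma hoelder_half_continuous L f : hoelder_half L f -> {within I01, continuous f}.
Proof.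
move=> hf; apply/subspace_continuousP => x Ix; apply/cvgrPdist_le => e e0.
rewrite near_withinE -nbhs_ballE; exists (e ^+ 2 / (`|L| + 1)).
  by rewrite /= divr_gt0 ?exprn_gt0// ltr_wpDl.
move=> y; rewrite /ball /= ltr_pdivlMr ?ltr_wpDl// => xy Iy.
have H : (f x - f y) ^+ 2 <= e ^+ 2.
  apply: (le_trans (hf x y Ix Iy)); apply: le_trans (ltW xy).
  rewrite mulrC ler_wpM2l// (le_trans (ler_norm L))// lerDl//.
by apply: (sqr_le_norm _ H); exact: ltW.
Qed.

Definition rsum N f : R := N%:R^-1 * \sum_(k < N) f (k%:R / N%:R).

Lemma rsum_point N (k : 'I_N) : I01 (k%:R / N%:R).
Proof.
rewrite /= in_itv/= divr_ge0//= ler_pdivrMr ?mul1r ?ler_nat 1?ltnW//.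
by rewrite ltr0n; case: N k => [[]|].
Qed.

Lemma rsumB N f g : rsum N (fun x => f x - g x) = rsum N f - rsum N g.
Proof. by rewrite /rsum sumrB mulrBr. Qed.

Lemma rsum_cst N c : (0 < N)%N -> rsum N (fun=> c) = c.
Proof.
move=> N0; rewrite /rsum sumr_const card_ord -(mulr_natl c N) mulrA mulVf ?mul1r//.
by rewrite pnatr_eq0 -lt0n.
Qed.

Lemma rsum_dist N f g e : (0 < N)%N -> (forall x, I01 x -> `|f x - g x| <= e) ->
  `|rsum N f - rsum N g| <= e.
Proof.
move=> N0 fg; rewrite -rsumB -(rsum_cst e N0) /rsum normrM ger0_norm ?invr_ge0//.
rewrite ler_wpM2l ?invr_ge0// (le_trans (ler_norm_sum _ _ _))//.
by apply: ler_sum => k _; exact/fg/rsum_point.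
Qed.

Lemma riemann_error N f e : (0 < N)%N -> {within I01, continuous f} ->
  (forall x y, I01 x -> I01 y -> `|x - y| <= N%:R^-1 -> `|f x - f y| <= e) ->
  `|rsum N f - \int[leb]_(x in I01) f x| <= e.
Proof.
move=> N0 cf fe; have N0' : 0 < N%:R :> R by rewrite ltr0n.
have If := continuous_integrable_itv cf.
have Isub (i : interval R) : [set` i] `<=` I01 -> leb.-integrable [set` i] (EFin \o f).
  by move=> iI; apply: integrableS If => //; exact: measurable_itv.
have pI k : (k <= N)%N -> I01 (k%:R / N%:R).
  by move=> kN; rewrite /= in_itv/= divr_ge0//= ler_pdivrMr// mul1r ler_nat.
suff H k : (k <= N)%N -> `|N%:R^-1 * \sum_(i < k) f (i%:R / N%:R) -
    \int[leb]_(x in `[0, k%:R / N%:R]) f x| <= e * (k%:R / N%:R).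
  by have := H _ (leqnn N); rewrite divff ?gt_eqF// mulr1.
elim: k => [_|k IH kN].
  by rewrite big_ord0 mulr0 mul0r mulr0 set_itv1 Rintegral_set1 subrr normr0.
have {}IH := IH (ltnW kN).
set p := k%:R / N%:R in IH *; set p' := k.+1%:R / N%:R.
have Ep : p' = p + N%:R^-1 by rewrite /p' -addn1 natrD mulrDl mul1r.
have pp : p < p' by rewrite Ep ltrDl invr_gt0.
have /andP[p0 p1] : 0 <= p <= 1 by have := pI _ (ltnW kN); rewrite /= in_itv.
have /andP[p0' p1'] : 0 <= p' <= 1 by have := pI _ kN; rewrite /= in_itv.
have sub : `]p, p'] `<=` I01.
  by apply: subset_itv; rewrite bnd_simp.
have E1 : \int[leb]_(x in `[0, p']) f x = \int[leb]_(x in `[0, p]) f x + \int[leb]_(x in `]p, p']) f x.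
  rewrite -(@Rintegral_itvB _ f (BLeft 0) (BRight p') p) ?bnd_simp//; last exact: ltW.
    by rewrite addrC subrK.
  by apply: Isub; apply: subset_itvl; rewrite bnd_simp.
have lE : fine (leb `]p, p']) = N%:R^-1.
  by rewrite lebesgue_measure_itv /= lte_fin pp -EFinD /= Ep addrAC subrr add0r.
have Isb := Isub `]p, p'] sub.
have Ic c : leb.-integrable `]p, p'] (EFin \o (fun=> c)).
  apply: (@integrableS _ _ _ leb I01) => //.
  by apply: continuous_integrableT => y; exact: cvg_cst.
have mS : measurable (`]p, p']%classic : set (measurableTypeR R)) by exact: measurable_itv.
have E2 : `|N%:R^-1 * f p - \int[leb]_(x in `]p, p']) f x| <= e * N%:R^-1.
  have -> : N%:R^-1 * f p = \int[leb]_(x in `]p, p']) (f p).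
    by rewrite Rintegral_cst// lE mulrC.
  rewrite -RintegralB//; apply: le_trans (le_normr_Rintegral _ _) _ => //.
    by have := integrableB mS (Ic (f p)) Isb.
  have -> : e * N%:R^-1 = \int[leb]_(x in `]p, p']) e by rewrite Rintegral_cst// lE.
  apply: le_Rintegral => //.
    by have := integrable_abse (integrableB mS (Ic (f p)) Isb).
  move=> x xp; apply: fe; [exact: pI (ltnW kN)|exact: sub|].
  move: xp; rewrite /= in_itv/= => /andP[x1 x2].
  rewrite Ep in x2; rewrite distrC ger0_norm ?subr_ge0; last exact: ltW.
  by rewrite lerBlDr addrC.
rewrite big_ord_recr /= mulrDr E1 -/p opprD addrACA.
apply: le_trans (ler_normD _ _) _; rewrite [X in e * X]Ep mulrDr.
exact: lerD.
Unshelve. all: by [].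
Qed.

Lemma continuous_ae_eq01 f g : {within I01, continuous f} -> {within I01, continuous g} ->
  {ae leb, forall x, I01 x -> f x = g x} -> forall x, I01 x -> f x = g x.
Proof.
move=> cf cg fg x Ix; apply/eqP; rewrite -subr_eq0 -normr_le0; move: x Ix.
pose u x := f x - g x.
have cu : {within I01, continuous u}.
  by apply: within_continuous_eq (within_continuousD cf (within_continuousZ (c := -1) cg)) => x; rewrite mulN1r.
apply: (@le_closure01 R (fun x => `|u x|)).
  by move=> x; apply: cvg_norm; exact: cu.
move=> x x01; rewrite leNgt; apply/negP => ux.
have cux : {for x, continuous u} by exact: within_continuous_at.
have [d d0 Hd] := continuous_delta cux (divr_gt0 ux (ltr0n R 2)).
pose r := Num.min d (Num.min x (1 - x)).
have r0 : 0 < r by rewrite !lt_min d0 /=; case/andP: x01 => -> /=; rewrite subr_gt0.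
have rd : r <= d by rewrite /r ge_min lexx.
have rx : r <= x by rewrite /r !ge_min lexx orbT.
have rx' : r <= 1 - x by rewrite /r !ge_min lexx !orbT.
have neg : leb.-negligible (`]x - r, x + r[%classic : set (measurableTypeR R)).
  apply: negligibleS fg => y /=; rewrite in_itv/= => /andP[y1 y2] H.
  have yx : `|y - x| < d by rewrite ltr_norml; lra.
  have := Hd _ yx; rewrite /u H ?subrr ?sub0r ?normrN; last by rewrite in_itv/=; lra.
  by have := ux; rewrite /u; lra.
have E0 := (negligibleP leb (measurable_itv `]x - r, x + r[)).1 neg.
have LE : leb (`]x - r, x + r[%classic : set R) = (2 * r)%:E.
  rewrite lebesgue_measure_itv /= lte_fin ifT; last by clear -r0; lra.
  by rewrite -EFinD; congr (_%:E); ring.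
have : (2 * r)%:E = 0%E :> \bar R by rewrite -LE; exact: E0.
by move/eqP; rewrite eqe mulf_eq0 pnatr_eq0 /= gt_eqF.
Qed.

End hoelder_and_riemann.

(** * The kernel operator and its eigenfunctions *)

Section sobolev_kernel_properties.
Context {R : realType}.
Local Notation I01 := (`[0%R, 1%R]%classic : set R).
Local Notation leb := (@lebesgue_measure R).
Local Notation mI := (@measurable_I01 R).
Variable m : nat.
Hypothesis m_gt0 : (0 < m)%N.
Variable K : R -> R -> R.
Hypothesis hK : sobolev_kernel m K.
Implicit Types (f g h q : R -> R) (x y z a b c e u w L B : R) (k n N : nat).

Local Notation H := (@sobolev R m).
Local Notation inner := (@sobolev_inner R m).
Local Notation T q := (integral_operator leb I01 K q).
Local Notation energy q := (\int[leb]_(x in I01) (q x * integral_operator leb I01 K q x)).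

Lemma kernel_sobolev x : I01 x -> H (K x).
Proof. by move=> /hK[]. Qed.

Lemma kernel_reproducing f x : H f -> I01 x -> inner f (K x) = f x.
Proof. by move=> Hf /hK[_]; exact. Qed.

Lemma kernel_reproducingl f x : H f -> I01 x -> inner (K x) f = f x.
Proof. by move=> Hf Ix; rewrite inner_sym kernel_reproducing. Qed.

Local Opaque sobolev sobolev_inner.

Lemma kernel_sym x y : I01 x -> I01 y -> K x y = K y x.
Proof.
move=> Ix Iy; rewrite -(kernel_reproducing (kernel_sobolev Ix) Iy).
by rewrite (kernel_reproducingl (kernel_sobolev Iy) Ix).
Qed.

(** Self-bounding: K x x is both the value at x and the squared norm of the section K x. The
    pointwise inequality at h = 1 thus reads (K x x)^2 <= 2 C (K x x); off the diagonal
    Cauchy-Schwarz is used. *)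
Lemma kernel_bound : exists2 B, 0 < B & forall x y, I01 x -> I01 y -> `|K x y| <= B.
Proof.
have [C C0 HC] := @sobolev_pointwise R m m_gt0.
have diag x : I01 x -> 0 <= K x x <= 2 * C.
  move=> Ix; have Hx := kernel_sobolev Ix.
  have Exx : inner (K x) (K x) = K x x by exact: kernel_reproducing.
  have Kx0 : 0 <= K x x by rewrite -Exx; exact: inner_ge0.
  have := HC _ Hx 1 _ x Ix; rewrite ltr01 lexx => /(_ isT).
  rewrite invr1 expr1n !mul1r Exx => H1.
  have := sqnorm_le_inner Hx; rewrite Exx => H2.
  have : K x x * K x x <= (2 * C) * K x x.
    rewrite -expr2 (le_trans H1)// mulrAC mulrC ler_wpM2r//; last by lra.
    by rewrite ltW.
  have [->|xn0] := eqVneq (K x x) 0; first by rewrite lexx/= mulr_ge0// ltW.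
  by rewrite ler_pM2r ?lt_neqAle ?Kx0 1?eq_sym ?xn0//= => ->.
exists (2 * C); first by rewrite mulr_gt0.
move=> x y Ix Iy; apply: sqr_le_norm; first by rewrite mulr_ge0// ltW.
have Hx := kernel_sobolev Ix; have Hy := kernel_sobolev Iy.
have := inner_cauchy_schwarz Hx Hy.
rewrite (kernel_reproducing Hx Ix) (kernel_reproducing Hy Iy) (kernel_reproducing Hx Iy).
have /andP[x0 xC] := diag _ Ix; have /andP[y0 yC] := diag _ Iy.
by move=> /le_trans; apply; rewrite expr2; exact: ler_pM.
Qed.

(** The difference u of the sections at x and x' has squared norm u x - u x'. The Hoelder bound for
    u then gives squared norm at most 2 |x - x'|, and u y is its product with the section at y. *)
Lemma kernel_hoelder : exists2 L, 0 < L & forall y, I01 y -> hoelder_half L (fun x => K x y).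
Proof.
have [B B0 HB] := kernel_bound; exists (2 * B); first by rewrite mulr_gt0.
move=> y Iy x x' Ix Ix'.
have Hx := kernel_sobolev Ix; have Hx' := kernel_sobolev Ix'; have Hy := kernel_sobolev Iy.
have Hu : H (fun z => K x z - K x' z) by exact: (sobolevB Hx Hx').
set u := (fun z => K x z - K x' z) in Hu *.
have Euu : inner u u = u x - u x'.
  rewrite (innerBl Hx Hx' Hu) (kernel_reproducingl Hu Ix) (kernel_reproducingl Hu Ix').
  by [].
have uu : inner u u <= 2 * `|x - x'|.
  have := sobolev_hoelder m_gt0 Hu Ix' Ix; rewrite -Euu.
  have [->|n0] := eqVneq (inner u u) 0; first by rewrite mulr_ge0.
  have u0 : 0 < inner u u by rewrite lt_neqAle eq_sym n0 inner_ge0.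
  by rewrite expr2 ler_pM2r.
have := inner_cauchy_schwarz Hu Hy.
rewrite (kernel_reproducing Hu Iy) (kernel_reproducing Hy Iy) => /le_trans; apply.
have Kyy : K y y <= B by rewrite (le_trans (ler_norm _))// HB.
have Kyy0 : 0 <= K y y by rewrite -(kernel_reproducing Hy Iy) inner_ge0.
rewrite (mulrC 2 B) -mulrA mulrC; apply: ler_pM => //; exact: inner_ge0.
Qed.

Lemma kernel_continuous x : I01 x -> {within I01, continuous (K x)}.
Proof.
move=> Ix; have [L _ HL] := kernel_hoelder.
apply: (@hoelder_half_continuous _ L) => y z Iy Iz.
by rewrite !(kernel_sym Ix)//; exact: HL.
Qed.

Lemma sobolev_bounded f : H f -> exists2 B, 0 < B & forall x, I01 x -> `|f x| <= B.
Proof.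
move=> Hf; have [C C0 HC] := @sobolev_pointwise R m m_gt0.
set A := C * (sqnorm leb I01 f + inner f f).
have A0 : 0 <= A by rewrite mulr_ge0 ?addr_ge0 ?sqnorm_ge0 ?inner_ge0// ltW.
exists (Num.sqrt A + 1); first by rewrite ltr_wpDl ?sqrtr_ge0.
move=> x Ix; apply: (@le_trans _ _ (Num.sqrt A)); last by rewrite lerDl.
apply: sqr_le_norm; first exact: sqrtr_ge0.
rewrite sqr_sqrtr//; have := HC _ Hf 1 _ x Ix; rewrite ltr01 lexx => /(_ isT).
by rewrite invr1 expr1n !mul1r.
Qed.

Lemma sobolev_hoelder_half f : H f -> exists2 L, 0 < L & hoelder_half L f.
Proof.
move=> Hf; exists (2 * inner f f + 1).
  by rewrite ltr_wpDl// mulr_ge0// inner_ge0.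
move=> x y Ix Iy; apply: (le_trans (sobolev_hoelder m_gt0 Hf Iy Ix)).
by move: (inner f f) (normr_ge0 (x - y)) => A; move: `|x - y| => B B0; lra.
Qed.

Lemma sobolev_continuous f : H f -> {within I01, continuous f}.
Proof. by move=> /sobolev_hoelder_half[L _]; exact: hoelder_half_continuous. Qed.

Lemma integral_bound f c : {within I01, continuous f} -> (forall x, I01 x -> `|f x| <= c) ->
  `|\int[leb]_(x in I01) f x| <= c.
Proof.
move=> cf fc; apply: le_trans (le_normr_Rintegral mI (integrable_I01 cf)) _.
rewrite -(Rintegral_I01_cst c); apply: le_Rintegral; [exact: mI| |exact: (integrable_I01 (@within_continuous_cst R I01 _))|exact: fc].
by have := integrable_abse (integrable_I01 cf).
Qed.

Lemma integral_dist f g c : {within I01, continuous f} -> {within I01, continuous g} ->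
  (forall x, I01 x -> `|f x - g x| <= c) ->
  `|\int[leb]_(x in I01) f x - \int[leb]_(x in I01) g x| <= c.
Proof.
move=> cf cg fgc; rewrite -(RintegralB mI (integrable_I01 cf) (integrable_I01 cg)).
apply: integral_bound => //.
by apply: within_continuous_eq (within_continuousD cf (within_continuousZ (c := -1) cg)) => x; rewrite mulN1r.
Qed.

Lemma continuous_Kq q x : {within I01, continuous q} -> I01 x ->
  {within I01, continuous (fun y => K x y * q y)}.
Proof. by move=> cq Ix; apply: within_continuousM => //; exact: kernel_continuous. Qed.

Lemma operator_hoelder q : {within I01, continuous q} -> (exists B, forall x, I01 x -> `|q x| <= B) ->
  exists2 L, 0 < L & hoelder_half L (T q).
Proof.
move=> cq [B Bq]; have [L L0 HL] := kernel_hoelder.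
exists (L * B ^+ 2 + 1); first by rewrite ltr_wpDl// mulr_ge0 ?sqr_ge0// ltW.
move=> x y Ix Iy; have cx := continuous_Kq cq Ix; have cy := continuous_Kq cq Iy.
have B0 : 0 <= B by apply: le_trans (Bq 0 _) => //; rewrite /= in_itv/= lexx ler01.
have : `|T q x - T q y| <= Num.sqrt (L * `|x - y|) * B.
  apply: integral_dist => // z Iz; rewrite -mulrBl normrM; apply: ler_pM => //; last exact: Bq.
  apply: sqr_le_norm; first exact: sqrtr_ge0.
  by rewrite sqr_sqrtr ?mulr_ge0 ?(ltW L0)//; exact: HL.
rewrite -(@ler_pXn2r _ 2)// ?nnegrE ?mulr_ge0 ?sqrtr_ge0//.
rewrite real_normK ?num_real// exprMn sqr_sqrtr ?mulr_ge0 ?(ltW L0)// => /le_trans; apply.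
by rewrite mulrDl mul1r -mulrAC lerDl.
Qed.

Lemma operator_continuous q : {within I01, continuous q} -> (exists B, forall x, I01 x -> `|q x| <= B) ->
  {within I01, continuous (T q)}.
Proof. by move=> cq Bq; have [L _] := operator_hoelder cq Bq; exact: hoelder_half_continuous. Qed.

Lemma hoelder_modulus L f e : 0 < L -> 0 < e -> hoelder_half L f ->
  forall N, L / e ^+ 2 < N%:R ->
  forall x y, I01 x -> I01 y -> `|x - y| <= N%:R^-1 -> `|f x - f y| <= e.
Proof.
move=> L0 e0 hf N; rewrite ltr_pdivrMr ?exprn_gt0// => LN x y Ix Iy xy.
have N0 : 0 < N%:R :> R.
  by rewrite lt_neqAle ler0n andbT eq_sym; apply: contraTneq LN => ->; rewrite mul0r -leNgt ltW.
apply: sqr_le_norm; first exact: ltW.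
apply: (le_trans (hf x y Ix Iy)).
rewrite (@le_trans _ _ (L * N%:R^-1))// ?ler_wpM2l ?(ltW L0)//.
by rewrite ler_pdivrMr// mulrC ltW.
Qed.

(* The Riemann sums of y |-> q(y) K_y lie in H^m; they approximate T q
   uniformly, and their squared norms approximate the energy of q. *)
Lemma operator_approximation q e : H q -> 0 < e -> exists2 S, H S &
  (forall x, I01 x -> `|S x - T q x| <= e) /\ inner S S <= energy q + e.
Proof.
move=> Hq e0; have [B B0 Bq] := sobolev_bounded Hq.
have [Lq Lq0 hq] := sobolev_hoelder_half Hq; have cq := sobolev_continuous Hq.
have [BK BK0 HBK] := kernel_bound; have [LK LK0 HLK] := kernel_hoelder.
have exB : exists B, forall x, I01 x -> `|q x| <= B by exists B.
have cT := operator_continuous cq exB.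
have [LT LT0 hT] := operator_hoelder cq exB.
have BT x : I01 x -> `|T q x| <= BK * B.
  move=> Ix; apply: integral_bound; first exact: continuous_Kq.
  by move=> y Iy; rewrite normrM; apply: ler_pM => //; [exact: HBK|exact: Bq].
pose e1 := Num.min e (e / (2 * B)).
have e10 : 0 < e1 by rewrite lt_min e0 divr_gt0// mulr_gt0.
have e1e : e1 <= e by rewrite ge_min lexx.
have e1B : B * e1 <= e / 2.
  rewrite (@le_trans _ _ (B * (e / (2 * B))))// ?ler_wpM2l ?(ltW B0)// ?ge_min ?lexx ?orbT//.
  by rewrite le_eqVlt; apply/orP; left; apply/eqP; field; rewrite gt_eqF.
pose L1 := 2 * (B ^+ 2 * LK + BK ^+ 2 * Lq).
have L10 : 0 < L1 by rewrite mulr_gt0// addr_gt0// mulr_gt0 ?exprn_gt0.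
have h1 x : I01 x -> hoelder_half L1 (fun y => K x y * q y).
  move=> Ix; apply: hoelder_halfM => //; last by move=> y; exact: HBK.
  by move=> y z Iy Iz; rewrite !(kernel_sym Ix)//; exact: HLK.
pose L2 := 2 * ((BK * B) ^+ 2 * Lq + B ^+ 2 * LT).
have L20 : 0 < L2 by rewrite mulr_gt0// addr_gt0// mulr_gt0 ?exprn_gt0// mulr_gt0.
have h2 : hoelder_half L2 (fun y => q y * T q y) by exact: hoelder_halfM.
have e20 : 0 < e / 2 by rewrite divr_gt0.
pose N := (Num.truncn (L1 / e1 ^+ 2) + Num.truncn (L2 / (e / 2) ^+ 2)).+1.
have N1 : L1 / e1 ^+ 2 < N%:R.
  apply: (lt_le_trans (truncnS_gt _)); rewrite ler_nat /N ltnS leq_addr//.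
have N2 : L2 / (e / 2) ^+ 2 < N%:R.
  by apply: (lt_le_trans (truncnS_gt _)); rewrite ler_nat /N ltnS leq_addl.
pose p (k : 'I_N) : R := k%:R / N%:R.
have Ip (k : 'I_N) : I01 (p k) by exact: rsum_point.
pose S x := N%:R^-1 * \sum_(k < N) (q (p k) * K (p k) x).
have HF (k : 'I_N) : H (fun x => q (p k) * K (p k) x) by exact: (sobolevZ (q (p k)) (kernel_sobolev (Ip k))).
have HS0 : H (fun x => \sum_(k < N) (q (p k) * K (p k) x)) by apply: sobolev_sum => k _; exact: HF.
have HS : H S by exact: (sobolevZ (N%:R^-1) HS0).
have ES x : I01 x -> S x = rsum N (fun y => K x y * q y).
  move=> Ix; rewrite /S /rsum; congr (_ * _); apply: eq_bigr => k _.
  by rewrite (kernel_sym (Ip k) Ix) mulrC.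
have ST x : I01 x -> `|S x - T q x| <= e1.
  move=> Ix; rewrite ES//; apply: riemann_error => //; first exact: continuous_Kq.
  exact: (hoelder_modulus L10 e10 (h1 x Ix) N1).
exists S => //; split; first by move=> x Ix; rewrite (le_trans (ST x Ix)).
have -> : inner S S = rsum N (fun y => q y * S y).
  rewrite {1}/S (innerZl _ HS0 HS) (inner_suml _ HF HS) /rsum; congr (_ * _).
  apply: eq_bigr => k _; rewrite (innerZl _ (kernel_sobolev (Ip k)) HS).
  by rewrite (kernel_reproducingl HS (Ip k)).
have D1 : `|rsum N (fun y => q y * S y) - rsum N (fun y => q y * T q y)| <= B * e1.
  apply: rsum_dist => // y Iy; rewrite -mulrBr normrM.
  by apply: ler_pM => //; [exact: Bq|exact: ST].
have D2 : `|rsum N (fun y => q y * T q y) - energy q| <= e / 2.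
  apply: riemann_error => //; first exact: within_continuousM.
  exact: (hoelder_modulus L20 e20 h2 N2).
move: D1 D2; rewrite !ler_norml; move: (rsum _ _) (rsum _ _) (energy q) => X Y Z; lra.
Qed.

(** The pointwise inequality is applied to the approximants S of [operator_approximation], which do
    lie in H^m, and passed to the limit. The energy of q takes the place of the squared H^m-norm of
    T q. *)
Lemma operator_pointwise : exists2 C, 0 < C & forall q, H q ->
  forall h : R, 0 < h <= 1 -> forall x, I01 x ->
    T q x ^+ 2 <= C * (h^-1 * sqnorm leb I01 (T q) + h ^+ (2 * m).-1 * energy q).
Proof.
have [C C0 HC] := @sobolev_pointwise R m m_gt0; exists C => // q Hq h h01 x Ix.
have [B B0 Bq] := sobolev_bounded Hq; have cq := sobolev_continuous Hq.
have exB : exists B, forall x, I01 x -> `|q x| <= B by exists B.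
have cT := operator_continuous cq exB.
have [BK BK0 HBK] := kernel_bound.
have BT y : I01 y -> `|T q y| <= BK * B.
  move=> Iy; apply: integral_bound; first exact: continuous_Kq.
  by move=> z Iz; rewrite normrM; apply: ler_pM => //; [exact: HBK|exact: Bq].
have B2 : 0 < BK * B by rewrite mulr_gt0.
move: (BK * B) BT B2 => BT HBT BT0.
have /andP[h0 h1] := h01.
set X := sqnorm _ _ _; set Y := energy q.
have hX : 0 <= h^-1 by rewrite invr_ge0 ltW.
have hY : 0 <= h ^+ (2 * m).-1 by rewrite exprn_ge0// ltW.
(* Collects every coefficient multiplying the approximation error d, plus 1 for positivity. *)
pose D := 2 * BT + C * (h^-1 * (2 * BT + 1) + h ^+ (2 * m).-1) + 1.
have D0 : 0 < D.
  rewrite /D ltr_wpDl// addr_ge0// ?mulr_ge0 ?(ltW C0) ?(ltW BT0)// addr_ge0// mulr_ge0//.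
  by rewrite addr_ge0// mulr_ge0// ltW.
apply/ler_addgt0Pr => e e0.
pose d := Num.min 1 (e / D).
have d0 : 0 < d by rewrite lt_min ltr01 divr_gt0.
have d1 : d <= 1 by rewrite ge_min lexx.
have dD : D * d <= e.
  by rewrite mulrC -ler_pdivlMr// ge_min lexx orbT.
have [S HS [HST HSS]] := operator_approximation Hq d0.
have HSx := HC _ HS h h01 x Ix.
have sq (y : R) : I01 y -> S y ^+ 2 <= T q y ^+ 2 + (2 * BT + 1) * d /\ T q y ^+ 2 <= S y ^+ 2 + 2 * BT * d.
  move=> Iy; have := HST y Iy; have := HBT y Iy.
  move: (T q y) => t tB; have -> : S y = t + (S y - t) by rewrite addrC subrK.
  rewrite (addrC t) addrK; move: (S y - t) => r rd.
  have : `|t * r| <= BT * d by rewrite normrM; exact: ler_pM.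
  have rr : r ^+ 2 <= d.
    rewrite -(real_normK (num_real r)) (@le_trans _ _ (d * 1))//; last by rewrite mulr1.
    by rewrite expr2; apply: ler_pM => //; exact: le_trans rd d1.
  have := sqr_ge0 r; rewrite ler_norml sqrrD; move: rr; rewrite (mulrC r t) mulr2n.
  by move: (r ^+ 2) (t * r) (t ^+ 2) => X1 X2 X3 r1 r2 /andP[r3 r4]; split; lra.
have cS := sobolev_continuous HS.
have XS : sqnorm leb I01 S <= X + (2 * BT + 1) * d.
  rewrite /X /sqnorm -(Rintegral_I01_cst ((2 * BT + 1) * d)).
  have cS2 : {within I01, continuous (fun x => S x ^+ 2)}.
    by apply: within_continuous_eq (within_continuousM cS cS) => y; rewrite expr2.
  have cT2 : {within I01, continuous (fun x => T q x ^+ 2)}.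
    by apply: within_continuous_eq (within_continuousM cT cT) => y; rewrite expr2.
  rewrite -(RintegralD mI (integrable_I01 cT2) (integrable_I01 (@within_continuous_cst R I01 _))).
  apply: le_Rintegral; [exact: mI|exact: integrable_I01| |by move=> y /sq[]].
  by apply: integrable_I01; apply: within_continuousD => //; exact: (@within_continuous_cst R I01).
have [_ Tx] := sq x Ix.
apply: (le_trans Tx); apply: (@le_trans _ _ (C * (h^-1 * X + h ^+ (2 * m).-1 * Y) + D * d)); last by rewrite lerD2l.
apply: (@le_trans _ _ (C * (h^-1 * (X + (2 * BT + 1) * d) + h ^+ (2 * m).-1 * (Y + d)) + 2 * BT * d)).
  rewrite lerD2r (le_trans HSx)// ler_wpM2l ?(ltW C0)//.
  by apply: lerD; apply: ler_wpM2l.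
rewrite /D; nra.
Qed.

(** Expand the squared norm of K x - S, which is nonnegative, for S approximating T q: it is K x x -
    2 S x plus the squared norm of S. *)
Lemma operator_energy_le q x : H q -> I01 x -> 2 * T q x <= K x x + energy q.
Proof.
move=> Hq Ix; apply/ler_addgt0Pr => e e0.
have [S HS [HST HSS]] := operator_approximation Hq (divr_gt0 e0 (ltr0n R 3)).
have HKx := kernel_sobolev Ix.
have := @inner_ge0 R m (fun y => K x y - S y).
have HB := sobolevB HKx HS.
rewrite (innerBl HKx HS HB) (kernel_reproducingl HB Ix) (inner_sym m S) (innerBl HKx HS HS).
rewrite (kernel_reproducingl HS Ix).
have := HST x Ix; rewrite ler_norml; move: HSS.
move: (inner S S) (energy q) (T q x) (S x) (K x x) => A1 A2 A3 A4 A5; lra.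
Qed.

End sobolev_kernel_properties.

Lemma cauchy_schwarz_sum (R : realType) (I : Type) (r : seq I) (P : pred I) (F G : I -> R) :
  (\sum_(i <- r | P i) F i * G i) ^+ 2 <=
  (\sum_(i <- r | P i) F i ^+ 2) * (\sum_(i <- r | P i) G i ^+ 2).
Proof.
apply: quadratic_discr; first by apply: sumr_ge0 => i _; exact: sqr_ge0.
move=> t; have : 0 <= \sum_(i <- r | P i) (F i + t * G i) ^+ 2.
  by apply: sumr_ge0 => i _; exact: sqr_ge0.
rewrite !mulr_sumr -!big_split /=; congr (_ <= _).
by apply: eq_bigr => i _; ring.
Qed.

(** * Eigenfunctions: Bessel bound, univariate spectral bound and Mercer's expansion *)

Section sobolev_eigenfunctions.
Context {R : realType}.
Local Notation I01 := (`[0%R, 1%R]%classic : set R).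
Local Notation leb := (@lebesgue_measure R).
Local Notation mI := (@measurable_I01 R).
Variable m : nat.
Hypothesis m_gt0 : (0 < m)%N.
Variables (K : R -> R -> R) (mu : nat -> R) (phi : nat -> R -> R).
Hypothesis hK : sobolev_kernel m K.
Hypothesis hphi : sobolev_eigen_system m K mu phi.
Implicit Types (f g h q : R -> R) (x y z c e u w L B : R) (i j k n N : nat) (a b : nat -> R).

Local Notation H := (@sobolev R m).
Local Notation T q := (integral_operator leb I01 K q).
Local Notation comb n b := (fun y => \sum_(j < n) b j * phi j y).

Lemma mu_gt0 j : 0 < mu j.
Proof. by case: hphi => -[]. Qed.

Lemma phi_sobolev j : H (phi j).
Proof. by case: hphi. Qed.

Lemma phi_orthonormal i j : \int[leb]_(x in I01) (phi i x * phi j x) = (i == j)%:R.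
Proof. by case: hphi => -[_ _ + _ _ _]; apply. Qed.

Local Opaque sobolev sobolev_inner.

Lemma phi_continuous j : {within I01, continuous (phi j)}.
Proof. exact: (sobolev_continuous m_gt0 (phi_sobolev j)). Qed.
Arguments phi_continuous : clear implicits.

Lemma phi_bounded j : exists2 B, 0 < B & forall x, I01 x -> `|phi j x| <= B.
Proof. exact: (sobolev_bounded m_gt0 (phi_sobolev j)). Qed.

(** Both sides are continuous, so the almost-everywhere eigen-equation holds at every point. *)
Lemma phi_eigen j x : I01 x -> T (phi j) x = mu j * phi j x.
Proof.
have [B B0 HB] := phi_bounded j.
move: x; apply: continuous_ae_eq01; last by case: hphi => -[_ _ _ + _ _]; apply.
  by apply: (operator_continuous m_gt0 hK (phi_continuous j)); exists B.
exact: within_continuousZ (phi_continuous j).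
Qed.

Lemma comb_sobolev n b : H (comb n b).
Proof.
apply: sobolev_sum => j _; exact: (sobolevZ (b j) (phi_sobolev j)).
Qed.

Lemma comb_continuous n b : {within I01, continuous (comb n b)}.
Proof. exact: (sobolev_continuous m_gt0 (comb_sobolev n b)). Qed.
Arguments comb_continuous : clear implicits.

Lemma integral_comb n b g : {within I01, continuous g} ->
  \int[leb]_(x in I01) (g x * (\sum_(j < n) b j * phi j x)) =
  \sum_(j < n) b j * \int[leb]_(x in I01) (g x * phi j x).
Proof.
move=> cg; have cgp j : {within I01, continuous (fun x => g x * phi j x)}.
  exact: within_continuousM cg (phi_continuous j).
transitivity (\int[leb]_(x in I01) (\sum_(j < n) b j * (g x * phi j x))).
  by apply: eq_Rintegral => x _; rewrite mulr_sumr; apply: eq_bigr => j _; rewrite mulrCA.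
rewrite (Rintegral_sum mI); last first.
  by move=> j _; apply: (integrableZ_EFin mI); exact: integrable_I01.
by apply: eq_bigr => j _; rewrite RintegralZl//; exact: integrable_I01.
Qed.

Lemma comb_operator n b x : I01 x ->
  T (comb n b) x = \sum_(j < n) (b j * mu j) * phi j x.
Proof.
move=> Ix; rewrite /integral_operator integral_comb; last exact: (kernel_continuous m_gt0 hK).
by apply: eq_bigr => j _; rewrite -mulrA; congr (_ * _); exact: phi_eigen.
Qed.

Lemma comb_inner n a b :
  \int[leb]_(x in I01) ((\sum_(j < n) a j * phi j x) * (\sum_(j < n) b j * phi j x)) =
  \sum_(j < n) a j * b j.
Proof.
rewrite integral_comb; last exact: comb_continuous.
apply: eq_bigr => j _; rewrite mulrC; congr (_ * _).
under eq_Rintegral do rewrite mulrC.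
rewrite integral_comb; last exact: phi_continuous.
rewrite (bigD1 j)//= phi_orthonormal eqxx mulr1 big1 ?addr0// => i ij.
by rewrite phi_orthonormal eq_sym (_ : _ == _ = false) ?mulr0//; exact/negbTE.
Qed.

Lemma comb_energy n b :
  \int[leb]_(x in I01) ((\sum_(j < n) b j * phi j x) * T (comb n b) x) = \sum_(j < n) b j ^+ 2 * mu j.
Proof.
transitivity (\int[leb]_(x in I01) ((\sum_(j < n) b j * phi j x) * (\sum_(j < n) (b j * mu j) * phi j x))).
  by apply: eq_Rintegral => x; rewrite inE => Ix; rewrite comb_operator.
by rewrite (comb_inner n b (fun j => b j * mu j)); apply: eq_bigr => j _; rewrite mulrA expr2.
Qed.

Lemma comb_operator_sqnorm n b :
  sqnorm leb I01 (T (comb n b)) = \sum_(j < n) (b j * mu j) ^+ 2.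
Proof.
rewrite /sqnorm.
transitivity (\int[leb]_(x in I01) ((\sum_(j < n) (b j * mu j) * phi j x) * (\sum_(j < n) (b j * mu j) * phi j x))).
  by apply: eq_Rintegral => x; rewrite inE => Ix; rewrite comb_operator// expr2.
transitivity (\sum_(j < n) (b j * mu j) * (b j * mu j)); last by apply: eq_bigr => j _; rewrite expr2.
exact: (comb_inner n (fun j => b j * mu j) (fun j => b j * mu j)).
Qed.

(** For q = sum_j phi_j(x) phi_j, both T q (x) and the energy of q equal the sum A to be bounded,
    and [operator_energy_le] reads 2 A <= K x x + A. *)
Lemma kernel_bessel n x : I01 x -> \sum_(j < n) mu j * phi j x ^+ 2 <= K x x.
Proof.
move=> Ix; have := @operator_energy_le R m m_gt0 K hK _ _ (comb_sobolev n (fun j => phi j x)) Ix.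
have E1 := comb_operator n (fun j => phi j x) Ix; have E2 := comb_energy n (fun j => phi j x).
cbv beta in E1, E2; rewrite E1 E2.
have -> : \sum_(j < n) phi j x * mu j * phi j x = \sum_(j < n) mu j * phi j x ^+ 2.
  by apply: eq_bigr => j _; rewrite expr2; ring.
have -> : \sum_(j < n) phi j x ^+ 2 * mu j = \sum_(j < n) mu j * phi j x ^+ 2.
  by apply: eq_bigr => j _; rewrite mulrC.
by move: (\sum_(j < n) _) (K x x) => A B; lra.
Qed.

Lemma kernel_bessel_bound : exists2 B, 0 < B & forall n x, I01 x ->
  \sum_(j < n) mu j * phi j x ^+ 2 <= B.
Proof.
have [B B0 HB] := kernel_bound m_gt0 hK; exists B => // n x Ix.
by rewrite (le_trans (kernel_bessel n Ix))// (le_trans (ler_norm _))// HB.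
Qed.

Lemma mu_bounded : exists2 B, 0 < B & forall j, mu j <= B.
Proof.
have [B B0 HB] := kernel_bessel_bound; exists B => // j.
have cp := within_continuousM (phi_continuous j) (phi_continuous j).
have E : \int[leb]_(x in I01) (phi j x * phi j x) = 1 by rewrite phi_orthonormal eqxx.
rewrite -[leLHS]mulr1 -E -RintegralZl//; last exact: integrable_I01.
rewrite -[leRHS](Rintegral_I01_cst B); apply: le_Rintegral => //.
- apply: integrable_I01; exact: within_continuousZ.
- exact: (integrable_I01 (@within_continuous_cst R I01 B)).
move=> x Ix; rewrite -expr2; apply: le_trans (HB j.+1 x Ix).
rewrite big_ord_recr /= lerDr sumr_ge0// => i _.
by rewrite mulr_ge0 ?sqr_ge0// ltW// mu_gt0.
Qed.

(* With q = \sum_j phi_j(x) phi_j / (mu_j + t) one has T q (x) = S, the sum to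
   be bounded, while |T q|^2 <= S and t * energy q <= S; for t = h^(2m) the
   interpolation inequality reads S^2 <= 2 C S / h. *)
Lemma spectral_bound1 : exists2 C, 0 < C & forall h : R, 0 < h -> forall n x, I01 x ->
  \sum_(j < n) phi j x ^+ 2 / (1 + h ^+ (2 * m) / mu j) <= C / h.
Proof.
have [C C0 HC] := @operator_pointwise R m m_gt0 K hK.
have [B B0 HB] := kernel_bessel_bound.
exists (2 * C + B); first by rewrite addr_gt0// mulr_gt0.
move=> h h0 n x Ix.
have h20 : 0 < h ^+ (2 * m) by rewrite exprn_gt0.
(* Interpolation is limited to h <= 1. For h > 1 one has h <= h^(2m), each term is at most mu_j
   phi_j(x)^2 / h, and the Bessel bound suffices. *)
have [h1|h1] := lerP h 1; last first.
  apply: (@le_trans _ _ (B / h)); last first.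
    by rewrite ler_pM2r ?invr_gt0// lerDr mulr_ge0// ltW.
  apply: (@le_trans _ _ (\sum_(j < n) h^-1 * (mu j * phi j x ^+ 2))); last first.
    by rewrite -mulr_sumr mulrC ler_pM2r ?invr_gt0// HB.
  apply: ler_sum => j _; rewrite mulrA mulrC; apply: ler_wpM2r; first exact: sqr_ge0.
  have hh : h <= h ^+ (2 * m).
    by rewrite -[leLHS]expr1 ler_weXn2l ?(ltW h1)// muln_gt0.
  have := mu_gt0 j; move: (mu j) => u u0.
  rewrite -[leRHS]invrK lef_pV2 ?posrE ?invr_gt0 ?mulr_gt0 ?invr_gt0//; last first.
    by rewrite ltr_wpDl// divr_gt0.
  rewrite invfM invrK (@le_trans _ _ (h ^+ (2 * m) / u))// ?lerDr// ler_pM2r ?invr_gt0//.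
pose t := h ^+ (2 * m); rewrite -/t in h20 *.
pose b j := phi j x / (mu j + t).
have mt j : 0 < mu j + t by rewrite addr_gt0// mu_gt0.
set S := \sum_(j < n) _.
have ES : T (comb n b) x = S.
  rewrite comb_operator//; apply: eq_bigr => j _; rewrite /b.
  by field; rewrite !gt_eqF// mu_gt0.
have S0 : 0 <= S.
  apply: sumr_ge0 => j _; rewrite divr_ge0 ?sqr_ge0// addr_ge0// divr_ge0 ?(ltW h20)//.
  by rewrite ltW// mu_gt0.
have bj (j : nat) : phi j x ^+ 2 / (1 + t / mu j) = b j ^+ 2 * mu j * (mu j + t).
  by rewrite /b; field; rewrite !gt_eqF// mu_gt0.
have X1 : \sum_(j < n) (b j * mu j) ^+ 2 <= S.
  apply: ler_sum => j _; rewrite bj.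
  rewrite exprMn (expr2 (mu j)) mulrA; apply: ler_wpM2l; last by rewrite lerDl ltW.
  by rewrite mulr_ge0 ?sqr_ge0// ltW// mu_gt0.
have X2 : t * \sum_(j < n) b j ^+ 2 * mu j <= S.
  rewrite mulr_sumr; apply: ler_sum => j _; rewrite bj mulrC; apply: ler_wpM2l.
    by rewrite mulr_ge0 ?sqr_ge0// ltW// mu_gt0.
  by rewrite lerDr ltW// mu_gt0.
have h01 : 0 < h <= 1 by rewrite h0.
have := HC _ (comb_sobolev n b) h h01 x Ix.
rewrite ES comb_operator_sqnorm comb_energy.
have X3 : h ^+ (2 * m).-1 * \sum_(j < n) b j ^+ 2 * mu j <= h^-1 * S.
  apply: le_trans (ler_wpM2l _ X2); last by rewrite invr_ge0 ltW.
  rewrite mulrA /t; have -> : (2 * m = (2 * m).-1.+1)%N by rewrite prednK// muln_gt0.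
  by rewrite exprS mulKf// gt_eqF.
have X4 : h^-1 * \sum_(j < n) (b j * mu j) ^+ 2 <= h^-1 * S.
  by rewrite ler_pM2l ?invr_gt0.
have [->|Sn0] := eqVneq S 0; first by rewrite divr_ge0 ?(ltW h0)// addr_ge0 ?ltW// mulr_gt0.
have Sp : 0 < S by rewrite lt_neqAle eq_sym Sn0.
move=> X5; have : S * S <= (2 * C / h) * S.
  rewrite -expr2 (le_trans X5)// (@le_trans _ _ (C * (h^-1 * S + h^-1 * S)))//.
    by rewrite ler_wpM2l ?(ltW C0)// lerD.
  by rewrite le_eqVlt; apply/orP; left; apply/eqP; ring.
rewrite ler_pM2r// => /le_trans; apply.
by rewrite ler_pM2r ?invr_gt0// lerDl ltW.
Qed.

Let term x y j := mu j * phi j x * phi j y.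

Let bessel_series_cvg x : I01 x -> cvgn (series (fun j => mu j * phi j x ^+ 2)).
Proof.
move=> Ix; have [B B0 HB] := kernel_bessel_bound.
apply: nondecreasing_is_cvgn.
  apply/nondecreasing_seqP => n; rewrite /series/= big_nat_recr//= lerDl.
  by rewrite mulr_ge0 ?sqr_ge0// ltW// mu_gt0.
by exists B => _ [n _ <-]; rewrite /series/= big_mkord HB.
Qed.

Let mercer_series_cvg x y : I01 x -> I01 y -> cvgn (series (term x y)).
Proof.
move=> Ix Iy; apply: normed_cvg; apply: series_le_cvg.
- by move=> n; exact: normr_ge0.
- move=> n; apply: (addr_ge0 (x := mu n * phi n x ^+ 2) (y := mu n * phi n y ^+ 2)).
    by rewrite mulr_ge0 ?sqr_ge0// ltW// mu_gt0.
  by rewrite mulr_ge0 ?sqr_ge0// ltW// mu_gt0.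
- move=> n /=; rewrite /term -mulrA normrM (gtr0_norm (mu_gt0 n)) -mulrDr ler_pM2l ?mu_gt0//.
  move: (phi n x) (phi n y) => s t; rewrite ler_norml; nra.
- have := is_cvg_seriesD (bessel_series_cvg Ix) (bessel_series_cvg Iy); exact.
Qed.

(** By Cauchy-Schwarz a block of the series is at most the root of B times the same block of the
    Bessel series at x. That block does not involve y, so convergence is uniform in y and the limit
    is continuous. *)
Let mercer_uniform x : I01 x -> exists S : R -> R, {within I01, continuous S} /\
  (forall y, I01 y -> series (term x y) @ \oo --> S y) /\
  forall e, 0 < e -> exists N, forall n, (N <= n)%N -> forall y, I01 y ->
    `|S y - series (term x y) n| <= e.
Proof.
move=> Ix; have [B B0 HB] := kernel_bessel_bound.
pose S y := limn (series (term x y)).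
have cS y : I01 y -> series (term x y) @ \oo --> S y by exact: mercer_series_cvg.
pose a := series (fun j => mu j * phi j x ^+ 2).
have ca := bessel_series_cvg Ix.
have nda : {homo a : n p / (n <= p)%N >-> n <= p}.
  apply/nondecreasing_seqP => n; rewrite /a /series/= big_nat_recr//= lerDl.
  by rewrite mulr_ge0 ?sqr_ge0// ltW// mu_gt0.
have step n p y : (n <= p)%N -> I01 y ->
    `|series (term x y) p - series (term x y) n| <= Num.sqrt ((limn a - a n) * B).
  move=> np Iy; have an : a p <= limn a by exact: nondecreasing_cvgn_le.
  have an' : a n <= a p by exact: nda.
  apply: sqr_le_norm; first exact: sqrtr_ge0.
  rewrite sqr_sqrtr; last by rewrite mulr_ge0 ?(ltW B0)// subr_ge0 (le_trans an').
  rewrite sub_series_geq//.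
  have := cauchy_schwarz_sum (index_iota n p) xpredT
     (fun j => Num.sqrt (mu j) * phi j x) (fun j => Num.sqrt (mu j) * phi j y).
  have Emu z (r : seq nat) : \sum_(j <- r) (Num.sqrt (mu j) * phi j z) ^+ 2 = \sum_(j <- r) mu j * phi j z ^+ 2.
    by apply: eq_bigr => j _; rewrite exprMn sqr_sqrtr// ltW// mu_gt0.
  rewrite !Emu.
  have -> : \sum_(n <= j < p) Num.sqrt (mu j) * phi j x * (Num.sqrt (mu j) * phi j y) = \sum_(n <= k < p) term x y k.
    apply: eq_bigr => j _; rewrite /term mulrACA -expr2 sqr_sqrtr ?mulrA//.
    by rewrite ltW// mu_gt0.
  move=> /le_trans; apply; apply: ler_pM.
  - by apply: sumr_ge0 => j _; rewrite mulr_ge0 ?sqr_ge0// ltW// mu_gt0.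
  - by apply: sumr_ge0 => j _; rewrite mulr_ge0 ?sqr_ge0// ltW// mu_gt0.
  - by rewrite -sub_series_geq// lerB.
  - apply: le_trans (HB p y Iy); rewrite -(big_mkord xpredT (fun j => mu j * phi j y ^+ 2)).
    rewrite [leRHS](big_cat_nat (n := n))//= lerDr; apply: sumr_ge0 => j _.
    by rewrite mulr_ge0 ?sqr_ge0// ltW// mu_gt0.
have unif e : 0 < e -> exists N, forall n, (N <= n)%N -> forall y, I01 y ->
    `|S y - series (term x y) n| <= e.
  move=> e0; have /cvgrPdist_lt := ca => /(_ (e ^+ 2 / B)).
  rewrite divr_gt0 ?exprn_gt0// => /(_ isT)[N _ HN]; exists N => n Nn y Iy.
  have st : forall p, (n <= p)%N -> `|series (term x y) p - series (term x y) n| <= e.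
    move=> p np; apply: (le_trans (step _ _ _ np Iy)).
    rewrite -[leRHS]ger0_norm ?(ltW e0)// -sqrtr_sqr ler_wsqrtr//.
    have := HN n Nn; rewrite -ler_pdivlMr// => /ltW; apply: le_trans; exact: ler_norm.
  rewrite ler_distl; apply/andP; split.
    apply: (@limr_ge _ _ _ _ _ (series (term x y))); first exact: cS.
    by exists n => // p /= np; have := st _ np; rewrite ler_distl => /andP[].
  apply: (@limr_le _ _ _ _ _ (series (term x y))); first exact: cS.
  by exists n => // p /= np; have := st _ np; rewrite ler_distl => /andP[].
exists S; split; last by split.
apply: (@uniform_limit_continuous_subspace _ _ I01 ((fun n y => series (term x y) n) @ \oo)).
  exists 0%N => // n _ /=.
  apply: within_continuous_eq (comb_continuous n (fun j => mu j * phi j x)) => y.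
  by rewrite /series /= big_mkord.
move=> P /uniform_nbhs[E [entE sub]].
move: entE; rewrite -entourage_ballE => -[e /= e0 He].
have [N HN] := unif _ (divr_gt0 e0 (ltr0n R 2)).
exists N => // n /= Nn; apply: sub => y Iy; apply: He.
rewrite /= /ball /=; apply: (le_lt_trans (HN n Nn y Iy)).
by rewrite ltr_pdivrMr// ltr_pMr// ltr1n.
Qed.

(** Let r be K x minus the sum S of the series. By the eigen-equation r is orthogonal to every
    phi_i, hence to S by uniform convergence. By exhaustion of the spectrum and continuity T r
    vanishes at x, that is, r is orthogonal to K x. So r is orthogonal to itself, and being
    continuous it is 0. *)
Lemma mercer1 x y : I01 x -> I01 y -> (\sum_(j < n) mu j * phi j x * phi j y) @[n --> \oo] --> K x y.
Proof.
move=> Ix; have [S [cS [limS unifS]]] := mercer_uniform Ix.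
have sE n y0 : series (term x y0) n = \sum_(j < n) (mu j * phi j x) * phi j y0.
  by rewrite /series/= big_mkord.
have cser n : {within I01, continuous (fun y0 => series (term x y0) n)}.
  apply: within_continuous_eq (comb_continuous n (fun j => mu j * phi j x)) => y0.
  by rewrite sE.
pose r y0 := K x y0 - S y0.
have cr : {within I01, continuous r}.
  apply: within_continuous_eq (within_continuousD (kernel_continuous m_gt0 hK Ix) (within_continuousZ (c := -1) cS)) => y0.
  by rewrite mulN1r.
have [BK BK0 HBK] := kernel_bound m_gt0 hK.
have [N0 HN0] := unifS _ (ltr01 : 0 < 1 :> R).
have [Br Br0 HBr] : exists2 B, 0 < B & forall y, I01 y -> `|r y| <= B.
  have [Bc Bc0 HBc] := sobolev_bounded m_gt0 (comb_sobolev N0 (fun j => mu j * phi j x)).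
  exists (BK + (1 + Bc)); first by rewrite !addr_gt0.
  move=> y0 Iy0; apply: (le_trans (ler_normB _ _)); apply: lerD; first exact: HBK.
  rewrite -(subrK (series (term x y0) N0) (S y0)); apply: (le_trans (ler_normD _ _)).
  by apply: lerD; [exact: HN0|rewrite sE; exact: HBc].
(* Integrals against the partial sums that are eventually constant pass to the uniform limit S. *)
have limint g B : 0 < B -> {within I01, continuous g} -> (forall y, I01 y -> `|g y| <= B) ->
    forall c N1, (forall n, (N1 <= n)%N -> \int[leb]_(y in I01) (g y * series (term x y) n) = c) ->
    \int[leb]_(y in I01) (g y * S y) = c.
  move=> B0 cg HB c N1 Hc; apply/eqP; rewrite -subr_eq0 -normr_le0; apply/ler_addgt0Pr => e e0.
  rewrite add0r; have [N HN] := unifS _ (divr_gt0 e0 B0).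
  rewrite -(Hc (maxn N N1) (leq_maxr _ _)); apply: integral_dist.
  - exact: within_continuousM.
  - exact: within_continuousM.
  move=> y0 Iy0; rewrite -mulrBr normrM.
  rewrite (le_trans (ler_pM _ _ (HB _ Iy0) (HN _ (leq_maxl _ _) _ Iy0)))//.
  by rewrite mulrC divfK// gt_eqF.
have orth i : \int[leb]_(y in I01) (r y * phi i y) = 0.
  have [Bi Bi0 HBi] := phi_bounded i.
  have cpK : {within I01, continuous (fun y => K x y * phi i y)}.
    by apply: within_continuousM; [exact: (kernel_continuous m_gt0 hK)|exact: phi_continuous].
  have cpS : {within I01, continuous (fun y => phi i y * S y)}.
    by apply: within_continuousM => //; exact: phi_continuous.
  transitivity (\int[leb]_(y in I01) (K x y * phi i y - phi i y * S y)).
    by apply: eq_Rintegral => y0 _; rewrite /r mulrBl (mulrC (S _)).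
  rewrite (RintegralB mI (integrable_I01 cpK) (integrable_I01 cpS)).
  apply/eqP; rewrite subr_eq0; apply/eqP; rewrite -[LHS]/(T (phi i) x) phi_eigen//.
  apply/esym; apply: (limint _ Bi Bi0 (phi_continuous i) HBi _ i.+1) => n ni.
  under eq_Rintegral do rewrite sE.
  rewrite (@integral_comb n (fun j => mu j * phi j x)); last exact: phi_continuous.
  rewrite (bigD1 (Ordinal ni))//= phi_orthonormal eqxx mulr1 big1 ?addr0// => j ij.
  rewrite phi_orthonormal (_ : _ == _ = false) ?mulr0//; apply/negbTE.
  by apply: contraNneq ij => ij; apply/eqP/val_inj.
have rS : \int[leb]_(y in I01) (r y * S y) = 0.
  apply: (limint _ Br Br0 cr HBr _ 0%N) => n _.
  under eq_Rintegral do rewrite sE.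
  rewrite (@integral_comb n (fun j => mu j * phi j x))// big1// => j _.
  by rewrite orth mulr0.
have sr : square_integrable leb I01 r by exact: continuous_square_integrable.
have Tr : T r x = 0.
  apply: (@continuous_ae_eq01 R (T r) (fun=> 0)) => //.
  - by apply: (operator_continuous m_gt0 hK cr); exists Br.
  - exact: (@within_continuous_cst R I01 0).
  - by case: hphi => -[_ _ _ _ + _]; apply.
have rK : \int[leb]_(y in I01) (K x y * r y) = 0 by exact: Tr.
have r2 : \int[leb]_(y in I01) (r y ^+ 2) = 0.
  transitivity (\int[leb]_(y in I01) (K x y * r y - r y * S y)).
    by apply: eq_Rintegral => y0 _; rewrite /r; ring.
  have cpK : {within I01, continuous (fun y => K x y * r y)}.
    by apply: within_continuousM => //; exact: (kernel_continuous m_gt0 hK).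
  have cpS : {within I01, continuous (fun y => r y * S y)} by exact: within_continuousM.
  by rewrite (RintegralB mI (integrable_I01 cpK) (integrable_I01 cpS)) rK rS subrr.
have r0 : {ae leb, forall y, I01 y -> r y = 0}.
  have /square_integrableP[mr ir] := sr.
  have mr2 : measurable_fun I01 (fun y => (r y ^+ 2)%:E).
    by apply/measurable_EFinP; exact: measurable_funX.
  have := (ae_eq_integral_abs leb mI mr2).1.
  have -> : (\int[leb]_(y in I01) `|(r y ^+ 2)%:E| = 0)%E.
    under eq_integral do rewrite gee0_abs ?lee_fin ?sqr_ge0//.
    by have := fineK (integrable_fin_num mI ir); rewrite -[fine _]/(Rintegral _ _ _) r2 => <-.
  move=> /(_ erefl); apply: filterS => y0 + Iy0 => /(_ Iy0) [] /eqP.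
  by rewrite sqrf_eq0 => /eqP.
move=> Iy; have -> : K x y = S y.
  apply/eqP; rewrite -subr_eq0; apply/eqP; apply: (@continuous_ae_eq01 R r (fun=> 0)) => //.
  exact: (@within_continuous_cst R I01 0).
by under eq_fun do rewrite -sE; exact: limS.
Qed.

End sobolev_eigenfunctions.

(** * Tensor products *)

(** All multi-indices with entries below N. Sums over such boxes factor into univariate sums or
    split off the first coordinate, which sums over arbitrary finite sets do not; the boxes exhaust
    the index set. *)
Fixpoint tbox (N d : nat) : seq (d.-tuple nat) :=
  match d with
  | 0 => [:: [tuple]]
  | d'.+1 => [seq cons_tuple j t | j <- iota 0 N, t <- tbox N d']
  end.

Lemma mem_tbox N d (t : d.-tuple nat) : (t \in tbox N d) = all (fun j => (j < N)%N) t.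
Proof.
elim: d t => [|d IH] t /=; first by rewrite [t]tuple0; exact: mem_head.
have Et : t = cons_tuple (thead t) [tuple of behead t] by exact: tuple_eta.
apply/idP/idP => [/allpairsP[[j s] /= [jN sN ->]]|].
  by move: jN sN; rewrite mem_iota add0n /= IH => ->.
rewrite [in X in X -> _]Et /= => /andP[jN sN]; apply/allpairsP.
by exists (thead t, [tuple of behead t]); rewrite mem_iota add0n IH.
Qed.

Lemma tbox_uniq N d : uniq (tbox N d).
Proof.
elim: d => //= d IH; apply: allpairs_uniq => //; first exact: iota_uniq.
by move=> [j t] [j' t'] _ _ /= /(congr1 val)/= [-> /val_inj ->].
Qed.

Lemma sum_fset_tbox (R : realType) N d (F : d.-tuple nat -> R) :
  \sum_(i <- [fset i in tbox N d]%fset) F i = \sum_(i <- tbox N d) F i.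
Proof.
apply: perm_big; apply: uniq_perm; [exact: fset_uniq|exact: tbox_uniq|].
by move=> i; rewrite in_fset.
Qed.

Lemma sum_tboxS (R : realType) N d (F : d.+1.-tuple nat -> R) :
  \sum_(i <- tbox N d.+1) F i = \sum_(j < N) \sum_(t <- tbox N d) F (cons_tuple (j : nat) t).
Proof. rewrite big_allpairs_dep.
by rewrite -(big_mkord xpredT (fun j => \sum_(t <- tbox N d) F (cons_tuple j t))) /index_iota subn0. Qed.

Lemma tbox_subset N M d : (N <= M)%N -> {subset tbox N d <= tbox M d}.
Proof.
by move=> NM t; rewrite !mem_tbox; apply: sub_all => j /leq_trans; apply.
Qed.

Lemma tbox_exhaust d (A : seq (d.-tuple nat)) :
  exists N, forall M, (N <= M)%N -> {subset A <= tbox M d}.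
Proof.
elim: A => [|t A [N HN]]; first by exists 0%N.
exists (maxn N (\max_(j <- t) j).+1) => M; rewrite geq_max => /andP[NM tM] u.
rewrite inE => /predU1P[->|/(HN _ NM)//].
by rewrite mem_tbox; apply/allP => j jt; apply: leq_ltn_trans tM; exact: leq_bigmax_seq.
Qed.

Lemma tnth_lift0 (T : Type) n (t : n.+1.-tuple T) (k : 'I_n) :
  tnth t (lift ord0 k) = tnth [tuple of behead t] k.
Proof. by rewrite {1}(tuple_eta t) tnthS. Qed.

Section tensor_products.
Context {R : realType}.
Variables (phi : nat -> R -> R) (mu : nat -> R).

Definition tensor_phi d (i : d.-tuple nat) (x : d.-tuple R) : R :=
  \prod_(k < d) phi (tnth i k) (tnth x k).

Definition tensor_mu d (i : d.-tuple nat) : R := \prod_(k < d) mu (tnth i k).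

Lemma tensor_phi_cons d j (t : d.-tuple nat) (x : d.+1.-tuple R) :
  tensor_phi (cons_tuple j t) x = phi j (thead x) * tensor_phi t [tuple of behead x].
Proof.
rewrite /tensor_phi big_ord_recl (_ : tnth x ord0 = thead x)//; congr (phi _ _ * _).
by apply: eq_bigr => k _; rewrite tnthS {1}(tuple_eta x) tnthS.
Qed.

Lemma tensor_mu_cons d j (t : d.-tuple nat) :
  tensor_mu (cons_tuple j t) = mu j * tensor_mu t.
Proof.
rewrite /tensor_mu big_ord_recl; congr (mu _ * _).
by apply: eq_bigr => k _; rewrite tnthS.
Qed.

Lemma unit_cube_cons d (x : d.+1.-tuple R) : unit_cube x <->
  `[0%R, 1%R]%classic (thead x) /\ unit_cube [tuple of behead x].
Proof.
rewrite {1}(tuple_eta x); split.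
  move=> cx; split; first by have := cx ord0; rewrite tnth0 /= in_itv.
  by move=> k; have := cx (lift ord0 k); rewrite tnthS.
move=> [x0 cx] k; case: (unliftP ord0 k) => [k' ->|->]; first by rewrite tnthS; exact: cx.
by rewrite tnth0; move: x0; rewrite /= in_itv.
Qed.

Lemma tensor_sum d N (x y : d.-tuple R) :
  \sum_(i <- tbox N d) tensor_mu i * tensor_phi i x * tensor_phi i y =
  \prod_(k < d) \sum_(j < N) mu j * phi j (tnth x k) * phi j (tnth y k).
Proof.
elim: d x y => [|d IH] x y.
  by rewrite big_ord0 big_seq1 /tensor_mu /tensor_phi !big_ord0 !mulr1.
rewrite sum_tboxS big_ord_recl mulr_suml; apply: eq_bigr => j _.
have -> : \prod_(i < d) \sum_(j0 < N) mu j0 * phi j0 (tnth x (lift ord0 i)) * phi j0 (tnth y (lift ord0 i))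
   = \sum_(i <- tbox N d) tensor_mu i * tensor_phi i [tuple of behead x] * tensor_phi i [tuple of behead y].
  rewrite IH; apply: eq_bigr => k _; apply: eq_bigr => l _.
  by rewrite !tnth_lift0.
rewrite mulr_sumr; apply: eq_bigr => t _.
rewrite tensor_mu_cons !tensor_phi_cons (_ : tnth x ord0 = thead x)// (_ : tnth y ord0 = thead y)//.
by ring.
Qed.

Hypothesis mu_gt0 : forall j, 0 < mu j.

Lemma tensor_mu_gt0 d (i : d.-tuple nat) : 0 < tensor_mu i.
Proof. by apply: prodr_gt0. Qed.

Lemma tensor_spectral_sumS d N (x : d.+1.-tuple R) (s : R) :
  \sum_(i <- tbox N d.+1) tensor_phi i x ^+ 2 / (1 + s / tensor_mu i) =
  \sum_(j < N) phi j (thead x) ^+ 2 *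
    \sum_(t <- tbox N d) tensor_phi t [tuple of behead x] ^+ 2 / (1 + s / mu j / tensor_mu t).
Proof.
rewrite sum_tboxS; apply: eq_bigr => j _; rewrite mulr_sumr; apply: eq_bigr => t _.
by rewrite tensor_phi_cons tensor_mu_cons exprMn invfM (mulrA s) [RHS]mulrA.
Qed.

Hypothesis bessel : exists2 B : R, 0 < B & forall n (x : R), `[0%R, 1%R]%classic x ->
  \sum_(j < n) mu j * phi j x ^+ 2 <= B.

Lemma tensor_bessel d : exists2 B : R, 0 < B & forall N (x : d.-tuple R), unit_cube x ->
  \sum_(i <- tbox N d) tensor_mu i * tensor_phi i x ^+ 2 <= B.
Proof.
have [B B0 HB] := bessel; exists (B ^+ d); first exact: exprn_gt0.
move=> N x cx.
have -> : \sum_(i <- tbox N d) tensor_mu i * tensor_phi i x ^+ 2 =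
    \sum_(i <- tbox N d) tensor_mu i * tensor_phi i x * tensor_phi i x.
  by apply: eq_bigr => i _; rewrite expr2 mulrA.
rewrite tensor_sum -[in leRHS](card_ord d) -prodr_const; apply: ler_prod => k _.
have -> : \sum_(j < N) mu j * phi j (tnth x k) * phi j (tnth x k) =
    \sum_(j < N) mu j * phi j (tnth x k) ^+ 2.
  by apply: eq_bigr => i _; rewrite expr2 mulrA.
rewrite HB ?andbT /=; last by rewrite in_itv /=; exact: cx.
by apply: sumr_ge0 => j _; rewrite mulr_ge0 ?sqr_ge0// ltW.
Qed.

(** Crude bound from 1 / (1 + s / mu) <= mu / s. The recursion on the dimension uses it only for s
    >= 1, where nothing is lost. *)
Lemma tensor_spectral_bessel d : exists2 B : R, 0 < B & forall s : R, 0 < s ->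
  forall N (x : d.-tuple R), unit_cube x ->
  \sum_(i <- tbox N d) tensor_phi i x ^+ 2 / (1 + s / tensor_mu i) <= B / s.
Proof.
have [B B0 HB] := tensor_bessel d; exists B => // s s0 N x cx.
apply: (@le_trans _ _ (\sum_(i <- tbox N d) s^-1 * (tensor_mu i * tensor_phi i x ^+ 2))); last first.
  by rewrite -mulr_sumr mulrC ler_pM2r ?invr_gt0// HB.
apply: ler_sum => i _; rewrite mulrA mulrC; apply: ler_wpM2r; first exact: sqr_ge0.
have := tensor_mu_gt0 i; move: (tensor_mu i) => u u0.
rewrite -[leRHS]invrK lef_pV2 ?posrE ?invr_gt0 ?mulr_gt0 ?invr_gt0//; last first.
  by rewrite ltr_wpDl// divr_gt0.
by rewrite invfM invrK lerDr.
Qed.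

Variable m : nat.
Hypothesis m_gt0 : (0 < m)%N.
Hypothesis mu_bounded : exists2 B : R, 0 < B & forall j : nat, mu j <= B.
Hypothesis spectral1 : exists2 C : R, 0 < C & forall h : R, 0 < h -> forall n (x : R), `[0%R, 1%R]%classic x ->
  \sum_(j < n) phi j x ^+ 2 / (1 + h ^+ (2 * m) / mu j) <= C / h.

(** Since h^(2m) / mu_j = (h / root_j)^(2m), fixing the index j of one coordinate amounts to
    replacing the bandwidth h by h / root_j in the remaining ones. *)
Let root j := mu j `^ (2 * m)%:R^-1.

Let root_gt0 j : 0 < root j.
Proof. by rewrite powR_gt0. Qed.

Let rootE j : root j ^+ (2 * m) = mu j.
Proof.
rewrite -powR_mulrn ?powR_ge0// -powRrM mulVf ?powRr1 ?ltW//.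
by rewrite pnatr_eq0 -lt0n muln_gt0.
Qed.

(** Surrogate of log(1/h) that is at least 1 for every h > 0: its powers are monotone, and dividing
    h by a bounded factor costs only a multiplicative constant. *)
Definition loglevel (h : R) := 1 + ln (1 + h^-1).

Lemma loglevel_ge1 h : 0 < h -> 1 <= loglevel h.
Proof. by move=> h0; rewrite lerDl ln_ge0// lerDl invr_ge0 ltW. Qed.

Lemma loglevel_scale G h g : 0 < h -> 0 < g <= G -> 1 <= G ->
  loglevel (h / g) <= (1 + ln G) * loglevel h.
Proof.
move=> h0 /andP[g0 gG] G1; have G0 : 0 < G := lt_le_trans ltr01 G1.
have lG : 0 <= ln G by rewrite ln_ge0.
apply: (@le_trans _ _ (ln G + loglevel h)).
  rewrite /loglevel addrCA lerD2l -lnM ?posrE ?addr_gt0 ?invr_gt0//.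
  rewrite ler_ln ?posrE ?mulr_gt0 ?addr_gt0 ?invr_gt0 ?divr_gt0//.
  rewrite invf_div mulrDr mulr1; apply: lerD => //.
  by rewrite ler_pM2r ?invr_gt0.
have := loglevel_ge1 h0; move: (loglevel h) (ln G) lG => X Y; nra.
Qed.

(* Every root in ]h, G] lies in one of the shells ]G e^(-k-1), G e^(-k)], of
   which there are O(log(1/h)), and each shell contributes O(1). *)
Let root_sum : exists2 C : R, 0 < C & forall h : R, 0 < h -> forall n (x : R), `[0%R, 1%R]%classic x ->
  \sum_(j < n | h < root j) phi j x ^+ 2 * root j <= C * loglevel h.
Proof.
have [B B0 HB] := mu_bounded; have [C C0 HC] := spectral1.
pose G := 1 + B `^ (2 * m)%:R^-1.
have G1 : 1 <= G by rewrite lerDl powR_ge0.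
have G0 : 0 < G := lt_le_trans ltr01 G1.
have rG j : root j <= G.
  rewrite (@le_trans _ _ (B `^ (2 * m)%:R^-1)) ?lerDr//.
  apply: ge0_ler_powR; [by rewrite invr_ge0 ler0n|by rewrite nnegrE ltW|by rewrite nnegrE ltW|exact: HB].
clearbody G.
(* On its shell [hk k] is at most e times the root, so the denominator in the spectral sum is at
   most this constant. *)
pose c : R := 1 + expR 1 ^+ (2 * m).
have c0 : 0 < c by rewrite addr_gt0// exprn_gt0 ?expR_gt0.
exists (c * C * (1 + ln G)).
  by rewrite !mulr_gt0// ltr_pwDl// ln_ge0.
move=> h h0 n x Ix.
pose M := (Num.truncn (ln (1 + (h / G)^-1))).+1.
pose hk k : R := G * expR (- k%:R).
have hk0 k : 0 < hk k by rewrite mulr_gt0 ?expR_gt0.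
have shell (j : nat) : h < root j -> root j <= c * \sum_(k < M) hk k / (1 + hk k ^+ (2 * m) / mu j).
  move=> hj; have Gr : 1 <= G / root j by rewrite ler_pdivlMr// mul1r.
  have l0 : 0 <= ln (G / root j) by rewrite ln_ge0.
  pose k := Num.truncn (ln (G / root j)).
  have k1 : k%:R <= ln (G / root j) by rewrite truncn_le.
  have k2 : ln (G / root j) < k%:R + 1 by rewrite natr1 truncnS_gt.
  have kM : (k < M)%N.
    rewrite ltnS; apply: le_truncn.
    rewrite ler_ln ?posrE ?divr_gt0 ?addr_gt0 ?invr_gt0 ?divr_gt0//.
    rewrite invf_div (@le_trans _ _ (G / h)) ?lerDr//.
    by rewrite ler_pM2l// lef_pV2 ?posrE// ltW.
  have Er : G = root j * expR (ln (G / root j)).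
    by rewrite lnK ?posrE ?divr_gt0// mulrC divfK// gt_eqF.
  have r1 : root j <= hk k.
    rewrite /hk Er -mulrA -expRD -[leLHS]mulr1 ler_pM2l// -[leLHS]expR0 ler_expR.
    by rewrite subr_ge0.
  have r2 : hk k <= root j * expR 1.
    rewrite /hk {1}Er -mulrA -expRD ler_pM2l// ler_expR; lra.
  rewrite (@le_trans _ _ (c * (hk k / (1 + hk k ^+ (2 * m) / mu j))))//; last first.
    rewrite ler_pM2l// (bigD1 (Ordinal kM))//= lerDl sumr_ge0// => i _.
    by rewrite divr_ge0 ?(ltW (hk0 _))// addr_ge0// divr_ge0 ?exprn_ge0 ?ltW.
  have D0 : 0 < 1 + hk k ^+ (2 * m) / mu j.
    by rewrite addr_gt0// divr_gt0 ?exprn_gt0.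
  rewrite mulrA ler_pdivlMr// mulrC; apply: ler_pM => //; [exact: ltW|exact: ltW|].
  rewrite lerD2l ler_pdivrMr// -rootE -exprMn mulrC.
  apply: lerXn2r => //; rewrite nnegrE; first exact: ltW.
  by apply: mulr_ge0; rewrite ?expR_ge0 ?ltW.
apply: (@le_trans _ _ (\sum_(j < n) \sum_(k < M) c * hk k * (phi j x ^+ 2 / (1 + hk k ^+ (2 * m) / mu j)))).
  rewrite big_mkcond /=; apply: ler_sum => j _; case: ifPn => hj; last first.
    apply: sumr_ge0 => k _; apply: mulr_ge0; first by rewrite mulr_ge0// ltW.
    apply: divr_ge0; first exact: sqr_ge0.
    by rewrite addr_ge0// divr_ge0 ?exprn_ge0 ?ltW.
  have -> : \sum_(k < M) c * hk k * (phi j x ^+ 2 / (1 + hk k ^+ (2 * m) / mu j)) =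
     phi j x ^+ 2 * (c * \sum_(k < M) hk k / (1 + hk k ^+ (2 * m) / mu j)).
    by rewrite !mulr_sumr; apply: eq_bigr => k _; ring.
  by apply: ler_wpM2l; [exact: sqr_ge0|exact: shell].
rewrite exchange_big /=.
apply: (@le_trans _ _ (\sum_(k < M) c * C)).
  apply: ler_sum => k _; rewrite -mulr_sumr -mulrA ler_pM2l//.
  by rewrite -ler_pdivlMl// mulrC; exact: HC.
rewrite sumr_const card_ord -(mulr_natr (c * C) M) -[leRHS]mulrA ler_pM2l ?mulr_gt0//.
apply: le_trans (loglevel_scale h0 (_ : 0 < G <= G) G1); last by rewrite G0 lexx.
rewrite /M -natr1 addrC lerD2l truncn_le// ln_ge0// lerDl invr_ge0 divr_ge0 ?ltW//.
Qed.

(** Induction on the dimension, splitting the first index. If root_j <= h, the remaining coordinates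
    are handled by the crude bound, and the univariate bound finishes, with 1 / u <= 2 / (1 + u) for
    u >= 1. If root_j > h, the induction hypothesis at h / root_j leaves the weights phi_j^2 root_j,
    whose sum [root_sum] bounds by one further logarithm. *)
Lemma tensor_spectral_bound d : exists2 C : R, 0 < C & forall h : R, 0 < h ->
  forall N (x : d.+1.-tuple R), unit_cube x ->
  \sum_(i <- tbox N d.+1) tensor_phi i x ^+ 2 / (1 + h ^+ (2 * m) / tensor_mu i) <=
  C / h * loglevel h ^+ d.
Proof.
have [C1 C10 HC1] := spectral1; have [Cr Cr0 HCr] := root_sum.
elim: d => [|d [C C0 IH]].
  exists C1 => // h h0 N x /unit_cube_cons[x0 _]; rewrite tensor_spectral_sumS expr0 mulr1.
  apply: le_trans (HC1 _ h0 N _ x0); apply: ler_sum => j _.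
  by rewrite big_seq1 /tensor_phi /tensor_mu !big_ord0 expr1n divr1 div1r.
have [B B0 HB] := tensor_spectral_bessel d.+1.
have [Bm Bm0 HBm] := mu_bounded.
pose G := 1 + Bm `^ (2 * m)%:R^-1.
have G1 : 1 <= G by rewrite lerDl powR_ge0.
have G0 : 0 < G := lt_le_trans ltr01 G1.
have rG j : root j <= G.
  rewrite (@le_trans _ _ (Bm `^ (2 * m)%:R^-1)) ?lerDr//.
  apply: ge0_ler_powR; [by rewrite invr_ge0 ler0n|by rewrite nnegrE ltW|by rewrite nnegrE ltW|exact: HBm].
have lG : 0 < 1 + ln G by rewrite ltr_pwDl// ln_ge0.
exists (2 * B * C1 + C * (1 + ln G) ^+ d * Cr).
  by rewrite addr_gt0 ?mulr_gt0 ?exprn_gt0.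
move=> h h0 N x /unit_cube_cons[x0 cx]; rewrite tensor_spectral_sumS.
have l1 := loglevel_ge1 h0; have l0 := lt_le_trans ltr01 l1.
set y := thead x in x0 *; set x' := [tuple of behead x] in cx *.
have Eh (j : nat) : h ^+ (2 * m) / mu j = (h / root j) ^+ (2 * m).
  by rewrite expr_div_n rootE.
rewrite (bigID (fun j : 'I_N => h < root j)) /= addrC mulrDl mulrDl; apply: lerD.
  apply: (@le_trans _ _ (2 * B * (C1 / h))); last first.
    rewrite -!mulrA !ler_pM2l// -[leLHS]mulr1 ler_pM2l ?invr_gt0//.
    by rewrite exprn_ege1.
  apply: le_trans (ler_wpM2l _ (HC1 _ h0 N _ x0)); last by rewrite mulr_ge0 ?ltW.
  rewrite mulr_sumr [leRHS](bigID (fun j : 'I_N => h < root j)) /=.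
  apply: ler_wpDl.
    apply: sumr_ge0 => j _; apply: mulr_ge0; first by rewrite mulr_ge0 ?(ltW B0).
    apply: divr_ge0; first exact: sqr_ge0.
    by rewrite addr_ge0// divr_ge0 ?exprn_ge0 ?ltW.
  apply: ler_sum => j; rewrite -leNgt => hj.
  rewrite mulrCA; apply: ler_wpM2l; first exact: sqr_ge0.
  have u1 : 1 <= h / root j by rewrite ler_pdivlMr// mul1r.
  have u2 : 1 <= (h / root j) ^+ (2 * m) by rewrite exprn_ege1.
  have u0 := lt_le_trans ltr01 u2.
  have := HB (h ^+ (2 * m) / mu j) _ N x' cx; rewrite Eh => /(_ u0) /le_trans; apply.
  move: (_ ^+ _) u2 u0 => u u1' u0'.
  rewrite ler_pdivrMr// [leRHS]mulrAC ler_pdivlMr; last by rewrite addr_gt0.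
  rewrite (mulrC B) [leRHS]mulrAC ler_pM2r//; lra.
apply: (@le_trans _ _ (\sum_(j < N | h < root j) phi j y ^+ 2 * root j * (C / h * ((1 + ln G) * loglevel h) ^+ d))).
  apply: ler_sum => j hj; rewrite -mulrA; apply: ler_wpM2l; first exact: sqr_ge0.
  have u0 : 0 < h / root j by rewrite divr_gt0.
  have := IH _ u0 N x' cx; rewrite -Eh => /le_trans; apply.
  rewrite invf_div !mulrA [root j * C]mulrC; apply: ler_wpM2l.
    by rewrite !mulr_ge0 ?invr_ge0 ?ltW.
  apply: lerXn2r; rewrite ?nnegrE.
  - exact: le_trans ler01 (loglevel_ge1 u0).
  - by rewrite mulr_ge0 ?ltW.
  - by apply: loglevel_scale => //; rewrite root_gt0 rG.
rewrite -mulr_suml.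
apply: (@le_trans _ _ (Cr * loglevel h * (C / h * ((1 + ln G) * loglevel h) ^+ d))).
  apply: ler_wpM2r; last exact: HCr.
  by rewrite !mulr_ge0 ?invr_ge0 ?exprn_ge0 ?mulr_ge0 ?ltW.
by rewrite exprMn exprS le_eqVlt; apply/orP; left; apply/eqP; ring.
Qed.

Variable K : R -> R -> R.
Hypothesis mercer : forall x y : R, `[0%R, 1%R]%classic x -> `[0%R, 1%R]%classic y ->
  (\sum_(j < n) mu j * phi j x * phi j y) @[n --> \oo] --> K x y.

Lemma tensor_mercer d (x y : d.-tuple R) : unit_cube x -> unit_cube y ->
  (\sum_(i <- tbox N d) tensor_mu i * tensor_phi i x * tensor_phi i y) @[N --> \oo] -->
  tensor_kernel K x y.
Proof.
move=> cx cy; under eq_fun do rewrite tensor_sum.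
rewrite /tensor_kernel; have I (z : d.-tuple R) k : unit_cube z -> `[0%R, 1%R]%classic (tnth z k).
  by move=> cz; rewrite /= in_itv /=; exact: cz.
pose F (k : 'I_d) N := \sum_(j < N) mu j * phi j (tnth x k) * phi j (tnth y k).
rewrite -/(F _ _); elim: (index_enum _) => [|k r IH].
  rewrite big_nil (_ : (fun N => _) = fun=> 1); first exact: cvg_cst.
  by apply/funext => N; rewrite big_nil.
rewrite big_cons (_ : (fun N => _) = fun N => F k N * \prod_(k <- r) F k N); last first.
  by apply/funext => N; rewrite big_cons.
apply: cvgM => //.
by apply: mercer; exact: I.
Qed.

End tensor_products.

Lemma sum_subset (R : zmodType) (I : choiceType) (r r' : seq I) (F : I -> R) :
  uniq r -> uniq r' -> {subset r <= r'} ->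
  \sum_(i <- r') F i = \sum_(i <- r) F i + \sum_(i <- r' | i \notin r) F i.
Proof.
move=> ur ur' rr'; rewrite (bigID (mem r)) /=; congr (_ + _).
rewrite -big_filter; apply: perm_big; apply: uniq_perm => //; first exact: filter_uniq.
by move=> i; rewrite mem_filter; apply/andP/idP => [[]//|ir]; split=> //; exact: rr'.
Qed.

Section box_sums.
Context {R : realType} {d : nat}.
Implicit Types (F G c : d.-tuple nat -> R) (s M : R) (N : nat).

Lemma tbox_sum_le F N N' : (forall i, 0 <= F i) -> (N <= N')%N ->
  \sum_(i <- tbox N d) F i <= \sum_(i <- tbox N' d) F i.
Proof.
move=> F0 NN'; rewrite (sum_subset F (tbox_uniq N d) (tbox_uniq N' d) (tbox_subset NN')).
by rewrite lerDl sumr_ge0.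
Qed.

Lemma tbox_cvg_le F s N : (forall i, 0 <= F i) ->
  (\sum_(i <- tbox N d) F i) @[N --> \oo] --> s -> \sum_(i <- tbox N d) F i <= s.
Proof.
move=> F0 Fs; apply: (ler_cvg_to (cvg_cst _) Fs); exists N => // N' /= NN'; exact: tbox_sum_le.
Qed.

Lemma tbox_bounded_cvg F M : (forall i, 0 <= F i) ->
  (forall N, \sum_(i <- tbox N d) F i <= M) ->
  exists2 s, s <= M & (\sum_(i <- tbox N d) F i) @[N --> \oo] --> s.
Proof.
move=> F0 FM; have cF : cvgn (fun N => \sum_(i <- tbox N d) F i).
  apply: nondecreasing_is_cvgn; first by move=> N N' NN'; exact: tbox_sum_le.
  by exists M => _ [N _ <-].
exists (limn (fun N => \sum_(i <- tbox N d) F i)) => //.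
by apply: limr_le => //; exact: nearW.
Qed.

Lemma tbox_esum F : (forall i, 0 <= F i) ->
  (\sum_(i <- tbox N d) F i)%:E @[N --> \oo] --> (\esum_(i in [set: d.-tuple nat]) (F i)%:E)%E.
Proof.
move=> F0; have nd : nondecreasing_seq (fun N => (\sum_(i <- tbox N d) F i)%:E).
  by move=> N N' NN'; rewrite lee_fin tbox_sum_le.
have := ereal_nondecreasing_cvgn nd; congr (_ --> _); apply/eqP; rewrite eq_le; apply/andP; split.
  apply: ge_ereal_sup => _ [N _ <-]; apply: ereal_sup_ubound.
  exists [set` tbox N d]; first by split=> //; exact: finite_seq.
  by rewrite -fsbig_seq ?tbox_uniq// sumEFin.
apply: ge_ereal_sup => _ [A [finA _] <-].
have [X ->] := finite_fsetP.1 finA.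
have [N /(_ _ (leqnn N)) HN] := tbox_exhaust X.
rewrite -fsbig_seq ?fset_uniq//; apply: (@le_trans _ _ (\sum_(i <- tbox N d) F i)%:E).
  by rewrite sumEFin lee_fin (sum_subset F (fset_uniq X) (tbox_uniq N d) HN) lerDl sumr_ge0.
by apply: ereal_sup_ubound; exists N.
Qed.

Lemma tbox_esumP F s : (forall i, 0 <= F i) ->
  (\esum_(i in [set: d.-tuple nat]) (F i)%:E = s%:E)%E <->
  (\sum_(i <- tbox N d) F i) @[N --> \oo] --> s.
Proof.
move=> F0; have := tbox_esum F0; split=> [Fs|Fs].
  by move: H; rewrite Fs => /fine_cvgP[].
apply/esym; apply: (cvg_unique _ _ H) => //.
by apply: cvg_EFin => //; exact: nearW.
Qed.

Lemma has_sum_tbox F s : has_sum F s -> (\sum_(i <- tbox N d) F i) @[N --> \oo] --> s.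
Proof.
move=> Fs; apply/cvgrPdist_lt => e e0; have [A HA] := Fs e e0.
have [N0 HN0] := tbox_exhaust A.
exists N0 => // N /= N0N; rewrite distrC -sum_fset_tbox; apply: HA.
by apply/fsubsetP => i iA; rewrite in_fset; exact: (HN0 N N0N).
Qed.

(** Whatever a finite set adds to a large box is bounded by the tail of the absolute values, so
    convergence along boxes becomes unconditional. *)
Lemma tbox_has_sum F s M : (forall N, \sum_(i <- tbox N d) `|F i| <= M) ->
  (\sum_(i <- tbox N d) F i) @[N --> \oo] --> s -> has_sum F s.
Proof.
move=> FM Fs; have F0 i : 0 <= `|F i| by [].
have [L LM cL] := tbox_bounded_cvg F0 FM.
move=> e e0; have e2 : 0 < e / 2 by rewrite divr_gt0.
have /cvgrPdist_lt/(_ _ e2)[N1 _ HN1] := Fs; have /cvgrPdist_lt/(_ _ e2)[N2 _ HN2] := cL.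
pose N := maxn N1 N2; exists [fset i in tbox N d]%fset => B AB.
have sAB : {subset tbox N d <= B}.
  by move=> i iN; apply: (fsubsetP AB); rewrite in_fset.
have [N3 /(_ _ (leqnn _)) HB] := tbox_exhaust B.
have E G := sum_subset G (tbox_uniq N d) (fset_uniq B) sAB.
rewrite (E F) addrAC.
have H1 : `|s - \sum_(i <- tbox N d) F i| < e / 2 by apply: HN1; exact: leq_maxl.
have H2 : `|L - \sum_(i <- tbox N d) `|F i| | < e / 2 by apply: HN2; exact: leq_maxr.
have H3 : `|\sum_(i <- B | i \notin tbox N d) F i| <= L - \sum_(i <- tbox N d) `|F i|.
  apply: (le_trans (ler_norm_sum _ _ _)).
  rewrite lerBrDl -(E (fun i => `|F i|)).
  apply: le_trans (tbox_cvg_le N3 F0 cL).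
  by rewrite (sum_subset _ (fset_uniq B) (tbox_uniq N3 d) HB) lerDl sumr_ge0.
apply: (le_lt_trans (ler_normD _ _)); rewrite distrC.
have := le_lt_trans (ler_norm _) H2; move: H1 H3; lra.
Qed.

End box_sums.

Section tensor_space.
Context {R : realType} {d : nat}.
Variables (phi : nat -> R -> R) (mu : nat -> R).
Hypothesis mu_gt0 : forall j, 0 < mu j.
Hypothesis bessel : exists2 B : R, 0 < B & forall n (x : R), `[0%R, 1%R]%classic x ->
  \sum_(j < n) mu j * phi j x ^+ 2 <= B.
Implicit Types (c a : d.-tuple nat -> R) (f g : d.-tuple R -> R) (s t : R) (N : nat) (x : d.-tuple R).

Local Notation P := (@tensor_phi R phi d).
Local Notation M := (@tensor_mu R mu d).

(** Working form of [tensor_sqnorm]: the coefficients are exposed and both sums are ordinary limits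
    along boxes. [tensor_sqnormP] proves the equivalence. *)
Definition tensor_coef c f s : Prop :=
  (forall x, unit_cube x -> (\sum_(i <- tbox N d) c i * P i x) @[N --> \oo] --> f x) /\
  (\sum_(i <- tbox N d) c i ^+ 2 / M i) @[N --> \oo] --> s.

Let coef_ge0 c i : 0 <= c i ^+ 2 / M i.
Proof. by rewrite divr_ge0 ?sqr_ge0// ltW// tensor_mu_gt0. Qed.

(** Cauchy-Schwarz with weights the roots of the tensor eigenvalues, against the tensor Bessel
    bound. *)
Lemma tensor_abs_bound c s : (forall N, \sum_(i <- tbox N d) c i ^+ 2 / M i <= s) ->
  forall x, unit_cube x -> exists L : R, forall N, \sum_(i <- tbox N d) `|c i * P i x| <= L.
Proof.
move=> cs x cx; have [B B0 HB] := tensor_bessel mu_gt0 bessel d.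
exists (Num.sqrt (s * B)) => N.
have s0 : 0 <= s by apply: le_trans (cs 0%N); apply: sumr_ge0.
rewrite -[leLHS]ger0_norm ?sumr_ge0//; apply: sqr_le_norm; first exact: sqrtr_ge0.
rewrite sqr_sqrtr; last by rewrite mulr_ge0// ltW.
have := cauchy_schwarz_sum (tbox N d) xpredT (fun i => `|c i| / Num.sqrt (M i)) (fun i => Num.sqrt (M i) * `|P i x|).
have M0 i : 0 < M i by exact: tensor_mu_gt0.
have -> : \sum_(i <- tbox N d) `|c i| / Num.sqrt (M i) * (Num.sqrt (M i) * `|P i x|) = \sum_(i <- tbox N d) `|c i * P i x|.
  by apply: eq_bigr => i _; rewrite mulrA divfK ?normrM// gt_eqF// sqrtr_gt0.
move=> /le_trans; apply; apply: ler_pM.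
- by apply: sumr_ge0 => i _; exact: sqr_ge0.
- by apply: sumr_ge0 => i _; exact: sqr_ge0.
- apply: le_trans (cs N); apply: ler_sum => i _.
  by rewrite expr_div_n (sqr_sqrtr (ltW (M0 i))) real_normK ?num_real.
- apply: le_trans (HB N x cx); apply: ler_sum => i _.
  by rewrite exprMn (sqr_sqrtr (ltW (M0 i))) real_normK ?num_real.
Qed.

Lemma tensor_sqnormP f s : tensor_sqnorm mu phi f s <-> exists c, tensor_coef c f s.
Proof.
split=> [[c cf cs]|[c [cf cs]]].
  exists c; split; first by move=> x cx; apply: has_sum_tbox; exact: cf.
  exact: (tbox_esumP _ (coef_ge0 c)).1 cs.
exists c; last exact: (tbox_esumP _ (coef_ge0 c)).2 cs.
move=> x cx; have [|L HL] := @tensor_abs_bound c s _ x cx.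
  by move=> N; apply: (tbox_cvg_le N (coef_ge0 c) cs).
exact: tbox_has_sum HL (cf x cx).
Qed.

Lemma tensor_coef_sumE c f s N : tensor_coef c f s -> \sum_(i <- tbox N d) c i ^+ 2 / M i <= s.
Proof. by move=> [_]; apply: tbox_cvg_le. Qed.

Lemma tensor_coef_lin c1 c2 f1 f2 s1 s2 (a b : R) : tensor_coef c1 f1 s1 -> tensor_coef c2 f2 s2 ->
  exists t, tensor_coef (fun i => a * c1 i + b * c2 i) (fun x => a * f1 x + b * f2 x) t.
Proof.
move=> H1 H2; have [t _ ct] : exists2 t, t <= 2 * a ^+ 2 * s1 + 2 * b ^+ 2 * s2 &
    (\sum_(i <- tbox N d) (a * c1 i + b * c2 i) ^+ 2 / M i) @[N --> \oo] --> t.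
  apply: tbox_bounded_cvg => [i|N]; first exact: (coef_ge0 (fun i => a * c1 i + b * c2 i)).
  apply: (@le_trans _ _ (2 * a ^+ 2 * (\sum_(i <- tbox N d) c1 i ^+ 2 / M i) + 2 * b ^+ 2 * (\sum_(i <- tbox N d) c2 i ^+ 2 / M i))).
    rewrite !mulr_sumr -big_split /=; apply: ler_sum => i _.
    rewrite !mulrA -mulrDl ler_pM2r ?invr_gt0 ?tensor_mu_gt0//.
    have := sqr_ge0 (a * c1 i - b * c2 i); move: (c1 i) (c2 i) => u v; nra.
  have q2 (z : R) : 0 <= 2 * z ^+ 2 by rewrite mulr_ge0// sqr_ge0.
  by apply: lerD; (apply: ler_wpM2l; first exact: q2); [exact: (tensor_coef_sumE N H1)|exact: (tensor_coef_sumE N H2)].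
exists t; split=> // x cx.
have -> : (fun N => \sum_(i <- tbox N d) (a * c1 i + b * c2 i) * P i x) =
   (fun N => a * (\sum_(i <- tbox N d) c1 i * P i x) + b * (\sum_(i <- tbox N d) c2 i * P i x)).
  by apply/funext => N; rewrite !mulr_sumr -big_split /=; apply: eq_bigr => i _; ring.
have [H1' _] := H1; have [H2' _] := H2.
apply: cvgD; (apply: cvgM; first exact: cvg_cst); [exact: H1'|exact: H2'].
Qed.

Lemma tensor_coef_convex c1 c2 f1 f2 s1 s2 (th : R) : 0 <= th <= 1 ->
  tensor_coef c1 f1 s1 -> tensor_coef c2 f2 s2 ->
  exists2 t, t <= (1 - th) * s1 + th * s2 &
  tensor_coef (fun i => (1 - th) * c1 i + th * c2 i) (fun x => (1 - th) * f1 x + th * f2 x) t.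
Proof.
move=> th01 H1 H2; have [t Ht] := tensor_coef_lin (1 - th) th H1 H2.
exists t => //; have [_ ct] := Ht; have [_ k1] := H1; have [_ k2] := H2.
have k3 : ((1 - th) * (\sum_(i <- tbox N d) c1 i ^+ 2 / M i) + th * (\sum_(i <- tbox N d) c2 i ^+ 2 / M i))
    @[N --> \oo] --> (1 - th) * s1 + th * s2.
  by apply: cvgD; (apply: cvgM; first exact: cvg_cst).
apply: (ler_cvg_to ct k3); apply: nearW => N /=.
rewrite !mulr_sumr -big_split /=; apply: ler_sum => i _.
rewrite !mulrA -mulrDl ler_pM2r ?invr_gt0 ?tensor_mu_gt0//.
move: (c1 i) (c2 i) => u v; rewrite -subr_ge0.
have -> : (1 - th) * u * u + th * v * v - ((1 - th) * u + th * v) ^+ 2 = th * (1 - th) * (u - v) ^+ 2 by ring.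
by case/andP: th01 => th0 th1; apply: mulr_ge0; [rewrite mulr_ge0 ?subr_ge0|exact: sqr_ge0].
Qed.

End tensor_space.

Lemma measurable_unit_cube (R : realType) d : measurable (@unit_cube R d).
Proof.
have -> : @unit_cube R d = \bigcap_(k in [set: 'I_d]) (fun x => tnth x k) @^-1` `[0%R, 1%R]%classic.
  apply/seteqP; split=> x.
    by move=> cx k _; rewrite /= in_itv; exact: cx.
  by move=> cx k; have := cx k I; rewrite /= in_itv.
apply: fin_bigcap_measurable => // k _; rewrite -[X in measurable X]setTI.
by apply: (measurable_tnth k) => //; exact: measurable_itv.
Qed.

Lemma dominated_Rintegral {d} {T : measurableType d} {R : realType}
    (mu : {measure set T -> \bar R}) (D : set T) (mD : measurable D)
    (F : nat -> T -> R) (f g : T -> R) :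
  (forall n, measurable_fun D (F n)) ->
  (forall x, D x -> F ^~ x @ \oo --> f x) ->
  (forall n x, D x -> `|F n x| <= g x) -> mu.-integrable D (EFin \o g) ->
  [/\ measurable_fun D f, mu.-integrable D (EFin \o f) &
  \int[mu]_(x in D) F n x @[n --> \oo] --> \int[mu]_(x in D) f x].
Proof.
move=> mF Ff Fg ig; have mf : measurable_fun D f by exact: (measurable_fun_cvg mF Ff).
have [|||||iF _ cF] := @dominated_convergence _ T R mu D mD (fun n x => (F n x)%:E) (fun x => (f x)%:E) (EFin \o g).
- by move=> n; exact/measurable_EFinP.
- exact/measurable_EFinP.
- by apply: aeW => x Dx; apply: cvg_EFin; [exact: nearW|exact: Ff].
- exact: ig.
- by apply: aeW => x n Dx; rewrite /= lee_fin Fg.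
split=> //; rewrite /Rintegral; apply: fine_cvg.
by rewrite fineK ?(integrable_fin_num mD iF).
Qed.

(** * The tensor kernel operator on L^2(v) *)

Section tensor_operator.
Context {R : realType} {d : nat}.
Variables (phi : nat -> R -> R) (mu : nat -> R) (K : R -> R -> R).
Hypothesis mu_gt0 : forall j, 0 < mu j.
Hypothesis bessel : exists2 B : R, 0 < B & forall n (x : R), `[0%R, 1%R]%classic x ->
  \sum_(j < n) mu j * phi j x ^+ 2 <= B.
Hypothesis mercer : forall x y : R, `[0%R, 1%R]%classic x -> `[0%R, 1%R]%classic y ->
  (\sum_(j < n) mu j * phi j x * phi j y) @[n --> \oo] --> K x y.
Hypothesis mphi : forall j, measurable_fun (`[0%R, 1%R]%classic : set R) (phi j).
Variable v : probability (d.-tuple R) R.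
Implicit Types (c a : d.-tuple nat -> R) (f g q : d.-tuple R -> R) (s t : R) (N : nat) (x : d.-tuple R).

Local Notation cube := (@unit_cube R d).
Local Notation mC := (@measurable_unit_cube R d).
Local Notation P := (@tensor_phi R phi d).
Local Notation M := (@tensor_mu R mu d).
Local Notation KT := (@tensor_kernel R d K).
Local Notation T := (integral_operator v cube KT).

Lemma measurable_tensor_phi (i : d.-tuple nat) : measurable_fun cube (P i).
Proof.
rewrite /tensor_phi; elim: (index_enum _) => [|k r IH].
  rewrite (_ : (fun x => _) = fun=> 1); first exact: measurable_cst.
  by apply/funext => x; rewrite big_nil.
rewrite (_ : (fun x => _) = (fun x => phi (tnth i k) (tnth x k) * \prod_(k0 <- r) phi (tnth i k0) (tnth x k0))); last first.
  by apply/funext => x; rewrite big_cons.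
apply: measurable_funM => //.
apply: (measurable_comp (F := (`[0%R, 1%R]%classic : set R))) => //.
- by move=> _ [x cx <-]; rewrite /= in_itv /=; exact: cx.
- exact: (@measurable_funTS _ _ _ _ cube (fun x : d.-tuple R => tnth x k) (measurable_tnth k)).
Qed.

Lemma integrable_bounded_cube f g : v.-integrable cube (EFin \o g) -> measurable_fun cube f ->
  forall b, (forall x, cube x -> `|f x| <= b) -> v.-integrable cube (EFin \o (fun x => f x * g x)).
Proof.
move=> ig mf b fb; have mg : measurable_fun cube g by have /measurable_int/measurable_EFinP := ig.
apply: (@le_integrable_EFin _ _ _ v cube mC _ (fun x => b * `|g x|)); first exact: measurable_funM.
  by move=> x cx; rewrite normrM; apply: ler_wpM2r => //; exact: fb.
by apply: (integrableZ_EFin mC); have := integrable_abse ig.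
Qed.

Lemma square_integrable_bounded f b : measurable_fun cube f -> (forall x, cube x -> `|f x| <= b) ->
  square_integrable v cube f.
Proof.
move=> mf fb; apply/square_integrableP; split=> //.
apply: (@le_integrable_EFin _ _ _ v cube mC _ (fun x => b ^+ 2)); first exact: measurable_funX.
  by move=> x cx; rewrite normrX lerXn2r ?nnegrE// ?fb// (le_trans _ (fb x cx)).
apply: finite_measure_integrable_cst => //; exact: mC.
Qed.

Lemma square_integrable_cube_integrable q : square_integrable v cube q -> v.-integrable cube (EFin \o q).
Proof.
move=> sq; have s1 : square_integrable v cube (fun=> 1).
  by apply: (@square_integrable_bounded _ 1); [exact: measurable_cst|move=> x _; rewrite normr1].
by have := square_integrableM mC sq s1; apply: eq_integrable => [|x _]; [exact: mC|rewrite /= mulr1].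
Qed.

Lemma sqnorm_cube_cst b : 0 <= b -> \int[v]_(x in cube) b <= b.
Proof.
move=> b0; rewrite /Rintegral integral_cst; last exact: mC.
have v1 : (v cube <= 1)%E by apply: probability_le1; exact: mC.
have vf : v cube \is a fin_num by rewrite ge0_fin_numE// (le_lt_trans v1)// ltry.
by rewrite fineM// -[leRHS]mulr1 ler_wpM2l// -lee_fin fineK.
Qed.

Lemma tensor_kernel_bound : exists2 B : R, 0 < B &
  (forall x y, cube x -> cube y -> forall N, `|\sum_(i <- tbox N d) M i * P i x * P i y| <= B) /\
  (forall x y, cube x -> cube y -> `|KT x y| <= B).
Proof.
have [B B0 HB] := tensor_bessel mu_gt0 bessel d; exists B => //.
have M0 i : 0 < M i by exact: tensor_mu_gt0.
have H1 x y : cube x -> cube y -> forall N, `|\sum_(i <- tbox N d) M i * P i x * P i y| <= B.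
  move=> cx cy N; apply: sqr_le_norm; first exact: ltW.
  have := cauchy_schwarz_sum (tbox N d) xpredT (fun i => Num.sqrt (M i) * P i x) (fun i => Num.sqrt (M i) * P i y).
  have -> : \sum_(i <- tbox N d) Num.sqrt (M i) * P i x * (Num.sqrt (M i) * P i y) = \sum_(i <- tbox N d) M i * P i x * P i y.
    by apply: eq_bigr => i _; rewrite mulrACA -expr2 (sqr_sqrtr (ltW (M0 i))) mulrA.
  have E z : \sum_(i <- tbox N d) (Num.sqrt (M i) * P i z) ^+ 2 = \sum_(i <- tbox N d) M i * P i z ^+ 2.
    by apply: eq_bigr => i _; rewrite exprMn (sqr_sqrtr (ltW (M0 i))).
  rewrite !E => /le_trans; apply; rewrite expr2.
  by apply: ler_pM; rewrite ?HB//; apply: sumr_ge0 => i _; apply: mulr_ge0; rewrite ?sqr_ge0 ?ltW.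
split=> // x y cx cy.
have H2 : `|\sum_(i <- tbox N d) M i * P i x * P i y| @[N --> \oo] --> `|KT x y|.
  by apply: cvg_norm; exact: tensor_mercer.
by apply: (ler_cvg_to H2 (cvg_cst _)); apply: nearW => N; exact: H1.
Qed.

(** The link between v and the Lebesgue-orthonormal basis. Inserting Mercer's expansion under the
    integral, by dominated convergence, gives T q the coefficients M_i <P_i, q>_v. The squared norm
    is then the sum of M_i <P_i, q>_v^2, and a second passage to the limit identifies it with <q, T
    q>_v. *)
Lemma tensor_operator_coef q : square_integrable v cube q ->
  [/\ measurable_fun cube (T q),
      tensor_coef phi mu (fun i => M i * \int[v]_(x in cube) (P i x * q x)) (T q)
        (\int[v]_(x in cube) (q x * T q x))
    & exists b, forall x, cube x -> `|T q x| <= b].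
Proof.
move=> sq; have iq := square_integrable_cube_integrable sq.
have mq : measurable_fun cube q by have /measurable_int/measurable_EFinP := iq.
have [B B0 [HB1 HB2]] := tensor_kernel_bound.
pose Sx N x y := \sum_(i <- tbox N d) M i * P i x * P i y.
pose b i := \int[v]_(x in cube) (P i x * q x).
(* The Bessel bound limits P_i^2 by Bd / M_i, and a number whose square is at most w is itself at
   most 1 + w. *)
have iPq i : v.-integrable cube (EFin \o (fun y => P i y * q y)).
  have [Bd Bd0 HBd] := tensor_bessel mu_gt0 bessel d.
  apply: (@integrable_bounded_cube _ _ iq (measurable_tensor_phi i) (1 + Bd / M i)) => x cx.
  have [N /(_ _ (leqnn _)) HN] := tbox_exhaust [:: i].
  have := HBd N x cx; rewrite (sum_subset (r := [:: i])) ?tbox_uniq// big_seq1 => H1.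
  have H2 : M i * P i x ^+ 2 <= Bd.
    apply: le_trans H1; rewrite lerDl sumr_ge0// => j _.
    by apply: mulr_ge0; rewrite ?sqr_ge0// ltW// tensor_mu_gt0.
  have M0 : 0 < M i by exact: tensor_mu_gt0.
  have H3 : P i x ^+ 2 <= Bd / M i by rewrite ler_pdivlMr// mulrC.
  move: H3; rewrite -(real_normK (num_real (P i x))); move: `|_| (Bd / _) => u w.
  have := sqr_ge0 (u - 1); nra.
have mS N x : cube x -> measurable_fun cube (Sx N x).
  move=> cx; apply: measurable_sum => i.
  by apply: measurable_funM => //; exact: measurable_tensor_phi.
have intS N x : cube x -> \int[v]_(y in cube) (Sx N x y * q y) = \sum_(i <- tbox N d) M i * b i * P i x.
  move=> cx; transitivity (\int[v]_(y in cube) (\sum_(i <- tbox N d) (M i * P i x) * (P i y * q y))).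
    by apply: eq_Rintegral => y _; rewrite mulr_suml; apply: eq_bigr => i _; rewrite !mulrA.
  rewrite (Rintegral_sum mC) => [|i _]; last exact: (integrableZ_EFin mC).
  by apply: eq_bigr => i _; rewrite RintegralZl//; [rewrite mulrAC|exact: mC].
have iBq : v.-integrable cube (EFin \o (fun y => B * `|q y|)).
  by apply: (integrableZ_EFin mC); have := integrable_abse iq.
have lim1 x : cube x -> (\sum_(i <- tbox N d) M i * b i * P i x) @[N --> \oo] --> T q x.
  move=> cx; under eq_fun do rewrite -intS//.
  have [] // := @dominated_Rintegral _ _ _ v cube mC (fun N y => Sx N x y * q y) (fun y => KT x y * q y) (fun y => B * `|q y|).
  - by move=> N; apply: measurable_funM => //; exact: mS.
  - move=> y cy; apply: cvgM; last exact: cvg_cst.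
    exact: (tensor_mercer mercer cx cy).
  - by move=> N y cy; rewrite normrM; apply: ler_wpM2r => //; exact: HB1.
have mTN N : measurable_fun cube (fun x => \sum_(i <- tbox N d) M i * b i * P i x).
  by apply: measurable_sum => i; apply: measurable_funM => //; exact: measurable_tensor_phi.
have mT : measurable_fun cube (T q) by exact: (measurable_fun_cvg mTN lim1).
pose Q := \int[v]_(y in cube) `|q y|.
have bndN N x : cube x -> `|\sum_(i <- tbox N d) M i * b i * P i x| <= B * Q.
  move=> cx; rewrite -intS//.
  have iSq : v.-integrable cube (EFin \o (fun y => Sx N x y * q y)).
    by apply: (integrable_bounded_cube iq (mS N x cx)) => y cy; exact: HB1.
  apply: (le_trans (le_normr_Rintegral mC iSq)).
  rewrite /Q -RintegralZl//; [|exact: mC|by have := integrable_abse iq].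
  apply: le_Rintegral; [exact: mC|by have := integrable_abse iSq|exact: iBq|].
  by move=> y cy; rewrite normrM; apply: ler_wpM2r => //; exact: HB1.
have bnd x : cube x -> `|T q x| <= B * Q.
  move=> cx; have H2 : `|\sum_(i <- tbox N d) M i * b i * P i x| @[N --> \oo] --> `|T q x|.
    by apply: cvg_norm; exact: lim1.
  by apply: (ler_cvg_to H2 (cvg_cst _)); apply: nearW => N; exact: bndN.
split=> //; last by exists (B * Q).
split; first by move=> x cx; exact: lim1.
have EN N : \sum_(i <- tbox N d) (M i * b i) ^+ 2 / M i =
    \int[v]_(x in cube) (q x * (\sum_(i <- tbox N d) M i * b i * P i x)).
  transitivity (\int[v]_(x in cube) (\sum_(i <- tbox N d) (M i * b i) * (P i x * q x))); last first.
    by apply: eq_Rintegral => x _; rewrite mulr_sumr; apply: eq_bigr => i _; ring.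
  rewrite (Rintegral_sum mC) => [|i _]; last exact: (integrableZ_EFin mC).
  apply: eq_bigr => i _; rewrite RintegralZl//; last exact: mC.
  rewrite -/(b i) expr2 mulrA -mulrA mulrAC -!mulrA; congr (_ * _).
  by rewrite mulVf ?mulr1// gt_eqF// tensor_mu_gt0.
under eq_fun do rewrite EN.
have [] // := @dominated_Rintegral _ _ _ v cube mC
   (fun N x => q x * (\sum_(i <- tbox N d) M i * b i * P i x)) (fun x => q x * T q x) (fun y => (B * Q) * `|q y|).
- by move=> N; exact: measurable_funM.
- by move=> x cx; apply: cvgM; [exact: cvg_cst|exact: lim1].
- by move=> N x cx; rewrite normrM mulrC; apply: ler_wpM2r => //; exact: bndN.
- by apply: (integrableZ_EFin mC); have := integrable_abse iq.
Qed.

End tensor_operator.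

(** * The regularized target *)

Lemma powRD_gt0 (R : realType) (t a b : R) : 0 < t -> t `^ (a + b) = t `^ a * t `^ b.
Proof. by move=> t0; rewrite powRD// (gt_eqF t0) implybT. Qed.

Section source_condition.
Context {R : realType} {d : nat}.
Variables (phi : nat -> R -> R) (mu : nat -> R) (K : R -> R -> R).
Hypothesis mu_gt0 : forall j, 0 < mu j.
Hypothesis bessel : exists2 B : R, 0 < B & forall n (x : R), `[0%R, 1%R]%classic x ->
  \sum_(j < n) mu j * phi j x ^+ 2 <= B.
Hypothesis mercer : forall x y : R, `[0%R, 1%R]%classic x -> `[0%R, 1%R]%classic y ->
  (\sum_(j < n) mu j * phi j x * phi j y) @[n --> \oo] --> K x y.
Hypothesis mphi : forall j, measurable_fun (`[0%R, 1%R]%classic : set R) (phi j).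
Variable v : probability (d.-tuple R) R.
Variables (tmu : nat -> R) (tphi : nat -> d.-tuple R -> R).

Local Notation cube := (@unit_cube R d).
Local Notation mC := (@measurable_unit_cube R d).
Local Notation KT := (@tensor_kernel R d K).
Local Notation T := (integral_operator v cube KT).

Hypothesis htphi : eigen_system v cube KT tmu tphi.
Implicit Types (a c e : nat -> R) (q f : d.-tuple R -> R) (x : d.-tuple R) (J N : nat).

Let tmu_gt0 j : 0 < tmu j. Proof. by case: htphi. Qed.
Let tphi_sq j : square_integrable v cube (tphi j). Proof. by case: htphi. Qed.
Let tphi_on i j : \int[v]_(x in cube) (tphi i x * tphi j x) = (i == j)%:R.
Proof. by case: htphi. Qed.
Let tphi_eigen : {ae v, forall x, cube x -> forall j, T (tphi j) x = tmu j * tphi j x}.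
Proof.
have H : {ae v, forall x, forall j, cube x -> T (tphi j) x = tmu j * tphi j x}.
  by apply/ae_foralln => j; case: htphi.
by apply: filterS H => x H cx j; exact: H.
Qed.
Let toper (q : d.-tuple R -> R) (sq : square_integrable v cube q) :=
  tensor_operator_coef mu_gt0 bessel mercer mphi sq.

Local Notation scomb J a := (fun x => \sum_(j < J) a j * tphi j x).

Let scomb_sq J a : square_integrable v cube (scomb J a).
Proof. by apply: (square_integrable_sum mC) => j _; apply: (square_integrableZ mC). Qed.

Let scomb_inner J a c : \int[v]_(x in cube) ((\sum_(j < J) a j * tphi j x) * (\sum_(j < J) c j * tphi j x)) =
  \sum_(j < J) a j * c j.
Proof.
have expand (g : d.-tuple R -> R) b : square_integrable v cube g ->
    \int[v]_(x in cube) (g x * (\sum_(j < J) b j * tphi j x)) =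
    \sum_(j < J) b j * \int[v]_(x in cube) (g x * tphi j x).
  move=> sg; transitivity (\int[v]_(x in cube) (\sum_(j < J) b j * (g x * tphi j x))).
    by apply: eq_Rintegral => x _; rewrite mulr_sumr; apply: eq_bigr => j _; rewrite mulrCA.
  rewrite (Rintegral_sum mC) => [|j _].
    by apply: eq_bigr => j _; rewrite RintegralZl//; [exact: mC|exact: (square_integrableM mC)].
  by apply: (integrableZ_EFin mC); exact: (square_integrableM mC).
rewrite expand; last exact: scomb_sq.
apply: eq_bigr => j _; rewrite mulrC; congr (_ * _).
under eq_Rintegral do rewrite mulrC.
rewrite expand// (bigD1 j)//= tphi_on eqxx mulr1 big1 ?addr0// => i ij.
by rewrite tphi_on eq_sym (_ : _ == _ = false) ?mulr0//; exact/negbTE.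
Qed.

Let scomb_operator J a : {ae v, forall x, cube x -> T (scomb J a) x = \sum_(j < J) a j * tmu j * tphi j x}.
Proof.
apply: filterS tphi_eigen => x Hx cx.
have [B B0 [_ HB2]] := tensor_kernel_bound (d := d) mu_gt0 bessel mercer.
have iK j : v.-integrable cube (EFin \o (fun y => KT x y * tphi j y)).
  apply: (integrable_bounded_cube (square_integrable_cube_integrable (tphi_sq j)) _ (b := B)).
    apply: (@measurable_fun_cvg _ _ _ cube (fun N y => \sum_(i <- tbox N d) tensor_mu mu i * tensor_phi phi i x * tensor_phi phi i y)).
      by move=> N; apply: measurable_sum => i; apply: measurable_funM => //; exact: measurable_tensor_phi.
    by move=> y cy; exact: (tensor_mercer mercer cx cy).
  by move=> y cy; exact: HB2.
transitivity (\int[v]_(y in cube) (\sum_(j < J) a j * (KT x y * tphi j y))).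
  by apply: eq_Rintegral => y _; rewrite mulr_sumr; apply: eq_bigr => j _; rewrite mulrCA.
rewrite (Rintegral_sum mC) => [|j _]; last exact: (integrableZ_EFin mC).
apply: eq_bigr => j _; rewrite RintegralZl//; last exact: mC.
by rewrite -mulrA -(Hx cx).
Qed.

(** The squared eigenvalue is the squared norm of T applied to a normalized eigenfunction; pointwise
    Cauchy-Schwarz and the kernel bound limit it by B^2. *)
Let tmu_bounded : exists2 B : R, 0 < B & forall j, tmu j <= B.
Proof.
have [B B0 [_ HB2]] := tensor_kernel_bound (d := d) mu_gt0 bessel mercer.
exists B => // j; rewrite -(@ler_pXn2r _ 2) ?nnegrE ?(ltW B0) ?(ltW (tmu_gt0 _))//.
have [mT _ [b Tb]] := toper (tphi_sq j).
have sT := square_integrable_bounded v mT Tb.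
have mtp : measurable_fun cube (tphi j) by case: (tphi_sq j).
have -> : tmu j ^+ 2 = \int[v]_(x in cube) (T (tphi j) x ^+ 2).
  transitivity (\int[v]_(x in cube) (tmu j ^+ 2 * (tphi j x * tphi j x))).
    by rewrite RintegralZl ?tphi_on ?eqxx ?mulr1//; [exact: mC|exact: (square_integrableM mC)].
  apply: (@Rintegral_ae_eq _ _ _ v cube mC).
  - by apply: measurable_funM => //; exact: measurable_funM.
  - exact: measurable_funX.
  - by apply: filterS tphi_eigen => x Hx cx; rewrite Hx// exprMn (expr2 (tphi j x)).
apply: le_trans (sqnorm_cube_cst v (sqr_ge0 B)).
have /square_integrableP[_ iT] := sT.
apply: le_Rintegral; [exact: mC|exact: iT| |].
  by apply: finite_measure_integrable_cst => //; exact: mC.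
move=> x cx.
have sK : square_integrable v cube (KT x).
  apply: (square_integrable_bounded v _ (b := B)); last by move=> y cy; exact: HB2.
  apply: (@measurable_fun_cvg _ _ _ cube (fun N y => \sum_(i <- tbox N d) tensor_mu mu i * tensor_phi phi i x * tensor_phi phi i y)).
    by move=> N; apply: measurable_sum => i; apply: measurable_funM => //; exact: measurable_tensor_phi.
  by move=> y cy; exact: (tensor_mercer mercer cx cy).
have := cauchy_schwarz mC sK (tphi_sq j) => /le_trans; apply.
have -> : sqnorm v cube (tphi j) = 1.
  transitivity ((j == j)%:R : R); last by rewrite eqxx.
  by rewrite -tphi_on; apply: eq_Rintegral => y _; rewrite expr2.
rewrite mulr1; apply: le_trans (sqnorm_cube_cst v (sqr_ge0 B)).
have /square_integrableP[_ iK2] := sK.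
apply: le_Rintegral; [exact: mC|exact: iK2| |].
  by apply: finite_measure_integrable_cst => //; exact: mC.
by move=> y cy; rewrite -(real_normK (num_real (KT x y))) lerXn2r ?nnegrE ?(ltW B0)// HB2.
Qed.

Variables (beta alpha : R) (f0 : d.-tuple R -> R).
Hypothesis alpha_beta : 0 < alpha < beta.
Hypothesis beta_le1 : beta <= 1.
Hypothesis hf0 : power_space v cube tmu tphi beta f0.
Hypothesis hA6 : power_embeds_Linfty v cube tmu tphi alpha.

(* The spectral cut-off of f0 at level la, with the tail of the expansion
   removed so that it is a finite combination; as T q with q in L^2(v), it is
   defined pointwise. *)
Lemma regularized_target : exists2 C : R, 0 < C & forall la : R, 0 < la <= 1 ->
  exists (cf : d.-tuple nat -> R) f (s : R), [/\ tensor_coef phi mu cf f s, measurable_fun cube f,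
    la * s <= C * la `^ beta,
    square_integrable v cube (fun x => f0 x - f x) /\
    \int[v]_(x in cube) ((f0 x - f x) ^+ 2) <= C * la `^ beta
  & {ae v, forall x, cube x -> `|f0 x - f x| <= C * la `^ ((beta - alpha) / 2)}].
Proof.
have [c [csum sf0 clim]] := hf0; have [C6 HC6] := hA6.
have [Bt Bt0 HBt] := tmu_bounded.
have /andP[a0 ab] := alpha_beta; have b0 : 0 < beta := lt_trans a0 ab.
have csum0 : (0 <= \sum_(0 <= j <oo) (c j ^+ 2)%:E)%E by apply: nneseries_ge0 => j _ _; rewrite lee_fin sqr_ge0.
pose S := fine (\sum_(0 <= j <oo) (c j ^+ 2)%:E)%E.
have ES : (\sum_(0 <= j <oo) (c j ^+ 2)%:E = S%:E)%E by rewrite fineK// ge0_fin_numE.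
have S0 : 0 <= S by rewrite fine_ge0.
have cS : series (fun j => c j ^+ 2) @ \oo --> S.
  have : (fun n => \sum_(0 <= j < n) (c j ^+ 2)%:E)%E @ \oo --> S%:E.
    by rewrite -ES; apply: is_cvg_nneseries => j _ _; rewrite lee_fin sqr_ge0.
  rewrite (_ : (fun n => _) = (fun n => (series (fun j => c j ^+ 2) n)%:E)); last first.
    by apply/funext => n; rewrite sumEFin.
  by move=> /fine_cvgP[].
have leS n : series (fun j => c j ^+ 2) n <= S.
  apply: (ler_cvg_to (cvg_cst _) cS); exists n => // N /= nN.
  by rewrite -subr_ge0 sub_series_geq// sumr_ge0// => j _; exact: sqr_ge0.
pose D w := S + Bt `^ w.
have D0 w : 0 <= D w by rewrite addr_ge0// powR_ge0.
pose C := 1 + (S + (2 + 2 * D beta) + (1 + `|C6|) * (1 + D (beta - alpha))).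
have C0 : 0 < C.
  rewrite /C; have := D0 beta; have := D0 (beta - alpha); have := normr_ge0 C6.
  by move: `|C6| (D _) (D _) => X Y Z; nra.
exists C => // la /andP[la0 la1].
have lab0 : 0 < la `^ beta by rewrite powR_gt0.
(* The tail beyond J is allowed the order la^beta, that of the squared bias itself. *)
have [J HJ] : exists J, S - series (fun j => c j ^+ 2) J <= la `^ beta.
  have /cvgrPdist_lt/(_ _ lab0)[J _ HJ] := cS; exists J.
  exact: (le_trans (ler_norm _) (ltW (HJ J (leqnn J)))).
pose e j := (j < J)%N && (la < tmu j).
(* Coefficients of q: dividing by [tmu j] makes T q equal to the retained part of the expansion of
   f0. *)
pose a j := if e j then c j * tmu j `^ (beta / 2) / tmu j else 0.
have tmn0 j : tmu j != 0 by rewrite gt_eqF.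
have atmu j : a j * tmu j = if e j then c j * tmu j `^ (beta / 2) else 0.
  by rewrite /a; case: ifP => _; rewrite ?mul0r// divfK.
have half2 (t w : R) : 0 < t -> t `^ (w / 2) ^+ 2 = t `^ w.
  move=> t0; rewrite expr2 -powRD_gt0//.
  by congr (_ `^ _); field.
have sq := scomb_sq J a.
have [mT cT [b Tb]] := toper sq.
have := scomb_operator J a; set q := (fun x => \sum_(j < J) a j * tphi j x) in sq mT cT Tb *.
move=> aeT.
pose g x := \sum_(j < J) (a j * tmu j) * tphi j x.
have sg : square_integrable v cube g by exact: (scomb_sq J (fun j => a j * tmu j)).
have mg : measurable_fun cube g by case: sg.
have mq : measurable_fun cube q by case: sq.
have mf0 : measurable_fun cube f0 by case: sf0.
pose s := \int[v]_(x in cube) (q x * T q x).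
have Es : s = \sum_(j < J) a j * (a j * tmu j).
  rewrite -(scomb_inner J a (fun j => a j * tmu j)).
  apply: (Rintegral_ae_eq mC); [exact: measurable_funM|exact: measurable_funM|].
  by apply: filterS aeT => x Hx cx; rewrite Hx.
(* Here la s is the sum of la tmu_j^(beta - 1) c_j^2 over retained indices; for these la < tmu_j,
   and beta <= 1 gives la tmu_j^(beta - 1) <= la^beta. *)
have las : la * s <= C * la `^ beta.
  apply: (@le_trans _ _ (la `^ beta * S)); last first.
    rewrite mulrC ler_wpM2r ?(ltW lab0)// /C.
    have := D0 beta; have := D0 (beta - alpha); have := normr_ge0 C6.
    by move: `|C6| (D _) (D _) => X Y Z; nra.
  apply: (@le_trans _ _ (la `^ beta * \sum_(j < J) c j ^+ 2)); last first.
    rewrite ler_wpM2l ?(ltW lab0)//; have := leS J; by rewrite /series/= big_mkord.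
  rewrite Es !mulr_sumr; apply: ler_sum => j _; rewrite atmu /a.
  case: ifP => [/andP[_ lat]|_]; last by rewrite mul0r mulr0 mulr_ge0 ?sqr_ge0 ?ltW.
  have t0 := tmu_gt0 j; move: (tmu j) t0 lat => t t0 lat.
  have -> : la * (c j * t `^ (beta / 2) / t * (c j * t `^ (beta / 2))) =
     c j ^+ 2 * (la * (t `^ (beta / 2) ^+ 2 / t)) by rewrite expr2; ring.
  rewrite half2// mulrC ler_wpM2r ?sqr_ge0//.
  have Ela : la = la `^ beta * la `^ (1 - beta).
    by rewrite -powRD_gt0// addrC subrK powRr1// ltW.
  have Et : t = t `^ beta * t `^ (1 - beta).
    by rewrite -powRD_gt0// addrC subrK powRr1// ltW.
  rewrite {1}Ela {2}Et invfM mulrA -[in leLHS]mulrA.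
  rewrite [X in _ * X]mulrA mulfV ?gt_eqF ?powR_gt0// mul1r -mulrA.
  rewrite -[leRHS]mulr1 ler_wpM2l ?(ltW lab0)// ler_pdivrMr ?powR_gt0// mul1r.
  by apply: ge0_ler_powR; rewrite ?nnegrE ?subr_ge0// ltW.
(* The discarded part written as an element of the power space of order alpha: the remaining factor
   tmu_j^((beta - alpha) / 2) goes into the coefficients, so that (A6) applies to f0 - T q. *)
pose c' j := if e j then 0 else c j * tmu j `^ ((beta - alpha) / 2).
pose SN N x := \sum_(j < N) c' j * tmu j `^ (alpha / 2) * tphi j x.
have ct' j : c' j * tmu j `^ (alpha / 2) = if e j then 0 else c j * tmu j `^ (beta / 2).
  rewrite /c'; case: ifP => _; first by rewrite mul0r.
  by rewrite -mulrA -powRD_gt0// -mulrDl subrK.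
have ESN N x : (J <= N)%N -> SN N x = \sum_(j < N) c j * tmu j `^ (beta / 2) * tphi j x - g x.
  move=> JN; apply/eqP; rewrite eq_sym subr_eq; apply/eqP.
  have -> : g x = \sum_(j < N) (a j * tmu j) * tphi j x.
    rewrite -(big_mkord xpredT (fun j => a j * tmu j * tphi j x)) /g.
    rewrite -(big_mkord xpredT (fun j => a j * tmu j * tphi j x)).
    rewrite [RHS](big_cat_nat (n := J))//=.
    have -> : \sum_(J <= j < N) a j * tmu j * tphi j x = 0; last by rewrite addr0.
    rewrite big_nat_cond big1// => j /andP[/andP[Jj _] _].
    by rewrite atmu /e ltnNge Jj /= mul0r.
  rewrite -big_split /=; apply: eq_bigr => j _; rewrite -mulrDl ct' atmu.
  by case: ifP => _; rewrite ?addr0 ?add0r.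
(* A discarded index is below J with tmu_j <= la, or lies in the tail. The weight tmu_j^w is at most
   la^w in the first case, which accounts for S in D w. In the second it is at most Bt^w, against a
   tail of size la^beta <= la^w. Used with w = beta for the L^2 error and with w = beta - alpha for
   the uniform one. *)
have HW w N : 0 <= w -> w <= beta ->
    \sum_(j < N) (if e j then 0 else c j ^+ 2 * tmu j `^ w) <= la `^ w * D w.
  move=> w0 wb.
  have tail : \sum_(j < N) (if (j < J)%N then 0 else c j ^+ 2) <= la `^ beta.
    apply: le_trans HJ.
    apply: (@le_trans _ _ (series (fun j => c j ^+ 2) (N + J) - series (fun j => c j ^+ 2) J)); last by rewrite lerB.
    rewrite sub_series_geq ?leq_addl//.
    rewrite -(big_mkord xpredT (fun j => if (j < J)%N then 0 else c j ^+ 2)).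
    apply: (@le_trans _ _ (\sum_(0 <= j < N + J) (if (j < J)%N then 0 else c j ^+ 2))).
      rewrite [leRHS](big_cat_nat (n := N)) ?leq_addr//= lerDl sumr_ge0// => j _.
      by case: ifP => // _; exact: sqr_ge0.
    rewrite (big_cat_nat (n := J)) ?leq_addl//= big_nat_cond big1 ?add0r => [|j /andP[/andP[_ ->]]//].
    rewrite [leLHS]big_nat_cond [leRHS]big_nat_cond; apply: ler_sum => j /andP[/andP[Jj _] _].
    by rewrite ltnNge Jj.
  have law : la `^ beta <= la `^ w by apply: ger_powR => //; rewrite la0.
  apply: (@le_trans _ _ (la `^ w * (\sum_(j < N) c j ^+ 2) + Bt `^ w * (\sum_(j < N) (if (j < J)%N then 0 else c j ^+ 2)))).
    rewrite !mulr_sumr -big_split /=; apply: ler_sum => j _; rewrite /e.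
    have ge1 : 0 <= la `^ w * c j ^+ 2 by rewrite mulr_ge0 ?powR_ge0 ?sqr_ge0.
    have ge2 : 0 <= Bt `^ w * c j ^+ 2 by rewrite mulr_ge0 ?powR_ge0 ?sqr_ge0.
    case: (ltnP j J) => jJ /=.
      case: (ltP la (tmu j)) => lat; rewrite mulr0 addr0//.
      rewrite mulrC ler_wpM2r ?sqr_ge0//.
      by apply: ge0_ler_powR; rewrite ?nnegrE// ltW.
    rewrite -[leLHS]add0r; apply: lerD => //.
    rewrite mulrC ler_wpM2r ?sqr_ge0//.
    by apply: ge0_ler_powR; rewrite ?nnegrE// ltW.
  rewrite /D mulrDr; apply: lerD.
    rewrite ler_wpM2l ?powR_ge0//; have := leS N; by rewrite /series/= big_mkord.
  rewrite mulrC ler_wpM2r ?powR_ge0//; exact: le_trans law.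
have ba0 : 0 <= beta - alpha by rewrite subr_ge0 ltW.
have bab : beta - alpha <= beta by rewrite lerBlDr lerDl ltW.
have c'2 N : \sum_(j < N) c' j ^+ 2 <= la `^ (beta - alpha) * D (beta - alpha).
  apply: le_trans (HW _ N ba0 bab); apply: ler_sum => j _; rewrite /c'.
  by case: ifP => _; rewrite ?expr0n// exprMn half2.
have c't2 N : \sum_(j < N) (c' j * tmu j `^ (alpha / 2)) ^+ 2 <= la `^ beta * D beta.
  apply: le_trans (HW _ N (ltW b0) (lexx _)); apply: ler_sum => j _; rewrite ct'.
  by case: ifP => _; rewrite ?expr0n// exprMn half2.
have c'sum : (\sum_(0 <= j <oo) (c' j ^+ 2)%:E <= (la `^ (beta - alpha) * D (beta - alpha))%:E)%E.
  apply: lime_le.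
    by apply: is_cvg_nneseries => j _ _; rewrite lee_fin sqr_ge0.
  by apply: nearW => N; rewrite sumEFin lee_fin big_mkord.
pose u x := f0 x - T q x.
have sT := square_integrable_bounded v mT Tb.
have su : square_integrable v cube u by exact: (square_integrableB mC sf0 sT).
have mu' : measurable_fun cube u by case: su.
have sSN N : square_integrable v cube (SN N) by exact: (scomb_sq N (fun j => c' j * tmu j `^ (alpha / 2))).
have mSN N : measurable_fun cube (SN N) by case: (sSN N).
have expand : power_expansion v cube tmu tphi alpha c' u.
  split; [exact: (le_lt_trans c'sum (ltry _))|exact: su|].
  suff EqN N : (J <= N)%N ->
      (\int[v]_(x in cube) ((f0 x - (\sum_(j < N) c j * tmu j `^ (beta / 2) * tphi j x)%R) ^+ 2)%:E)%E =
      (\int[v]_(x in cube) ((u x - (\sum_(j < N) c' j * tmu j `^ (alpha / 2) * tphi j x)%R) ^+ 2)%:E)%E.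
    by refine (cvg_trans (near_eq_cvg _) clim); exists J; [exact: Logic.I|exact: EqN].
  move=> JN.
  have sF : square_integrable v cube (fun x => \sum_(j < N) c j * tmu j `^ (beta / 2) * tphi j x).
    exact: (scomb_sq N (fun j => c j * tmu j `^ (beta / 2))).
  apply: ae_eq_integral; [exact: mC| | |].
  - by apply/measurable_EFinP; apply: measurable_funX; apply: measurable_funB => //; case: sF.
  - by apply/measurable_EFinP; apply: measurable_funX; apply: measurable_funB => //; exact: mSN.
  - apply: filterS aeT => x Hx cx; congr (_%:E); congr (_ ^+ 2).
    rewrite -/(SN N x) ESN// /u -/q Hx// -/(g x); ring.
(* One partial sum within la^beta of u is enough; its own squared norm is given by [HW], and
   splitting the square doubles both terms. *)
have int_u : \int[v]_(x in cube) (u x ^+ 2) <= C * la `^ beta.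
  have [_ _ lim'] := expand.
  have [N HN] : exists N, (\int[v]_(x in cube) ((u x - SN N x) ^+ 2)%:E < (la `^ beta)%:E)%E.
    have : nbhs (0%E : \bar R) [set y | (y < (la `^ beta)%:E)%E].
      by apply: open_nbhs_nbhs; split; [exact: open_ereal_lt_ereal|rewrite /= lte_fin].
    by move=> /lim'[N _ HN]; exists N; apply: (HN N) => /=.
  have sB : square_integrable v cube (fun x => u x - SN N x) by exact: (square_integrableB mC).
  have /square_integrableP[_ iB] := sB; have /square_integrableP[_ iS] := sSN N.
  have /square_integrableP[_ iu] := su.
  have HB : \int[v]_(x in cube) ((u x - SN N x) ^+ 2) <= la `^ beta.
    rewrite -lee_fin [X in (X <= _)%E]fineK; first exact: ltW.
    exact: (integrable_fin_num mC iB).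
  have HS : \int[v]_(x in cube) (SN N x ^+ 2) <= la `^ beta * D beta.
    apply: le_trans (c't2 N).
    rewrite (_ : \int[v]_(x in cube) (SN N x ^+ 2) = \int[v]_(x in cube) (SN N x * SN N x)); last first.
      by apply: eq_Rintegral => x _; rewrite expr2.
    have E := scomb_inner N (fun j => c' j * tmu j `^ (alpha / 2)) (fun j => c' j * tmu j `^ (alpha / 2)).
    cbv beta in E; rewrite /SN E le_eqVlt; apply/orP; left; apply/eqP.
    by apply: eq_bigr => j _; rewrite expr2.
  apply: (@le_trans _ _ (\int[v]_(x in cube) (2 * (u x - SN N x) ^+ 2 + 2 * SN N x ^+ 2))).
    apply: le_Rintegral; [exact: mC|exact: iu| |].
      by apply: (integrableD_EFin mC); exact: (integrableZ_EFin mC).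
    move=> x cx; have := sqr_ge0 (u x - 2 * SN N x); move: (u x) (SN N x) => X Y; nra.
  rewrite (RintegralD mC (integrableZ_EFin mC 2 iB) (integrableZ_EFin mC 2 iS)).
  rewrite !RintegralZl//; [|exact: mC|exact: mC].
  apply: (@le_trans _ _ ((2 + 2 * D beta) * la `^ beta)).
    move: HB HS; move: (Rintegral _ _ _) (Rintegral _ _ _) (la `^ beta) (D beta) => X Y Z W; nra.
  rewrite ler_wpM2r ?(ltW lab0)// /C.
  have := D0 beta; have := D0 (beta - alpha); have := normr_ge0 C6.
  by move: `|C6| (D (beta - alpha)) (D beta) => X Y Z; nra.
exists (fun i => tensor_mu mu i * \int[v]_(x in cube) (tensor_phi phi i x * q x)), (T q), s.
split; [exact: cT|exact: mT|exact: las|exact: (conj su int_u)|].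
have := HC6 c' u expand.
set Z := (\sum_(0 <= j <oo) _)%E in c'sum *.
have Z0 : (0 <= Z)%E by apply: nneseries_ge0 => j _ _; rewrite lee_fin sqr_ge0.
have Zfin : Z \is a fin_num by rewrite ge0_fin_numE// (le_lt_trans c'sum)// ltry.
move: c'sum Z0; rewrite -(fineK Zfin) lee_fin lee_fin; move: (fine Z) => z zD z0.
rewrite poweR_EFin -EFinM => He.
have := ess_sup_ge v (fun x => (`|(u \_ cube) x|)%:E); apply: filterS => x Hx cx.
have : ((`|u x|)%:E <= (C6 * z `^ 2^-1)%:E)%E.
  by apply: le_trans He; move: Hx; rewrite patchE mem_set.
rewrite lee_fin => /le_trans; apply.
have zb : z `^ 2^-1 <= (1 + D (beta - alpha)) * la `^ ((beta - alpha) / 2).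
  have D1 : 0 <= 1 + D (beta - alpha) by apply: addr_ge0 => //; exact: D0.
  rewrite powR12_sqrt// -[leRHS]ger0_norm; last by apply: mulr_ge0; [exact: D1|exact: powR_ge0].
  rewrite -sqrtr_sqr ler_wsqrtr// (le_trans zD)// exprMn half2// mulrC ler_wpM2r ?powR_ge0//.
  by have := D0 (beta - alpha); move: (D _) => Y; nra.
apply: (@le_trans _ _ ((1 + `|C6|) * ((1 + D (beta - alpha)) * la `^ ((beta - alpha) / 2)))).
  apply: (@le_trans _ _ (`|C6| * z `^ 2^-1)).
    by rewrite ler_wpM2r ?powR_ge0// ler_norm.
  by apply: ler_pM => //; [exact: powR_ge0|rewrite lerDr].
rewrite mulrA ler_wpM2r ?powR_ge0// /C !addrA lerDr.
apply: addr_ge0; last by apply: mulr_ge0 => //; exact: D0.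
by rewrite !addr_ge0.
Qed.

End source_condition.

(** * A maximal inequality *)

Section rademacher.
Context {R : realType} {T : finType} (t0 : T).
Implicit Types (A B y t : T -> R) (ys ts : seq (T -> R)).

Definition fmax A : R := \big[Num.max/A t0]_(g : T) A g.

Lemma fmax_ge A g : A g <= fmax A.
Proof. exact: le_bigmax. Qed.

Lemma fmax_le A c : (forall g, A g <= c) -> fmax A <= c.
Proof. by move=> H; apply: bigmax_le. Qed.

Lemma fmax_ex A : exists g, fmax A = A g.
Proof.
rewrite /fmax; elim/big_ind: _ => [|x y [g ->] [h ->]|g _]; [by exists t0| |by exists g].
by case: (leP (A g) (A h)) => _; [exists h|exists g].
Qed.

Lemma fmaxD A B : fmax (fun g => A g + B g) <= fmax A + fmax B.
Proof. by apply: fmax_le => g; rewrite lerD ?fmax_ge. Qed.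

(* Expectation of fmax (A + s_1 y_1 + ... + s_n y_n) over independent random
   signs, computed one sign at a time. *)
Fixpoint rad ys A : R :=
  match ys with
  | [::] => fmax A
  | y :: ys' => (rad ys' (fun g => A g + y g) + rad ys' (fun g => A g - y g)) / 2
  end.

Let addfAC A y t : (fun g => A g + y g + t g) = (fun g => A g + t g + y g).
Proof. by apply/funext => g; rewrite addrAC. Qed.

(** With maximizers g1 of A + y and g2 of A - y, the left side is A g1 + A g2 + y g1 - y g2. The
    last difference is at most |t g1 - t g2|, and giving +t to one of the two points and -t to the
    other realizes this absolute value. The remaining signs are averaged on both sides alike. *)
Lemma rad_swap ts A y t : (forall g g', `|y g - y g'| <= `|t g - t g'|) ->
  rad ts (fun g => A g + y g) + rad ts (fun g => A g - y g) <=
  rad ts (fun g => A g + t g) + rad ts (fun g => A g - t g).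
Proof.
move=> yt; elim: ts A => [|t' ts IH] A /=.
  have [g1 E1] := fmax_ex (fun g => A g + y g); have [g2 E2] := fmax_ex (fun g => A g - y g).
  rewrite E1 E2; have := fmax_ge (fun g => A g + t g) g1; have := fmax_ge (fun g => A g - t g) g1.
  have := fmax_ge (fun g => A g + t g) g2; have := fmax_ge (fun g => A g - t g) g2.
  have := yt g1 g2; have := ler_norm (y g1 - y g2).
  move: (fmax _) (fmax _) => X Y; case: (ger0P (t g1 - t g2)) => _; lra.
have := IH (fun g => A g + t' g); have := IH (fun g => A g - t' g).
rewrite (addfAC A (fun g => - t' g) y) (addfAC A (fun g => - t' g) (fun g => - y g)).
rewrite (addfAC A (fun g => - t' g) t) (addfAC A (fun g => - t' g) (fun g => - t g)).
rewrite (addfAC A t' y) (addfAC A t' (fun g => - y g)) (addfAC A t' t) (addfAC A t' (fun g => - t g)).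
lra.
Qed.

Lemma rad_contraction (I : Type) (r : seq I) (y t : I -> T -> R) A :
  (forall i g g', `|y i g - y i g'| <= `|t i g - t i g'|) ->
  rad (map y r) A <= rad (map t r) A.
Proof.
move=> yt; elim: r A => [|i r IH] A //=.
rewrite ler_pM2r ?invr_gt0//; apply: le_trans (rad_swap _ A (yt i)).
by rewrite lerD.
Qed.

(** Separates the two independent copies, so that each can be contracted with its own Lipschitz
    constant. *)
Lemma radD (I : Type) (r : seq I) (y t : I -> T -> R) A B :
  rad (map (fun i g => y i g + t i g) r) (fun g => A g + B g) <=
  rad (map y r) A + rad (map t r) B.
Proof.
elim: r A B => [|i r IH] A B /=; first exact: fmaxD.
have := IH (fun g => A g + y i g) (fun g => B g + t i g).
have := IH (fun g => A g - y i g) (fun g => B g - t i g).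
have -> : (fun g => A g + y i g + (B g + t i g)) = (fun g => A g + B g + (y i g + t i g)).
  by apply/funext => g; rewrite addrACA.
have -> : (fun g => A g - y i g + (B g - t i g)) = (fun g => A g + B g - (y i g + t i g)).
  by apply/funext => g; rewrite opprD addrACA.
lra.
Qed.

Lemma rad_ge ys A : (forall y, List.In y ys -> y t0 = 0) -> A t0 <= rad ys A.
Proof.
elim: ys A => [|y ys IH] A Hy /=; first exact: fmax_ge.
have H0 : y t0 = 0 by apply: Hy; left.
have Hys z : List.In z ys -> z t0 = 0 by move=> zy; apply: Hy; right.
have := IH (fun g => A g + y g) Hys; have := IH (fun g => A g - y g) Hys.
by rewrite H0 addr0 subr0; lra.
Qed.

(* Completing the square in each coordinate; the cross terms cancel when the
   signs are averaged. *)
Lemma rad_linear (I J : Type) (r : seq I) (s : seq J) (a : T -> I -> R) (u w : I -> R)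
    (z : J -> I -> R) (b : R) : 0 < b -> (forall i, 0 < w i) ->
  rad (map (fun j g => \sum_(i <- r) a g i * z j i) s)
    (fun g => \sum_(i <- r) a g i * u i - b * \sum_(i <- r) w i * a g i ^+ 2) <=
  (4 * b)^-1 * \sum_(i <- r) (u i ^+ 2 + \sum_(j <- s) z j i ^+ 2) / w i.
Proof.
move=> b0 w0; elim: s u => [|j s IH] u /=.
  apply: fmax_le => g; rewrite !mulr_sumr -sumrB; apply: ler_sum => i _.
  rewrite big_nil addr0 -subr_ge0.
  have -> : (4 * b)^-1 * (u i ^+ 2 / w i) - (a g i * u i - b * (w i * a g i ^+ 2)) =
    b * w i * (a g i - u i / (2 * b * w i)) ^+ 2.
    by field; rewrite !gt_eqF.
  by rewrite mulr_ge0 ?sqr_ge0// mulr_ge0 ?ltW.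
have E (e : R) : (fun g => \sum_(i <- r) a g i * u i - b * \sum_(i <- r) w i * a g i ^+ 2
     + e * \sum_(i <- r) a g i * z j i) =
   (fun g => \sum_(i <- r) a g i * (u i + e * z j i) - b * \sum_(i <- r) w i * a g i ^+ 2).
  apply/funext => g; rewrite addrAC; congr (_ - _).
  by rewrite mulr_sumr -big_split /=; apply: eq_bigr => i _; ring.
have := IH (fun i => u i + 1 * z j i); have := IH (fun i => u i + -1 * z j i).
rewrite -!E.
have -> : (fun g => \sum_(i <- r) a g i * u i - b * \sum_(i <- r) w i * a g i ^+ 2 + 1 * \sum_(i <- r) a g i * z j i) =
  (fun g => \sum_(i <- r) a g i * u i - b * \sum_(i <- r) w i * a g i ^+ 2 + \sum_(i <- r) a g i * z j i).
  by apply/funext => g; rewrite mul1r.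
have -> : (fun g => \sum_(i <- r) a g i * u i - b * \sum_(i <- r) w i * a g i ^+ 2 + -1 * \sum_(i <- r) a g i * z j i) =
  (fun g => \sum_(i <- r) a g i * u i - b * \sum_(i <- r) w i * a g i ^+ 2 - \sum_(i <- r) a g i * z j i).
  by apply/funext => g; rewrite mulN1r.
move=> H1 H2; rewrite ler_pdivrMr//; apply: (le_trans (lerD H2 H1)).
rewrite -mulrDr -mulrA; apply: ler_wpM2l; first by rewrite invr_ge0 mulr_ge0// ltW.
rewrite mulr_suml -big_split /= le_eqVlt; apply/orP; left; apply/eqP; apply: eq_bigr => i _.
by rewrite big_cons; field; rewrite gt_eqF.
Qed.

End rademacher.

Section random_max.
Context {d : measure_display} {W : measurableType d} {R : realType} {T : finType} (t0 : T).

Lemma measurable_fmax (F : T -> W -> R) : (forall g, measurable_fun setT (F g)) ->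
  measurable_fun setT (fun w => fmax t0 (F^~ w)).
Proof.
move=> mF; rewrite /fmax; elim: (index_enum _) => [|g r IH].
  rewrite (_ : (fun w => _) = F t0)//; by apply/funext => w; rewrite big_nil.
rewrite (_ : (fun w => _) = (F g) \max (fun w => \big[Num.max/F t0 w]_(h <- r) F h w)).
  exact: measurable_maxr.
by apply/funext => w; rewrite big_cons.
Qed.

Lemma measurable_rad (I : Type) (r : seq I) (y : I -> T -> W -> R) (A : T -> W -> R) :
  (forall i g, measurable_fun setT (y i g)) -> (forall g, measurable_fun setT (A g)) ->
  measurable_fun setT (fun w => rad t0 (map (fun i g => y i g w) r) (A^~ w)).
Proof.
move=> my; elim: r A => [|i r IH] A mA /=; first exact: measurable_fmax.
apply: measurable_funM => //; apply: measurable_funD.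
  by apply: (IH (fun g w => A g w + y i g w)) => g; exact: measurable_funD.
by apply: (IH (fun g w => A g w - y i g w)) => g; exact: measurable_funB.
Qed.

End random_max.

(** * Exchangeability of a sample with an independent copy of it *)

Section exchangeable_pairs.
Context {dO dE : measure_display} {Omega : measurableType dO} {E : measurableType dE} {R : realType}.
Variable P : probability Omega R.
Variable Pi : set (set E).
Hypothesis measurablePi : @measurable _ E = <<s Pi >>.
Hypothesis setI_Pi : setI_closed Pi.
Hypothesis setT_Pi : Pi setT.
Variable n : nat.
Variable Z : 'I_n -> Omega -> E.
Hypothesis mZ : forall l, measurable_fun setT (Z l).
Hypothesis indepZ : forall A : 'I_n -> set E, (forall l, Pi (A l)) ->
  (P (\bigcap_(l in [set: 'I_n]) Z l @^-1` A l) = \prod_(l < n) P (Z l @^-1` A l))%E.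
Implicit Types (A B : 'I_n -> set E) (s : 'I_n -> bool).

Let box A B : set ('I_n -> E * E) := [set h | forall l, A l (h l).1 /\ B l (h l).2].

(** A pi-system on configurations of pairs: probabilities are known to factor only for sides in
    [Pi], so the sigma-algebra is generated by these boxes and laws are compared on them. *)
Definition pair_boxes : set (set ('I_n -> E * E)) :=
  [set X | exists A B, [/\ forall l, Pi (A l), forall l, Pi (B l) & X = box A B]].

Definition pair_space := g_sigma_algebraType pair_boxes.

Let PiM X : Pi X -> measurable X.
Proof. by rewrite measurablePi; exact: sub_sigma_algebra. Qed.

Definition swapped s (w : Omega * Omega) : pair_space :=
  fun l => if s l then (Z l w.2, Z l w.1) else (Z l w.1, Z l w.2).

Let swapped_box s A B : swapped s @^-1` box A B =
  (\bigcap_(l in [set: 'I_n]) Z l @^-1` (if s l then B l else A l)) `*`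
  (\bigcap_(l in [set: 'I_n]) Z l @^-1` (if s l then A l else B l)).
Proof.
apply/seteqP; split=> -[w w'] /=.
  by move=> H; split=> l _ /=; have := H l; rewrite /swapped; case: (s l) => -[].
by move=> [H H'] l; have := H l I; have := H' l I; rewrite /swapped; case: (s l).
Qed.

Let measurable_cap A : (forall l, Pi (A l)) -> measurable (\bigcap_(l in [set: 'I_n]) Z l @^-1` A l).
Proof.
move=> HA; apply: fin_bigcap_measurable => // l _.
by rewrite -[X in measurable X]setTI; apply: mZ => //; exact: PiM.
Qed.

Lemma measurable_swapped s : measurable_fun setT (swapped s).
Proof.
apply: (@measurability _ _ _ (pair_space : measurableType _) setT _ pair_boxes) => //.
move=> _ [_ [A [B [HA HB ->]]] <-]; rewrite setTI swapped_box.
by apply: measurableX; apply: measurable_cap => l; case: (s l).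
Qed.

Lemma measurable_pair_fst l : measurable_fun setT (fun h : pair_space => (h l).1).
Proof.
apply: (@measurability _ _ _ _ setT _ Pi); first exact: measurablePi.
move=> _ [A HA <-]; apply: sub_sigma_algebra.
exists (fun k => if k == l then A else setT), (fun=> setT); split=> //.
  by move=> k; case: ifP.
rewrite setTI; apply/seteqP; split=> h /=.
  by move=> Ah k; split=> //; case: eqP => // ->.
by move=> /(_ l)[]; rewrite eqxx.
Qed.

Lemma measurable_pair_snd l : measurable_fun setT (fun h : pair_space => (h l).2).
Proof.
apply: (@measurability _ _ _ _ setT _ Pi); first exact: measurablePi.
move=> _ [A HA <-]; apply: sub_sigma_algebra.
exists (fun=> setT), (fun k => if k == l then A else setT); split=> //.
  by move=> k; case: ifP.
rewrite setTI; apply/seteqP; split=> h /=.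
  by move=> Ah k; split=> //; case: eqP => // ->.
by move=> /(_ l)[_]; rewrite eqxx.
Qed.

Let law s : set pair_space -> \bar R := pushforward (P \x P)%E (swapped s).

Let law0 s : law s set0 = 0%E.
Proof. by rewrite /law /pushforward preimage_set0 measure0. Qed.

Let law_ge0 s X : (0 <= law s X)%E.
Proof. by rewrite /law /pushforward; exact: measure_ge0. Qed.

Let law_additive s : semi_sigma_additive (law s).
Proof.
move=> F mF tF mUF; rewrite /law /pushforward preimage_bigcup.
have mS X : measurable X -> measurable (swapped s @^-1` X).
  by move=> mX; rewrite -[X in measurable X]setTI; exact: measurable_swapped.
apply: measure_semi_sigma_additive.
- by move=> k; exact: mS.
- apply/trivIsetP => /= i j _ _ ij; rewrite -preimage_setI.
  by move/trivIsetP : tF => /(_ _ _ _ _ ij) ->//; rewrite preimage_set0.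
- by rewrite -preimage_bigcup; exact: mS.
Qed.

HB.instance Definition _ s := isMeasure.Build _ _ _ (law s) (law0 s) (law_ge0 s) (@law_additive s).

(** On a box the probability is the product over l of P(A_l) P(B_l). This is symmetric in A_l and
    B_l, hence independent of which pairs are swapped; uniqueness of measures on a pi-system does
    the rest. *)
Let law_eq s s' X : measurable X -> law s X = law s' X.
Proof.
have mT : Pi setT by [].
apply: (@measure_unique _ R (pair_space : measurableType _) pair_boxes (fun=> setT)) => //.
- move=> _ _ [A [B [HA HB ->]]] [A' [B' [HA' HB' ->]]].
  exists (fun l => A l `&` A' l), (fun l => B l `&` B' l); split.
  + by move=> l; exact: setI_Pi.
  + by move=> l; exact: setI_Pi.
  apply/seteqP; split=> h /=.
    by move=> [H H'] l; have [? ?] := H l; have [? ?] := H' l.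
  by move=> H; split=> l; have [[? ?] [? ?]] := H l.
- move=> _; exists (fun=> setT), (fun=> setT); split=> //.
  by apply/seteqP; split.
- by apply/seteqP; split=> // h _; exists 0%N.
- move=> _ [A [B [HA HB ->]]]; rewrite /= /law /pushforward !swapped_box.
  have E1 t : ((P \x P) ((\bigcap_(l in [set: 'I_n]) Z l @^-1` (if t l then B l else A l)) `*`
      (\bigcap_(l in [set: 'I_n]) Z l @^-1` (if t l then A l else B l))) =
      \prod_(l < n) (P (Z l @^-1` A l) * P (Z l @^-1` B l)))%E.
    have HC (l : 'I_n) : Pi (if t l then B l else A l) by case: (t l).
    have HC' (l : 'I_n) : Pi (if t l then A l else B l) by case: (t l).
    apply: (etrans (product_measure1E _ _ _ _)); [exact: measurable_cap|exact: measurable_cap|].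
    apply: (etrans (f_equal2 _ (indepZ HC) (indepZ HC'))); rewrite -big_split /=.
    by apply: eq_bigr => l _; case: (t l) => //; rewrite muleC.
  exact: (etrans (E1 s) (esym (E1 s'))).
- move=> _; rewrite /= /law /pushforward preimage_setT [X in (X < _)%E](_ : _ = 1%E) ?ltry//.
  rewrite -setXTT; apply: (etrans (product_measure1E _ _ _ _)) => //.
  by apply: (etrans (f_equal2 _ (probability_setT P) (probability_setT P))); rewrite mule1.
Qed.

Lemma swapped_integral (G : pair_space -> \bar R) s s' :
  measurable_fun setT G -> (forall h, 0 <= G h)%E ->
  (\int[P \x P]_w G (swapped s w) = \int[P \x P]_w G (swapped s' w))%E.
Proof.
move=> mG G0; have H t : (\int[P \x P]_w G (swapped t w) = \int[law t]_h G h)%E.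
  by rewrite /law ge0_integral_pushforward//; exact: measurable_swapped.
by rewrite !H; apply: eq_measure_integral => X mX _; exact: law_eq.
Qed.

End exchangeable_pairs.

Section maximal_inequality.
Context {dO dE : measure_display} {Omega : measurableType dO} {E : measurableType dE} {R : realType}.
Variable P : probability Omega R.
Variable Pi : set (set E).
Hypothesis measurablePi : @measurable _ E = <<s Pi >>.
Hypothesis setI_Pi : setI_closed Pi.
Hypothesis setT_Pi : Pi setT.
Variable n : nat.
Variable Z : 'I_n -> Omega -> E.
Hypothesis mZ : forall l, measurable_fun setT (Z l).
Hypothesis indepZ : forall A : 'I_n -> set E, (forall l, Pi (A l)) ->
  (P (\bigcap_(l in [set: 'I_n]) Z l @^-1` A l) = \prod_(l < n) P (Z l @^-1` A l))%E.
Context {T : finType} (t0 : T).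
Variables (Y : T -> E -> R) (M : T -> R).
Hypothesis mY : forall g, measurable_fun setT (Y g).
Hypothesis Y0 : forall z, Y t0 z = 0.
Hypothesis intY : forall g l, P.-integrable setT (EFin \o (fun w => Y g (Z l w))).
Hypothesis meanY : forall g l, \int[P]_w Y g (Z l w) = M g.
Context {I : Type} (r : seq I).
Variables (a : T -> I -> R) (f : I -> E -> R) (q : I -> R) (b N V : R) (L : E -> R).
Hypothesis b0 : 0 < b.
Hypothesis N0 : 0 <= N.
Hypothesis q0 : forall i, 0 < q i.
Hypothesis a0 : forall i, a t0 i = 0.
Hypothesis mL : measurable_fun setT L.
Hypothesis lipY : forall g g' z, `|Y g z - Y g' z| <= L z * `|\sum_(i <- r) a g i * f i z - \sum_(i <- r) a g' i * f i z|.
Hypothesis L0 : forall z, 0 <= L z.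
Hypothesis specf : forall z, \sum_(i <- r) f i z ^+ 2 / q i <= N.
Hypothesis intL : forall l, (\int[P]_w (L (Z l w) ^+ 2)%:E <= V%:E)%E.

Let pen g := b * \sum_(i <- r) q i * a g i ^+ 2.
Let dev (w : Omega) g := \sum_(l < n) (M g - Y g (Z l w)) - 2 * pen g.
Let D (l : 'I_n) g (h : 'I_n -> E * E) := Y g (h l).2 - Y g (h l).1.

Let pen0 : pen t0 = 0.
Proof. by rewrite /pen big1 ?mulr0// => i _; rewrite a0 expr0n mulr0. Qed.

(** The doubled penalty is shared between the two copies by [radD]. In each half contraction
    replaces Y by the linear form times L, and [rad_linear] with N bounding the weighted squares
    gives N / (4 b) times the sum of the L^2. *)
Let rad_bound (h : 'I_n -> E * E) :
  rad t0 [seq (fun g => D l g h) | l <- enum 'I_n] (fun g => - (2 * pen g)) <=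
  \sum_(l < n) (N / (4 * b)) * (L (h l).2 ^+ 2 + L (h l).1 ^+ 2).
Proof.
have half (eps : R) (k : 'I_n -> E) : `|eps| = 1 ->
    rad t0 [seq (fun g => eps * Y g (k l)) | l <- enum 'I_n] (fun g => - pen g) <=
    \sum_(l < n) (N / (4 * b)) * L (k l) ^+ 2.
  move=> e1; apply: (@le_trans _ _ (rad t0 [seq (fun g => \sum_(i <- r) a g i * (L (k l) * f i (k l))) | l <- enum 'I_n]
     (fun g => \sum_(i <- r) a g i * 0 - b * \sum_(i <- r) q i * a g i ^+ 2))).
    have -> : (fun g => \sum_(i <- r) a g i * 0 - b * \sum_(i <- r) q i * a g i ^+ 2) = (fun g => - pen g).
      by apply/funext => g; rewrite big1 ?sub0r// => i _; rewrite mulr0.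
    apply: rad_contraction => l g g'; rewrite -mulrBr normrM e1 mul1r.
    apply: (le_trans (lipY g g' (k l))).
    rewrite -{1}(ger0_norm (L0 (k l))) -normrM mulrBr !mulr_sumr.
    by rewrite le_eqVlt; apply/orP; left; apply/eqP; congr `|_ - _|; apply: eq_bigr => i _; ring.
  apply: (le_trans (@rad_linear R T t0 I 'I_n r (enum 'I_n) a (fun=> 0) q (fun l i => L (k l) * f i (k l)) b b0 q0)).
  have -> : \sum_(i <- r) (0 ^+ 2 + \sum_(l <- enum 'I_n) (L (k l) * f i (k l)) ^+ 2) / q i =
      \sum_(l < n) L (k l) ^+ 2 * \sum_(i <- r) f i (k l) ^+ 2 / q i.
    transitivity (\sum_(i <- r) \sum_(l < n) L (k l) ^+ 2 * (f i (k l) ^+ 2 / q i)).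
      apply: eq_bigr => i _; rewrite expr0n add0r big_enum /= mulr_suml.
      by apply: eq_bigr => l _; rewrite exprMn mulrA.
    by rewrite exchange_big /=; apply: eq_bigr => l _; rewrite mulr_sumr.
  rewrite mulr_sumr; apply: ler_sum => l _.
  rewrite [leLHS]mulrCA [leRHS]mulrC; apply: ler_wpM2l; first exact: sqr_ge0.
  rewrite mulrC; apply: ler_wpM2r; last exact: specf.
  by rewrite invr_ge0 mulr_ge0// ltW.
have := radD t0 (enum 'I_n) (fun l g => 1 * Y g (h l).2) (fun l g => -1 * Y g (h l).1) (fun g => - pen g) (fun g => - pen g).
have -> : (fun g => - pen g + - pen g) = (fun g => - (2 * pen g)).
  by apply/funext => g; rewrite -opprD mulr_natl mulr2n.
have -> : [seq (fun g => 1 * Y g (h l).2 + -1 * Y g (h l).1) | l <- enum 'I_n] = [seq (fun g => D l g h) | l <- enum 'I_n].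
  by apply: eq_map => l; apply/funext => g; rewrite mul1r mulN1r.
move=> /le_trans; apply.
have := half 1 (fun l => (h l).2) (normr1 _); have := half (-1) (fun l => (h l).1) (normrN1 _).
move=> H1 H2; apply: (le_trans (lerD H2 H1)).
by rewrite -big_split /=; apply: ler_sum => l _; rewrite mulrDr.
Qed.

Let zeta := swapped Pi Z (fun=> false).
Let sgn (s : 'I_n -> bool) l : R := if s l then -1 else 1.
(** Intermediate state of the averaging: indices outside [rr] already carry the sign prescribed by
    [s], those in [rr] are left to [rad]. *)
Let Asum s (rr : seq 'I_n) (h : 'I_n -> E * E) g :=
  - (2 * pen g) + \sum_(l < n) (if l \in rr then 0 else sgn s l * D l g h).

Let D0 l h : D l t0 h = 0.
Proof. by rewrite /D !Y0 subrr. Qed.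

Let Asum0 s rr h : Asum s rr h t0 = 0.
Proof.
by rewrite /Asum pen0 mulr0 oppr0 add0r big1// => l _; case: ifP => // _; rewrite D0 mulr0.
Qed.

Let rad_ge0 s rr h : 0 <= rad t0 [seq (fun g => D l g h) | l <- rr] (Asum s rr h).
Proof.
rewrite -{1}(Asum0 s rr h); apply: rad_ge => y.
by elim: rr => //= l rr IH [<-|/IH //]; rewrite D0.
Qed.

Let mD l g : measurable_fun setT (fun h : pair_space Pi n => D l g h).
Proof.
apply: measurable_funB; apply: measurableT_comp => //.
  exact: (measurable_pair_snd measurablePi).
exact: (measurable_pair_fst measurablePi).
Qed.

Let mAsum s rr g : measurable_fun setT (fun h : pair_space Pi n => Asum s rr h g).
Proof.
apply: measurable_funD => //; apply: measurable_sum => l.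
by case: (l \in rr) => //; apply: measurable_funM.
Qed.

Let mrad s rr : measurable_fun setT (fun w => rad t0 [seq (fun g => D l g (zeta w)) | l <- rr] (Asum s rr (zeta w))).
Proof.
apply: (measurableT_comp (f := fun h : pair_space Pi n => rad t0 [seq (fun g => D l g h) | l <- rr] (Asum s rr h))).
  by apply: (@measurable_rad _ (pair_space Pi n : measurableType _) R T t0 _ rr (fun l g h => D l g h) (fun g h => Asum s rr h g)).
exact: (measurable_swapped measurablePi mZ).
Qed.

(** By exchangeability every choice of signs yields the same integral, so averaging over signs
    changes nothing. Signs are moved one by one from [rad] into [s]. *)
Let symmetrization rr s : uniq rr ->
  (\int[P \x P]_w (rad t0 [seq (fun g => D l g (zeta w)) | l <- rr] (Asum s rr (zeta w)))%:E =
   \int[P \x P]_w (fmax t0 (Asum (fun=> false) [::] (zeta w)))%:E)%E.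
Proof.
elim: rr s => [|l rr IH] s /=.
  move=> _; pose G (h : pair_space Pi n) := (fmax t0 (Asum (fun=> false) [::] h))%:E.
  have mG : measurable_fun setT G.
    apply/measurable_EFinP; apply: (measurable_fmax t0 (F := fun g (h : pair_space Pi n) => Asum (fun=> false) [::] h g)).
    by move=> g; exact: mAsum.
  have G0 h : (0 <= G h)%E by rewrite lee_fin; exact: (rad_ge0 (fun=> false) [::] h).
  have := swapped_integral measurablePi setI_Pi setT_Pi mZ indepZ s (fun=> false) mG G0.
  move=> <-; apply: eq_integral => w _; rewrite /G; congr (fmax t0 _)%:E; apply/funext => g.
  congr (_ + _); apply: eq_bigr => l _; rewrite /= /sgn /D /zeta /swapped /= mul1r.
  by case: (s l); rewrite /= ?mul1r// mulN1r opprB.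
move=> /andP[lrr urr].
have E1 (e : bool) h : (fun g => Asum s (l :: rr) h g + (if e then -1 else 1) * D l g h) =
   Asum (fun k => if k == l then e else s k) rr h.
  apply/funext => g; rewrite /Asum -addrA; congr (_ + _).
  rewrite (bigD1 l)//= mem_head add0r [RHS](bigD1 l)//= (negbTE lrr) addrC; congr (_ + _); first by rewrite /sgn eqxx.
  by apply: eq_bigr => k kl; rewrite inE (negbTE kl) /= /sgn (negbTE kl).
have E2 w : ((rad t0 [seq (fun g => D k g (zeta w)) | k <- rr] (fun g => Asum s (l :: rr) (zeta w) g + D l g (zeta w)) +
   rad t0 [seq (fun g => D k g (zeta w)) | k <- rr] (fun g => Asum s (l :: rr) (zeta w) g - D l g (zeta w))) / 2)%:E =
  (2^-1%:E * ((rad t0 [seq (fun g => D k g (zeta w)) | k <- rr] (Asum (fun k => if k == l then false else s k) rr (zeta w)))%:E +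
    (rad t0 [seq (fun g => D k g (zeta w)) | k <- rr] (Asum (fun k => if k == l then true else s k) rr (zeta w)))%:E))%E.
  rewrite -EFinD -EFinM mulrC -!E1; congr (_ * (rad t0 _ _ + rad t0 _ _))%:E.
    by apply/funext => g; rewrite mul1r.
  by apply/funext => g; rewrite mulN1r.
under eq_integral do rewrite E2.
have mr s' : measurable_fun setT (fun w => (rad t0 [seq (fun g => D k g (zeta w)) | k <- rr] (Asum s' rr (zeta w)))%:E).
  by apply/measurable_EFinP; exact: mrad.
have r0 s' w : (0 <= (rad t0 [seq (fun g => D k g (zeta w)) | k <- rr] (Asum s' rr (zeta w)))%:E)%E.
  by rewrite lee_fin.
rewrite ge0_integralZl_EFin//; last 2 first.
- by move=> w _; exact: adde_ge0.
- exact: emeasurable_funD.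
rewrite ge0_integralD// !IH//.
have : (0 <= \int[P \x P]_w (fmax t0 (Asum (fun=> false) [::] (zeta w)))%:E)%E.
  by apply: integral_ge0 => w _; rewrite lee_fin; exact: (rad_ge0 (fun=> false) [::]).
(* No integrability of the maximum is available here, so the value +oo has to be allowed. *)
case: (integral _ _ _) => [x x0|//|//].
  by rewrite -EFinD -EFinM; congr (_%:E); rewrite -mulr2n -[x *+ 2]mulr_natl mulKf.
by move=> _; rewrite addye// gt0_muley// lte_fin.
Qed.

Let marginal (phi : Omega -> \bar R) : measurable_fun setT phi -> (forall w, 0 <= phi w)%E ->
  (\int[P \x P]_w phi w.1 = \int[P]_w phi w /\ \int[P \x P]_w phi w.2 = \int[P]_w phi w)%E.
Proof.
move=> mphi phi0; split; rewrite fubini_tonelli1//; try by apply: measurableT_comp.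
- apply: eq_integral => w _; transitivity (\int[P]_y (cst (phi w)) y)%E; first by [].
  by rewrite integral_cst// -[LHS]/(_ * P setT)%E probability_setT mule1.
- transitivity (\int[P]_x (cst (\int[P]_w phi w)%E) x)%E; first by [].
  by rewrite integral_cst// -[LHS]/(_ * P setT)%E probability_setT mule1.
Qed.

Let dev0 w : dev w t0 = 0.
Proof.
rewrite /dev pen0 mulr0 subr0 big1// => l _; rewrite Y0 subr0 -(meanY t0 l).
by rewrite /Rintegral (eq_integral (fun=> 0%E)) ?integral0// => w' _; rewrite Y0.
Qed.

Let devf_ge0 w : 0 <= fmax t0 (dev w).
Proof. by rewrite -(dev0 w); exact: fmax_ge. Qed.

Let mYZ g l : measurable_fun setT (fun w => Y g (Z l w)).
Proof. by apply: measurableT_comp. Qed.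

Let mdev : measurable_fun setT (fun w => fmax t0 (dev w)).
Proof.
apply: (measurable_fmax t0 (F := fun g w => dev w g)) => g.
by apply: measurable_funB => //; apply: measurable_sum => l; exact: measurable_funB.
Qed.

(** The mean M g is the integral over an independent copy; then the maximum of integrals is at most
    the integral of the maximum. The positive part can be taken because the maximum is at least its
    value 0 at [t0]. *)
Let ghost_ge w : ((fmax t0 (dev w))%:E <=
  \int[P]_w' (fmax t0 (Asum (fun=> false) [::] (zeta (w, w'))))%:E)%E.
Proof.
have [g ->] := fmax_ex t0 (dev w).
pose c : R := - (2 * pen g) - \sum_(l < n) Y g (Z l w).
pose h w' := c + \sum_(l < n) Y g (Z l w').
have hE w' : h w' = Asum (fun=> false) [::] (zeta (w, w')) g.
  rewrite /h /c /Asum -addrA; congr (_ + _).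
  rewrite addrC -sumrB; apply: eq_bigr => l _.
  by rewrite /= /sgn /D /zeta /swapped /= mul1r.
have iS : P.-integrable setT (EFin \o (fun w' => \sum_(l < n) Y g (Z l w'))).
  by apply: integrable_sum_EFin => // l _; exact: intY.
have ic : P.-integrable setT (EFin \o (fun=> c)).
  exact: finite_measure_integrable_cst.
have ih : P.-integrable setT (EFin \o h) by exact: (integrableD_EFin measurableT ic iS).
have -> : (dev w g)%:E = (\int[P]_w' (h w')%:E)%E.
  rewrite -(fineK (integrable_fin_num measurableT ih)); congr (_%:E).
  rewrite -[RHS]/(\int[P]_w' h w') (RintegralD measurableT ic iS) Rintegral_cst//.
  rewrite (Rintegral_sum measurableT) => [|l _]; last exact: intY.
  rewrite (eq_bigr (fun=> M g)) => [|l _]; last exact: meanY.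
  have -> : fine (P setT) = 1 by rewrite probability_setT.
  by rewrite mulr1 /dev /c sumrB; ring.
rewrite integralE; apply: (@le_trans _ _ (\int[P]_x ((fun w' => (h w')%:E)^\+ x))%E).
  by apply: geeDl; rewrite oppe_le0; apply: integral_ge0 => x _; exact: funeneg_ge0.
have mh : measurable_fun setT (fun w' => (h w')%:E) by have /measurable_int := ih.
apply: ge0_le_integral => //.
- exact: measurable_funepos.
- apply: (measurableT_comp (f := fun w0 => (fmax t0 (Asum (fun=> false) [::] (zeta w0)))%:E) (g := fun w' => (w, w'))).
    by apply/measurable_EFinP; exact: (mrad (fun=> false) [::]).
  exact: measurable_pair1.
move=> x _; rewrite funeposE ge_max; apply/andP; split; rewrite lee_fin.
  by rewrite hE; exact: fmax_ge.
exact: (rad_ge0 (fun=> false) [::]).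
Qed.

Let main_bound : (\int[P]_w (fmax t0 (dev w))%:E <= (n%:R * (N / (2 * b)) * V)%:E)%E.
Proof.
pose F2 (w : Omega * Omega) := (fmax t0 (Asum (fun=> false) [::] (zeta w)))%:E.
have F20 w : (0 <= F2 w)%E by rewrite lee_fin; exact: (rad_ge0 (fun=> false) [::]).
have mF2 : measurable_fun setT F2 by apply/measurable_EFinP; exact: (mrad (fun=> false) [::]).
apply: (@le_trans _ _ (\int[P \x P]_w F2 w)%E).
  rewrite fubini_tonelli1//; apply: ge0_le_integral => //.
  - by move=> w _; rewrite lee_fin.
  - exact/measurable_EFinP.
  exact: measurable_fun_fubini_tonelli_F.
rewrite /F2 -(symmetrization (fun=> false) (enum_uniq 'I_n)).
have EA h : Asum (fun=> false) (enum 'I_n) h = (fun g => - (2 * pen g)).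
  by apply/funext => g; rewrite /Asum big1 ?addr0// => l _; rewrite mem_enum.
pose c := N / (4 * b).
have c0 : 0 <= c by rewrite divr_ge0// mulr_ge0// ltW.
have mLZ l : measurable_fun setT (fun w => (L (Z l w) ^+ 2)%:E).
  by apply/measurable_EFinP; apply: measurable_funX; exact: measurableT_comp.
have m1 l : measurable_fun setT (fun w : Omega * Omega => (L (Z l w.1) ^+ 2)%:E).
  by apply: (measurableT_comp (mLZ l)).
have m2 l : measurable_fun setT (fun w : Omega * Omega => (L (Z l w.2) ^+ 2)%:E).
  by apply: (measurableT_comp (mLZ l)).
have L20 l (w : Omega) : (0 <= (L (Z l w) ^+ 2)%:E)%E by rewrite lee_fin sqr_ge0.
apply: (@le_trans _ _ (\int[P \x P]_w (c%:E * \sum_(l < n) ((L (Z l w.2) ^+ 2)%:E + (L (Z l w.1) ^+ 2)%:E)))%E).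
  apply: ge0_le_integral => //.
  - by move=> w _; rewrite lee_fin.
  - by apply/measurable_EFinP; exact: mrad.
  - apply: emeasurable_funM => //; apply: emeasurable_sum => l.
    exact: emeasurable_funD.
  move=> w _; have := rad_bound (zeta w); rewrite -(EA (zeta w)) -lee_fin => /le_trans; apply.
  rewrite -mulr_sumr EFinM -sumEFin.
  by apply: lee_wpmul2l; [rewrite lee_fin|apply: lee_sum => l _; rewrite EFinD].
rewrite ge0_integralZl_EFin//; last 2 first.
- by move=> w _; apply: sume_ge0 => l _; exact: adde_ge0.
- by apply: emeasurable_sum => l; exact: emeasurable_funD.
rewrite ge0_integral_sum//; last 2 first.
- by move=> l; exact: emeasurable_funD.
- by move=> l w _; exact: adde_ge0.
have -> : (n%:R * (N / (2 * b)) * V)%:E = (c%:E * \sum_(l < n) (V%:E + V%:E))%E.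
  rewrite sumEFin -EFinM; congr (_%:E); rewrite sumr_const card_ord -mulr_natl /c.
  by field; rewrite gt_eqF.
apply: lee_wpmul2l; first by rewrite lee_fin.
apply: lee_sum => l _; rewrite ge0_integralD//.
have [E1 E2] := marginal (mLZ l) (L20 l).
by apply: leeD; [rewrite E2|rewrite E1].
Qed.

(** Markov's inequality for the maximum of the penalized deviations, nonnegative because the
    deviation vanishes at [t0]. The penalty inside [dev] makes the bound uniform over the class,
    without its cardinality. *)
Lemma maximal_inequality (t : R) : 0 < t ->
  measurable [set w | exists g, t <= dev w g] /\
  (t%:E * P [set w | exists g, (t <= dev w g)%R] <= (n%:R * (N / (2 * b)) * V)%:E)%E.
Proof.
move=> tp.
have E1 : [set w | exists g, t <= dev w g] = setT `&` [set w | (t%:E <= `|(fmax t0 (dev w))%:E|)%E].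
  apply/seteqP; split=> w /=.
    move=> [g tg]; split=> //; rewrite ger0_norm// lee_fin (le_trans tg)//; exact: fmax_ge.
  by move=> [_]; rewrite ger0_norm// lee_fin; have [g ->] := fmax_ex t0 (dev w); exists g.
have mE : measurable_fun setT (fun w => (fmax t0 (dev w))%:E) by exact/measurable_EFinP.
split.
  rewrite E1; have -> : [set w | (t%:E <= `|(fmax t0 (dev w))%:E|)%E] = (fun w => fmax t0 (dev w)) @^-1` `[t, +oo[.
    by apply/seteqP; split=> w /=; rewrite ger0_norm// lee_fin in_itv/= andbT.
  by apply: mdev => //; exact: measurable_itv.
rewrite E1; apply: le_trans main_bound.
apply: (le_trans (le_integral_abse P measurableT mE tp)).
by under eq_integral do rewrite /= ger0_norm//.
Qed.

End maximal_inequality.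

(** * The expected loss *)

(* h behaves like a convex function with derivative m near 0, the tangent
   inequality being available at a dense set of points only. *)
Lemma quadratic_sandwich_pos (R : realType) (h m : R -> R) (good : R -> Prop) (t1 g Lam : R) :
  0 < t1 -> 0 < g -> 0 <= Lam -> (forall x y, x < y -> exists2 a, x < a < y & good a) ->
  (forall a b, good a -> `|a| <= t1 -> `|b| <= t1 -> m a * (b - a) <= h b - h a) ->
  (forall a b, `|a| <= t1 -> `|b| <= t1 -> `|h a - h b| <= Lam * `|a - b|) -> h 0 = 0 ->
  (forall t, `|t| <= t1 -> `|m t - g * t| <= g / 4 * `|t|) ->
  forall s, 0 <= s <= t1 / 2 -> g / 16 * s ^+ 2 <= h s <= 5 * g * s ^+ 2.
Proof.
move=> t10 g0 L0 dense tang lip h0 mg s /andP[s0 st].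
have mlow t : 0 <= t <= t1 -> 3 * g / 4 * t <= m t <= 5 * g / 4 * t.
  move=> /andP[t0 tt]; have := mg t; rewrite (ger0_norm t0) ler_norml => /(_ tt) /andP[]; lra.
have ab t : 0 <= t <= t1 -> `|t| <= t1 by move=> /andP[t0 tt]; rewrite ger0_norm.
(* The tangent at a good point p just right of 0 has nonnegative slope, so h a >= h p, and the
   Lipschitz bound makes h p arbitrarily small. *)
have hnn a : 0 <= a <= t1 -> 0 <= h a.
  move=> /andP[a0 at1]; have [->|an0] := eqVneq a 0; first by rewrite h0.
  have ap : 0 < a by rewrite lt_neqAle eq_sym an0.
  apply/ler_addgt0Pr => e e0.
  have [p /andP[p0 pe] gp] : exists2 p, 0 < p < Num.min a (e / (Lam + 1)) & good p.
    by apply: dense; rewrite lt_min ap divr_gt0// ltr_wpDl.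
  move: pe; rewrite lt_min => /andP[pa pe].
  have pt : 0 <= p <= t1 by rewrite ltW//= (le_trans (ltW pa)).
  have H1 := tang p a gp (ab _ pt) (ab a _).
  have {}H1 : 0 <= h a - h p.
    apply: le_trans (H1 _); last by rewrite ltW.
    by have /andP[m1 _] := mlow p pt; rewrite mulr_ge0 ?subr_ge0 ?(ltW pa)// (le_trans _ m1)// mulr_ge0 ?ltW// divr_gt0 ?mulr_gt0.
  have := lip p 0 (ab _ pt); rewrite normr0 h0 !subr0 (ger0_norm (ltW p0)) => /(_ (ltW t10)).
  have : p * (Lam + 1) < e by rewrite -ltr_pdivlMr// ltr_wpDl.
  rewrite ler_norml => X1 /andP[X2 _]; nra.
have [->|sn0] := eqVneq s 0; first by rewrite h0 expr0n !mulr0 lexx.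
have sp : 0 < s by rewrite lt_neqAle eq_sym sn0.
have sab : `|s| <= t1 by apply: ab; lra.
apply/andP; split.
  (* Lower bound: at a good point a between s/2 and 3s/4 the slope is at least 3 g s / 8 and at
     least s/4 remains to s, giving 3 g s^2 / 32 or more. *)
  have [a /andP[a1 a2] ga] : exists2 a, s / 2 < a < 3 * s / 4 & good a by apply: dense; lra.
  have at1 : 0 <= a <= t1 by lra.
  have H1 := tang a s ga (ab _ at1) sab; have H2 := hnn a at1.
  have /andP[m1 _] := mlow a at1.
  have m2 : 3 * g / 8 * s <= m a by nra.
  have : (3 * g / 8 * s) * (s / 4) <= m a * (s - a).
    by apply: ler_pM => //; [nra|lra|lra].
  nra.
apply/ler_addgt0Pr => e e0.
(* Upper bound: the tangent at a good point a just right of s, evaluated at 0, gives h a <= a m(a).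
   The condition a < 2 s limits this by 5 g s^2, and the Lipschitz bound returns from a to s. *)
have [a /andP[a1 a2] ga] : exists2 a, s < a < Num.min (2 * s) (s + e / (Lam + 1)) & good a.
  by apply: dense; rewrite lt_min ltrDl divr_gt0 ?ltr_wpDl// andbT; lra.
move: a2; rewrite lt_min => /andP[a2 a3].
have at1 : 0 <= a <= t1 by lra.
have := tang a 0 ga (ab _ at1); rewrite normr0 h0 !sub0r => /(_ (ltW t10)) H1.
have /andP[_ m1] := mlow a at1.
have H2 : h a <= 5 * g * s ^+ 2.
  have : m a * a <= 5 * g / 4 * (2 * s) * (2 * s).
    apply: ler_pM; [|lra|nra|lra].
    by have /andP[m2 _] := mlow a at1; nra.
  nra.
have := lip s a sab (ab _ at1); rewrite ler_norml => /andP[_].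
rewrite distrC (ger0_norm (_ : 0 <= a - s)); last lra.
have : (a - s) * (Lam + 1) < e by rewrite -ltr_pdivlMr ?ltr_wpDl//; lra.
nra.
Qed.

Lemma quadratic_sandwich (R : realType) (h m : R -> R) (good : R -> Prop) (t1 g Lam : R) :
  0 < t1 -> 0 < g -> 0 <= Lam -> (forall x y, x < y -> exists2 a, x < a < y & good a) ->
  (forall a b, good a -> `|a| <= t1 -> `|b| <= t1 -> m a * (b - a) <= h b - h a) ->
  (forall a b, `|a| <= t1 -> `|b| <= t1 -> `|h a - h b| <= Lam * `|a - b|) -> h 0 = 0 ->
  (forall t, `|t| <= t1 -> `|m t - g * t| <= g / 4 * `|t|) ->
  forall s, `|s| <= t1 / 2 -> g / 16 * s ^+ 2 <= h s <= 5 * g * s ^+ 2.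
Proof.
move=> t10 g0 L0 dense tang lip h0 mg s st.
have [s0|s0] := leP 0 s.
  apply: (@quadratic_sandwich_pos R h m good t1 g Lam) => //.
  by rewrite s0/=; move: st; rewrite ger0_norm.
rewrite -sqrrN -[s in h s]opprK.
apply: (@quadratic_sandwich_pos R (fun t => h (- t)) (fun t => - m (- t)) (fun t => good (- t)) t1 g Lam) => //.
- move=> x y xy; have [|a /andP[a1 a2] ga] := dense (- y) (- x); first by lra.
  by exists (- a); [lra|rewrite opprK].
- move=> a b ga a1 b1; have := tang (- a) (- b) ga; rewrite !normrN => /(_ a1 b1); lra.
- by move=> a b a1 b1; have := lip (- a) (- b); rewrite !normrN -opprD normrN; apply.
- by rewrite oppr0.
- move=> t tt; have := mg (- t); rewrite normrN => /(_ tt).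
  have -> : - m (- t) - g * t = - (m (- t) - g * - t) by ring.
  by rewrite normrN.
- by move: st; rewrite ltr0_norm// oppr_ge0 (ltW s0).
Qed.

Section convex_loss.
Context {R : realType}.
Variables rho psi : R -> R.
Hypothesis rho_convex : convex_function [set: R^o] rho.
Hypothesis rho_ac : absolutely_continuous rho.
Hypothesis rho_psi : {ae (@lebesgue_measure R), forall u, is_derive (u : R) (1 : R) rho (psi u)}.
Implicit Types (u x y a b t e q : R).

Lemma loss_convex x y t : 0 <= t <= 1 -> rho ((1 - t) * x + t * y) <= (1 - t) * rho x + t * rho y.
Proof.
move=> /andP[t0 t1]; have := rho_convex (Itv01 t0 t1) (mem_set (I : setT (y : R^o))) (mem_set (I : setT (x : R^o))).
have E (p q : R^o) : conv (Itv01 t0 t1) p q = (1 - t) * q + t * p by rewrite convRE /= addrC.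
move=> H; apply: (le_trans (le_trans _ H) _); rewrite le_eqVlt; apply/orP; left; apply/eqP.
  by congr rho; exact/esym/E.
exact: E.
Qed.

Lemma loss_continuous x : {for x, continuous rho}.
Proof.
apply/cvgrPdist_lt => e e0.
have [dl dl0 H] := @rho_ac (x - 1) (x + 1) e (ltac:(lra)) e0.
exists (Num.min dl 1); first by rewrite /= lt_min dl0 ltr01.
move=> y /=; rewrite lt_min => /andP[y1 y2].
have := H 1%N (fun=> Num.min x y) (fun=> Num.max x y).
rewrite !big_ord1 => Hy.
have E : `|rho (Num.max x y) - rho (Num.min x y)| = `|rho x - rho y|.
  by case: (leP x y) => _ //; rewrite distrC.
rewrite -E; apply: Hy.
- by move=> _; move: y2; rewrite ltr_norml; case: (leP x y) => xy /andP[? ?]; split; lra.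
- by move=> i j _ _ _; rewrite !ord1.
- by apply: le_lt_trans y1; rewrite ler_normr; case: (leP x y) => xy; apply/orP; [right|left]; lra.
Qed.

Definition tangent u := forall q, rho u + psi u * (q - u) <= rho q.

(** If the tangent exceeded rho at q by A > 0, convexity would keep rho below the tangent by A t at
    the point u + t (q - u), contradicting the o(t) error of the derivative. *)
Lemma derive_tangent u : is_derive (u : R) (1 : R) rho (psi u) -> tangent u.
Proof.
move=> Hd; have D : (fun h : R => h^-1 *: (rho (h *: (1 : R) + u) - rho u)) @ 0^' --> psi u.
  by case: Hd => ex <-; exact: ex.
move=> q; rewrite leNgt; apply/negP => Hq.
pose w := q - u; pose A := rho u + psi u * w - rho q.
have A0 : 0 < A by rewrite subr_gt0.
have w0 : 0 < `|w|.
  rewrite normr_gt0; apply: contraTneq A0 => w0; rewrite /A w0 mulr0 addr0.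
  by move/eqP : w0; rewrite subr_eq0 => /eqP ->; rewrite subrr ltxx.
have /cvgrPdist_lt/(_ (A / `|w|)) := D; rewrite divr_gt0// => /(_ isT)[dl /= dl0 Hdl].
pose t := Num.min 1 (dl / (2 * `|w|)).
have t0 : 0 < t by rewrite lt_min ltr01 divr_gt0// mulr_gt0.
have t1 : t <= 1 by rewrite ge_min lexx.
have tw : t * `|w| < dl.
  apply: (@le_lt_trans _ _ (dl / 2)); last by rewrite ltr_pdivrMr// ltr_pMr// ltr1n.
  rewrite -ler_pdivlMr// -mulrA -invfM ge_min; apply/orP; right.
  exact: lexx.
have h0 : t * w != 0 by apply: mulf_neq0; [rewrite gt_eqF|rewrite -normr_gt0].
have Hb : ball_ [eta Num.norm] 0 dl (t * w) by rewrite /= sub0r normrN normrM (gtr0_norm t0).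
have := Hdl (t * w) Hb h0.
rewrite /= scaler1 -[_ *: _]/(_ * _) (addrC (t * w) u) => H1.
have t01 : 0 <= t <= 1 by rewrite ltW.
have := loss_convex u q t01.
have -> : (1 - t) * u + t * q = u + t * w by rewrite /w; ring.
set Dl := rho (u + t * w) in H1 * => H2.
have : `|psi u * (t * w) - (Dl - rho u)| < A * t.
  have -> : psi u * (t * w) - (Dl - rho u) = (psi u - (t * w)^-1 * (Dl - rho u)) * (t * w).
    by rewrite mulrBl mulrAC mulVf// mul1r.
  rewrite normrM -ltr_pdivlMr ?normr_gt0//; apply: (lt_le_trans H1).
  rewrite normrM (gtr0_norm t0) invfM mulrA mulrAC -(mulrA A) mulrAC.
  by rewrite (mulrA (A / t)) divfK ?gt_eqF// lexx.
rewrite ltr_norml => /andP[_]; rewrite /A; move: H2; nra.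
Qed.

Lemma tangent_ae : {ae (@lebesgue_measure R), forall u, tangent u}.
Proof.
have FF := ae_filter_ringOfSetsType (@lebesgue_measure R).
by apply: filterS rho_psi => u; exact: derive_tangent.
Qed.

Lemma ae_dense (Q : R -> Prop) : {ae (@lebesgue_measure R), forall u, Q u} ->
  forall x y, x < y -> exists2 a, x < a < y & Q a.
Proof.
move=> aeQ x y xy; apply: contrapT => H.
have neg : (@lebesgue_measure R).-negligible (`]x, y[%classic : set (measurableTypeR R)).
  by apply: negligibleS aeQ => a /=; rewrite in_itv/= => axy Qa; apply: H; exists a.
have E0 := (negligibleP (@lebesgue_measure R) (measurable_itv `]x, y[)).1 neg.
have LE : (@lebesgue_measure R) (`]x, y[%classic : set R) = (y - x)%:E.
  by rewrite lebesgue_measure_itv /= lte_fin xy EFinB.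
have : (y - x)%:E = 0%E :> \bar R by rewrite -LE; exact: E0.
by move/eqP; rewrite eqe subr_eq0 gt_eqF.
Qed.

Hypothesis measurable_psi : measurable_fun setT psi.
Variables kap M1 : R.
Hypothesis kap0 : 0 < kap.
Hypothesis M10 : 0 < M1.
Hypothesis psi_osc : forall y, `|y| <= kap -> forall u, `|psi (u + y) - psi u| <= M1.

(** By (A3) every slope within distance kap of e is at most |psi e| + M1, a constant depending on e
    alone. Tangents exist only almost everywhere, so the tangent is taken slightly to the right of
    the larger-value point and continuity of rho closes the gap. *)
Lemma loss_lipschitz e a b : `|a| < kap -> `|b| < kap ->
  `|rho (e + a) - rho (e + b)| <= (`|psi e| + M1) * `|a - b|.
Proof.
pose L := `|psi e| + M1; have L0 : 0 < L by rewrite ltr_wpDl.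
have psiL p : `|p - e| <= kap -> `|psi p| <= L.
  move=> pe; have := psi_osc pe e; rewrite (addrC e) subrK => H.
  rewrite -(subrK (psi e) (psi p)) (le_trans (ler_normD _ _))// addrC lerD2l//.
have one x y : `|x - e| < kap -> `|y - e| < kap -> rho y - rho x <= L * `|y - x|.
  move=> xe ye; apply/ler_addgt0Pr => r r0.
  pose eta := r / (1 + L); have eta0 : 0 < eta by rewrite divr_gt0// addr_gt0.
  have [dl dl0 Hdl] := continuous_delta (@loss_continuous y) eta0.
  have [p /andP[p1 p2] tp] : exists2 p, y < p < Num.min (y + dl) (Num.min (y + eta) (e + kap)) & tangent p.
    apply: (ae_dense tangent_ae); rewrite !lt_min !ltrDl dl0 eta0 /=.
    by move: ye; rewrite ltr_norml; lra.
  move: p2; rewrite !lt_min => /and3P[p2 p3 p4].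
  have pL : `|psi p| <= L by apply: psiL; move: ye; rewrite ltr_norml ler_norml; lra.
  have py : `|p - y| < dl by rewrite ltr_norml; lra.
  have := Hdl _ py; rewrite ler_norml => /andP[H1 H2].
  have := tp x; have : psi p * (p - x) <= L * (`|y - x| + eta).
    apply: (le_trans (ler_norm _)); rewrite normrM; apply: ler_pM => //.
    have -> : p - x = (y - x) + (p - y) by ring.
    by rewrite (le_trans (ler_normD _ _))// lerD2l ger0_norm; lra.
  have : eta * (1 + L) = r by rewrite divfK// gt_eqF// addr_gt0.
  have -> : psi p * (x - p) = - (psi p * (p - x)) by ring.
  rewrite (mulrDr L) (mulrDr eta) mulr1 (mulrC eta L).
  by move: (L * `|_|) (L * eta) (psi p * _) => X X' X''; lra.
move=> ak bk; have Ea c : e + c - e = c by rewrite addrAC subrr add0r.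
have H1 : rho (e + a) - rho (e + b) <= L * `|a - b|.
  by have := one (e + b) (e + a); rewrite !Ea opprD addrACA subrr add0r; apply.
have H2 : rho (e + b) - rho (e + a) <= L * `|a - b|.
  by rewrite distrC; have := one (e + a) (e + b); rewrite !Ea opprD addrACA subrr add0r; apply.
rewrite -/L ler_norml; move: H1 H2; move: (L * _) => X H1 H2.
by apply/andP; split; lra.
Qed.

Context {d : measure_display} {W : measurableType d}.
Variable P : probability W R.
Variable eps : W -> R.
Hypothesis meps : measurable_fun setT eps.
Hypothesis psi_sq : (\int[P]_w ((psi (eps w)) ^+ 2)%:E < +oo)%E.
Hypothesis psi_mean : \int[P]_w psi (eps w) = 0.
Variable gam : R.
Hypothesis gam0 : 0 < gam.
Hypothesis psi_lin : (fun t : R => (\int[P]_w psi (eps w + t) - gam * t) / t) @ (0 : R)^' --> (0 : R).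

Let Lp w := `|psi (eps w)| + M1.

Let mrho : measurable_fun setT rho.
Proof. by apply: continuous_measurable_fun => x; exact: loss_continuous. Qed.

Let mLp : measurable_fun setT Lp.
Proof.
apply: measurable_funD => //; apply: measurableT_comp => //.
exact: measurableT_comp.
Qed.

Lemma slope_square_integrable : square_integrable P setT Lp.
Proof.
have s1 : square_integrable P setT (fun w => psi (eps w)).
  by split=> //; exact: measurableT_comp.
have s1' : square_integrable P setT (fun w => `|psi (eps w)|).
  split; first by apply: measurableT_comp => //; exact: measurableT_comp.
  by under eq_integral do rewrite real_normK ?num_real//.
have s2 : square_integrable P setT (fun=> M1).
  apply/square_integrableP; split=> //.
  exact: finite_measure_integrable_cst.
exact: square_integrableD.
Qed.

Lemma slope_integrable : P.-integrable setT (EFin \o Lp).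
Proof.
have s2 : square_integrable P setT (fun=> 1).
  apply/square_integrableP; split=> //.
  exact: finite_measure_integrable_cst.
have := square_integrableM measurableT slope_square_integrable s2.
by apply: eq_integrable => // w _; rewrite /= mulr1.
Qed.

Let int_Lp := slope_integrable.

Let mshift t : measurable_fun setT (fun w => rho (eps w + t)).
Proof. by apply: measurableT_comp => //; exact: measurable_funD. Qed.

Lemma excess_loss_integrable a b : `|a| < kap -> `|b| < kap ->
  P.-integrable setT (EFin \o (fun w => rho (eps w + a) - rho (eps w + b))).
Proof.
move=> ak bk; apply: (@le_integrable_EFin _ _ _ P setT measurableT _ (fun w => `|a - b| * Lp w)).
- exact: measurable_funB.
- by move=> w _; rewrite mulrC; exact: loss_lipschitz.
- exact: integrableZ_EFin.
Qed.

Definition excess_loss t := \int[P]_w (rho (eps w + t) - rho (eps w + 0)).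

Let kap0' : `|0 : R| < kap. Proof. by rewrite normr0. Qed.

Lemma excess_lossB a b : `|a| < kap -> `|b| < kap ->
  excess_loss a - excess_loss b = \int[P]_w (rho (eps w + a) - rho (eps w + b)).
Proof.
move=> ak bk; rewrite /excess_loss -RintegralB//; [|exact: excess_loss_integrable|exact: excess_loss_integrable].
by apply: eq_Rintegral => w _; ring.
Qed.

Let lip_excess a b : `|a| < kap -> `|b| < kap ->
  `|excess_loss a - excess_loss b| <= (\int[P]_w Lp w) * `|a - b|.
Proof.
move=> ak bk; rewrite excess_lossB// (le_trans (le_normr_Rintegral measurableT (excess_loss_integrable ak bk)))//.
rewrite mulrC -RintegralZl//; apply: le_Rintegral => //.
- by have := integrable_abse (excess_loss_integrable ak bk).
- exact: integrableZ_EFin.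
- by move=> w _; rewrite mulrC; exact: loss_lipschitz.
Qed.

Let shift_null (N : set (measurableTypeR R)) (e : R) : measurable N -> (@lebesgue_measure R) N = 0%E ->
  (@lebesgue_measure R) [set a | N (e + a)] = 0%E.
Proof.
move=> mN N0; rewrite -N0.
have mf : measurable_fun setT (fun a : measurableTypeR R => (e + a : measurableTypeR R)).
  exact: measurable_funD.
rewrite -[LHS]/(pushforward (@lebesgue_measure R) (fun a : measurableTypeR R => (e + a : measurableTypeR R)) N).
apply/esym/lebesgue_measure_unique => //= _ [[a b]] _ <-.
rewrite /pushforward /=.
have -> : (fun a0 : R => e + a0) @^-1` `]a, b]%classic = `]a - e, b - e]%classic.
  by apply/seteqP; split=> z /=; rewrite !in_itv /= => /andP[z1 z2]; apply/andP; split; lra.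
rewrite !lebesgue_measure_itv /= !lte_fin ltrD2r.
by case: ifP => // _; rewrite -!EFinB; congr (_%:E); ring.
Qed.

(* Fubini: the exceptional null set is hit by eps + t with probability 0, for
   almost every t. *)
Let tangent_shift : {ae (@lebesgue_measure R), forall t, {ae P, forall w, tangent (eps w + t)}}.
Proof.
have [N [mN N0 HN]] := tangent_ae.
pose A : set (W * measurableTypeR R) := [set p | N (eps p.1 + p.2)].
have mA : measurable A.
  have mg : measurable_fun setT (fun p : W * measurableTypeR R => (eps p.1 + p.2 : measurableTypeR R)).
    apply: measurable_funD; first exact: measurableT_comp.
    exact: measurable_snd.
  by rewrite -[X in measurable X]setTI; exact: mg.
pose f (p : W * measurableTypeR R) : \bar R := (\1_A p)%:E.
have mf : measurable_fun setT f by apply/measurable_EFinP; exact: measurable_indic.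
have f0 p : (0 <= f p)%E by rewrite lee_fin.
have I0 : (\int[P \x (@lebesgue_measure R)]_p f p = 0)%E.
  rewrite fubini_tonelli1//; apply: integral0_eq => w _; rewrite /fubini_F.
  rewrite -[LHS]/(\int[@lebesgue_measure R]_y (\1_[set a | N (eps w + a)] y)%:E)%E.
  rewrite integral_indic// ?setIT; first exact: shift_null.
  rewrite -[X in measurable X]setTI.
  have mf' : measurable_fun setT (fun a : measurableTypeR R => (eps w + a : measurableTypeR R)).
    exact: measurable_funD.
  exact: mf'.
rewrite fubini_tonelli2// in I0.
have mG : measurable_fun setT (fubini_G P f) by exact: measurable_fun_fubini_tonelli_G.
have G0 y : (0 <= fubini_G P f y)%E by apply: integral_ge0.
have := (ae_eq_integral_abs (@lebesgue_measure R) measurableT mG).1.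
have -> : (\int[@lebesgue_measure R]_x `|fubini_G P f x| = 0)%E.
  by under eq_integral do rewrite gee0_abs//.
have FF := ae_filter_ringOfSetsType (@lebesgue_measure R).
move=> /(_ erefl); apply: filterS => t /(_ I) Ht.
exists [set w | N (eps w + t)]; split.
- rewrite -[X in measurable X]setTI.
  have mf' : measurable_fun setT (fun w => (eps w + t : measurableTypeR R)).
    exact: measurable_funD.
  exact: mf'.
- transitivity (fubini_G P f t); last exact: Ht.
  rewrite /fubini_G -[RHS]/(\int[P]_w (\1_[set w | N (eps w + t)] w)%:E)%E.
  rewrite integral_indic// ?setIT//.
  rewrite -[X in measurable X]setTI.
  have mf' : measurable_fun setT (fun w => (eps w + t : measurableTypeR R)).
    exact: measurable_funD.
  exact: mf'.
- by move=> w /= Hw; apply: HN => /=.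
Qed.

Let int_psi t : `|t| <= kap -> P.-integrable setT (EFin \o (fun w => psi (eps w + t))).
Proof.
move=> tk; apply: (@le_integrable_EFin _ _ _ P setT measurableT _ Lp) => //.
  by apply: measurableT_comp => //; exact: measurable_funD.
move=> w _; have := psi_osc tk (eps w).
rewrite -[X in `|X| <= Lp w](subrK (psi (eps w))) => H; rewrite (le_trans (ler_normD _ _))// addrC lerD2l//.
Qed.

(** Instance of [quadratic_sandwich] with m t = E psi(eps + t), the good shifts being those at which
    the tangent inequality holds almost surely and can be integrated. (A4) gives the tolerance gam /
    4 on the slope. *)
Lemma excess_loss_quadratic : exists2 k1, 0 < k1 < kap & forall s, `|s| <= k1 ->
  gam / 16 * s ^+ 2 <= excess_loss s <= 5 * gam * s ^+ 2.
Proof.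
have g4 : 0 < gam / 4 by rewrite divr_gt0.
have /cvgrPdist_lt/(_ _ g4)[dl /= dl0 Hdl] := psi_lin.
pose t1 := Num.min (dl / 2) (kap / 2).
have t10 : 0 < t1 by rewrite lt_min !divr_gt0.
have t1dl : t1 < dl by rewrite gt_min; apply/orP; left; lra.
have t1k : t1 < kap by rewrite gt_min; apply/orP; right; have := kap0; lra.
exists (t1 / 2); first by lra.
pose m t := \int[P]_w psi (eps w + t).
apply: (@quadratic_sandwich R excess_loss m
  (fun a => {ae P, forall w, tangent (eps w + a)}) t1 gam (\int[P]_w Lp w)) => //.
- by apply: Rintegral_ge0 => w _; rewrite addr_ge0 ?normr_ge0 ?ltW.
- exact: ae_dense tangent_shift.
- move=> a b ta a1 b1; have ak := le_lt_trans a1 t1k; have bk := le_lt_trans b1 t1k.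
  rewrite excess_lossB// /m -RintegralZr//; last exact: int_psi (ltW ak).
  have ip : P.-integrable setT (EFin \o (fun w => psi (eps w + a) * (b - a))).
    have := integrableZ_EFin measurableT (b - a) (int_psi (ltW ak)).
    by apply: eq_integrable => // w _; rewrite /= mulrC.
  rewrite -subr_ge0 -RintegralB//; last exact: excess_loss_integrable.
  pose D w := rho (eps w + b) - rho (eps w + a) - psi (eps w + a) * (b - a).
  have mDw : measurable_fun setT D.
    by apply: measurable_funB; [exact: measurable_funB|apply: measurable_funM => //; apply: measurableT_comp => //; exact: measurable_funD].
  (* D is nonnegative only almost everywhere, so it is exchanged for its positive part. *)
  rewrite -[leRHS]/(\int[P]_w D w) (@Rintegral_ae_eq _ _ _ P setT measurableT _ (fun w => Num.max (D w) 0))//.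
  - by apply: Rintegral_ge0 => w _; rewrite le_max lexx orbT.
  - exact: measurable_maxr.
  have FF := ae_filter_ringOfSetsType P.
  apply: filterS ta => w /(_ (eps w + b)) Hw _.
  rewrite max_l// /D subr_ge0 lerBrDl.
  by have -> : b - a = eps w + b - (eps w + a) by ring.
- by move=> a b a1 b1; apply: lip_excess; exact: le_lt_trans t1k.
- by rewrite /excess_loss /Rintegral (eq_integral (fun=> 0%E)) ?integral0// => w _; rewrite subrr.
- move=> t tt; have [->|tn0] := eqVneq t 0.
    rewrite mulr0 subr0 normr0 mulr0 /m.
    have -> : \int[P]_w psi (eps w + 0) = 0.
      by rewrite -[RHS]psi_mean; apply: eq_Rintegral => w _; rewrite addr0.
    by rewrite normr0.
  have Hb : ball_ [eta Num.norm] 0 dl t by rewrite /= sub0r normrN (le_lt_trans tt).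
  have := Hdl t Hb tn0.
  rewrite sub0r normrN normrM normfV ltr_pdivrMr ?normr_gt0// => /ltW; exact.
Qed.

End convex_loss.

Lemma prod_Rintegral {d1 d2} {T1 : measurableType d1} {T2 : measurableType d2} {R : realType}
    (m1 : {sigma_finite_measure set T1 -> \bar R}) (m2 : {sigma_finite_measure set T2 -> \bar R})
    (f : T1 -> R) (g : T2 -> R) :
  m1.-integrable setT (EFin \o f) -> m2.-integrable setT (EFin \o g) ->
  (m1 \x m2)%E.-integrable setT (EFin \o (fun p : T1 * T2 => f p.1 * g p.2)) /\
  \int[(m1 \x m2)%E]_p (f p.1 * g p.2) = (\int[m1]_x f x) * (\int[m2]_y g y).
Proof.
move=> If Ig.
have mf : measurable_fun setT f by have /measurable_int/measurable_EFinP := If.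
have mg : measurable_fun setT g by have /measurable_int/measurable_EFinP := Ig.
have mfg : measurable_fun setT (fun p : T1 * T2 => f p.1 * g p.2).
  by apply: measurable_funM; exact: measurableT_comp.
have If' := integrable_abse If; have Ig' := integrable_abse Ig.
have intg : (m1 \x m2)%E.-integrable setT (EFin \o (fun p : T1 * T2 => f p.1 * g p.2)).
  apply/integrable12ltyP; first exact/measurable_EFinP.
  pose c := \int[m2]_y `|g y|.
  have Ec : (\int[m2]_y `|(g y)%:E| = c%:E)%E.
    by rewrite /c /Rintegral fineK//; exact: (integrable_fin_num measurableT Ig').
  under eq_integral => x _.
    rewrite (_ : (\int[m2]_y `|(EFin \o (fun p : T1 * T2 => (f p.1 * g p.2)%R)) (x, y)|)%E = (`|f x| * c)%:E); last first.
      rewrite EFinM -Ec -ge0_integralZl_EFin//.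
        by apply: eq_integral => y _; rewrite /= normrM EFinM.
      by apply/measurable_EFinP; exact: measurableT_comp.
    over.
  have Ifc : m1.-integrable setT (EFin \o (fun x => `|f x| * c)).
    have := integrableZ_EFin measurableT c If'.
    by apply: eq_integrable => // x _; rewrite /= mulrC.
  move/integrableP : Ifc => [_]; apply: le_lt_trans; apply: ge0_le_integral => //.
  - by move=> x _; rewrite lee_fin mulr_ge0// Rintegral_ge0.
  - apply/measurable_EFinP; apply: measurable_funM => //; exact: measurableT_comp.
  - apply: measurableT_comp => //; apply/measurable_EFinP; apply: measurable_funM => //; exact: measurableT_comp.
  - by move=> x _; rewrite /= lee_fin ler_norm.
split=> //.
rewrite {1}/Rintegral -integral12_prod_meas1//.
have Eg x : fubini_F m2 (EFin \o (fun p : T1 * T2 => f p.1 * g p.2)) x = (f x * \int[m2]_y g y)%:E.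
  rewrite /fubini_F -RintegralZl// /Rintegral fineK//.
  by have := integrableZ_EFin measurableT (f x) Ig => /(integrable_fin_num measurableT).
under eq_integral do rewrite Eg.
rewrite -[LHS]/(\int[m1]_x (f x * \int[m2]_y g y)) RintegralZr//.
Qed.

(** * Orthonormality of the tensor basis and comparison with the design measure *)

Section tensor_orthonormality.
Context {R : realType}.
Variable phi : nat -> R -> R.
Local Notation I01 := (`[0%R, 1%R]%classic : set R).
Local Notation leb := (@lebesgue_measure R).
Hypothesis mphi : forall j, measurable_fun I01 (phi j).
Hypothesis sphi : forall j, square_integrable leb I01 (phi j).
Hypothesis ophi : forall i j, \int[leb]_(x in I01) (phi i x * phi j x) = (i == j)%:R.

(** Induction along the pushforward that builds the measure on tuples. Restricting to the cube by
    zero extension makes the integrand a product of a function of the head and one of the tail on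
    the whole space. *)
Lemma tensor_orthonormal d (i i' : d.-tuple nat) :
  (lebesgue_tuple d).-integrable (@unit_cube R d)
     (EFin \o (fun x => tensor_phi phi i x * tensor_phi phi i' x)) /\
  \int[lebesgue_tuple d]_(x in @unit_cube R d) (tensor_phi phi i x * tensor_phi phi i' x) = (i == i')%:R.
Proof.
have mC e : measurable (@unit_cube R e) by exact: measurable_unit_cube.
elim: d i i' => [|d IH] i i'.
  have E (j : 0.-tuple nat) x : tensor_phi phi j x = 1 by rewrite /tensor_phi big_ord0.
  have -> : (fun x : 0.-tuple R => tensor_phi phi i x * tensor_phi phi i' x) = (fun=> 1).
    by apply/funext => x; rewrite !E mulr1.
  have D1 : lebesgue_tuple 0 (@unit_cube R 0) = 1%E.
    by rewrite /= diracE mem_set// => -[].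
  have Ei : i = i' by rewrite (tuple0 i) (tuple0 i').
  split; last first.
    apply: (etrans (Rintegral_cst _ (mC 0%N) 1)).
    by apply: (etrans (f_equal (fun z => 1 * fine z) D1)); rewrite mul1r Ei eqxx.
  apply/integrableP; split; first by apply/measurable_EFinP; exact: measurable_cst.
  rewrite [X in (X < _)%E](_ : _ = 1%E) ?ltry// (eq_integral (cst 1%E)) => [|x _]; last by rewrite /= normr1.
  by apply: (etrans (integral_cst _ (mC 0%N) 1%E)); apply: (etrans (f_equal (mule 1%E) D1)); rewrite mule1.
case/tupleP: i => j t; case/tupleP: i' => j' t'.
have [IH1 IH2] := IH t t'.
pose f (y : R) := phi j y * phi j' y.
pose g (y : d.-tuple R) := tensor_phi phi t y * tensor_phi phi t' y.
pose F (x : d.+1.-tuple R) := tensor_phi phi [tuple of j :: t] x * tensor_phi phi [tuple of j' :: t'] x.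
have FE p : (F \_ (@unit_cube R d.+1)) (tuple_cons p) = (f \_ I01) p.1 * (g \_ (@unit_cube R d)) p.2.
  have hd : thead (tuple_cons p) = p.1 by rewrite /tuple_cons theadE.
  have tl : [tuple of behead (tuple_cons p)] = p.2 by apply: val_inj.
  rewrite !patchE; case: ifPn => [/set_mem/unit_cube_cons|].
    rewrite hd tl => -[H1 H2]; rewrite !mem_set//.
    by rewrite /F /f /g !tensor_phi_cons hd tl; ring.
  rewrite notin_setE => H; case: ifPn => [/set_mem H1|_]; last by rewrite mul0r.
  case: ifPn => [/set_mem H2|_]; last by rewrite mulr0.
  by exfalso; apply: H; apply/unit_cube_cons; rewrite hd tl.
have If : leb.-integrable I01 (EFin \o f) by exact: (square_integrableM (@measurable_I01 R)).
have If' : leb.-integrable setT (EFin \o (f \_ I01)).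
  by rewrite -restrict_EFin; exact: (iffLR (integrable_mkcond _ (@measurable_I01 R)) If).
have Ig' : (lebesgue_tuple d).-integrable setT (EFin \o (g \_ (@unit_cube R d))).
  by rewrite -restrict_EFin; exact: (iffLR (integrable_mkcond _ (mC d)) IH1).
have [IFG EFG] := prod_Rintegral If' Ig'.
have mF : measurable_fun setT (EFin \o (F \_ (@unit_cube R d.+1))).
  apply/measurable_EFinP; apply/(measurable_restrictT _ (mC d.+1)).
  by apply: measurable_funM; exact: measurable_tensor_phi.
have EFc : (EFin \o (F \_ (@unit_cube R d.+1))) \o (@tuple_cons R d) =
   EFin \o (fun p => (f \_ I01) p.1 * (g \_ (@unit_cube R d)) p.2).
  by apply/funext => p /=; rewrite FE.
have IFc : (leb \x lebesgue_tuple d)%E.-integrable (@tuple_cons R d @^-1` setT)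
    ((EFin \o (F \_ (@unit_cube R d.+1))) \o (@tuple_cons R d)).
  by rewrite EFc preimage_setT.
have IP := integrable_pushforward (@measurable_tuple_cons R d) mF IFc measurableT.
have EP := integral_pushforward (@measurable_tuple_cons R d) mF IFc measurableT.
split.
  by apply/integrable_mkcond; [exact: mC|rewrite restrict_EFin; exact: IP].
rewrite Rintegral_mkcond /Rintegral.
transitivity (fine (\int[(leb \x lebesgue_tuple d)%E]_x ((EFin \o (F \_ (@unit_cube R d.+1))) \o (@tuple_cons R d)) x)%E).
  exact: (congr1 fine EP).
rewrite EFc -[LHS]/(Rintegral _ _ _) EFG -!Rintegral_mkcond ophi IH2.
rewrite -[RHS]/((((j == j') && (t == t') : bool))%:R : R).
by case: (j == j'); rewrite ?mul1r ?mul0r.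
Qed.

Lemma tensor_comb_sqnorm d (r : seq (d.-tuple nat)) (a : d.-tuple nat -> R) : uniq r ->
  (lebesgue_tuple d).-integrable (@unit_cube R d)
    (EFin \o (fun x => (\sum_(i <- r) a i * tensor_phi phi i x) ^+ 2)) /\
  \int[lebesgue_tuple d]_(x in @unit_cube R d) (\sum_(i <- r) a i * tensor_phi phi i x) ^+ 2 =
  \sum_(i <- r) a i ^+ 2.
Proof.
move=> ur; have mC : measurable (@unit_cube R d) by exact: measurable_unit_cube.
have E : (fun x => (\sum_(i <- r) a i * tensor_phi phi i x) ^+ 2) =
   (fun x => \sum_(i <- r) \sum_(i' <- r) (a i * a i') * (tensor_phi phi i x * tensor_phi phi i' x)).
  apply/funext => x; rewrite expr2 big_distrlr /=; apply: eq_bigr => i _; apply: eq_bigr => i' _.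
  by rewrite mulrACA.
have I1 i i' : (lebesgue_tuple d).-integrable (@unit_cube R d)
    (EFin \o (fun x => (a i * a i') * (tensor_phi phi i x * tensor_phi phi i' x))).
  by apply: (integrableZ_EFin mC); have [] := tensor_orthonormal i i'.
have I2 i : (lebesgue_tuple d).-integrable (@unit_cube R d)
    (EFin \o (fun x => \sum_(i' <- r) (a i * a i') * (tensor_phi phi i x * tensor_phi phi i' x))).
  by apply: integrable_sum_EFin => // i' _; exact: I1.
rewrite E; split; first by apply: integrable_sum_EFin => // i _; exact: I2.
rewrite (Rintegral_sum mC) => [|i _]; last exact: I2.
rewrite !big_seq; apply: eq_bigr => i ir.
rewrite (Rintegral_sum mC) => [|i' _]; last exact: I1.
rewrite (eq_bigr (fun i' => a i * a i' * (i == i')%:R)) => [|i' _]; last first.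
  by have [Ii Ei] := tensor_orthonormal i i'; rewrite RintegralZl// Ei.
rewrite (bigD1_seq i)//= eqxx mulr1 big1 ?addr0 ?expr2// => i' ii'.
by rewrite eq_sym (negbTE ii') mulr0.
Qed.

End tensor_orthonormality.

Section integral_le_measure.
Import HBNNSimple.

Lemma ge0_le_integral_of_le_measure {d} {T : measurableType d} {R : realType}
    (m1 m2 : {measure set T -> \bar R}) (D : set T) (f : T -> \bar R) : measurable D ->
  (forall S, measurable S -> S `<=` D -> m1 S <= m2 S)%E ->
  (forall x, D x -> 0 <= f x)%E ->
  (\int[m1]_(x in D) f x <= \int[m2]_(x in D) f x)%E.
Proof.
move=> mD m12 f0; rewrite !ge0_integralE//= ge_ereal_sup// => _ [h /= hf] <-.
apply: le_ereal_sup_tmp; exists (sintegral m2 h); first by exists h.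
rewrite !sintegralE lee_fsum// => r [t _ <-].
have [->|h0] := eqVneq (h t) 0; first by rewrite !mul0e.
apply: lee_pmul; rewrite ?lee_fin//.
apply: m12 => // y /= hy; apply: contrapT => Dy.
have := hf y; rewrite patchE memNset//= hy lee_fin leNgt.
by rewrite lt_neqAle eq_sym h0 /= fun_ge0.
Qed.

End integral_le_measure.

(** Transfers squared errors from L^2(v), where the statistical analysis takes place, to the
    Lebesgue norm of the conclusion. *)
Lemma lebesgue_le_density (R : realType) d (v : {measure set (d.-tuple R) -> \bar R}) :
  bounded_density v -> exists2 c : R, 0 < c &
    forall f : d.-tuple R -> \bar R, measurable_fun (@unit_cube R d) f ->
      (forall x, unit_cube x -> 0 <= f x)%E ->
      (c%:E * \int[lebesgue_tuple d]_(x in @unit_cube R d) f x <= \int[v]_(x in @unit_cube R d) f x)%E.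
Proof.
move=> [p [c1 [c2 [c10 mp pc vE]]]]; exists c1 => // f mf f0.
have mC : measurable (@unit_cube R d) by exact: measurable_unit_cube.
have := @ge0_integral_mscale _ _ R (lebesgue_tuple d) _ mC (NngNum (ltW c10)) f mf f0.
rewrite /= => <-; apply: ge0_le_integral_of_le_measure => // S mS SC.
apply: (@le_trans _ _ (\int[lebesgue_tuple d]_(x in S) (cst c1%:E) x)%E).
  by rewrite integral_cst//; exact: lexx.
rewrite vE// (setIidl SC); apply: ge0_le_integral => //.
- by move=> x _; rewrite lee_fin ltW.
- by apply/measurable_EFinP; exact: measurable_funS mp.
- by move=> x Sx; rewrite lee_fin; have /andP[] := pc x (SC x Sx).
Qed.

(** * The sample *)

Section image_measure.
Context {d1 d2 : measure_display} {X : measurableType d1} {Y : measurableType d2} {R : realType}.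
Variables (m1 : {measure set X -> \bar R}) (m2 : {measure set Y -> \bar R}) (phi : X -> Y).
Hypothesis mphi : measurable_fun setT phi.
Hypothesis m12 : forall A, measurable A -> m1 (phi @^-1` A) = m2 A.

Lemma ge0_image_integral (f : Y -> \bar R) : measurable_fun setT f -> (forall y, 0 <= f y)%E ->
  (\int[m1]_x f (phi x) = \int[m2]_y f y)%E.
Proof.
move=> mf f0.
have /esym E := @ge0_integral_pushforward _ _ _ _ R _ mphi m1 setT f measurableT mf (fun y _ => f0 y).
apply: (etrans E).
apply: (@eq_measure_integral _ _ _ _ m2 (measure_function_pushforward__canonical__measure_function_Measure m1 mphi)).
by move=> A mA _; rewrite -m12.
Qed.

Lemma image_integral (f : Y -> R) : m2.-integrable setT (EFin \o f) ->
  m1.-integrable setT (EFin \o (fun x => f (phi x))) /\ \int[m1]_x f (phi x) = \int[m2]_y f y.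
Proof.
move=> intf; have mf : measurable_fun setT (EFin \o f) by exact: (measurable_int _ intf).
have intg : m1.-integrable setT (EFin \o (fun x => f (phi x))).
  apply/integrableP; split; first exact: (measurableT_comp mf mphi).
  rewrite (@ge0_image_integral (fun y => `|(f y)%:E|)%E) => //; last exact: measurableT_comp.
  by have /integrableP[] := intf.
split=> //; rewrite /Rintegral; congr fine.
have /esym E := @integral_pushforward _ _ _ _ R _ mphi m1 setT (EFin \o f) mf intg measurableT.
apply: (etrans E).
apply: (@eq_measure_integral _ _ _ _ m2 (measure_function_pushforward__canonical__measure_function_Measure m1 mphi)).
by move=> A mA _; rewrite -m12.
Qed.

End image_measure.
Lemma iid_bigcap {dO dE : measure_display} {Omega : measurableType dO} {E : measurableType dE}
    {R : realType} (P : probability Omega R) (X : nat -> {mfun Omega >-> E}) n (A : 'I_n -> set E) :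
  iid P X -> (forall l, measurable (A l)) ->
  (P (\bigcap_(l in [set: 'I_n]) X l @^-1` A l) = \prod_(l < n) P (X l @^-1` A l))%E.
Proof.
move=> [HX _] mA; pose A' i := if insub i is Some l then A l else setT.
have A'E (l : 'I_n) : A' l = A l by rewrite /A' valK.
have mA' i : measurable (A' i) by rewrite /A'; case: insub => //; exact: measurableT.
have := HX [fset i in iota 0 n]%fset A' mA'.
have -> : \bigcap_(i in [set` [fset i in iota 0 n]%fset]) X i @^-1` A' i =
    \bigcap_(l in [set: 'I_n]) X l @^-1` A l.
  apply/seteqP; split=> w Hw.
    by move=> l _; have := Hw l; rewrite /= A'E; apply; rewrite !inE mem_iota /=.
  move=> i /=; rewrite !inE mem_iota /= add0n => ni.
  by have := Hw (Ordinal ni) Logic.I; rewrite /= -A'E.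
move=> ->.
transitivity (\prod_(i <- iota 0 n) P (X i @^-1` A' i))%E.
  apply: perm_big; apply: uniq_perm; [exact: fset_uniq|exact: iota_uniq|].
  by move=> i; rewrite !inE.
have -> : iota 0 n = index_iota 0 n by rewrite /index_iota subn0.
by rewrite big_mkord; apply: eq_bigr => l _; rewrite A'E.
Qed.

Lemma sigma_generated_bigcap {dO dE : measure_display} {Omega : measurableType dO} {E : measurableType dE}
    {R : realType} (X : nat -> {mfun Omega >-> E}) n (A : 'I_n -> set E) :
  (forall l, measurable (A l)) -> sigma_generated X (\bigcap_(l in [set: 'I_n]) X l @^-1` A l).
Proof.
move=> mA; pose G := \bigcup_i preimage_set_system setT (X i) (@measurable _ E).
apply: (@fin_bigcap_measurable _ (g_sigma_algebraType G)) => // l _.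
apply: sub_sigma_algebra; exists (l : nat) => //; exists (A l) => //.
by rewrite setTI.
Qed.

Section sample_law.
Context {dO dX dY : measure_display} {Omega : measurableType dO} {X : measurableType dX}
  {Y : measurableType dY} {R : realType}.
Variables (P : probability Omega R) (x : nat -> {mfun Omega >-> X}) (eps : nat -> {mfun Omega >-> Y}).
Hypotheses (x_iid : iid P x) (eps_iid : iid P eps) (x_eps : independent_families P x eps).

Let xe l (w : Omega) := (x l w, eps l w).

Lemma measurable_sample l : measurable_fun setT (xe l).
Proof. by apply/measurable_fun_pairP; split; exact: measurable_funPT. Qed.

Let sigma1 (Z : nat -> {mfun Omega >-> X}) l A : measurable A -> sigma_generated Z (Z l @^-1` A).
Proof.
by move=> mA; apply: sub_sigma_algebra; exists l => //; exists A => //; rewrite setTI.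
Qed.

Let sigma2 (Z : nat -> {mfun Omega >-> Y}) l A : measurable A -> sigma_generated Z (Z l @^-1` A).
Proof.
by move=> mA; apply: sub_sigma_algebra; exists l => //; exists A => //; rewrite setTI.
Qed.

(** Factorization on measurable rectangles, the pi-system that the maximal inequality asks for. *)
Lemma sample_indep n (A : 'I_n -> set (X * Y)) :
  (forall l, [set B `*` C | B in measurable & C in measurable] (A l)) ->
  (P (\bigcap_(l in [set: 'I_n]) xe l @^-1` A l) = \prod_(l < n) P (xe l @^-1` A l))%E.
Proof.
move=> HA; have {HA}/choice[BC HBC] : forall l, exists p : set X * set Y,
    [/\ measurable p.1, measurable p.2 & A l = p.1 `*` p.2].
  by move=> l; have [B mB [C mC <-]] := HA l; exists (B, C).
have mB l : measurable (BC l).1 by have [] := HBC l.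
have mC l : measurable (BC l).2 by have [] := HBC l.
have AE (l : 'I_n) : xe l @^-1` A l = x l @^-1` (BC l).1 `&` eps l @^-1` (BC l).2.
  by have [_ _ ->] := HBC l.
transitivity (P ((\bigcap_(l in [set: 'I_n]) x l @^-1` (BC l).1) `&`
   (\bigcap_(l in [set: 'I_n]) eps l @^-1` (BC l).2))).
  by rewrite -bigcapI; congr (P _); apply: eq_bigcapr => l _; exact: AE.
rewrite x_eps; [|exact: sigma_generated_bigcap|exact: sigma_generated_bigcap].
rewrite (iid_bigcap x_iid)// (iid_bigcap eps_iid)// -big_split /=.
apply: eq_bigr => l _; rewrite AE x_eps//; [exact: sigma1|exact: sigma2].
Qed.

Let nu := distribution P (eps 0%N).

Lemma sample_law (v : probability X R) (x_law : forall A, measurable A -> distribution P (x 0%N) A = v A)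
  l S : measurable S -> P (xe l @^-1` S) = (v \x nu)%E S.
Proof.
move=> mS; have mz := measurable_sample l.
have := @product_measure_unique _ _ _ _ R v nu (distribution P (mfun_Sub (mem_set mz) : {mfun Omega >-> (X * Y)%type})).
move=> /(_ _ _ mS) => -> // A B mA mB.
rewrite -[LHS]/(P (x l @^-1` A `&` eps l @^-1` B)).
rewrite x_eps; [|exact: sigma1|exact: sigma2].
have [_ Hx] := x_iid; have [_ He] := eps_iid.
exact: (f_equal2 mule (etrans (Hx l A mA) (x_law _ mA)) (He l B mB)).
Qed.

End sample_law.

(** From (g - 2 r)^2 >= 0 one has (r - g)^2 >= g^2 / 2 - r^2; the loss gam r^2 / 16 together with 5
    gam r^2 is rounded up to 6 gam r^2. *)
Lemma quadratic_increment (R : realFieldType) (gam A B r g : R) : 0 < gam ->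
  gam / 16 * (r - g) ^+ 2 <= A -> B <= 5 * gam * r ^+ 2 ->
  gam / 32 * g ^+ 2 - 6 * gam * r ^+ 2 <= A - B.
Proof.
move=> g0 q1 q2.
have : gam / 32 * (g - 2 * r) ^+ 2 >= 0 by apply: mulr_ge0; [lra|exact: sqr_ge0].
have : gam * r ^+ 2 >= 0 by apply: mulr_ge0; [lra|exact: sqr_ge0].
move: q1 q2; nra.
Qed.

Section loss_increment.
Context {dO dX : measure_display} {Omega : measurableType dO} {X : measurableType dX} {R : realType}.
Variables rho psi : R -> R.
Hypothesis rho_convex : convex_function [set: R^o] rho.
Hypothesis rho_ac : absolutely_continuous rho.
Hypothesis rho_psi : {ae (@lebesgue_measure R), forall u, is_derive (u : R) (1 : R) rho (psi u)}.
Hypothesis measurable_psi : measurable_fun setT psi.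
Variables kap M1 : R.
Hypothesis kap0 : 0 < kap.
Hypothesis M10 : 0 < M1.
Hypothesis psi_osc : forall y, `|y| <= kap -> forall u, `|psi (u + y) - psi u| <= M1.
Variables (P : probability Omega R) (x : nat -> {mfun Omega >-> X}) (eps : nat -> {mfun Omega >-> R}).
Hypotheses (x_iid : iid P x) (eps_iid : iid P eps) (x_eps : independent_families P x eps).
Variables (v : probability X R) (x_law : forall A, measurable A -> distribution P (x 0%N) A = v A).
Hypothesis psi_sq : (\int[P]_w ((psi (eps 0%N w)) ^+ 2)%:E < +oo)%E.

Let slope (e : R) := `|psi e| + M1.
Let nu := distribution P (eps 0%N).

Let mslope : measurable_fun setT slope.
Proof. by apply: measurable_funD => //; exact: measurableT_comp. Qed.

Let slope_ge0 e : 0 <= slope e.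
Proof. by rewrite addr_ge0// ltW. Qed.

Let meps0 : measurable_fun setT (eps 0%N). Proof. exact: measurable_funPT. Qed.

Lemma slope_second_moment : exists2 V : R, 0 <= V &
  forall l, (\int[P]_w ((`|psi (eps l w)| + M1) ^+ 2)%:E <= V%:E)%E.
Proof.
have [_ fin] := slope_square_integrable measurable_psi M1 meps0 psi_sq.
have i0 : (0 <= \int[P]_w ((`|psi (eps 0%N w)| + M1) ^+ 2)%:E)%E.
  by apply: integral_ge0 => w _; rewrite lee_fin sqr_ge0.
exists (fine (\int[P]_w ((`|psi (eps 0%N w)| + M1) ^+ 2)%:E)%E); first exact: fine_ge0.
move=> l; rewrite fineK; last by rewrite ge0_fin_numE.
have [_ He] := eps_iid.
have ms : measurable_fun setT (fun e => (slope e ^+ 2)%:E).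
  by apply/measurable_EFinP; exact: measurable_funX.
have sq0 e : (0 <= (slope e ^+ 2)%:E)%E by rewrite lee_fin sqr_ge0.
have -> : (\int[P]_w ((`|psi (eps l w)| + M1) ^+ 2)%:E = \int[nu]_e (slope e ^+ 2)%:E)%E.
  by apply: (@ge0_image_integral _ _ _ _ _ P nu (eps l) _ (fun A mA => He l A mA) (fun e => (slope e ^+ 2)%:E)).
have -> // : (\int[P]_w ((`|psi (eps 0 w)| + M1) ^+ 2)%:E = \int[nu]_e (slope e ^+ 2)%:E)%E.
by apply: (@ge0_image_integral _ _ _ _ _ P nu (eps 0%N) _ (fun A mA => He 0%N A mA) (fun e => (slope e ^+ 2)%:E)).
Qed.

Let mrho : measurable_fun setT rho.
Proof. by apply: continuous_measurable_fun => y; exact: (loss_continuous rho_ac). Qed.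

Variables gam k1 : R.
Hypothesis gam0 : 0 < gam.
Hypothesis k10 : 0 < k1 < kap.
Hypothesis excess_quad : forall s, `|s| <= k1 ->
  gam / 16 * s ^+ 2 <= excess_loss rho P (eps 0%N) s <= 5 * gam * s ^+ 2.
Variables rr gg : X -> R.
Hypotheses (mrr : measurable_fun setT rr) (mgg : measurable_fun setT gg).
Hypotheses (rr_le : forall u, `|rr u| <= k1 / 2) (gg_le : forall u, `|gg u| <= k1 / 2).

Let Y (z : X * R) := rho (z.2 + (rr z.1 - gg z.1)) - rho (z.2 + rr z.1).

Let k1kap : k1 < kap. Proof. by case/andP : k10. Qed.

Let rg_le u : `|rr u - gg u| <= k1.
Proof. by apply: (le_trans (ler_normB _ _)); have := rr_le u; have := gg_le u; lra. Qed.

Let rr_le' u : `|rr u| <= k1.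
Proof. by have := rr_le u; have /andP[] := k10; lra. Qed.

Lemma measurable_loss_increment : measurable_fun setT Y.
Proof.
have m2 : measurable_fun setT (fun z : X * R => z.2) by exact: measurable_snd.
have mr1 : measurable_fun setT (fun z : X * R => rr z.1) by exact: measurableT_comp.
have mg1 : measurable_fun setT (fun z : X * R => gg z.1) by exact: measurableT_comp.
apply: measurable_funB; apply: (measurableT_comp mrho); apply: measurable_funD => //.
exact: measurable_funB.
Qed.

Let Y_le z : `|Y z| <= (k1 / 2) * slope z.2.
Proof.
have h1 := le_lt_trans (rg_le z.1) k1kap; have h2 := le_lt_trans (rr_le' z.1) k1kap.
have := loss_lipschitz rho_convex rho_ac rho_psi M10 psi_osc z.2 h1 h2.
move=> /le_trans; apply; rewrite mulrC; apply: ler_wpM2r; first exact: slope_ge0.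
by rewrite addrAC subrr sub0r normrN.
Qed.

Let islope : nu.-integrable setT (EFin \o slope).
Proof.
apply: integrable_pushforward => //.
- by apply/measurable_EFinP.
- exact: (slope_integrable measurable_psi M1 meps0 psi_sq).
Qed.

Let iY : (v \x nu)%E.-integrable setT (EFin \o Y).
Proof.
apply: (@le_integrable_EFin _ _ _ (v \x nu)%E setT measurableT _ (fun z => (k1 / 2) * slope z.2)).
- exact: measurable_loss_increment.
- by move=> z _; exact: Y_le.
have ic : v.-integrable setT (EFin \o (fun _ : X => k1 / 2)) by exact: finite_measure_integrable_cst.
by have [] := prod_Rintegral ic islope.
Qed.

(** [rr] plays the bias and [gg] the candidate. Integrating out the error first, the mean increment
    at a fixed predictor is the excess loss at rr - gg minus that at rr, to which the quadratic
    bounds apply. *)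
Lemma loss_increment : exists2 M, gam / 32 * \int[v]_u (gg u ^+ 2) - 6 * gam * \int[v]_u (rr u ^+ 2) <= M &
  forall l, P.-integrable setT (EFin \o (fun w => Y (x l w, eps l w))) /\ \int[P]_w Y (x l w, eps l w) = M.
Proof.
exists (\int[(v \x nu)%E]_z Y z); last first.
  move=> l; apply: (@image_integral _ _ _ _ _ P (v \x nu)%E (fun w => (x l w, eps l w))) => //.
    exact: measurable_sample.
  by move=> A mA; exact: sample_law.
have [_ He] := eps_iid.
have Fu u : fubini_F nu (EFin \o Y) u =
    (excess_loss rho P (eps 0%N) (rr u - gg u) - excess_loss rho P (eps 0%N) (rr u))%:E.
  have iYu : nu.-integrable setT (EFin \o (fun e => Y (u, e))).
    apply: (@le_integrable_EFin _ _ _ nu setT measurableT _ (fun e => (k1 / 2) * slope e)).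
    - by apply: (measurableT_comp measurable_loss_increment); exact: measurable_pair1.
    - by move=> e _; exact: Y_le.
    - exact: integrableZ_EFin.
  rewrite /fubini_F -[LHS]fineK ?(integrable_fin_num _ iYu)//; congr EFin.
  have [_ E] := @image_integral _ _ _ _ _ P nu (eps 0%N) meps0 (fun A mA => erefl) _ iYu.
  rewrite -[LHS]/(Rintegral _ _ _) -E.
  rewrite (excess_lossB rho_convex rho_ac rho_psi measurable_psi kap0 M10 psi_osc meps0 psi_sq)//.
  - exact: le_lt_trans (rg_le _) k1kap.
  - exact: le_lt_trans (rr_le' _) k1kap.
have iF := integrable_fubini_F iY.
have EF := integral12_prod_meas1 iY.
rewrite /Rintegral -EF.
have -> : (\int[v]_u fubini_F nu (EFin \o Y) u = \int[v]_u (excess_loss rho P (eps 0%N) (rr u - gg u) - excess_loss rho P (eps 0%N) (rr u))%:E)%E.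
  by apply: eq_integral => u _; exact: Fu.
rewrite -[leRHS]/(Rintegral _ _ _).
have ib (f : X -> R) (B : R) : measurable_fun setT f -> (forall u, `|f u| <= B) -> v.-integrable setT (EFin \o f).
  move=> mf fB; apply: (@le_integrable_EFin _ _ _ v setT measurableT _ (fun=> B)) => //.
  exact: finite_measure_integrable_cst.
have isq (f : X -> R) : measurable_fun setT f -> (forall u, `|f u| <= k1 / 2) ->
    v.-integrable setT (EFin \o (fun u => f u ^+ 2)).
  move=> mf fB; apply: (ib _ ((k1 / 2) ^+ 2)); first exact: measurable_funX.
  move=> u; rewrite normrX; apply: lerXn2r; rewrite ?nnegrE//.
  by have /andP[] := k10; lra.
have i1 := isq _ mrr rr_le; have i2 := isq _ mgg gg_le.
rewrite -!RintegralZl// -RintegralB//; [|exact: integrableZ_EFin|exact: integrableZ_EFin].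
apply: le_Rintegral => //.
- have := integrableD_EFin measurableT (integrableZ_EFin measurableT (gam / 32) i2) (integrableZ_EFin measurableT (- (6 * gam)) i1).
  by apply: eq_integrable => // u _; rewrite /= mulNr.
- by apply: eq_integrable iF => // u _; exact: Fu.
move=> u _.
have /andP[q1 _] := excess_quad (rg_le u); have /andP[_ q2] := excess_quad (rr_le' u).
move: q1 q2; move: (excess_loss _ _ _ _) (excess_loss _ _ _ _) => A B.
exact: (quadratic_increment gam0).
Qed.

End loss_increment.

(** * Localization of the estimator *)

Lemma leq_max3 (i j k : nat) (s := maxn i (maxn j k)) : [/\ (i <= s)%N, (j <= s)%N & (k <= s)%N].
Proof. by split; rewrite /s; lia. Qed.

Lemma cvg_seq_sum (R : realType) (I : Type) (r : seq I) (u : nat -> I -> R) (l : I -> R) :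
  (forall i, u k i @[k --> \oo] --> l i) -> \sum_(i <- r) u k i @[k --> \oo] --> \sum_(i <- r) l i.
Proof.
move=> H; elim: r => [|j r IH].
  under eq_fun do rewrite big_nil.
  by rewrite big_nil; exact: cvg_cst.
under eq_fun do rewrite big_cons.
by rewrite big_cons; apply: cvgD.
Qed.

Lemma rational_approximation (R : realType) (x : R) : exists u : nat -> rat, ratr (u k) @[k --> \oo] --> x.
Proof.
have H (k : nat) : exists p : rat, `|x - ratr p| < k.+1%:R^-1.
  have k0 : 0 < (k.+1%:R : R)^-1 by rewrite invr_gt0.
  have /rat_in_itvoo[p] : x - k.+1%:R^-1 < x + k.+1%:R^-1 by move: k0; set z := _^-1; lra.
  by rewrite in_itv /= => /andP[p1 p2]; exists p; rewrite ltr_distlC p1 p2.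
have [u Hu] := choice H; exists u; apply/cvgrPdist_lt => e e0.
have /cvgrPdist_lt/(_ _ e0)[N _ HN] := @cvg_harmonic R.
exists N => // k /= Nk; apply: (lt_trans (Hu k)).
by have := HN k Nk; rewrite /harmonic /= sub0r normrN ger0_norm// invr_ge0.
Qed.

Section rational_coefficients.
Context {R : realType} {d : nat}.

(** A candidate is coded by a level and a list of rationals read along the box, so that the class is
    countable. *)
Definition rational_coef N (u : seq rat) (i : d.-tuple nat) : R :=
  if i \in tbox N d then ratr (nth 0 u (index i (tbox N d))) else 0.

Lemma rational_coef_map N (a : d.-tuple nat -> rat) i : i \in tbox N d ->
  rational_coef N (map a (tbox N d)) i = ratr (a i).
Proof.
by move=> Hi; rewrite /rational_coef Hi (nth_map i) ?index_mem// nth_index.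
Qed.

End rational_coefficients.

Section candidate.
Context {R : realType} {d : nat}.
Variables (phi : nat -> R -> R) (mu : nat -> R) (rho : R -> R).
Hypothesis mu_gt0 : forall j, 0 < mu j.
Hypothesis mu_bounded : exists2 B : R, 0 < B & forall j : nat, mu j <= B.
Hypothesis rho_convex : forall x y t, 0 <= t <= 1 -> rho ((1 - t) * x + t * y) <= (1 - t) * rho x + t * rho y.
Hypothesis rho_cont : continuous rho.

Local Notation P := (@tensor_phi R phi d).
Local Notation M := (@tensor_mu R mu d).

Let mu0 i : 0 < M i. Proof. exact: tensor_mu_gt0. Qed.

Lemma tensor_mu_bounded : exists2 B, 0 < B & forall i : d.-tuple nat, M i <= B.
Proof.
have [B B0 HB] := mu_bounded; exists (B ^+ d); first exact: exprn_gt0.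
move=> i; rewrite /tensor_mu.
have -> : B ^+ d = \prod_(k < d) B by rewrite prodr_const card_ord.
by apply: ler_prod => k _; rewrite HB ltW.
Qed.

Lemma tensor_coef_weighted (la : R) (c : d.-tuple nat -> R) f s : 0 < la -> tensor_coef phi mu c f s ->
  exists W : R, (\sum_(i <- tbox N d) (1 + la / M i) * c i ^+ 2) @[N --> \oo] --> W.
Proof.
move=> la0 Hc; have [B B0 HB] := tensor_mu_bounded.
have [W _ HW] : exists2 W : R, W <= (B + la) * s & (\sum_(i <- tbox N d) (1 + la / M i) * c i ^+ 2) @[N --> \oo] --> W.
  apply: tbox_bounded_cvg => [i|N].
    by apply: mulr_ge0; [apply: addr_ge0 => //; apply/ltW/divr_gt0|exact: sqr_ge0].
  apply: (@le_trans _ _ ((B + la) * \sum_(i <- tbox N d) c i ^+ 2 / M i)); last first.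
    apply: ler_wpM2l; first by apply: addr_ge0; exact: ltW.
    exact: (tensor_coef_sumE mu_gt0 N Hc).
  rewrite mulr_sumr; apply: ler_sum => i _.
  have -> : (1 + la / M i) * c i ^+ 2 = (M i + la) * (c i ^+ 2 / M i) by field; rewrite gt_eqF.
  by apply: ler_wpM2r; [apply: divr_ge0; [exact: sqr_ge0|exact: ltW]|rewrite lerD2r].
by exists W.
Qed.

Variables (n : nat) (la T eta Lam : R) (xs : 'I_n -> d.-tuple R) (es : 'I_n -> R) (f0 : d.-tuple R -> R).
Hypotheses (la0 : 0 < la) (T0 : 0 < T) (eta0 : 0 < eta).
Hypothesis xs_cube : forall l, unit_cube (xs l).

Local Notation q i := (1 + la / M i).

(** Excess risk of a perturbation with half the penalty: the other half is given up when the squared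
    norm of a sum is bounded below by half of one squared norm minus the other. *)
Let ex_risk (r : 'I_n -> R) (g : 'I_n -> R) (s : R) : R :=
  n%:R^-1 * \sum_(l < n) (rho (es l + (r l - g l)) - rho (es l + r l)) + la / 2 * s.

Let ex_risk_cvg (r : 'I_n -> R) (g : nat -> 'I_n -> R) (s : nat -> R) g' s' :
  (forall l, g k l @[k --> \oo] --> g' l) -> s k @[k --> \oo] --> s' ->
  ex_risk r (g k) (s k) @[k --> \oo] --> ex_risk r g' s'.
Proof.
move=> Hg Hs; apply: cvgD; apply: cvgM; try exact: cvg_cst; last exact: Hs.
apply: cvg_seq_sum => l; apply: cvgB; last exact: cvg_cst.
apply: (@cvg_comp _ _ _ (fun k => es l + (r l - g k l)) rho); last exact: rho_cont.
by apply: cvgD; [exact: cvg_cst|apply: cvgB; [exact: cvg_cst|exact: Hg]].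
Qed.

Lemma candidate_exists cf f s ch fh sh N0 :
  tensor_coef phi mu cf f s -> tensor_coef phi mu ch fh sh -> la * s <= Lam ->
  penalized_risk rho la xs (fun l => f0 (xs l) + es l) fh sh <=
    penalized_risk rho la xs (fun l => f0 (xs l) + es l) f s ->
  T < \sum_(i <- tbox N0 d) q i * (ch i - cf i) ^+ 2 ->
  exists N (u : seq rat), let a := rational_coef N u in
   T / 2 < \sum_(i <- tbox N d) q i * a i ^+ 2 < 2 * T /\
   n%:R^-1 * \sum_(l < n) (rho (es l + ((f0 (xs l) - f (xs l)) - \sum_(i <- tbox N d) a i * P i (xs l))) -
       rho (es l + (f0 (xs l) - f (xs l)))) + la / 2 * (\sum_(i <- tbox N d) a i ^+ 2 / M i) < 2 * Lam + eta.
Proof.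
move=> Hf Hh sLam Hmin TN0.
have [tb Htb] := tensor_coef_lin mu_gt0 1 (-1) Hh Hf.
pose b i := ch i - cf i; pose g x := fh x - f x.
have Hb : tensor_coef phi mu b g tb.
  have -> : b = (fun i => 1 * ch i + -1 * cf i) by apply/funext => i; rewrite /b; ring.
  by have -> : g = (fun x => 1 * fh x + -1 * f x) by apply/funext => x; rewrite /g; ring.
have [W HW] := tensor_coef_weighted la0 Hb.
have q0 i : 0 <= q i by apply: addr_ge0 => //; apply/ltW/divr_gt0.
have TW : T < W.
  apply: (lt_le_trans TN0); apply: (@tbox_cvg_le _ _ _ W N0 _ HW) => i.
  by apply: mulr_ge0 => //; exact: sqr_ge0.
have W0 : 0 < W by exact: lt_trans TW.
(* Position on the segment at which the weighted square of the increment, W at its end, is exactly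
   T. *)
pose th := Num.sqrt (T / W).
have th2 : th ^+ 2 = T / W by rewrite sqr_sqrtr// divr_ge0// ltW.
have th0 : 0 <= th by exact: sqrtr_ge0.
have th1 : th <= 1.
  by rewrite -sqrtr1 ler_sqrt// ler_pdivrMr// mul1r ltW.
have th01 : 0 <= th <= 1 by rewrite th0.
have [t tle Ht] := tensor_coef_convex mu_gt0 th01 Hf Hh.
have [Hb1 Hb2] := Hb; have [_ Ht2] := Ht; have [_ Hf2] := Hf.
pose r l := f0 (xs l) - f (xs l).
have lim_le : ex_risk r (fun l => th * g (xs l)) (th ^+ 2 * tb) <= 2 * Lam.
  (* From (x + y)^2 >= y^2 / 2 - x^2 coefficientwise. Convexity puts the penalized risk at this
     point of the segment below that of f, whose penalty la s is at most Lam; the s given up here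
     costs another Lam, whence 2 Lam. *)
  have tge : 2^-1 * (th ^+ 2 * tb) - s <= t.
    have cl : (\sum_(i <- tbox N d) (2^-1 * (th ^+ 2 * (b i ^+ 2 / M i)) - cf i ^+ 2 / M i)) @[N --> \oo] --> 2^-1 * (th ^+ 2 * tb) - s.
      rewrite (_ : (fun N => _) = (fun N => 2^-1 * (th ^+ 2 * (\sum_(i <- tbox N d) b i ^+ 2 / M i)) - \sum_(i <- tbox N d) cf i ^+ 2 / M i)).
        apply: cvgB; last exact: Hf2.
        by apply: cvgM; [exact: cvg_cst|apply: cvgM; [exact: cvg_cst|exact: Hb2]].
      by apply/funext => N; rewrite !mulr_sumr -sumrB.
    apply: (ler_cvg_to cl Ht2); exists 0%N => // N _ /=; apply: ler_sum => i _.
    rewrite !mulrA -mulrBl; apply: ler_wpM2r; first by rewrite invr_ge0 ltW.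
    have -> : (1 - th) * cf i + th * ch i = cf i + th * b i by rewrite /b; ring.
    have := sqr_ge0 (2 * cf i + th * b i); move: (cf i) (th) (b i) => x y z; nra.
  have conv l : rho (es l + (r l - th * g (xs l))) - rho (es l + r l) <=
      th * (rho (f0 (xs l) + es l - fh (xs l)) - rho (f0 (xs l) + es l - f (xs l))).
    have -> : es l + r l = f0 (xs l) + es l - f (xs l) by rewrite /r; ring.
    have -> : es l + (r l - th * g (xs l)) =
        (1 - th) * (f0 (xs l) + es l - f (xs l)) + th * (f0 (xs l) + es l - fh (xs l)).
      by rewrite /r /g; ring.
    by have := rho_convex (f0 (xs l) + es l - f (xs l)) (f0 (xs l) + es l - fh (xs l)) th01; lra.
  have n1 : 0 <= (n%:R : R)^-1 by rewrite invr_ge0.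
  have := ler_wpM2l n1 (@ler_sum R 'I_n (index_enum _) xpredT _ _ (fun l _ => conv l)).
  rewrite /ex_risk -mulr_sumr !sumrB.
  have k1 := ler_wpM2l (ltW la0) tge; have k2 := ler_wpM2l (ltW la0) tle.
  have k3 := ler_wpM2l th0 Hmin; move: k3 k1 k2 sLam; rewrite /penalized_risk.
  move: (\sum_(l < n) _) (\sum_(i < n) rho _) (\sum_(i < n) rho _) => S1 S2 S3.
  set N1 := n%:R^-1; move: (th ^+ 2 * tb) => S4 k3 k1 k2 sLam k4.
  have := k4; rewrite mulrCA mulrBr => {}k4.
  move: k3; rewrite !mulrDr => k3.
  move: (N1 * _) => A in k4 *.
by move: k1 k2 k3 k4 sLam; lra.
have cv1 l : (\sum_(i <- tbox N d) th * b i * P i (xs l)) @[N --> \oo] --> th * g (xs l).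
  rewrite (_ : (fun N => _) = (fun N => th * \sum_(i <- tbox N d) b i * P i (xs l))).
    by apply: cvgM; [exact: cvg_cst|exact: Hb1].
  by apply/funext => N; rewrite mulr_sumr; apply: eq_bigr => i _; rewrite mulrA.
have cv2 : (\sum_(i <- tbox N d) (th * b i) ^+ 2 / M i) @[N --> \oo] --> th ^+ 2 * tb.
  rewrite (_ : (fun N => _) = (fun N => th ^+ 2 * \sum_(i <- tbox N d) b i ^+ 2 / M i)).
    by apply: cvgM; [exact: cvg_cst|exact: Hb2].
  by apply/funext => N; rewrite mulr_sumr; apply: eq_bigr => i _; rewrite exprMn -mulrA.
have cv3 : (\sum_(i <- tbox N d) q i * (th * b i) ^+ 2) @[N --> \oo] --> T.
  rewrite [in X in _ --> X](_ : T = th ^+ 2 * W); last by rewrite th2 divfK// gt_eqF.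
  rewrite (_ : (fun N => _) = (fun N => th ^+ 2 * \sum_(i <- tbox N d) q i * b i ^+ 2)).
    by apply: cvgM; [exact: cvg_cst|exact: HW].
  by apply/funext => N; rewrite mulr_sumr; apply: eq_bigr => i _; rewrite exprMn mulrCA.
have cvR := @ex_risk_cvg r (fun N l => \sum_(i <- tbox N d) th * b i * P i (xs l)) (fun N => \sum_(i <- tbox N d) (th * b i) ^+ 2 / M i)
   (fun l => th * g (xs l)) _ cv1 cv2.
have near_lt (u : nat -> R) (l h : R) : u k @[k --> \oo] --> l -> l < h -> exists N, forall k, (N <= k)%N -> u k < h.
  move=> ul lh; have hl : 0 < h - l by rewrite subr_gt0.
  have /cvgrPdist_lt/(_ _ hl)[N _ HN] := ul; exists N => k Nk; have := HN k Nk => /=.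
  by rewrite ltr_distlC => /andP[_]; lra.
have near_gt (u : nat -> R) (l h : R) : u k @[k --> \oo] --> l -> h < l -> exists N, forall k, (N <= k)%N -> h < u k.
  move=> ul lh; have hl : 0 < l - h by rewrite subr_gt0.
  have /cvgrPdist_lt/(_ _ hl)[N _ HN] := ul; exists N => k Nk; have := HN k Nk => /=.
  by rewrite ltr_distlC => /andP[]; lra.
(* The slack [eta] and the interval from T/2 to 2T make the conditions open, so that they survive
   truncation to a box and then rounding to rationals. *)
have [N [HN1 HN2 HN3]] : exists N, [/\ ex_risk r (fun l => \sum_(i <- tbox N d) th * b i * P i (xs l))
     (\sum_(i <- tbox N d) (th * b i) ^+ 2 / M i) < 2 * Lam + eta,
   T / 2 < \sum_(i <- tbox N d) q i * (th * b i) ^+ 2 & \sum_(i <- tbox N d) q i * (th * b i) ^+ 2 < 2 * T].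
  have [|N1 HN1] := near_lt _ _ (2 * Lam + eta) cvR; first by apply: (le_lt_trans lim_le); rewrite ltrDl.
  have [|N2 HN2] := near_gt _ _ (T / 2) cv3; first by move: T0; lra.
  have [|N3 HN3] := near_lt _ _ (2 * T) cv3; first by move: T0; lra.
  exists (maxn N1 (maxn N2 N3)); have [q1 q2 q3] := leq_max3 N1 N2 N3.
  by split; [exact: HN1|exact: HN2|exact: HN3].
have [ru Hru] := choice (fun i => @rational_approximation R (th * b i)).
have av1 l : (\sum_(i <- tbox N d) ratr (ru i k) * P i (xs l)) @[k --> \oo] --> \sum_(i <- tbox N d) th * b i * P i (xs l).
  by apply: cvg_seq_sum => i; apply: cvgM; [exact: Hru|exact: cvg_cst].
have sq (i : d.-tuple nat) : (ratr (ru i k) : R) ^+ 2 @[k --> \oo] --> (th * b i) ^+ 2.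
  by rewrite expr2; under eq_fun do rewrite expr2; apply: cvgM; exact: Hru.
have av2 : (\sum_(i <- tbox N d) ratr (ru i k) ^+ 2 / M i) @[k --> \oo] --> \sum_(i <- tbox N d) (th * b i) ^+ 2 / M i.
  by apply: cvg_seq_sum => i; apply: cvgM; [exact: sq|exact: cvg_cst].
have av3 : (\sum_(i <- tbox N d) q i * ratr (ru i k) ^+ 2) @[k --> \oo] --> \sum_(i <- tbox N d) q i * (th * b i) ^+ 2.
  by apply: cvg_seq_sum => i; apply: cvgM; [exact: cvg_cst|exact: sq].
have avR := @ex_risk_cvg r (fun k l => \sum_(i <- tbox N d) ratr (ru i k) * P i (xs l)) (fun k => \sum_(i <- tbox N d) ratr (ru i k) ^+ 2 / M i)
   (fun l => \sum_(i <- tbox N d) th * b i * P i (xs l)) _ av1 av2.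
have [N1 K1] := near_lt _ _ _ avR HN1.
have [N2 K2] := near_gt _ _ _ av3 HN2.
have [N3 K3] := near_lt _ _ _ av3 HN3.
pose k := maxn N1 (maxn N2 N3).
have [q1 q2 q3] := leq_max3 N1 N2 N3.
have {}K1 := K1 k q1; have {}K2 := K2 k q2; have {}K3 := K3 k q3.
exists N, (map (fun i => ru i k) (tbox N d)).
have sumE (F : d.-tuple nat -> R -> R) : \sum_(i <- tbox N d) F i (rational_coef N (map (fun i => ru i k) (tbox N d)) i) =
    \sum_(i <- tbox N d) F i (ratr (ru i k)).
  by rewrite !big_seq; apply: eq_bigr => i Hi; rewrite (rational_coef_map (fun i => ru i k)).
rewrite /= (sumE (fun i z => q i * z ^+ 2)) (sumE (fun i z => z ^+ 2 / M i)) K2 K3; split=> //.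
apply: le_lt_trans K1; rewrite /ex_risk lerD2r le_eqVlt; apply/orP; left; apply/eqP; congr (_ * _).
by apply: eq_bigr => l _; rewrite (sumE (fun i z => z * P i (xs l))).
Qed.

End candidate.

Lemma weighted_cauchy_schwarz (R : realType) (I : Type) (r : seq I) (q a f : I -> R) :
  (forall i, 0 < q i) ->
  (\sum_(i <- r) a i * f i) ^+ 2 <= (\sum_(i <- r) q i * a i ^+ 2) * (\sum_(i <- r) f i ^+ 2 / q i).
Proof.
move=> q0; have := cauchy_schwarz_sum r xpredT (fun i => Num.sqrt (q i) * a i) (fun i => f i / Num.sqrt (q i)).
have s0 i : Num.sqrt (q i) != 0 by rewrite gt_eqF// sqrtr_gt0.
rewrite (eq_bigr (fun i => a i * f i)) => [|i _]; last by field; exact: s0.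
move=> /le_trans; apply; rewrite le_eqVlt; apply/orP; left; apply/eqP; congr (_ * _); apply: eq_bigr => i _.
  by rewrite exprMn sqr_sqrtr// ltW.
by rewrite expr_div_n sqr_sqrtr// ltW.
Qed.

Section deviation_event.
Context {dO dX : measure_display} {Omega : measurableType dO} {X : measurableType dX} {R : realType}.
Variables rho psi : R -> R.
Hypothesis rho_convex : convex_function [set: R^o] rho.
Hypothesis rho_ac : absolutely_continuous rho.
Hypothesis rho_psi : {ae (@lebesgue_measure R), forall u, is_derive (u : R) (1 : R) rho (psi u)}.
Hypothesis measurable_psi : measurable_fun setT psi.
Variables kap M1 : R.
Hypothesis kap0 : 0 < kap.
Hypothesis M10 : 0 < M1.
Hypothesis psi_osc : forall y, `|y| <= kap -> forall u, `|psi (u + y) - psi u| <= M1.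
Variables (P : probability Omega R) (x : nat -> {mfun Omega >-> X}) (eps : nat -> {mfun Omega >-> R}).
Hypotheses (x_iid : iid P x) (eps_iid : iid P eps) (x_eps : independent_families P x eps).
Variables (v : probability X R) (x_law : forall A, measurable A -> distribution P (x 0%N) A = v A).
Hypothesis psi_sq : (\int[P]_w ((psi (eps 0%N w)) ^+ 2)%:E < +oo)%E.
Variables gam k1 : R.
Hypothesis gam0 : 0 < gam.
Hypothesis k10 : 0 < k1 < kap.
Hypothesis excess_quad : forall s, `|s| <= k1 ->
  gam / 16 * s ^+ 2 <= excess_loss rho P (eps 0%N) s <= 5 * gam * s ^+ 2.
Variables (V : R) (slope_sq : forall l, (\int[P]_w ((`|psi (eps l w)| + M1) ^+ 2)%:E <= V%:E)%E).
Variable rr : X -> R.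
Hypotheses (mrr : measurable_fun setT rr) (rr_le : forall u : X, `|rr u| <= k1 / 2).
Context {I : choiceType} (bx : nat -> seq I).
Hypotheses (bx_uniq : forall N, uniq (bx N)) (bx_sub : forall N N', (N <= N')%N -> {subset bx N <= bx N'}).
Variables (F : I -> X -> R) (q : I -> R) (N T : R) (ac : nat -> I -> R) (lev : nat -> nat) (valid : pred nat).
Hypotheses (mF : forall i, measurable_fun setT (F i)) (q0 : forall i, 0 < q i) (N0 : 0 <= N) (T0 : 0 <= T).
Hypothesis F_spec : forall L u, \sum_(i <- bx L) F i u ^+ 2 / q i <= N.
Hypothesis TN : T * N <= (k1 / 2) ^+ 2.
Hypothesis ac_supp : forall k i, i \notin bx (lev k) -> ac k i = 0.
Hypothesis ac_valid : forall k, valid k -> \sum_(i <- bx (lev k)) q i * ac k i ^+ 2 <= T.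

Definition class_fun k (u : X) := \sum_(i <- bx (lev k)) ac k i * F i u.
Definition class_increment k (z : X * R) := rho (z.2 + (rr z.1 - class_fun k z.1)) - rho (z.2 + rr z.1).
Definition class_mean k := \int[P]_w class_increment k (x 0%N w, eps 0%N w).

Lemma class_fun_le k u : valid k -> `|class_fun k u| <= k1 / 2.
Proof.
move=> vk; apply: sqr_le_norm; first by have /andP[] := k10; lra.
apply: le_trans TN; apply: (le_trans (weighted_cauchy_schwarz _ _ _ q0)).
apply: ler_pM => //; last exact: ac_valid.
  by apply: sumr_ge0 => i _; apply: mulr_ge0; [exact: ltW|exact: sqr_ge0].
by apply: sumr_ge0 => i _; apply: divr_ge0; [exact: sqr_ge0|exact: ltW].
Qed.

Lemma class_mean_ge k : valid k ->
  gam / 32 * \int[v]_u class_fun k u ^+ 2 - 6 * gam * \int[v]_u rr u ^+ 2 <= class_mean k.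
Proof.
move=> vk; have mG : measurable_fun setT (class_fun k) by apply: measurable_sum => i; apply: measurable_funM.
have [M HM1 HM2] := loss_increment rho_convex rho_ac rho_psi measurable_psi kap0 M10 psi_osc
  x_iid eps_iid x_eps x_law psi_sq gam0 k10 excess_quad mrr mG rr_le (fun u => class_fun_le u vk).
by apply: (le_trans HM1); have [_ <-] := HM2 0%N; exact: lexx.
Qed.

Section finite_class.
Variable L : nat.

(** [None] is the zero candidate, the base point that the maximal inequality requires; indices of
    bad candidates are sent to it as well. *)
Let cls := option 'I_L.

(** Requiring level at most L lets all candidates share the index set [bx L]; coefficients vanish
    outside their own box, so enlarging it changes no sum. *)
Let good (g : cls) : option nat := if g is Some k then (if (lev k <= L)%N && valid k then Some (k : nat) else None) else None.

Let a (g : cls) i := if good g is Some k then ac k i else 0.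

Let G g u := \sum_(i <- bx L) a g i * F i u.

Let supp_sum (f : I -> R) k : (lev k <= L)%N -> (forall i, i \notin bx (lev k) -> f i = 0) ->
  \sum_(i <- bx L) f i = \sum_(i <- bx (lev k)) f i.
Proof.
move=> kL f0; rewrite (sum_subset f (bx_uniq _) (bx_uniq _) (bx_sub kL)).
by rewrite [X in _ + X]big1 ?addr0.
Qed.

Let good_lev g k : good g = Some k -> (lev k <= L)%N && valid k.
Proof. by case: g => [k'|]//=; case: ifP => // H [<-]. Qed.

Let G_class g k : good g = Some k -> G g = class_fun k.
Proof.
move=> gk; have /andP[kL _] := good_lev gk; apply/funext => u; rewrite /G /class_fun /a gk.
by apply: supp_sum => // i Hi; rewrite ac_supp// mul0r.
Qed.

Let G_none g : good g = None -> G g = fun=> 0.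
Proof.
move=> gk; apply/funext => u; rewrite /G /a gk; apply: big1 => i _; exact: mul0r.
Qed.

Let S_class g k : good g = Some k -> \sum_(i <- bx L) q i * a g i ^+ 2 = \sum_(i <- bx (lev k)) q i * ac k i ^+ 2.
Proof.
move=> gk; have /andP[kL _] := good_lev gk; rewrite /a gk.
by apply: supp_sum => // i Hi; rewrite ac_supp// expr0n mulr0.
Qed.

Let S_none g : good g = None -> \sum_(i <- bx L) q i * a g i ^+ 2 = 0.
Proof. by move=> gk; rewrite /a gk big1// => i _; rewrite expr0n mulr0. Qed.

Let G_le g u : `|G g u| <= k1 / 2.
Proof.
apply: sqr_le_norm; first by have /andP[] := k10; lra.
apply: le_trans TN; apply: (le_trans (weighted_cauchy_schwarz _ _ _ q0)).
have S0 : 0 <= \sum_(i <- bx L) q i * a g i ^+ 2.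
  by apply: sumr_ge0 => i _; apply: mulr_ge0; [exact: ltW|exact: sqr_ge0].
apply: ler_pM => //.
  by apply: sumr_ge0 => i _; apply: divr_ge0; [exact: sqr_ge0|exact: ltW].
case E : (good g) => [k|]; last by rewrite S_none.
by rewrite (S_class E); apply: ac_valid; have /andP[] := good_lev E.
Qed.

Let mG g : measurable_fun setT (G g).
Proof. by apply: measurable_sum => i; apply: measurable_funM. Qed.

Let Y g (z : X * R) := rho (z.2 + (rr z.1 - G g z.1)) - rho (z.2 + rr z.1).

Let Ydef g : measurable_fun setT (Y g) /\ exists M, forall l,
  P.-integrable setT (EFin \o (fun w => Y g (x l w, eps l w))) /\ \int[P]_w Y g (x l w, eps l w) = M.
Proof.
split; first exact: (measurable_loss_increment rho_ac mrr (mG g)).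
have [M _ HM] := loss_increment rho_convex rho_ac rho_psi measurable_psi kap0 M10 psi_osc
  x_iid eps_iid x_eps x_law psi_sq gam0 k10 excess_quad mrr (mG g) rr_le (G_le g).
by exists M.
Qed.

Let M g := \int[P]_w Y g (x 0%N w, eps 0%N w).

Lemma finite_class_deviation n (b t : R) : 0 < b -> 0 < t ->
  let A := [set w | exists k, [/\ (k < L)%N, (lev k <= L)%N, valid k & t <=
     \sum_(l < n) (class_mean k - class_increment k (x l w, eps l w)) -
     2 * (b * \sum_(i <- bx (lev k)) q i * ac k i ^+ 2)]] in
  measurable A /\ (t%:E * P A <= (n%:R * (N / (2 * b)) * V)%:E)%E.
Proof.
move=> b0 t0.
pose dev w g := \sum_(l < n) (M g - Y g (x l w, eps l w)) - 2 * (b * \sum_(i <- bx L) q i * a g i ^+ 2).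
have devE w k g : good g = Some k -> dev w g =
    \sum_(l < n) (class_mean k - class_increment k (x l w, eps l w)) -
     2 * (b * \sum_(i <- bx (lev k)) q i * ac k i ^+ 2).
  by move=> gk; rewrite /dev (S_class gk) /M /Y (G_class gk).
have dev0 w g : good g = None -> dev w g = 0.
  move=> gk; rewrite /dev (S_none gk) /M /Y (G_none gk) !mulr0 subr0 big1// => l _.
  have E0 (z : X * R) : rho (z.2 + (rr z.1 - 0)) - rho (z.2 + rr z.1) = 0 by rewrite subr0 subrr.
  by rewrite E0 subr0; under eq_Rintegral do rewrite E0; rewrite /Rintegral integral0.
have -> : [set w | exists k, [/\ (k < L)%N, (lev k <= L)%N, valid k & t <=
     \sum_(l < n) (class_mean k - class_increment k (x l w, eps l w)) -
     2 * (b * \sum_(i <- bx (lev k)) q i * ac k i ^+ 2)]] = [set w | exists g, t <= dev w g].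
  apply/seteqP; split=> w /=.
    move=> [k [kL levL vk tk]]; exists (Some (Ordinal kL)).
    by rewrite (@devE w k)//= levL vk.
  move=> [g tg]; case E : (good g) => [k|]; last by move: tg; rewrite dev0// leNgt t0.
  exists k; have /andP[levL vk] := good_lev E; rewrite levL vk -(devE w k g E) tg; split=> //.
  move: E; case: (g) => [k'|]//=; case: ifP => // _ [<-]; exact: ltn_ord.
have Pi_sigma := measurable_prod_measurableType X R.
apply: (@maximal_inequality _ _ _ _ R P [set B `*` C | B in @measurable _ X & C in @measurable _ R] Pi_sigma _ _ n
  (fun l w => (x l w, eps l w)) _ _ cls None Y M _ _ _ _ I (bx L) a (fun i z => F i z.1) q b N V (fun z => `|psi z.2| + M1)) => //.
- move=> _ _ [B mB [C mC <-]] [B' mB' [C' mC' <-]]; exists (B `&` B'); first exact: measurableI.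
  by exists (C `&` C'); [exact: measurableI|rewrite setXI].
- by exists setT => //; exists setT => //; rewrite setXTT.
- by move=> l; exact: measurable_sample.
- by move=> A HA; exact: sample_indep.
- by move=> g; have [] := Ydef g.
- by move=> z; rewrite /Y G_none// subr0 subrr.
- by move=> g l; have [_ [M' HM']] := Ydef g; have [] := HM' l.
- move=> g l; have [_ [M' HM']] := Ydef g; have [_ ->] := HM' l.
  by rewrite /M; have [_ ->] := HM' 0%N.
- apply: measurable_funD => //; apply: measurableT_comp => //.
  by apply: measurableT_comp => //; exact: measurable_snd.
- move=> g g' z; rewrite -[X in _ * `|X - _|]/(G g z.1) -[X in _ * `|_ - X|]/(G g' z.1).
  have lt g1 : `|rr z.1 - G g1 z.1| < kap.
    have /andP[k1p k1k] := k10; apply: le_lt_trans k1k; apply: (le_trans (ler_normB _ _)).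
    by have := rr_le z.1; have := G_le g1 z.1; lra.
  have := loss_lipschitz rho_convex rho_ac rho_psi M10 psi_osc z.2 (lt g) (lt g').
  have -> : Y g z - Y g' z = rho (z.2 + (rr z.1 - G g z.1)) - rho (z.2 + (rr z.1 - G g' z.1)).
    by rewrite /Y; ring.
  have -> : rr z.1 - G g z.1 - (rr z.1 - G g' z.1) = - (G g z.1 - G g' z.1) by ring.
  by rewrite normrN.
- by move=> z; rewrite addr_ge0// ltW.
- by move=> l; exact: slope_sq.
Qed.

End finite_class.

(** The events of the finite classes increase with L and share one bound, which continuity from
    below passes to their union. Each valid k belongs to the class of level max(k + 1, lev k). *)
Lemma deviation_event n (b t : R) : 0 < b -> 0 < t -> exists A, [/\ measurable A,
  (t%:E * P A <= (n%:R * (N / (2 * b)) * V)%:E)%E &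
  forall w, ~ A w -> forall k, valid k ->
     \sum_(l < n) (class_mean k - class_increment k (x l w, eps l w)) -
     2 * (b * \sum_(i <- bx (lev k)) q i * ac k i ^+ 2) < t].
Proof.
move=> b0 t0.
pose A L := [set w | exists k, [/\ (k < L)%N, (lev k <= L)%N, valid k & t <=
     \sum_(l < n) (class_mean k - class_increment k (x l w, eps l w)) -
     2 * (b * \sum_(i <- bx (lev k)) q i * ac k i ^+ 2)]].
have HA L : measurable (A L) /\ (t%:E * P (A L) <= (n%:R * (N / (2 * b)) * V)%:E)%E.
  exact: finite_class_deviation.
have mA L : measurable (A L) by have [] := HA L.
have mU : measurable (\bigcup_L A L) by exact: bigcup_measurable.
exists (\bigcup_L A L); split=> //.
- have nd : {homo A : L L' / (L <= L')%N >-> (L <= L')%O}.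
    move=> L L' LL'; apply/subsetPset => w [k [k1L k2L vk tk]]; exists k; split=> //.
      exact: leq_trans LL'.
    exact: leq_trans LL'.
  have cvP := @nondecreasing_cvg_mu _ _ R P A mA mU nd.
  have PA L : (P (A L) <= (n%:R * (N / (2 * b)) * V / t)%:E)%E.
    have [_] := HA L; rewrite -[P (A L)]fineK ?fin_num_measure// -EFinM !lee_fin.
    by rewrite ler_pdivlMr// mulrC.
  have : (P (\bigcup_L A L) <= (n%:R * (N / (2 * b)) * V / t)%:E)%E.
    rewrite -(cvg_lim (@ereal_hausdorff R) cvP); apply: lime_le; first by apply/cvg_ex; eexists; exact: cvP.
    by exists 0%N => // L _ /=; exact: PA.
  rewrite -[P _]fineK ?fin_num_measure// -EFinM !lee_fin.
  by rewrite ler_pdivlMr// mulrC.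
- move=> w nA k vk; rewrite ltNge; apply/negP => tk; apply: nA; exists (maxn k.+1 (lev k)) => //.
  exists k; split=> //; [exact: leq_maxl|exact: leq_maxr].
Qed.

End deviation_event.

(** Curvature gives gam c1 / 32 times S1 and the halved penalty gives la S2 / 2, together at least
    kq (S1 + la S2). Half of this pays the penalty of the maximal inequality, with b = n kq / 4. The
    other half exceeds kq T / 4, of which kq T / 8 absorbs the bias terms. *)
Lemma deviation_arith (R : realFieldType) (n : nat) (gam c1 kq la T Lam S1 S2 SY IG IR Mk : R) :
  (0 < n)%N -> 0 < gam -> 0 < kq -> 0 < la -> kq <= gam * c1 / 32 -> kq <= 2^-1 ->
  (6 * gam + 3) * Lam <= kq * T / 8 -> 0 <= S1 -> 0 <= S2 ->
  gam / 32 * IG - 6 * gam * IR <= Mk -> IR <= Lam -> c1 * S1 <= IG ->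
  T / 2 < S1 + la * S2 < 2 * T -> n%:R^-1 * SY + la / 2 * S2 < 2 * Lam + Lam ->
  n%:R * (kq * T / 8) <= Mk *+ n - SY - 2 * (n%:R * kq / 4 * (S1 + la * S2)).
Proof.
move=> n0 g0 k0 la0 kq1 kq2 LT S1p S2p HM HR HG /andP[Su _] ru.
have nR : (0 : R) < n%:R by rewrite ltr0n.
have -> : SY = n%:R * (n%:R^-1 * SY) by rewrite mulrA divff ?mul1r// gt_eqF.
rewrite -[Mk *+ n]mulr_natl; move: (n%:R^-1 * SY) ru => Y ru.
have -> : n%:R * Mk - n%:R * Y - 2 * (n%:R * kq / 4 * (S1 + la * S2)) = n%:R * (Mk - Y - kq / 2 * (S1 + la * S2)) by field.
rewrite ler_pM2l//.
have laS2 : 0 <= la * S2 by apply: mulr_ge0 => //; exact: ltW.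
have h1 : kq * S1 <= gam * c1 / 32 * S1 by apply: ler_wpM2r.
have h2 : gam / 32 * (c1 * S1) <= gam / 32 * IG by apply: ler_wpM2l => //; lra.
have h3 : 6 * gam * IR <= 6 * gam * Lam by apply: ler_wpM2l => //; lra.
have h4 : kq * (la * S2) <= 2^-1 * (la * S2) by apply: ler_wpM2r.
have h5 : kq * (T / 2) <= kq * (S1 + la * S2) by apply: ler_wpM2l; exact: ltW.
lra.
Qed.

Section localization.
Context {dO : measure_display} {Omega : measurableType dO} {R : realType} {d : nat}.
Local Notation cube := (@unit_cube R d).
Local Notation mC := (@measurable_unit_cube R d).
Local Notation I01 := (`[0%R, 1%R]%classic : set R).
Local Notation leb := (@lebesgue_measure R).
Variables (phi : nat -> R -> R) (mu : nat -> R).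
Hypothesis mu_gt0 : forall j, 0 < mu j.
Hypothesis mu_bounded : exists2 B : R, 0 < B & forall j : nat, mu j <= B.
Hypothesis mphi : forall j, measurable_fun I01 (phi j).
Hypothesis sphi : forall j, square_integrable leb I01 (phi j).
Hypothesis ophi : forall i j, \int[leb]_(x in I01) (phi i x * phi j x) = (i == j)%:R.
Variables rho psi : R -> R.
Hypothesis rho_convex : convex_function [set: R^o] rho.
Hypothesis rho_ac : absolutely_continuous rho.
Hypothesis rho_psi : {ae leb, forall u, is_derive (u : R) (1 : R) rho (psi u)}.
Hypothesis measurable_psi : measurable_fun setT psi.
Variables kap M1 : R.
Hypothesis kap0 : 0 < kap.
Hypothesis M10 : 0 < M1.
Hypothesis psi_osc : forall y, `|y| <= kap -> forall u, `|psi (u + y) - psi u| <= M1.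
Variables (P : probability Omega R) (x : nat -> {mfun Omega >-> d.-tuple R}) (eps : nat -> {mfun Omega >-> R}).
Hypotheses (x_iid : iid P x) (eps_iid : iid P eps) (x_eps : independent_families P x eps).
Hypothesis x_cube : forall l w, unit_cube (x l w).
Variables (v : probability (d.-tuple R) R) (x_law : forall A, measurable A -> distribution P (x 0%N) A = v A).
Variables (c1 : R) (v_density : forall f : d.-tuple R -> \bar R, measurable_fun cube f ->
  (forall x, unit_cube x -> 0 <= f x)%E ->
  (c1%:E * \int[lebesgue_tuple d]_(x in cube) f x <= \int[v]_(x in cube) f x)%E).
Hypothesis psi_sq : (\int[P]_w ((psi (eps 0%N w)) ^+ 2)%:E < +oo)%E.
Variables gam k1 : R.
Hypothesis gam0 : 0 < gam.
Hypothesis k10 : 0 < k1 < kap.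
Hypothesis excess_quad : forall s, `|s| <= k1 ->
  gam / 16 * s ^+ 2 <= excess_loss rho P (eps 0%N) s <= 5 * gam * s ^+ 2.
Variables (V : R) (slope_sq : forall l, (\int[P]_w ((`|psi (eps l w)| + M1) ^+ 2)%:E <= V%:E)%E).

Local Notation TP := (@tensor_phi R phi d).
Local Notation M := (@tensor_mu R mu d).

(** Zero extension, measurable on the whole space; values at sample points are unchanged, since
    these lie in the cube. *)
Let Fi i := TP i \_ cube.

Let mFi i : measurable_fun setT (Fi i).
Proof. by apply/(measurable_restrictT _ mC); exact: measurable_tensor_phi. Qed.

Let comb_restrict r (a : d.-tuple nat -> R) u : \sum_(i <- r) a i * Fi i u = ((fun z => \sum_(i <- r) a i * TP i z) \_ cube) u.
Proof.
rewrite patchE; case: ifPn => Hu.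
  by apply: eq_bigr => i _; rewrite /Fi patchE Hu.
by apply: big1 => i _; rewrite /Fi patchE (negbTE Hu) mulr0.
Qed.

Lemma density_comb_sqnorm r (a : d.-tuple nat -> R) B : uniq r ->
  (forall u, `|\sum_(i <- r) a i * Fi i u| <= B) ->
  c1 * \sum_(i <- r) a i ^+ 2 <= \int[v]_u (\sum_(i <- r) a i * Fi i u) ^+ 2.
Proof.
move=> ur GB; have [iG EG] := tensor_comb_sqnorm mphi sphi ophi a ur.
have mG : measurable_fun cube (EFin \o (fun z => (\sum_(i <- r) a i * TP i z) ^+ 2)) by exact: (measurable_int _ iG).
have H := v_density mG (fun z _ => sqr_ge0 (\sum_(i <- r) a i * TP i z)).
have iv : v.-integrable setT (EFin \o (fun u => (\sum_(i <- r) a i * Fi i u) ^+ 2)).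
  apply: (@le_integrable_EFin _ _ _ v setT measurableT _ (fun=> B ^+ 2)).
  - by apply: measurable_funX; apply: measurable_sum => i; apply: measurable_funM.
  - move=> u _; rewrite normrX; apply: lerXn2r; rewrite ?nnegrE//.
    by apply: le_trans (GB u).
  - exact: finite_measure_integrable_cst.
pose g1 z := (\sum_(i <- r) a i * TP i z) ^+ 2; pose g2 z := (\sum_(i <- r) a i * Fi i z) ^+ 2.
have E1 : (\int[v]_(u in cube) (g1 u)%:E = \int[v]_u (g2 u)%:E)%E.
  rewrite integral_mkcond; apply: eq_integral => u _; rewrite /g2 comb_restrict !patchE.
  by case: ifP => //= _; rewrite expr0n.
have E2 : (\int[lebesgue_tuple d]_(u in cube) (g1 u)%:E = (\sum_(i <- r) a i ^+ 2)%:E)%E.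
  by rewrite -EG /Rintegral fineK//; exact: (integrable_fin_num mC iG).
have E3 : (\int[v]_u (g2 u)%:E = (\int[v]_u (g2 u))%:E)%E.
  by rewrite /Rintegral fineK//; exact: (integrable_fin_num measurableT iv).
have {H} : (c1%:E * \int[lebesgue_tuple d]_(u in cube) (g1 u)%:E <= \int[v]_(u in cube) (g1 u)%:E)%E by exact: H.
rewrite E1 E2 E3 -EFinM lee_fin; exact.
Qed.

Variables (n : nat) (la T N Lam kq : R) (f0 f : d.-tuple R -> R).
Hypotheses (n0 : (0 < n)%N) (la0 : 0 < la) (T0 : 0 < T) (N0 : 0 <= N) (Lam0 : 0 < Lam) (kq0 : 0 < kq).
Hypothesis N_spec : forall L u, unit_cube u -> \sum_(i <- tbox L d) TP i u ^+ 2 / (1 + la / M i) <= N.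
Hypothesis TN : 2 * T * N <= (k1 / 2) ^+ 2.
Hypotheses (mf0 : measurable_fun cube f0) (mf : measurable_fun cube f).
Hypothesis bias_sq : square_integrable v cube (fun u => f0 u - f u).
Hypothesis bias_le : \int[v]_(u in cube) (f0 u - f u) ^+ 2 <= Lam.
Hypothesis bias_sup : {ae v, forall u, cube u -> `|f0 u - f u| <= k1 / 2}.
Hypotheses (kq1 : kq <= gam * c1 / 32) (kq2 : kq <= 2^-1) (LamT : (6 * gam + 3) * Lam <= kq * T / 8).

(** The bias is small only almost everywhere. Cutting it off where it exceeds k1 / 2 gives a bounded
    measurable version; almost surely no sample point notices the difference. *)
Let D := cube `&` (fun u => `|f0 u - f u|) @^-1` `]-oo, k1 / 2].
Let rr := (fun u => f0 u - f u) \_ D.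

Let mD : measurable D.
Proof.
have mn : measurable_fun cube (fun u => `|f0 u - f u|).
  by apply: measurableT_comp => //; exact: measurable_funB.
by apply: mn; [exact: mC|exact: measurable_itv].
Qed.

Let mrr : measurable_fun setT rr.
Proof.
apply/(measurable_restrictT _ mD); apply: (@measurable_funS _ _ _ _ cube) => //; first exact: mC.
  by move=> u [].
exact: measurable_funB.
Qed.

Let k1p : 0 < k1. Proof. by case/andP : k10. Qed.

Let rr_le u : `|rr u| <= k1 / 2.
Proof.
rewrite /rr patchE; case: ifPn => [/set_mem[_]|_]; first by rewrite /= in_itv.
by rewrite normr0 divr_ge0// ltW.
Qed.

Let rr_sq : \int[v]_u rr u ^+ 2 <= Lam.
Proof.
apply: le_trans bias_le; rewrite [leRHS]Rintegral_mkcond.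
have iR : v.-integrable setT (EFin \o ((fun u => (f0 u - f u) ^+ 2) \_ cube)).
  rewrite -restrict_EFin; apply: (iffLR (integrable_mkcond _ mC)).
  by have /square_integrableP[] := bias_sq.
apply: le_Rintegral => //.
  apply: (@le_integrable_EFin _ _ _ v setT measurableT _ (fun=> (k1 / 2) ^+ 2)).
  - exact: measurable_funX.
  - move=> u _; rewrite normrX; apply: lerXn2r; rewrite ?nnegrE//.
    by apply: le_trans (rr_le u).
  - exact: finite_measure_integrable_cst.
move=> u _; rewrite /rr !patchE; case: ifPn => [/set_mem[Cu _]|_]; first by rewrite mem_set.
by rewrite expr0n /=; case: ifP => // _; exact: sqr_ge0.
Qed.

Let q i := 1 + la / M i.

Let q0 i : 0 < q i.
Proof. by apply: addr_gt0 => //; apply: divr_gt0 => //; exact: tensor_mu_gt0. Qed.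

(** Enumeration of all pairs of a level and a list of rationals; integers that code nothing yield
    the empty candidate. *)
Let code (k : nat) : (nat * seq rat)%type := odflt (0%N, [::]) (@choice.unpickle (nat * seq rat)%type k).
Let ac k := @rational_coef R d (code k).1 (code k).2.
Let lev k := (code k).1.
Let valid : pred nat := fun k => T / 2 < \sum_(i <- tbox (lev k) d) q i * ac k i ^+ 2 < 2 * T.

Let Fi_spec L u : \sum_(i <- tbox L d) Fi i u ^+ 2 / q i <= N.
Proof.
have [cu|ncu] := pselect (cube u).
  by apply: le_trans (N_spec L cu); apply: ler_sum => i _; rewrite /Fi patchE mem_set.
by rewrite big1// => i _; rewrite /Fi patchE memNset// expr0n mul0r.
Qed.

(** The event joins the deviation event to the null event that some sample point falls where the
    bias is large. Outside it, a weighted square above T would give, through [candidate_exists], a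
    valid index violating the deviation bound. The event is chosen before [fh], so it serves for all
    functions of no larger penalized risk than f. *)
Lemma estimator_localized : exists A, [/\ measurable A,
  ((n%:R * (kq * T / 8))%:E * P A <= (n%:R * (N / (2 * (n%:R * kq / 4))) * V)%:E)%E &
  forall w, ~ A w -> forall cf s ch fh sh, tensor_coef phi mu cf f s -> tensor_coef phi mu ch fh sh ->
    la * s <= Lam ->
    penalized_risk rho la (fun l : 'I_n => x l w) (fun l => f0 (x l w) + eps l w) fh sh <=
      penalized_risk rho la (fun l : 'I_n => x l w) (fun l => f0 (x l w) + eps l w) f s ->
    forall L, \sum_(i <- tbox L d) q i * (ch i - cf i) ^+ 2 <= T].
Proof.
have nR : (0 : R) < n%:R by rewrite ltr0n.
have b0 : 0 < n%:R * kq / 4 by apply: divr_gt0 => //; exact: mulr_gt0.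
have t0 : 0 < n%:R * (kq * T / 8) by apply: mulr_gt0 => //; apply: divr_gt0 => //; exact: mulr_gt0.
have ac_supp k i : i \notin tbox (lev k) d -> ac k i = 0 by move=> Hi; rewrite /ac /rational_coef (negbTE Hi).
have ac_valid k : valid k -> \sum_(i <- tbox (lev k) d) q i * ac k i ^+ 2 <= 2 * T.
  by move=> /andP[_ /ltW].
have T2 : 0 <= 2 * T by apply: mulr_ge0 => //; exact: ltW.
have tsub L L' : (L <= L')%N -> {subset tbox L d <= tbox L' d} by exact: tbox_subset.
have tuq L : uniq (tbox L d) by exact: tbox_uniq.
have [A1 [mA1 PA1 HA1]] := deviation_event rho_convex rho_ac rho_psi measurable_psi kap0 M10 psi_osc
  x_iid eps_iid x_eps x_law psi_sq gam0 k10 excess_quad slope_sq mrr rr_le tuq tsub mFi q0 N0 T2 Fi_spec TN ac_supp ac_valid n b0 t0.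
have [A2 [mA2 vA2 HA2]] := bias_sup.
pose A3 := \bigcup_l x l @^-1` A2.
have mxA2 l : measurable (x l @^-1` A2) by rewrite -[X in measurable X]setTI; exact: measurable_funPT.
have mA3 : measurable A3 by exact: bigcup_measurable.
have PA3 : P A3 = 0%E.
  apply: measure_negligible => //; apply: negligible_bigcup => l; exists (x l @^-1` A2); split=> //.
  have [_ Hx] := x_iid.
  exact: (etrans (Hx l A2 mA2) (etrans (x_law mA2) vA2)).
exists (A1 `|` A3); split; first exact: measurableU.
  apply: le_trans PA1; rewrite lee_pmul2l//; apply: (le_trans (measureU2 _ mA1 mA3)).
  by rewrite [X in (_ + X)%E](_ : _ = 0%E) ?adde0//; exact: PA3.
move=> w nAw cf s ch fh sh Hf Hh sLam Hmin L; rewrite leNgt; apply/negP => TL.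
have nA1 : ~ A1 w by move=> Aw; apply: nAw; left.
have rr_x l : rr (x l w) = f0 (x l w) - f (x l w).
  rewrite /rr patchE mem_set//; split; first exact: x_cube.
  rewrite /= in_itv /=; apply: contrapT => nle; apply: nAw; right; exists l => //.
  by apply: HA2 => /(_ (x_cube l w)).
have rconv := loss_convex rho_convex.
have rcont : continuous rho by move=> u; exact: (loss_continuous rho_ac).
have [N' [u /= [Su ru]]] := candidate_exists mu_gt0 mu_bounded rconv rcont la0 T0 Lam0
  (fun l : 'I_n => x_cube l w) Hf Hh sLam Hmin TL.
pose k := choice.pickle (N', u).
have codek : code k = (N', u) by rewrite /code /k choice.pickleK.
have ack : ac k = @rational_coef R d N' u by rewrite /ac codek.
have levk : lev k = N' by rewrite /lev codek.
have vk : valid k by rewrite /valid levk ack.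
have := HA1 w nA1 k vk; rewrite ltNge => /negP; apply.
have Gle z := class_fun_le k10 q0 Fi_spec TN ac_valid z vk.
have HM := class_mean_ge rho_convex rho_ac rho_psi measurable_psi kap0 M10 psi_osc
  x_iid eps_iid x_eps x_law psi_sq gam0 k10 excess_quad mrr rr_le mFi q0 Fi_spec TN ac_valid vk.
have HG := @density_comb_sqnorm (tbox (lev k) d) (ac k) (k1 / 2) (tuq _) Gle.
have incE (l : 'I_n) : class_increment rho rr (fun L => tbox L d) Fi ac lev k (x l w, eps l w) =
    rho (eps l w + (f0 (x l w) - f (x l w) - \sum_(i <- tbox N' d) rational_coef N' u i * TP i (x l w))) -
    rho (eps l w + (f0 (x l w) - f (x l w))).
  rewrite /class_increment /= rr_x /class_fun comb_restrict patchE mem_set; last exact: x_cube.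
  by rewrite levk ack.
rewrite sumrB sumr_const card_ord [X in _ *+ n - X](eq_bigr _ (fun l _ => incE l)).
move: HM HG Su ru; rewrite /class_fun levk ack; move: (@rational_coef R d N' u) => rc.
move: (class_mean _ _ _ _ _ _ _ _ _ _) => Mk.
have -> : \sum_(i <- tbox N' d) q i * rc i ^+ 2 =
    \sum_(i <- tbox N' d) rc i ^+ 2 + la * \sum_(i <- tbox N' d) rc i ^+ 2 / M i.
  by rewrite mulr_sumr -big_split /=; apply: eq_bigr => i _; rewrite /q; ring.
have S2p : 0 <= \sum_(i <- tbox N' d) rc i ^+ 2 / M i.
  apply: sumr_ge0 => i _; apply: divr_ge0; [exact: sqr_ge0|apply/ltW; exact: tensor_mu_gt0].
have S1p : 0 <= \sum_(i <- tbox N' d) rc i ^+ 2 by apply: sumr_ge0 => i _; exact: sqr_ge0.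
move: S1p S2p; move: (\sum_(i <- tbox N' d) rc i ^+ 2) (\sum_(i <- tbox N' d) _ / M i) => S1 S2.
move: (\sum_(l < n) _) (\int[v]_u _) => SY IG S1p S2p HM HG Su ru.
have HR := rr_sq; move: (\int[v]_u rr u ^+ 2) HM HR => IR HM HR.
exact: (@deviation_arith R n gam c1 kq la T Lam S1 S2 SY IG IR Mk).
Qed.

End localization.

(** * Rates *)

Lemma limn_einf_le (R : realType) (u : (\bar R)^nat) (c : \bar R) :
  (forall n, u n <= c)%E -> (limn_einf u <= c)%E.
Proof.
move=> uc; rewrite limn_einf_lim; apply: lime_le; first exact: is_cvg_einfs.
exists 0%N => // n _ /=; apply: le_trans (uc n); apply: ereal_inf_lbound.
by exists n => /=.
Qed.

Section coefficient_norm.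
Context {R : realType} {d : nat}.
Local Notation cube := (@unit_cube R d).
Local Notation mC := (@measurable_unit_cube R d).
Local Notation I01 := (`[0%R, 1%R]%classic : set R).
Local Notation leb := (@lebesgue_measure R).
Variables (phi : nat -> R -> R) (mu : nat -> R).
Hypothesis mphi : forall j, measurable_fun I01 (phi j).
Hypothesis sphi : forall j, square_integrable leb I01 (phi j).
Hypothesis ophi : forall i j, \int[leb]_(x in I01) (phi i x * phi j x) = (i == j)%:R.

Lemma tensor_coef_measurable c f s : tensor_coef phi mu c f s -> measurable_fun cube f.
Proof.
move=> [cf _]; apply: (@measurable_fun_cvg _ _ _ cube (fun N x => \sum_(i <- tbox N d) c i * tensor_phi phi i x)) => //.
by move=> N; apply: measurable_sum => i; apply: measurable_funM => //; exact: measurable_tensor_phi.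
Qed.

(** Fatou along the partial sums, whose squared norms are given by orthonormality. *)
Lemma tensor_coef_sqnorm_le c f s T : tensor_coef phi mu c f s ->
  (forall N, \sum_(i <- tbox N d) c i ^+ 2 <= T) ->
  (\int[lebesgue_tuple d]_(x in cube) ((f x) ^+ 2)%:E <= T%:E)%E.
Proof.
move=> [cf _] cT; pose g N x := ((\sum_(i <- tbox N d) c i * tensor_phi phi i x) ^+ 2)%:E.
have mg N : measurable_fun cube (g N).
  apply/measurable_EFinP; apply: measurable_funX.
  by apply: measurable_sum => i; apply: measurable_funM => //; exact: measurable_tensor_phi.
have g0 N x : cube x -> (0 <= g N x)%E by move=> _; rewrite lee_fin sqr_ge0.
have -> : (\int[lebesgue_tuple d]_(x in cube) ((f x) ^+ 2)%:E = \int[lebesgue_tuple d]_(x in cube) limn_einf (g ^~ x))%E.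
  apply: eq_integral => x /set_mem cx.
  have cg : g N x @[N --> \oo] --> ((f x) ^+ 2)%:E.
    apply: cvg_EFin; first by exists 0%N.
    have := cf x cx => /(fun H => cvgM H H); rewrite /g /= => H.
    by rewrite expr2; under eq_fun do rewrite /= expr2.
  by rewrite is_cvg_limn_einfE; [rewrite (cvg_lim (@ereal_hausdorff R) cg)|apply/cvg_ex; eexists; exact: cg].
apply: (le_trans (fatou (lebesgue_tuple d) mC mg g0)).
apply: limn_einf_le => N.
have [iG EG] := tensor_comb_sqnorm mphi sphi ophi c (tbox_uniq N d).
apply: (@le_trans _ _ (\int[lebesgue_tuple d]_(x in cube) (\sum_(i <- tbox N d) c i * tensor_phi phi i x) ^+ 2)%:E).
  by rewrite /Rintegral fineK//; exact: (integrable_fin_num mC iG).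
by rewrite lee_fin EG.
Qed.

End coefficient_norm.

Lemma integral_sqrD_le {dT : measure_display} {T : measurableType dT} {R : realType}
    (mu : {measure set T -> \bar R}) (D : set T) (f g : T -> R) (A B : R) : measurable D ->
  measurable_fun D f -> measurable_fun D g ->
  (\int[mu]_(x in D) (f x ^+ 2)%:E <= A%:E)%E -> (\int[mu]_(x in D) (g x ^+ 2)%:E <= B%:E)%E ->
  (\int[mu]_(x in D) ((f x - g x) ^+ 2)%:E <= (2 * A + 2 * B)%:E)%E.
Proof.
move=> mD mf mg fA gB.
have mf2 : measurable_fun D (fun x => (f x ^+ 2)%:E) by apply/measurable_EFinP; exact: measurable_funX.
have mg2 : measurable_fun D (fun x => (g x ^+ 2)%:E) by apply/measurable_EFinP; exact: measurable_funX.
have f2 x : D x -> (0 <= (f x ^+ 2)%:E)%E by move=> _; rewrite lee_fin sqr_ge0.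
have g2 x : D x -> (0 <= (g x ^+ 2)%:E)%E by move=> _; rewrite lee_fin sqr_ge0.
apply: (@le_trans _ _ (\int[mu]_(x in D) (2%:E * (f x ^+ 2)%:E + 2%:E * (g x ^+ 2)%:E))%E).
  apply: ge0_le_integral => //.
  - by move=> x _; rewrite lee_fin sqr_ge0.
  - by apply/measurable_EFinP; apply: measurable_funX; exact: measurable_funB.
  - by apply: emeasurable_funD; exact: measurable_funeM.
  - move=> x _; rewrite -!EFinM -EFinD lee_fin; have := sqr_ge0 (f x + g x); move: (f x) (g x) => a b; nra.
rewrite ge0_integralD//; [|by move=> x Dx; apply: mule_ge0 => //; exact: f2|exact: measurable_funeM
  |by move=> x Dx; apply: mule_ge0 => //; exact: g2|exact: measurable_funeM].
rewrite !ge0_integralZl//.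
apply: (@le_trans _ _ (2%:E * A%:E + 2%:E * B%:E)%E); last by rewrite -!EFinM -EFinD.
by apply: leeD; apply: lee_pmul => //; apply: integral_ge0.
Qed.

Section rates.
Context {R : realType}.
Variables (m d : nat) (la : R).
Hypotheses (m_gt0 : (0 < m)%N) (la0 : 0 < la).
Local Notation p := (la `^ (2 * m%:R)^-1).

Let m0 : (0 : R) < m%:R. Proof. by rewrite ltr0n. Qed.

Lemma bandwidth_gt0 : 0 < p. Proof. exact: powR_gt0. Qed.

Lemma bandwidth_pow : p ^+ (2 * m) = la.
Proof.
rewrite -powR_mulrn; last by rewrite ltW// bandwidth_gt0.
by rewrite -powRrM natrM mulVf ?powRr1 ?ltW// mulf_neq0// gt_eqF.
Qed.

Lemma bandwidth_sqV : la `^ (- m%:R^-1) = (p ^+ 2)^-1.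
Proof.
rewrite powRN; congr (_^-1); rewrite -powR_mulrn; last by rewrite ltW// bandwidth_gt0.
by rewrite -powRrM; congr (_ `^ _); field; rewrite gt_eqF.
Qed.

Lemma bandwidth_div beta : la `^ (beta - (2 * m%:R)^-1) = la `^ beta / p.
Proof. by rewrite powRD_gt0// powRN. Qed.

(** For la <= 1/e the logarithm is at least 1, and p >= la since the exponent is at most 1. Then 1 +
    ln(1 + 1/p) <= 1 + ln 2 + ln(1/la), at most three times ln(1/la). *)
Lemma loglevel_bandwidth : la <= expR (-1) -> 1 <= ln la^-1 /\ loglevel p <= 3 * ln la^-1.
Proof.
move=> lae; have L1 : 1 <= ln la^-1.
  rewrite lnV ?posrE// lerNr; have := lae; rewrite -ler_ln ?posrE ?expR_gt0//.
  by rewrite expRK.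
split=> //; have la1 : la <= 1.
  by apply: (le_trans lae); rewrite -expR0 ler_expR oppr_le0.
have lap : la <= p.
  have la01 : 0 < la <= 1 by rewrite la0.
  have p1 : (2 * m%:R)^-1 <= (1 : R) by rewrite invf_le1 ?mulr_gt0// -natrM ler1n; lia.
  by have := ger_powR la01 p1; rewrite powRr1// ltW.
have V1 : 1 <= la^-1 by rewrite invf_ge1.
have pV : p^-1 <= la^-1 by rewrite lef_pV2 ?posrE// bandwidth_gt0.
have : ln (1 + p^-1) <= ln 2 + ln la^-1.
  rewrite -lnM ?posrE ?invr_gt0// ler_ln ?posrE ?mulr_gt0 ?invr_gt0//; first by lra.
  by apply: addr_gt0 => //; rewrite invr_gt0 bandwidth_gt0.
have : ln 2 <= (1 : R) by have := @le_ln1Dx R 1; apply; lra.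
by rewrite /loglevel; lra.
Qed.

End rates.

Lemma tensor_spectral_bound_pos (R : realType) (phi : nat -> R -> R) (mu : nat -> R) m d :
  (0 < m)%N -> (0 < d)%N -> (forall j, 0 < mu j) ->
  (exists2 B : R, 0 < B & forall n (x : R), `[0%R, 1%R]%classic x -> \sum_(j < n) mu j * phi j x ^+ 2 <= B) ->
  (exists2 B : R, 0 < B & forall j, mu j <= B) ->
  (exists2 C : R, 0 < C & forall h : R, 0 < h -> forall n (x : R), `[0%R, 1%R]%classic x ->
     \sum_(j < n) phi j x ^+ 2 / (1 + h ^+ (2 * m) / mu j) <= C / h) ->
  exists2 C : R, 0 < C & forall la, 0 < la -> la <= expR (-1) -> forall N (x : d.-tuple R), unit_cube x ->
    \sum_(i <- tbox N d) tensor_phi phi i x ^+ 2 / (1 + la / tensor_mu mu i) <=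
    C * (ln la^-1 ^+ (d - 1) / la `^ (2 * m%:R)^-1).
Proof.
move=> m0; case: d => // d _ mu0 bes mub sp.
have [C C0 HC] := tensor_spectral_bound mu0 bes m0 mub sp d.
exists (C * 3 ^+ d) => [|la la0 lae N x cx]; first by apply: mulr_gt0 => //; exact: exprn_gt0.
have p0 := bandwidth_gt0 m la0.
have := HC _ p0 N x cx; rewrite bandwidth_pow// => /le_trans; apply.
have [L1 Lp] := loglevel_bandwidth m0 la0 lae.
rewrite subn1 /= -mulrA -mulrA; apply: ler_wpM2l; first exact: ltW.
rewrite mulrC mulrA; apply: ler_wpM2r; first by rewrite invr_ge0 ltW.
rewrite -exprMn; apply: lerXn2r => //; rewrite nnegrE.
  by apply: le_trans (loglevel_ge1 p0).
by apply: mulr_ge0 => //; apply: le_trans L1.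
Qed.

(** After cancelling n the hypothesis bounds the probability by 16 C2 V a / (kq^2 D (a + b)); the
    ratio a / (a + b) is at most 1 and D is large enough. *)
Lemma event_bound (R : realType) (n : nat) (kq T N V D C2 a b e : R) (pA : \bar R) : (0 < n)%N ->
  0 < kq -> 0 <= V -> 0 < D -> 0 < C2 -> 0 < a -> 0 < b -> 0 < e ->
  T = D * (a + b) -> N = C2 * (n%:R * a) -> 16 * C2 * V / (kq ^+ 2 * e) <= D ->
  ((n%:R * (kq * T / 8))%:E * pA <= (n%:R * (N / (2 * (n%:R * kq / 4))) * V)%:E)%E ->
  pA \is a fin_num -> (pA <= e%:E)%E.
Proof.
move=> n0 kq0 V0 D0 C20 a0 b0 e0 -> -> De + /fineK pE; rewrite -pE -EFinM !lee_fin.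
move: (fine pA) => p H; have nR : (0 : R) < n%:R by rewrite ltr0n.
have T0 : 0 < kq * (D * (a + b)) / 8 by rewrite divr_gt0// !mulr_gt0// addr_gt0.
rewrite -(ler_pM2l (mulr_gt0 nR T0)); apply: (le_trans H).
have -> : n%:R * (C2 * (n%:R * a) / (2 * (n%:R * kq / 4))) * V = n%:R * (2 * C2 * V / kq * a).
  by field; rewrite !gt_eqF.
rewrite -[leRHS]mulrA ler_pM2l//.
have : 16 * C2 * V <= D * (kq ^+ 2 * e) by rewrite -ler_pdivrMr ?mulr_gt0// exprn_gt0.
move=> H2; have -> : 2 * C2 * V / kq * a = (16 * C2 * V) * (a / (8 * kq)) by field; rewrite gt_eqF.
have ak : 0 <= a / (8 * kq) by rewrite divr_ge0// ltW// mulr_gt0.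
apply: (le_trans (ler_wpM2r ak H2)).
have -> : D * (kq ^+ 2 * e) * (a / (8 * kq)) = kq * (D * a) / 8 * e by field; rewrite gt_eqF.
rewrite ler_pM2r// ler_pM2r// ler_pM2l// ler_pM2l//.
by rewrite lerDl ltW.
Qed.

(** Expanded, the left side is 2 D C2 times the sum of L^2 / (n p^2) and b L / p, exactly the two
    quantities that the rate conditions send to 0. The 4 in [dl] allots half of the target to
    each. *)
Lemma small_radius (R : realType) (n : nat) (D C2 k L p b u w dl : R) : (0 < n)%N -> 0 < D -> 0 < C2 -> 0 < p ->
  dl = (k / 2) ^+ 2 / (4 * D * C2) -> L ^+ 2 / p ^+ 2 / n%:R = u -> b / p * L = w -> u < dl -> w < dl ->
  2 * (D * (L / (n%:R * p) + b)) * (C2 * (L / p)) <= (k / 2) ^+ 2.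
Proof.
move=> n0 D0 C20 p0 -> <- <- ud wd.
have nR : (0 : R) < n%:R by rewrite ltr0n.
have -> : 2 * (D * (L / (n%:R * p) + b)) * (C2 * (L / p)) = (2 * D * C2) * (L ^+ 2 / p ^+ 2 / n%:R + b / p * L).
  by field; rewrite !gt_eqF.
have DC : 0 < 2 * D * C2 by rewrite !mulr_gt0.
have -> : (k / 2) ^+ 2 = (2 * D * C2) * ((k / 2) ^+ 2 / (4 * D * C2) + (k / 2) ^+ 2 / (4 * D * C2)).
  by field; rewrite !gt_eqF.
by rewrite ler_pM2l// lerD// ltW.
Qed.

Theorem theorem2 (R : realType) (m d : nat) (hm : (1 <= m)%N) (hd : (1 <= d)%N)
  (* univariate Sobolev kernel and its eigensystem *)
  (K : R -> R -> R) (mu : nat -> R) (phi : nat -> R -> R)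
  (hK : sobolev_kernel m K)
  (hphi : sobolev_eigen_system m K mu phi)
  (* design distribution and the eigensystem defining the power spaces *)
  (v : probability (d.-tuple R) R)
  (hv : bounded_density v)
  (tmu : nat -> R) (tphi : nat -> d.-tuple R -> R)
  (htphi : eigen_system v (@unit_cube R d) (@tensor_kernel R d K) tmu tphi)
  (* sample *)
  (dO : measure_display) (Omega : measurableType dO) (P : probability Omega R)
  (x : nat -> {mfun Omega >-> d.-tuple R}) (eps : nat -> {mfun Omega >-> R})
  (f0 : d.-tuple R -> R)
  (hx_cube : forall i w, unit_cube (x i w))
  (hx_iid : iid P x)
  (hx_law : forall A, measurable A -> distribution P (x 0%N) A = v A)
  (* (A2) *)
  (rho psi : R -> R)
  (hrho_convex : convex_function [set: R^o] rho)
  (hrho_ac : absolutely_continuous rho)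
  (hpsi_meas : measurable_fun [set: R] psi)
  (hpsi : {ae (@lebesgue_measure R), forall u, is_derive (u : R) (1 : R) rho (psi u)})
  (* (A3) *)
  (hA3 : exists kappa M1 : R, [/\ 0 < kappa, 0 < M1 &
     forall y, `|y| <= kappa -> forall u, `|psi (u + y) - psi u| <= M1])
  (* (A4) *)
  (heps_iid : iid P eps)
  (hx_eps : independent_families P x eps)
  (hpsi_mean : ('E_P[fun w => psi (eps 0%N w)] = 0)%E)
  (hpsi_var : ('E_P[fun w => (psi (eps 0%N w) ^+ 2)%R] < +oo)%E)
  (hpsi_lin : exists2 gamma : R, 0 < gamma &
     (fun t : R =>
        (fine ('E_P[(fun w => psi (eps 0%N w + t)%R)])%E - gamma * t) / t)
       @ (0 : R)^' --> (0 : R))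
  (* (A5) *)
  (beta : R) (hbeta : 0 < beta <= 1)
  (hf0 : power_space v (@unit_cube R d) tmu tphi beta f0)
  (* (A6) *)
  (hA6 : exists2 alpha : R, 0 < alpha < beta &
     power_embeds_Linfty v (@unit_cube R d) tmu tphi alpha)
  (* estimator and penalty parameter *)
  (lambda : nat -> R)
  (hlambda_pos : forall n, (0 < n)%N -> 0 < lambda n)
  (fhat : nat -> Omega -> d.-tuple R -> R)
  (hfhat : forall n w, (0 < n)%N ->
     penalized_argmin mu phi rho (lambda n) (fun i : 'I_n => x i w)
       (fun i : 'I_n => f0 (x i w) + eps i w) (fhat n w))
  (hlambda0 : lambda n @[n --> \oo] --> (0 : R))
  (hlambda1 : lambda n `^ (- m%:R^-1) * ln (lambda n)^-1 ^+ (2 * (d - 1)) / n%:R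
     @[n --> \oo] --> (0 : R))
  (hlambda2 : lambda n `^ (beta - (2 * m%:R)^-1) * ln (lambda n)^-1 ^+ (d - 1)
     @[n --> \oo] --> (0 : R)) :
  exists Z1 Z2 : nat -> Omega -> R,
    [/\ bigO_prob P Z1 (fun n => ln (lambda n)^-1 ^+ (d - 1) /
                                 (n%:R * lambda n `^ (2 * m%:R)^-1)),
        bigO_prob P Z2 (fun n => lambda n `^ beta)
      & forall n w, (0 < n)%N ->
          (\int[lebesgue_tuple d]_(z in @unit_cube R d)
             ((fhat n w z - f0 z) ^+ 2)%:E <= (Z1 n w + Z2 n w)%:E)%E].
Proof.
have mC := @measurable_unit_cube R d.
have [[mu0 _ _ _ _] hsob] := hphi.
have bes := kernel_bessel_bound hm hK hphi.
have merc := mercer1 hm hK hphi.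
have mub := mu_bounded hm hK hphi.
have sp1 := spectral_bound1 hm hK hphi.
have ophi := phi_orthonormal hphi.
have sphi j : square_integrable (@lebesgue_measure R) (`[0%R, 1%R]%classic : set R) (phi j) by have [] := hsob j.
have mphi j : measurable_fun (`[0%R, 1%R]%classic : set R) (phi j) by have [] := sphi j.
have [kap [M1 [kap0 M10 psi_osc]]] := hA3.
have psi_sq : (\int[P]_w (psi (eps 0%N w) ^+ 2)%:E < +oo)%E by have := hpsi_var; rewrite expectation.unlock.
have psi_mean : \int[P]_w psi (eps 0%N w) = 0.
  by rewrite /Rintegral; have := hpsi_mean; rewrite expectation.unlock => ->.
have [gam gam0 psi_lin] := hpsi_lin.
rewrite expectation.unlock in psi_lin.
have meps : measurable_fun setT (eps 0%N) by exact: measurable_funPT.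
have [k1 k10 quad] := excess_loss_quadratic hrho_convex hrho_ac hpsi hpsi_meas kap0 M10 psi_osc meps psi_sq psi_mean gam0 psi_lin.
have [V V0 HV] := slope_second_moment hpsi_meas M1 heps_iid psi_sq.
have [c1 c10 dens] := lebesgue_le_density hv.
have [al al_beta emb] := hA6.
have /andP[beta0 beta1] := hbeta.
have [C C0 target] := regularized_target mu0 bes merc mphi htphi al_beta beta1 hf0 emb.
have [C2 C20 spec] := tensor_spectral_bound_pos hm hd mu0 bes mub sp1.
have sf0 : square_integrable v (@unit_cube R d) f0 by have [c []] := hf0.
have [mf0 f0fin] := sf0.
have density_le (g : d.-tuple R -> R) (B : R) : measurable_fun (@unit_cube R d) g ->
    (\int[v]_(z in @unit_cube R d) (g z ^+ 2)%:E <= B%:E)%E ->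
    (\int[lebesgue_tuple d]_(z in @unit_cube R d) (g z ^+ 2)%:E <= (B / c1)%:E)%E.
  move=> mg gB; have mg2 : measurable_fun (@unit_cube R d) (fun z => (g z ^+ 2)%:E).
    by apply/measurable_EFinP; exact: measurable_funX.
  have := le_trans (dens _ mg2 (fun z _ => sqr_ge0 (g z))) gB.
  by rewrite mulrC EFinM -lee_pdivlMl.
have coef_of n w : (0 < n)%N -> exists ch sh, tensor_coef phi mu ch (fhat n w) sh /\
    forall g t, tensor_sqnorm mu phi g t ->
      penalized_risk rho (lambda n) (fun i : 'I_n => x i w) (fun i : 'I_n => f0 (x i w) + eps i w) (fhat n w) sh <=
      penalized_risk rho (lambda n) (fun i : 'I_n => x i w) (fun i : 'I_n => f0 (x i w) + eps i w) g t.
  move=> n0; have [sh Hsh Hmin] := hfhat n w n0.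
  have [ch Hch] := iffLR (tensor_sqnormP mu0 bes _ _) Hsh.
  by exists ch, sh.
have [Bm Bm0 HBm] := @tensor_mu_bounded R d mu mu0 mub.
(* Finiteness makes the real number [I n w] below represent the integral faithfully. *)
have fhat_fin n w : (0 < n)%N ->
    (\int[lebesgue_tuple d]_(z in @unit_cube R d) ((fhat n w z - f0 z) ^+ 2)%:E < +oo)%E.
  move=> n0; have [ch [sh [Hch _]]] := coef_of n w n0.
  have chB N : \sum_(i <- tbox N d) ch i ^+ 2 <= Bm * sh.
    apply: (@le_trans _ _ (Bm * \sum_(i <- tbox N d) ch i ^+ 2 / tensor_mu mu i)); last first.
      by apply: ler_wpM2l; [exact: ltW|exact: (tensor_coef_sumE mu0 N Hch)].
    rewrite mulr_sumr; apply: ler_sum => i _; have mi := tensor_mu_gt0 mu0 i.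
    rewrite mulrCA -[leLHS]mulr1; apply: ler_wpM2l; first exact: sqr_ge0.
    by rewrite ler_pdivlMr// mul1r.
  have i0 : (0 <= \int[v]_(z in @unit_cube R d) (f0 z ^+ 2)%:E)%E by apply: integral_ge0 => z _; rewrite lee_fin sqr_ge0.
  have F0 : (\int[v]_(z in @unit_cube R d) (f0 z ^+ 2)%:E <= (fine (\int[v]_(z in @unit_cube R d) (f0 z ^+ 2)%:E))%:E)%E.
    by rewrite fineK// ge0_fin_numE.
  have := @integral_sqrD_le _ _ _ (lebesgue_tuple d) _ (fhat n w) f0 _ _ mC (tensor_coef_measurable mphi Hch) mf0
    (tensor_coef_sqnorm_le mphi sphi ophi Hch chB) (density_le _ _ mf0 F0).
  by move/le_lt_trans; apply; exact: ltry.
pose a n := ln (lambda n)^-1 ^+ (d - 1) / (n%:R * lambda n `^ (2 * m%:R)^-1).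
pose b n := lambda n `^ beta.
pose I n w := fine (\int[lebesgue_tuple d]_(z in @unit_cube R d) ((fhat n w z - f0 z) ^+ 2)%:E)%E.
have I0 n w : 0 <= I n w.
  by apply: fine_ge0; apply: integral_ge0 => z _; rewrite lee_fin sqr_ge0.
(* The bound is proved for the sum of the two rates; it is distributed over two summands only at the
   end. *)
have main e : 0 < e -> exists B, \forall n \near \oo, [/\ 0 < a n, 0 < b n &
    exists A, [/\ measurable A, (P A <= e%:E)%E & forall w, ~ A w -> I n w <= B * (a n + b n)]].
  move=> e0.
  pose kq := Num.min (gam * c1 / 32) 2^-1.
  have kq0 : 0 < kq by rewrite lt_min divr_gt0 ?mulr_gt0 //= invr_gt0.
  have kq1 : kq <= gam * c1 / 32 by rewrite ge_min lexx.
  have kq2 : kq <= 2^-1 by rewrite ge_min lexx orbT.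
  have g3 : 0 < 6 * gam + 3 by rewrite addr_gt0// mulr_gt0.
  (* D1 makes T dominate the bias terms of the expected risk, D2 brings the probability of the
     exceptional event below e; the 1 keeps D positive. *)
  pose D1 := 8 * (6 * gam + 3) * C / kq; pose D2 := 16 * C2 * V / (kq ^+ 2 * e).
  have D10 : 0 <= D1 by rewrite divr_ge0 ?ltW// !mulr_gt0.
  have D20 : 0 <= D2 by rewrite divr_ge0 ?mulr_ge0// ltW// mulr_gt0 ?exprn_gt0.
  pose D := 1 + D1 + D2.
  have D0 : 0 < D by rewrite ltr_pwDl// ltr_pwDl.
  have /andP[k1p k1k] := k10.
  pose dl := (k1 / 2) ^+ 2 / (4 * D * C2).
  have dl0 : 0 < dl by rewrite divr_gt0 ?exprn_gt0 ?divr_gt0 ?mulr_gt0.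
  have /andP[al0 alb] := al_beta.
  have ba0 : 0 < (beta - al) / 2 by rewrite divr_gt0// subr_gt0.
  (* Threshold below which the uniform bias C la^((beta - al) / 2) is at most k1 / 2; exp(-1) in the
     minimum makes the logarithm at least 1. *)
  pose dk := (k1 / 2 / C) `^ ((beta - al) / 2)^-1.
  have kC0 : 0 < k1 / 2 / C by rewrite !divr_gt0.
  have dm0 : 0 < Num.min dk (expR (-1)) by rewrite lt_min powR_gt0//= expR_gt0.
  have /cvgrPdist_lt/(_ _ dm0)[n1 _ H1] := hlambda0.
  have /cvgrPdist_lt/(_ _ dl0)[n2 _ H2] := hlambda1.
  have /cvgrPdist_lt/(_ _ dl0)[n3 _ H3] := hlambda2.
  (* 2 D accounts for the distance from fhat to the cut-off, 2 C / c1 for that from the cut-off to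
     f0, after passing from v to Lebesgue measure. *)
  exists (2 * D + 2 * (C / c1)), (maxn 1 (maxn n1 (maxn n2 n3))) => // n.
  rewrite /= !geq_max => /and4P[n0 nn1 nn2 nn3].
  have la0 := hlambda_pos n n0; set la := lambda n in la0 *.
  have := H1 n nn1; rewrite /= sub0r normrN gtr0_norm// lt_min => /andP[la_dk la_e].
  have la1 : la <= 1.
    by apply: (le_trans (ltW la_e)); rewrite -expR0 ler_expR oppr_le0.
  have la_e' := ltW la_e.
  have [L1 _] := loglevel_bandwidth hm la0 la_e'.
  have p0 := bandwidth_gt0 m la0.
  have nR : (0 : R) < n%:R by rewrite ltr0n.
  have L0 : 0 < ln la^-1 ^+ (d - 1) by apply: exprn_gt0; exact: lt_le_trans L1.
  have a0 : 0 < a n by rewrite /a divr_gt0// mulr_gt0.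
  have b0 : 0 < b n by exact: powR_gt0.
  split=> //.
  have h2 : ln la^-1 ^+ (d - 1) ^+ 2 / (la `^ (2 * m%:R)^-1) ^+ 2 / n%:R < dl.
    have := H2 n nn2; rewrite /= sub0r normrN -/la bandwidth_sqV// [(2 * _)%N]mulnC exprM.
    by move/(le_lt_trans (ler_norm _)); rewrite [X in X / _ < _]mulrC.
  have h3 : b n / la `^ (2 * m%:R)^-1 * ln la^-1 ^+ (d - 1) < dl.
    have := H3 n nn3; rewrite /= sub0r normrN -/la bandwidth_div//.
    by move/(le_lt_trans (ler_norm _)).
  have [cf [f [s [Hf mf sLam [sqb bias] sup]]]] : exists cf f s, [/\ tensor_coef phi mu cf f s,
      measurable_fun (@unit_cube R d) f, la * s <= C * b n,
      square_integrable v (@unit_cube R d) (fun z => f0 z - f z) /\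
      \int[v]_(z in @unit_cube R d) (f0 z - f z) ^+ 2 <= C * b n &
      {ae v, forall z, unit_cube z -> `|f0 z - f z| <= C * la `^ ((beta - al) / 2)}].
    by apply: target; rewrite la0.
  pose T := D * (a n + b n); pose N := C2 * (n%:R * a n).
  have na : n%:R * a n = ln la^-1 ^+ (d - 1) / la `^ (2 * m%:R)^-1.
    by rewrite /a -/la; field; rewrite !gt_eqF.
  have T0 : 0 < T by rewrite mulr_gt0// addr_gt0.
  have N0 : 0 <= N by apply/ltW; apply: mulr_gt0 => //; exact: mulr_gt0.
  have Lam0 : 0 < C * b n by rewrite mulr_gt0.
  have N_spec L u : unit_cube u -> \sum_(i <- tbox L d) tensor_phi phi i u ^+ 2 / (1 + la / tensor_mu mu i) <= N.
    by move=> cu; rewrite /N na; exact: spec.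
  have TN : 2 * T * N <= (k1 / 2) ^+ 2.
    rewrite /N na; exact: (small_radius n0 D0 C20 p0 erefl erefl erefl h2 h3).
  have sup' : {ae v, forall z, unit_cube z -> `|f0 z - f z| <= k1 / 2}.
    have FF := ae_filter_ringOfSetsType v; apply: filterS sup => z H cz; apply: (le_trans (H cz)).
    rewrite mulrC -ler_pdivlMr//.
    have -> : k1 / 2 / C = dk `^ ((beta - al) / 2) by rewrite -powRrM mulVf ?powRr1 ?ltW// gt_eqF.
    by apply: ge0_ler_powR; rewrite ?nnegrE ?powR_ge0 ?ltW.
  have LamT : (6 * gam + 3) * (C * b n) <= kq * T / 8.
    have -> : (6 * gam + 3) * (C * b n) = kq / 8 * (D1 * b n) by rewrite /D1; field; rewrite gt_eqF.
    rewrite [leRHS]mulrAC; apply: ler_wpM2l; first by rewrite divr_ge0// ltW.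
    apply: ler_pM => //; first exact: ltW.
      by rewrite /D addrAC lerDr addr_ge0.
    by rewrite lerDr ltW.
  have [A [mA PA HA]] := estimator_localized mu0 mub mphi sphi ophi hrho_convex hrho_ac hpsi hpsi_meas
    kap0 M10 psi_osc hx_iid heps_iid hx_eps hx_cube hx_law dens psi_sq gam0 k10 quad HV
    n0 la0 T0 N0 Lam0 kq0 N_spec TN mf0 mf sqb bias sup' kq1 kq2 LamT.
  exists A; split=> //.
    apply: (event_bound n0 kq0 V0 D0 C20 a0 b0 e0 _ _ _ PA) => //; last exact: fin_num_measure.
    by rewrite -/D2 /D lerDr addr_ge0.
  move=> w nAw; have [ch [sh [Hh Hmin]]] := coef_of n w n0.
  have Hfs : tensor_sqnorm mu phi f s by apply/(tensor_sqnormP mu0 bes); exists cf.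
  have HT := HA w nAw cf s ch (fhat n w) sh Hf Hh sLam (Hmin f s Hfs).
  have [tg Hg] := tensor_coef_lin mu0 1 (-1) Hh Hf.
  (* The weights are at least 1, so the localized weighted norm controls the plain one. *)
  have cT L : \sum_(i <- tbox L d) (1 * ch i + -1 * cf i) ^+ 2 <= T.
    apply: le_trans (HT L); apply: ler_sum => i _.
    rewrite mul1r mulN1r mulrDl mul1r lerDl; apply: mulr_ge0; last exact: sqr_ge0.
    by apply: divr_ge0; [exact: ltW|apply/ltW; exact: tensor_mu_gt0].
  have B1 := tensor_coef_sqnorm_le mphi sphi ophi Hg cT.
  have B2 : (\int[lebesgue_tuple d]_(z in @unit_cube R d) ((f0 z - f z) ^+ 2)%:E <= (C * b n / c1)%:E)%E.
    apply: density_le; first exact: measurable_funB.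
    have [_ fin] := sqb; rewrite -[leLHS]fineK ?lee_fin// ge0_fin_numE//.
    by apply: integral_ge0 => z _; rewrite lee_fin sqr_ge0.
  have := @integral_sqrD_le _ _ _ (lebesgue_tuple d) _ _ _ _ _ mC (tensor_coef_measurable mphi Hg) (measurable_funB mf0 mf) B1 B2.
  have -> : (\int[lebesgue_tuple d]_(z in @unit_cube R d) ((1 * fhat n w z + -1 * f z - (f0 z - f z)) ^+ 2)%:E =
     \int[lebesgue_tuple d]_(z in @unit_cube R d) ((fhat n w z - f0 z) ^+ 2)%:E)%E.
    by apply: eq_integral => z _; congr EFin; ring.
  rewrite -[leLHS]fineK; last first.
    rewrite ge0_fin_numE; first exact: fhat_fin.
    by apply: integral_ge0 => z _; rewrite lee_fin sqr_ge0.
  rewrite lee_fin -/(I n w) => /le_trans; apply.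
  have c10' : 0 <= C / c1 by rewrite divr_ge0// ltW.
  have -> : (2 * D + 2 * (C / c1)) * (a n + b n) = 2 * T + 2 * (C / c1 * (a n + b n)) by rewrite /T; ring.
  rewrite lerD2l ler_pM2l// [leLHS]mulrAC; apply: ler_wpM2l => //.
  by rewrite lerDr ltW.
(* Both summands will have the same ratio I / (a + b) to their rates, so a single tightness argument
   covers them. *)
have tight (Z : nat -> Omega -> R) (c : nat -> R) :
    (forall n w, 0 < a n -> 0 < b n -> `|Z n w / c n| = I n w / (a n + b n)) -> bigO_prob P Z c.
  move=> Zc e e0; have [B [n1 _ HB]] := main e e0; exists B; exists n1 => // n /= nn1.
  have [a0 b0 [A [mA PA HA]]] := HB n nn1; exists A; split=> // w /= Bw; apply: contrapT => nA.
  move: Bw; rewrite Zc// ltNge => /negP; apply; rewrite ler_pdivrMr ?addr_gt0//; exact: HA.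
(* The error is split in proportion to the two rates; taking the second summand as the remainder
   keeps the total equal to I even where a + b vanishes. *)
exists (fun n w => I n w * a n / (a n + b n)), (fun n w => I n w - I n w * a n / (a n + b n)); split.
- apply: tight => n w a0 b0; rewrite -/(a n).
  have -> : I n w * a n / (a n + b n) / a n = I n w / (a n + b n) by field; rewrite !gt_eqF ?addr_gt0.
  by rewrite ger0_norm// divr_ge0// ltW// addr_gt0.
- apply: tight => n w a0 b0; rewrite -/(b n).
  have -> : (I n w - I n w * a n / (a n + b n)) / b n = I n w / (a n + b n) by field; rewrite !gt_eqF ?addr_gt0.
  by rewrite ger0_norm// divr_ge0// ltW// addr_gt0.
- move=> n w n0; rewrite addrC subrK /I fineK// ge0_fin_numE; first exact: fhat_fin.
  by apply: integral_ge0 => z _; rewrite lee_fin sqr_ge0.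
Qed.
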